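(* For each $\alpha>0$ let $f_\alpha$ be a random multiplicative function with $\mathbb{E} f_\alpha(p)=-p^{-\alpha}$ for every prime $p$. Then the Riemann Hypothesis holds if and only if, for each $\alpha>0$, almost surely $M_{f_\alpha}(x)=o(x^{1/2+\epsilon})$ for all $\epsilon>0$.
   Context: $\mathcal{P}$ denotes the set of primes and $\mu$ the Möbius function. A random multiplicative function is a random function $f:\mathbb{N}\times\Omega\to\{-1,0,1\}$ on a probability space $(\Omega,\mathcal{F},\mathbb{P})$ with $f(1)=1$, $f(n)=|\mu(n)|\prod_{p\mid n}f(p)$ for $n\ge 2$ (so $f$ is supported on squarefree integers), where $\{f(p)\}_{p\in\mathcal{P}}$ is a sequence of independent $\pm1$-valued random variables. $M_f(x):=\sum_{n\le x}f(n)$. *)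

(* Defs.v *)
From HB Require Import structures.
From mathcomp Require Import all_boot all_order all_algebra finmap.
From mathcomp Require Import complex.
From mathcomp Require Import all_classical all_reals all_analysis.

Set Implicit Arguments.
Unset Strict Implicit.
Unset Printing Implicit Defensive.

Import Order.TTheory GRing.Theory Num.Theory.
Import numFieldNormedType.Exports.

Local Open Scope classical_set_scope.
Local Open Scope ring_scope.
Local Open Scope complex_scope.

Definition moebius (n : nat) : int :=
  if (0 < n)%N && all (fun p => logn p n == 1%N) (primes n)
  then (-1) ^+ size (primes n) else 0.

Definition cexp (R : realType) (z : R[i]) : R[i] :=
  (expR (complex.Re z))%:C * (cos (complex.Im z) +i* sin (complex.Im z)).

(* The Dirichlet monomial n^(-s), for n >= 1. *)
Definition dirichlet_monomial (R : realType) (s : R[i]) (n : nat) : R[i] :=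
  cexp (- s * (ln n%:R)%:C).

(* Z restricts, on the half-plane Re s > 0 punctured at 1, to the Riemann zeta
   function: it is the (unique) analytic continuation to this connected open
   set of the sum of the Dirichlet series \sum_(n >= 1) n^(-s), Re s > 1.  No
   condition is put on the values of Z outside this set. *)
Definition is_riemann_zeta (R : realType) (Z : R[i] -> R[i]) : Prop :=
  (forall s : R[i], 0 < complex.Re s -> s != 1 ->
     derivable (Z : R[i]^o -> R[i]^o) s 1) /\
  (forall s : R[i], 1 < complex.Re s ->
     (\sum_(1 <= n < N) dirichlet_monomial s n : R[i]^o) @[N --> \oo]
       --> (Z s : R[i]^o)).

(* The nontrivial zeros are those in the critical strip 0 < Re s < 1. *)
Definition RiemannHypothesis (R : realType) : Prop :=
  forall Z : R[i] -> R[i], is_riemann_zeta Z ->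
  forall s : R[i], 0 < complex.Re s < 1 -> Z s = 0 -> complex.Re s = 1 / 2.

Definition mutually_independent (d : measure_display) (T : measurableType d)
    (R : realType) (P : probability T R) (I : choiceType) (D : set I)
    (X : I -> {RV P >-> R}) : Prop :=
  forall (J : {fset I}) (B : I -> set R),
    [set` J] `<=` D -> (forall i, measurable (B i)) ->
    P (\bigcap_(i in [set` J]) X i @^-1` B i) =
    (\prod_(i <- J) P (X i @^-1` B i))%E.

(* The index set of the sequence is {1, 2, ...}; [f 0] is never used. *)
Definition random_multiplicative (d : measure_display) (T : measurableType d)
    (R : realType) (P : probability T R) (f : nat -> {RV P >-> R}) : Prop :=
  [/\ forall w, f 1%N w = 1,
      forall n w, (2 <= n)%N ->
        f n w = (`|moebius n|)%:~R * \prod_(p <- primes n) f p w,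
      forall p w, prime p -> f p w = 1 \/ f p w = -1
    & mutually_independent [set p | prime p] f].

Definition partial_sum (R : realType) (T : Type) (f : nat -> T -> R) (w : T)
    (x : R) : R :=
  \sum_(1 <= n < (Num.truncn x).+1) f n w.

(* Main.v *)
(* Under RH, 1/zeta(s) grows more slowly than any power of |s| to the right of the critical
   line (Borel-Caratheodory applied to log zeta), and inverting mu(n) n^(-s) at a huge real
   point, in the manner of Post and Widder, gives sum_(n <= x) mu(n) = O(x^(1/2+eps)).
   The signs f(p) have mean -p^(-a), so that M_f(x) has mean sum_(n <= x) mu(n) n^(-a); more
   precisely, conditioning on the primes dividing r leaves sums of the same kind of length
   x/r.  Expanding M_f(x) prime by prime bounds all its even moments, and Borel-Cantelli
   yields the almost sure bound.

   Conversely, let zeta(rho) = 0 with Re rho > 1/2, a = (Re rho - 1/2)/2 and s0 = rho - a.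
   Let e be the sequence 1, -2, 1, 0 of period 4, for which sum e(n) n^(-rho) is a multiple
   of zeta(rho), hence converges to 0 at a polynomial rate.  The sums
   V_X = sum_(m n <= X) f(m) m^(-s0) e(n) n^(-rho) log(X/(m n)) are then almost surely
   bounded if M_f(x) = o(x^(1/2+eps)), by summation by parts in both variables.  As
   f(m) m^(-s0) behaves on average like mu(m) m^(-rho), the mean of V_X is asymptotic to a
   nonzero multiple of log X, while its second moment is O(log^2 X).  By the Paley-Zygmund
   inequality V_X is of order log X with probability bounded below: a contradiction.

   Zeros to the left of the critical line are excluded by a functional equation for the
   zeros only: e is proportional to its own discrete Fourier transform, so a tent function
   of period 4 has both e and its Fourier coefficients as data, and comparing the discrete
   Mellin transforms of the two expressions relates zeta(s) to zeta(1 - s). *)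

Require Import Defs.
From mathcomp Require Import all_boot all_order all_algebra.
From mathcomp Require Import all_classical all_reals all_analysis.
From mathcomp Require Import complex finmap ring lra zify.

Import Order.TTheory GRing.Theory Num.Theory.
Import numFieldNormedType.Exports.

Set Implicit Arguments.
Unset Strict Implicit.
Unset Printing Implicit Defensive.

Local Open Scope ring_scope.

(** The mean of V_X grows whether or not zeta(rho) vanishes: the convolution of mu with e is
    supported on 1, 2 and 4, so the logarithm survives identically, before any estimate. A zero of
    zeta matters only for single samples, where it makes the tails of the series of e(n) n^(-rho)
    small. The weights e are there because the partial sums of n^(-rho) itself have a main term of
    order N^(1-rho); a sequence of mean zero removes it, at the cost of the factor (1 - 2^(-s))(1 -
    2^(1-s)), which has no zero with 0 < Re s < 1. The choice of a gives Re s0 = 1/2 + a, strictly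
    between 1/2 and Re rho: far enough to the right for the hypothesis on M_f to bound the sums of
    f(m) m^(-s0).

    All zeros are handled through [Efun], which represents (s - 1) zeta(s) and has no pole. Contour
    integrals are replaced by averages over 2^k equally spaced points of a circle, and the
    deformation of contours by subdivision of a square. The moment bound is a hypercontractive
    inequality for biased signs; its constant may depend on the order of the moment, since one
    moment of high order already gives summable tail probabilities. *)

Notation nc := Normc.normc.
Arguments Normc.normc : simpl never.

(** * The modulus as a real number *)

Section ComplexModulus.
Variable R : realType.
Local Open Scope complex_scope.
Implicit Types x y z : R[i].

Lemma ncE z : nc z = Num.sqrt (complex.Re z ^+ 2 + complex.Im z ^+ 2).
Proof. by case: z. Qed.
Lemma nc_ge0 z : 0 <= nc z. Proof. by rewrite ncE sqrtr_ge0. Qed.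
Lemma nc0 : nc (0 : R[i]) = 0. Proof. exact: Normc.normc0. Qed.
Lemma nc1 : nc (1 : R[i]) = 1. Proof. exact: Normc.normc1. Qed.
Lemma ncM x y : nc (x * y) = nc x * nc y. Proof. exact: Normc.normcM. Qed.
Lemma ncV x : nc x^-1 = (nc x)^-1. Proof. exact: Normc.normcV. Qed.
Lemma nc_div x y : nc (x / y) = nc x / nc y. Proof. by rewrite ncM ncV. Qed.
Lemma ncN x : nc (- x) = nc x. Proof. exact: normcN. Qed.
Lemma ncD x y : nc (x + y) <= nc x + nc y. Proof. exact: le_normcD. Qed.
Lemma ncB x y : nc (x - y) <= nc x + nc y. Proof. by rewrite -[nc y]ncN ncD. Qed.
Lemma nc_sym x y : nc (x - y) = nc (y - x). Proof. by rewrite -ncN opprB. Qed.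
Lemma nc_eq0 x : (nc x == 0) = (x == 0).
Proof. by apply/eqP/eqP => [/Normc.eq0_normc//|->]; rewrite nc0. Qed.
Lemma nc_gt0 x : (0 < nc x) = (x != 0).
Proof. by rewrite lt_neqAle nc_ge0 andbT eq_sym nc_eq0. Qed.
Lemma ncX x n : nc (x ^+ n) = nc x ^+ n.
Proof. by elim: n => [|n ih]; rewrite ?expr0 ?nc1// !exprS ncM ih. Qed.
Lemma nc_real (a : R) : nc a%:C = `|a|.
Proof. by rewrite ncE /= expr0n /= addr0 sqrtr_sqr. Qed.
Lemma nc_nat n : nc (n%:R : R[i]) = n%:R.
Proof. by rewrite -[n%:R in LHS](rmorph_nat (real_complex R)) nc_real normr_nat. Qed.
Lemma nc_sqr z : nc z ^+ 2 = complex.Re z ^+ 2 + complex.Im z ^+ 2.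
Proof. by rewrite ncE sqr_sqrtr// addr_ge0 ?sqr_ge0. Qed.
Lemma nc_Re z : `|complex.Re z| <= nc z.
Proof.
rewrite ncE -sqrtr_sqr ler_sqrt ?addr_ge0 ?sqr_ge0//.
by rewrite lerDl sqr_ge0.
Qed.
Lemma nc_Im z : `|complex.Im z| <= nc z.
Proof.
rewrite ncE -sqrtr_sqr ler_sqrt ?addr_ge0 ?sqr_ge0//.
by rewrite lerDr sqr_ge0.
Qed.
Lemma nc_le_ReIm z : nc z <= `|complex.Re z| + `|complex.Im z|.
Proof.
rewrite -(ler_pXn2r (_ : (0 < 2)%N)) ?nnegrE ?nc_ge0 ?addr_ge0// nc_sqr.
rewrite -(real_normK (num_real (complex.Re z))) -(real_normK (num_real (complex.Im z))).
have := normr_ge0 (complex.Re z); have := normr_ge0 (complex.Im z); nra.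
Qed.
Lemma nc_sum (I : Type) (r : seq I) (P : pred I) (F : I -> R[i]) :
  nc (\sum_(i <- r | P i) F i) <= \sum_(i <- r | P i) nc (F i).
Proof.
elim/big_rec2: _ => [|i y1 y2 _ h]; first by rewrite nc0.
by apply: (le_trans (ncD _ _)); rewrite lerD2l.
Qed.
Lemma nc_conj z : nc (conjc z) = nc z.
Proof. by case: z => a b; rewrite !ncE /= sqrrN. Qed.
Lemma ReD x y : complex.Re (x + y) = complex.Re x + complex.Re y.
Proof. by case: x y => ? ? []. Qed.
Lemma ReN x : complex.Re (- x) = - complex.Re x. Proof. by case: x. Qed.
Lemma ReB x y : complex.Re (x - y) = complex.Re x - complex.Re y.
Proof. by rewrite ReD ReN. Qed.
Lemma ImD x y : complex.Im (x + y) = complex.Im x + complex.Im y.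
Proof. by case: x y => ? ? []. Qed.
Lemma ImN x : complex.Im (- x) = - complex.Im x. Proof. by case: x. Qed.
Lemma ImB x y : complex.Im (x - y) = complex.Im x - complex.Im y.
Proof. by rewrite ImD ImN. Qed.
Lemma ReM x y : complex.Re (x * y) =
  complex.Re x * complex.Re y - complex.Im x * complex.Im y.
Proof. by case: x y => ? ? []. Qed.
Lemma ImM x y : complex.Im (x * y) =
  complex.Re x * complex.Im y + complex.Im x * complex.Re y.
Proof. by case: x y => ? ? []. Qed.
Lemma ReMl (a : R) x : complex.Re (a%:C * x) = a * complex.Re x.
Proof. by rewrite ReM /= mul0r subr0. Qed.
Lemma ImMl (a : R) x : complex.Im (a%:C * x) = a * complex.Im x.
Proof. by rewrite ImM /= mul0r addr0. Qed.
Lemma Re_sum (I : Type) (r : seq I) (P : pred I) (F : I -> R[i]) :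
  complex.Re (\sum_(i <- r | P i) F i) = \sum_(i <- r | P i) complex.Re (F i).
Proof. by elim/big_rec2: _ => //= i y1 y2 _ <-; rewrite ReD. Qed.
End ComplexModulus.

(** * Cauchy's formula by trapezoid sums *)

Section Goursat.
Variable R : realType.
Local Open Scope complex_scope.
Local Notation C := R[i].

Definition cdiff (f : C -> C) (z l : C) := forall e : R, 0 < e ->
  exists2 d : R, 0 < d & forall w, nc (w - z) <= d ->
    nc (f w - f z - l * (w - z)) <= e * nc (w - z).

(* Twice the trapezoid rule on the segment from z to w; it is exact for affine f. *)
Definition trapz (f : C -> C) (z w : C) := (f z + f w) * (w - z).

(** The map [P] carries the unit square to the plane region under study. An edge of a subsquare is
    cut into 2^k pieces, and [trapz] is summed over the images of the pieces; [cells] sums around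
    all 4^k cells of a subsquare. *)
Fixpoint hedge (f : C -> C) (P : R -> R -> C) k x y h : C :=
  if k is k'.+1 then hedge f P k' x y (h / 2) + hedge f P k' (x + h / 2) y (h / 2)
  else trapz f (P x y) (P (x + h) y).
Fixpoint vedge (f : C -> C) (P : R -> R -> C) k x y h : C :=
  if k is k'.+1 then vedge f P k' x y (h / 2) + vedge f P k' x (y + h / 2) (h / 2)
  else trapz f (P x y) (P x (y + h)).
Fixpoint cells (f : C -> C) (P : R -> R -> C) k x y h : C :=
  if k is k'.+1 then
    cells f P k' x y (h / 2) + cells f P k' (x + h / 2) y (h / 2) +
    cells f P k' x (y + h / 2) (h / 2) + cells f P k' (x + h / 2) (y + h / 2) (h / 2)
  else trapz f (P x y) (P (x + h) y) + trapz f (P (x + h) y) (P (x + h) (y + h))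
     + trapz f (P (x + h) (y + h)) (P x (y + h)) + trapz f (P x (y + h)) (P x y).

(** Exchanging the end points changes the sign of [trapz], so the edges shared by two quarters
    cancel at every level. *)
Lemma cells_boundary f P k x y h : cells f P k x y h =
  hedge f P k x y h + vedge f P k (x + h) y h - hedge f P k x (y + h) h - vedge f P k x y h.
Proof.
elim: k x y h => [|k ih] x y h /=; first by rewrite /trapz; ring.
rewrite !ih.
have e1 (t : R) : t + h / 2 + h / 2 = t + h by lra.
rewrite !e1; ring.
Qed.

Lemma cells_sub_affine f P (a b : C) k x y h :
  cells f P k x y h = cells (fun w => f w - (a + b * w)) P k x y h.
Proof. by elim: k x y h => [|k ih] x y h /=; [rewrite /trapz; ring|rewrite -!ih]. Qed.

Variables (P : R -> R -> C) (K : R).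
Hypothesis K0 : 0 < K.
Hypothesis Plip : forall u v u' v', 0 <= u <= 1 -> 0 <= v <= 1 -> 0 <= u' <= 1 ->
  0 <= v' <= 1 -> nc (P u v - P u' v') <= K * (`|u - u'| + `|v - v'|).

(** Halving an edge keeps the total Lipschitz length, which makes the bound uniform in the depth
    [k]. *)
Lemma hedge_bound f M k x y h : 0 <= x -> x + h <= 1 -> 0 <= y <= 1 -> 0 <= h ->
  (forall x', x <= x' <= x + h -> nc (f (P x' y)) <= M) ->
  nc (hedge f P k x y h) <= 2 * M * K * h.
Proof.
elim: k x h => [|k ih] x h x0 xh y01 h0 fM /=.
  rewrite /trapz ncM.
  have f1 := fM x ltac:(lra). have f2 := fM (x + h) ltac:(lra).
  have f3 := ncD (f (P x y)) (f (P (x + h) y)).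
  have p1 : nc (P (x + h) y - P x y) <= K * h.
    apply: (le_trans (Plip _ _ _ _)); [lra|lra|lra|lra|].
    rewrite subrr normr0 addr0 (_ : x + h - x = h) ?ger0_norm//; lra.
  have -> : 2 * M * K * h = (2 * M) * (K * h) by ring.
  apply: ler_pM; rewrite ?nc_ge0//; lra.
have -> : 2 * M * K * h = 2 * M * K * (h / 2) + 2 * M * K * (h / 2) by lra.
apply: (le_trans (ncD _ _)); apply: lerD; apply: ih; try lra.
- by move=> x' hx'; apply: fM; lra.
- by move=> x' hx'; apply: fM; lra.
Qed.

Lemma vedge_bound f M k x y h : 0 <= y -> y + h <= 1 -> 0 <= x <= 1 -> 0 <= h ->
  (forall y', y <= y' <= y + h -> nc (f (P x y')) <= M) ->
  nc (vedge f P k x y h) <= 2 * M * K * h.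
Proof.
elim: k y h => [|k ih] y h y0 yh x01 h0 fM /=.
  rewrite /trapz ncM.
  have f1 := fM y ltac:(lra). have f2 := fM (y + h) ltac:(lra).
  have f3 := ncD (f (P x y)) (f (P x (y + h))).
  have p1 : nc (P x (y + h) - P x y) <= K * h.
    apply: (le_trans (Plip _ _ _ _)); [lra|lra|lra|lra|].
    rewrite subrr normr0 add0r (_ : y + h - y = h) ?ger0_norm//; lra.
  have -> : 2 * M * K * h = (2 * M) * (K * h) by ring.
  apply: ler_pM; rewrite ?nc_ge0//; lra.
have -> : 2 * M * K * h = 2 * M * K * (h / 2) + 2 * M * K * (h / 2) by lra.
apply: (le_trans (ncD _ _)); apply: lerD; apply: ih; try lra.
- by move=> x' hx'; apply: fM; lra.
- by move=> x' hx'; apply: fM; lra.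
Qed.

Lemma nested_intervals (x h : nat -> R) :
  (forall n, x n <= x n.+1) -> (forall n, x n.+1 + h n.+1 <= x n + h n) ->
  (forall n, 0 <= h n) -> exists u, forall n, x n <= u <= x n + h n.
Proof.
move=> x_inc xh_dec h0.
have xle m n : (m <= n)%N -> x m <= x n.
  elim: n => [|n ih]; first by rewrite leqn0 => /eqP->.
  by rewrite leq_eqVlt => /orP[/eqP->//|]; rewrite ltnS => /ih /le_trans; apply.
have xhle m n : (m <= n)%N -> x n + h n <= x m + h m.
  elim: n => [|n ih]; first by rewrite leqn0 => /eqP->.
  rewrite leq_eqVlt => /orP[/eqP->//|]; rewrite ltnS => /ih; have := xh_dec n; lra.
have xub m n : x m <= x n + h n.
  have [mn|/ltnW nm] := leqP m n.
    by apply: (le_trans (xle _ _ mn)); rewrite lerDl.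
  by apply: le_trans (xhle _ _ nm); rewrite lerDl.
exists (sup (range x)) => n; apply/andP; split.
  apply: ub_le_sup; last by exists n.
  by exists (x 0%N + h 0%N) => _ [m _ <-].
by apply: ge_sup; [exists (x 0%N); exists 0%N|move=> _ [m _ <-]].
Qed.

Lemma half_pow_small (e : R) : 0 < e -> exists n : nat, (2^-1 : R) ^+ n <= e.
Proof.
move=> e0; have [n hn] : exists n : nat, e^-1 < n%:R.
  exists (Num.truncn e^-1).+1; exact: truncnS_gt.
exists n; rewrite exprVn -[e]invrK lef_pV2 ?posrE ?invr_gt0 ?exprn_gt0//.
apply: (le_trans (ltW hn)).
rewrite -natrX ler_nat; exact/ltnW/ltn_expl.
Qed.

(** Bisection in place of compactness: if the unit square were bad, some quarter of it would be bad,
    and so on; the nested bad squares shrink to a point (u, v), near which the second hypothesis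
    makes them good. *)
Lemma square_induction (good : R -> R -> R -> Prop) :
  (forall x y h, good x y (h / 2) -> good (x + h / 2) y (h / 2) ->
    good x (y + h / 2) (h / 2) -> good (x + h / 2) (y + h / 2) (h / 2) -> good x y h) ->
  (forall u v, 0 <= u <= 1 -> 0 <= v <= 1 -> exists2 d, 0 < d &
    forall x y h, 0 < h <= d -> x <= u <= x + h -> y <= v <= y + h ->
      0 <= x -> x + h <= 1 -> 0 <= y -> y + h <= 1 -> good x y h) ->
  good 0 0 1.
Proof.
move=> quad loc; apply: contrapT => nex.
pose H n : R := 2^-1 ^+ n.
have H0 n : 0 < H n by rewrite exprn_gt0.
have HS n : H n.+1 = H n / 2 by rewrite /H exprS mulrC.
pose step (q : R * R) (h : R) : R * R :=
  if `[< ~ good q.1 q.2 (h/2) >] then q else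
  if `[< ~ good (q.1 + h/2) q.2 (h/2) >] then (q.1 + h/2, q.2) else
  if `[< ~ good q.1 (q.2 + h/2) (h/2) >] then (q.1, q.2 + h/2) else
  (q.1 + h/2, q.2 + h/2).
pose q := fix q n : R * R := if n is m.+1 then step (q m) (H m) else (0, 0).
have qS n : q n.+1 = step (q n) (H n) by [].
have bad n : ~ good (q n).1 (q n).2 (H n).
  elim: n => [|n ih]; first by rewrite /H expr0.
  rewrite qS HS /step; case: asboolP => // /contrapT g1.
  case: asboolP => // /contrapT g2; case: asboolP => // /contrapT g3.
  by move=> g4; apply: ih; apply: quad.
have [u hu] : exists u, forall n, (q n).1 <= u <= (q n).1 + H n.
  apply: nested_intervals => n.
  - rewrite qS /step; have := H0 n; do ?[case: ifP => _ /=]; lra.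
  - rewrite qS HS /step; have := H0 n; do ?[case: ifP => _ /=]; lra.
  - exact: ltW.
have [v hv] : exists v, forall n, (q n).2 <= v <= (q n).2 + H n.
  apply: nested_intervals => n.
  - rewrite qS /step; have := H0 n; do ?[case: ifP => _ /=]; lra.
  - rewrite qS HS /step; have := H0 n; do ?[case: ifP => _ /=]; lra.
  - exact: ltW.
have rng n : [/\ 0 <= (q n).1, (q n).1 + H n <= 1, 0 <= (q n).2 & (q n).2 + H n <= 1].
  elim: n => [|n [a1 a2 a3 a4]]; first by rewrite /H expr0 /=; split; lra.
  move: (H0 n) a1 a2 a3 a4; rewrite qS HS /step; clear.
  by do ?[case: ifP => _ /=] => *; split; lra.
have u01 : 0 <= u <= 1 by have [] := rng 0%N; have := hu 0%N; lra.
have v01 : 0 <= v <= 1 by have [] := rng 0%N; have := hv 0%N; lra.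
have [d d0 hd] := loc u v u01 v01.
have [n hn] := half_pow_small d0.
have [a1 a2 a3 a4] := rng n.
by apply: (bad n); apply: hd; rewrite ?H0 ?hn ?hu ?hv.
Qed.

(** Near a point f is affine up to o(distance), and affine functions contribute nothing around a
    cell. A small square of side h thus contributes at most e h^2, and this bound is additive under
    subdivision, so bisection applies. *)
Lemma goursat (f : C -> C) :
  (forall u v, 0 <= u <= 1 -> 0 <= v <= 1 -> exists l, cdiff f (P u v) l) ->
  forall e : R, 0 < e -> exists k0, forall k, (k0 <= k)%N -> nc (cells f P k 0 0 1) <= e.
Proof.
move=> fdiff e e0.
pose good (x y h : R) := exists k0, forall k, (k0 <= k)%N ->
  nc (cells f P k x y h) <= e * h ^+ 2.
suff [k0 hk] : good 0 0 1.
  by exists k0 => k kk; have := hk k kk; rewrite expr1n mulr1.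
apply: square_induction => [x y h|u v u01 v01].
  move=> [k1 g1] [k2 g2] [k3 g3] [k4 g4]; exists (k1 + k2 + k3 + k4).+1 => -[//|k] kk.
  move: g1 => /(_ k ltac:(clear -kk; lia)) g1; move: g2 => /(_ k ltac:(clear -kk; lia)) g2.
  move: g3 => /(_ k ltac:(clear -kk; lia)) g3; move: g4 => /(_ k ltac:(clear -kk; lia)) g4.
  rewrite /=; apply: (le_trans (ncD _ _)).
  have := ncD (cells f P k x y (h / 2) + cells f P k (x + h / 2) y (h / 2))
     (cells f P k x (y + h / 2) (h / 2)).
  have := ncD (cells f P k x y (h / 2)) (cells f P k (x + h / 2) y (h / 2)).
  have -> : e * h ^+ 2 = e * (h/2) ^+ 2 + e * (h/2) ^+ 2 + e * (h/2) ^+ 2 + e * (h/2) ^+ 2.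
    by field.
  lra.
have [l fl] := fdiff u v u01 v01.
(* On a square of side h the remainder is at most e / (16 K^2) times the diameter bound 2 K h, so
   each of the four edges contributes at most e h^2 / 4. *)
have e1 : 0 < e / (16 * K ^+ 2) by rewrite divr_gt0// mulr_gt0// exprn_gt0.
have [dl dl0 hdl] := fl _ e1.
have K2 : 0 < 2 * K by rewrite mulr_gt0.
exists (dl / (2 * K)) => [|x y h /andP[h0 hn] b1 b2 a1 a2 a3 a4]; first by rewrite divr_gt0.
exists 0%N => k _.
rewrite (cells_sub_affine _ _ (f (P u v) - l * P u v) l).
set g := fun w => _.
have gM x' y' : x <= x' <= x + h -> y <= y' <= y + h ->
    nc (g (P x' y')) <= e / (16 * K ^+ 2) * (2 * K * h).
  move=> hx hy; have pp : nc (P x' y' - P u v) <= 2 * K * h.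
    apply: (le_trans (Plip _ _ _ _)) => //; [lra|lra|].
    rewrite -mulrA mulrCA ler_pM2l//.
    have : `|x' - u| <= h by rewrite ler_norml; lra.
    have : `|y' - v| <= h by rewrite ler_norml; lra.
    lra.
  rewrite /g (_ : _ - _ = f (P x' y') - f (P u v) - l * (P x' y' - P u v)); last by ring.
  apply: (le_trans (hdl _ _)).
    by apply: (le_trans pp); move: hn; rewrite ler_pdivlMr ?mulr_gt0// mulrC.
  by rewrite ler_wpM2l// ltW.
rewrite cells_boundary.
have yh : 0 <= y + h <= 1 by lra.
have xh : 0 <= x + h <= 1 by lra.
have c1 := @hedge_bound g _ k x y h a1 a2 ltac:(lra) (ltW h0)
   (fun x' hx => gM x' y hx ltac:(lra)).
have c2 := @hedge_bound g _ k x (y + h) h a1 a2 yh (ltW h0)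
   (fun x' hx => gM x' (y + h) hx ltac:(lra)).
have c3 := @vedge_bound g _ k x y h a3 a4 ltac:(lra) (ltW h0)
   (fun y' hy => gM x y' ltac:(lra) hy).
have c4 := @vedge_bound g _ k (x + h) y h a3 a4 xh (ltW h0)
   (fun y' hy => gM (x + h) y' ltac:(lra) hy).
apply: (le_trans (ncB _ _)).
have d1 := ncB (hedge g P k x y h + vedge g P k (x + h) y h) (hedge g P k x (y + h) h).
have d2 := ncD (hedge g P k x y h) (vedge g P k (x + h) y h).
have E : 2 * (e / (16 * K ^+ 2) * (2 * K * h)) * K * h = e * h ^+ 2 / 4.
  by field; rewrite gt_eqF.
move: c1 c2 c3 c4 d1 d2; rewrite E; clear; lra.
Qed.

End Goursat.

(** * Continuity and differentiability of complex functions *)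

Section ComplexContDiff.
Variable R : realType.
Local Open Scope complex_scope.
Local Notation C := R[i].
Implicit Types (f g : C -> C) (z w l : C).

Definition ccont f z := forall e : R, 0 < e ->
  exists2 d : R, 0 < d & forall w, nc (w - z) <= d -> nc (f w - f z) <= e.

Lemma ccont_cst c z : ccont (fun=> c) z.
Proof. by move=> e e0; exists 1 => // w _; rewrite subrr nc0 ltW. Qed.

Lemma ccont_id z : ccont id z.
Proof. by move=> e e0; exists e. Qed.

Lemma ccontD f g z : ccont f z -> ccont g z -> ccont (fun w => f w + g w) z.
Proof.
move=> fz gz e e0; have e2 : 0 < e / 2 by lra.
have [d1 d10 h1] := fz _ e2; have [d2 d20 h2] := gz _ e2.
exists (Num.min d1 d2) => [|w]; first by rewrite lt_min d10.
rewrite le_min => /andP[/h1 {}h1 /h2 {}h2].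
rewrite (_ : _ - _ = f w - f z + (g w - g z)); last by ring.
by have := ncD (f w - f z) (g w - g z); lra.
Qed.

Lemma ccontM f g z : ccont f z -> ccont g z -> ccont (fun w => f w * g w) z.
Proof.
move=> fz gz e e0.
have a0 := nc_ge0 (f z); have b0 := nc_ge0 (g z).
pose e1 := Num.min 1 (e / (nc (f z) + nc (g z) + 1)).
have e10 : 0 < e1 by rewrite lt_min ltr01 divr_gt0//; lra.
have [d1 d10 h1] := fz _ e10; have [d2 d20 h2] := gz _ e10.
exists (Num.min d1 d2) => [|w]; first by rewrite lt_min d10.
rewrite le_min => /andP[/h1 {}h1 /h2 {}h2].
rewrite (_ : _ - _ = (f w - f z) * (g w - g z) + f z * (g w - g z) + (f w - f z) * g z);
  last by ring.
have hA := ncD ((f w - f z) * (g w - g z) + f z * (g w - g z)) ((f w - f z) * g z).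
have hB := ncD ((f w - f z) * (g w - g z)) (f z * (g w - g z)).
move: hA hB; rewrite !ncM => hA hB.
have e11 : e1 <= 1 by rewrite ge_min lexx.
have e12 : e1 * (nc (f z) + nc (g z) + 1) <= e.
  by rewrite -ler_pdivlMr ?ge_min ?lexx ?orbT//; lra.
have := nc_ge0 (f w - f z); have := nc_ge0 (g w - g z); nra.
Qed.

Lemma ccontV f z : f z != 0 -> ccont f z -> ccont (fun w => (f w)^-1) z.
Proof.
move=> fz0 fz e e0.
have a0 : 0 < nc (f z) by rewrite nc_gt0.
pose e1 := Num.min (nc (f z) / 2) (e * nc (f z) ^+ 2 / 2).
have e10 : 0 < e1.
  by rewrite lt_min; apply/andP; split; rewrite divr_gt0// mulr_gt0// exprn_gt0.
have [d d0 h] := fz _ e10; exists d => // w /h {}h.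
have h1 : e1 <= nc (f z) / 2 by rewrite ge_min lexx.
have h2 : e1 <= e * nc (f z) ^+ 2 / 2 by rewrite ge_min lexx orbT.
have fw : nc (f z) / 2 <= nc (f w).
  by have := ncB (f w) (f w - f z); rewrite (_ : _ - (_ - _) = f z); [lra|ring].
have fw0 : f w != 0 by rewrite -nc_gt0; lra.
rewrite (_ : _ - _ = - (f w - f z) / (f w * f z)); last by field; rewrite fw0 fz0.
rewrite nc_div ncN ncM ler_pdivrMr ?mulr_gt0//; last by lra.
apply: (le_trans h); apply: (le_trans h2).
rewrite expr2; nra.
Qed.

Lemma ccont_comp f g z : ccont g z -> ccont f (g z) -> ccont (fun w => f (g w)) z.
Proof.
move=> gz fz e e0; have [d d0 h] := fz _ e0; have [d' d'0 h'] := gz _ d0.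
by exists d' => // w /h' /h.
Qed.

Lemma ccont_ext f g z d : 0 < d -> (forall w, nc (w - z) <= d -> f w = g w) ->
  ccont f z -> ccont g z.
Proof.
move=> d0 fg fz e e0; have [d' d'0 h] := fz _ e0.
exists (Num.min d d') => [|w]; first by rewrite lt_min d0.
rewrite le_min => /andP[h1 /h]; rewrite !fg// subrr nc0; exact: ltW.
Qed.

(** Caratheodory's form of differentiability, by a slope function continuous at z: the rules for
    products and compositions become algebra on slopes. *)
Lemma cdiffP f z l :
  cdiff f z l <-> exists2 s, ccont s z & s z = l /\ forall w, f w = f z + s w * (w - z).
Proof.
split=> [fz|[s sc [<- fs]] e e0]; last first.
  have [d d0 h] := sc _ e0; exists d => // w /h hw.
  rewrite (_ : _ - _ = (s w - s z) * (w - z)); last by rewrite fs; ring.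
  by rewrite ncM ler_wpM2r// nc_ge0.
pose s w := if w == z then l else (f w - f z) / (w - z).
exists s; last first.
  split=> [|w]; rewrite /s ?eqxx//; case: (eqVneq w z) => [->|wz].
    by rewrite subrr mulr0 addr0.
  by rewrite mulfVK ?subr_eq0// addrC subrK.
move=> e e0; have [d d0 h] := fz _ e0; exists d => // w /h {}h.
rewrite {2}/s eqxx /s; case: (eqVneq w z) => [_|wz]; first by rewrite subrr nc0 ltW.
have wz0 : 0 < nc (w - z) by rewrite nc_gt0 subr_eq0.
rewrite (_ : _ - l = (f w - f z - l * (w - z)) / (w - z)).
  by rewrite nc_div ler_pdivrMr.
by field; rewrite subr_eq0.
Qed.

Lemma cdiff_cont f z l : cdiff f z l -> ccont f z.
Proof.
move=> /cdiffP[s sc [_ fs]].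
have h : ccont (fun w => f z + s w * (w - z)) z.
  by apply: ccontD (ccont_cst _ _) (ccontM sc (ccontD (ccont_id _) (ccont_cst _ _))).
by apply: ccont_ext ltr01 _ h => w _; rewrite -fs.
Qed.

Lemma cdiff_cst c z : cdiff (fun=> c) z 0.
Proof. by apply/cdiffP; exists (fun=> 0); [exact: ccont_cst|split=> // w; rewrite mul0r addr0]. Qed.

Lemma cdiff_id z : cdiff id z 1.
Proof.
by apply/cdiffP; exists (fun=> 1); [exact: ccont_cst|split=> // w; rewrite mul1r addrC subrK].
Qed.

Lemma cdiffD f g z a b : cdiff f z a -> cdiff g z b -> cdiff (fun w => f w + g w) z (a + b).
Proof.
move=> /cdiffP[s sc [<- fs]] /cdiffP[t tc [<- gt]]; apply/cdiffP.
exists (fun w => s w + t w); first exact: ccontD.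
by split=> // w; rewrite fs gt; ring.
Qed.

Lemma cdiffM f g z a b : cdiff f z a -> cdiff g z b ->
  cdiff (fun w => f w * g w) z (a * g z + f z * b).
Proof.
move=> fd gd; have gc := cdiff_cont gd.
move: fd gd => /cdiffP[s sc [<- fs]] /cdiffP[t tc [<- gt]]; apply/cdiffP.
exists (fun w => s w * g w + f z * t w).
  by apply: ccontD; apply: ccontM => //; exact: ccont_cst.
by split=> // w; rewrite {1}(fs w) mulrDl {1}(gt w); ring.
Qed.

Lemma cdiffZ c f z a : cdiff f z a -> cdiff (fun w => c * f w) z (c * a).
Proof. by move=> fd; have := cdiffM (cdiff_cst c z) fd; rewrite mul0r add0r. Qed.

Lemma cdiffN f z a : cdiff f z a -> cdiff (fun w => - f w) z (- a).
Proof.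
move=> /(cdiffZ (-1)); rewrite mulN1r => h e /h[d d0 h'].
by exists d => // w /h'; rewrite !mulN1r.
Qed.

Lemma cdiffB f g z a b : cdiff f z a -> cdiff g z b -> cdiff (fun w => f w - g w) z (a - b).
Proof. by move=> fd /cdiffN; exact: cdiffD. Qed.

Lemma cdiffV f z a : f z != 0 -> cdiff f z a ->
  cdiff (fun w => (f w)^-1) z (- a / f z ^+ 2).
Proof.
move=> f0 fd; have fc := cdiff_cont fd.
have a0 : 0 < nc (f z) / 2 by rewrite divr_gt0// nc_gt0.
have [d d0 hd] := fc _ a0.
move: fd => /cdiffP[s sc [<- fs]] e e0.
have /(_ e e0)[d' d'0 hd'] : ccont (fun w => - s w / (f w * f z)) z.
  apply: ccontM.
    have /(ccont_ext ltr01) := ccontM (ccont_cst (-1) z) sc; apply=> w _.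
    by rewrite mulN1r.
  by apply: ccontV; [rewrite mulf_neq0|apply: ccontM fc (ccont_cst _ _)].
exists (Num.min d d') => [|w]; first by rewrite lt_min d0.
rewrite le_min => /andP[/hd h1 /hd' h2].
have fw : f w != 0.
  have := ncB (f w) (f w - f z); rewrite (_ : _ - (_ - _) = f z); last by ring.
  by move=> h; rewrite -nc_gt0; have := nc_gt0 (f z); rewrite f0; lra.
rewrite (_ : _ - _ = (- s w / (f w * f z) - (- s z / (f z * f z))) * (w - z)).
  by rewrite ncM ler_wpM2r// nc_ge0.
have -> : (f w)^-1 - (f z)^-1 = - (f w - f z) / (f w * f z) by field; rewrite fw f0.
have -> : f w - f z = s w * (w - z) by rewrite [f w]fs; ring.
by field; rewrite fw f0.
Qed.

Lemma cdiff_comp f g z a b : cdiff g z a -> cdiff f (g z) b ->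
  cdiff (fun w => f (g w)) z (b * a).
Proof.
move=> gd; have gc := cdiff_cont gd; move: gd.
move=> /cdiffP[s sc [<- gs]] /cdiffP[t tc [<- ft]]; apply/cdiffP.
exists (fun w => t (g w) * s w); first by apply: ccontM sc; exact: ccont_comp.
by split=> // w; rewrite ft [in X in _ + _ * X = _]gs; ring.
Qed.

Lemma cdiff_ext f g z l d : 0 < d -> (forall w, nc (w - z) <= d -> f w = g w) ->
  cdiff f z l -> cdiff g z l.
Proof.
move=> d0 fg fz e e0; have [d' d'0 h] := fz _ e0.
exists (Num.min d d') => [|w]; first by rewrite lt_min d0.
rewrite le_min => /andP[h1 /h]; rewrite !fg// subrr nc0; exact: ltW.
Qed.

Lemma cdiff_uniq f z a b : cdiff f z a -> cdiff f z b -> a = b.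
Proof.
move=> fa fb; apply/eqP; rewrite -subr_eq0 -nc_eq0 eq_le nc_ge0 andbT.
apply/ler_addgt0Pl => e e0; rewrite addr0.
have e2 : 0 < e / 2 by lra.
have [d d0 h] := fa _ e2; have [d' d'0 h'] := fb _ e2.
pose m := Num.min d d'; have m0 : 0 < m by rewrite lt_min d0.
have wm : nc (z + m%:C - z) = m by rewrite addrC addKr nc_real gtr0_norm.
have /h h1 : nc (z + m%:C - z) <= d by rewrite wm ge_min lexx.
have /h' h2 : nc (z + m%:C - z) <= d' by rewrite wm ge_min lexx orbT.
rewrite -(ler_pM2r m0) -{1}wm -ncM; move: h1 h2; rewrite wm => h1 h2.
set q := f _ in h1 h2; set w := _ - z in h1 h2 *.
rewrite (_ : _ * w = (q - f z - b * w) - (q - f z - a * w)); last by ring.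
by have := ncB (q - f z - b * w) (q - f z - a * w); lra.
Qed.

End ComplexContDiff.

(** * Cauchy's formula on a circle *)

Section Cauchy.
Variable R : realType.
Local Open Scope complex_scope.
Local Notation C := R[i].

Definition cto (u : nat -> C) (l : C) := forall e : R, 0 < e ->
  exists k0, forall k, (k0 <= k)%N -> nc (u k - l) <= e.

Lemma avg_cst (c : C) N : (0 < N)%N -> N%:R^-1 * \sum_(j < N) c = c.
Proof.
by move=> N0; rewrite sumr_const card_ord; field; rewrite pnatr_eq0 -lt0n.
Qed.

Definition eit (t : R) : C := cos t +i* sin t.

Lemma addDKl (a b : C) : a + b - a = b. Proof. by rewrite addrC addKr. Qed.

Lemma eitD s t : eit (s + t) = eit s * eit t.
Proof. by rewrite /eit cosD sinD; simpc; congr (_ +i* _); ring. Qed.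
Lemma eit0 : eit 0 = 1. Proof. by rewrite /eit cos0 sin0. Qed.
Lemma nc_eit t : nc (eit t) = 1.
Proof. by rewrite ncE /= cos2Dsin2 sqrtr1. Qed.
Lemma eit_neq0 t : eit t != 0. Proof. by rewrite -nc_gt0 nc_eit. Qed.
Lemma eitN t : eit (- t) = (eit t)^-1.
Proof. by apply: (mulfI (eit_neq0 t)); rewrite -eitD subrr eit0 divff// eit_neq0. Qed.
Lemma eit2pi : eit (2 * pi) = 1.
Proof. by rewrite mulrC mulr_natr /eit cos2pi sin2pi. Qed.
Lemma eitX t n : eit t ^+ n = eit (n%:R * t).
Proof.
by elim: n => [|n ih]; rewrite ?mul0r ?eit0// exprSr ih -eitD -natr1 mulrDl mul1r.
Qed.

Lemma lipschitz1 (f df : R -> R) : (forall x : R, is_derive x (1 : R) f (df x)) ->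
  (forall x, `|df x| <= 1) -> forall x y, `|f x - f y| <= `|x - y|.
Proof.
move=> fd df1.
have main x y : x < y -> `|f x - f y| <= `|x - y|.
  move=> xy.
  have fc : {within `[x, y], continuous f}%classic.
    apply: derivable_within_continuous => z _.
    exact: (@ex_derive _ _ _ _ _ _ _ (fd z)).
  have [c _ E] := MVT_segment (ltW xy) (fun z _ => fd z) fc.
  by rewrite distrC E normrM (distrC x) ler_piMl.
move=> x y; case: (ltgtP x y) => [/main//|/main|->]; last by rewrite !subrr normr0.
by rewrite distrC [in leRHS]distrC.
Qed.

Lemma eit_lip s t : nc (eit s - eit t) <= 2 * `|s - t|.
Proof.
apply: (le_trans (nc_le_ReIm _)).
have h1 : `|cos s - cos t| <= `|s - t|.
  apply: (@lipschitz1 cos (fun x => - sin x)) => x; rewrite normrN.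
  by rewrite ler_norml sin_geN1 sin_le1.
have h2 : `|sin s - sin t| <= `|s - t|.
  by apply: (@lipschitz1 sin cos) => x; rewrite ler_norml cos_geN1 cos_le1.
by rewrite /=; lra.
Qed.

Definition node (a : C) (r : R) (N : nat) (j : nat) : C :=
  a + r%:C * eit (j%:R * (2 * pi / N%:R)).

Lemma node_norm a r N j : 0 <= r -> nc (node a r N j - a) = r.
Proof. by move=> r0; rewrite /node addDKl ncM nc_eit mulr1 nc_real ger0_norm. Qed.

Definition cauchy_sum (f : C -> C) a r N z : C :=
  N%:R^-1 * \sum_(j < N) f (node a r N j) * (node a r N j - a) / (node a r N j - z).

Definition circle (c : C) (r v : R) : C := c + r%:C * eit (2 * pi * v).

Lemma circle_node c r N j : circle c r (j%:R / N%:R) = node c r N j.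
Proof. by rewrite /circle /node; congr (_ + _ * eit _); ring. Qed.

Lemma vedge_sum (h : C -> C) (P : R -> R -> C) k x y s : vedge h P k x y s =
  \sum_(j < 2 ^ k) trapz h (P x (y + j%:R * (s / 2 ^+ k))) (P x (y + j.+1%:R * (s / 2 ^+ k))).
Proof.
elim: k y s => [|k ih] y s.
  by rewrite /= expn0 big_ord1 mul0r addr0 expr0 divr1 mul1r.
rewrite /= !ih expnS mul2n -addnn big_split_ord /=; congr (_ + _).
  by apply: eq_bigr => j _; rewrite exprS invfM !mulrA.
apply: eq_bigr => j _.
have E (m : nat) : y + s / 2 + m%:R * (s / 2 / 2 ^+ k) = y + (2 ^ k + m)%:R * (s / 2 ^+ k.+1).
  rewrite natrD natrX exprS; field; rewrite expf_neq0//.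
by rewrite !E addnS.
Qed.

(* On a closed circle the trapezoid sums telescope to plain averages. *)
Lemma trapz_circle (h : C -> C) c r N : (0 < N)%N ->
  \sum_(j < N) trapz h (node c r N j) (node c r N j.+1) =
  (eit (2 * pi / N%:R) - eit (- (2 * pi / N%:R))) *
  \sum_(j < N) h (node c r N j) * (node c r N j - c).
Proof.
move=> N0; set w := 2 * pi / N%:R.
pose F j := h (node c r N j) * (r%:C * eit (j%:R * w)).
have nS j : node c r N j.+1 - node c r N j = r%:C * eit (j%:R * w) * (eit w - 1).
  by rewrite /node -/w -natr1 mulrDl mul1r eitD; ring.
have nS' j : node c r N j.+1 - node c r N j = r%:C * eit (j.+1%:R * w) * (1 - eit (- w)).
  rewrite nS -natr1 mulrDl mul1r eitD eitN; field; exact: eit_neq0.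
have -> : \sum_(j < N) trapz h (node c r N j) (node c r N j.+1) =
   (eit w - 1) * (\sum_(j < N) F j) + (1 - eit (- w)) * \sum_(j < N) F j.+1.
  rewrite !mulr_sumr -big_split /=; apply: eq_bigr => j _.
  by rewrite /trapz mulrDl {1}nS nS' /F; ring.
have FN : F N = F 0%N.
  have Nw : N%:R * w = 2 * pi by rewrite /w mulrC divfK// pnatr_eq0 -lt0n.
  by rewrite /F /node -/w Nw mul0r eit0 eit2pi.
have -> : \sum_(j < N) F j.+1 = \sum_(j < N) F j.
  case: N N0 w F nS nS' FN => // n _ w F _ _ FN.
  by rewrite big_ord_recr big_ord_recl /= FN addrC.
rewrite -mulrDl; congr (_ * _); first by ring.
by apply: eq_bigr => j _; rewrite /F /node -/w addDKl.
Qed.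

(** The sequence 2^k sin(2 pi / 2^k) is nondecreasing, because sin(2t) = 2 sin t cos t <= 2 sin t,
    and it equals 4 at k = 2. It bounds from below the factor in front of the averages in
    [trapz_circle]. *)
Lemma sin_dyadic k : (2 <= k)%N -> 4 <= 2 ^+ k * sin (2 * pi / 2 ^+ k) :> R.
Proof.
elim: k => // k ih; rewrite leq_eqVlt => /orP[/eqP[<-]|].
  have -> : 2 * pi / 2 ^+ 2 = pi / 2 :> R by field.
  by rewrite sin_pihalf mulr1 expr2; lra.
rewrite ltnS => k2; have {}ih := ih k2; set t := 2 * pi / 2 ^+ k.+1.
have e : 2 * pi / 2 ^+ k = t + t by rewrite /t exprS; field; rewrite expf_neq0.
have p0 : 0 < 2 ^+ k :> R by rewrite exprn_gt0.
have st : 0 <= sin t.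
  apply: sin_ge0_pi; rewrite /t divr_ge0 ?mulr_ge0 ?pi_ge0 ?exprn_ge0//=.
  rewrite ler_pdivrMr ?exprn_gt0// exprS.
  have := pi_ge0 R; have : 1 <= 2 ^+ k :> R by rewrite exprn_ege1// ler1n.
  by nra.
rewrite exprS; apply: (le_trans ih); rewrite e sinD.
have c1 : 0 <= 2 ^+ k * sin t * (1 - cos t).
  by rewrite !mulr_ge0 ?(ltW p0)// subr_ge0 cos_le1.
lra.
Qed.

(** The map [P] deforms the circle about a (u = 0) linearly into a small circle about z (u = 1)
    inside the domain of h(w) = f(w) / (w - z). The edges v = 0 and v = 1 have the same image and
    cancel, so [goursat] compares the averages over the two circles; the one over the small circle
    is close to f(z) by continuity. *)
Lemma cauchy_formula f a r z : 0 < r -> nc (z - a) < r ->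
  (forall w, nc (w - a) <= r -> exists l, cdiff f w l) ->
  cto (fun k => cauchy_sum f a r (2 ^ k) z) (f z).
Proof.
move=> r0 zr fd e e0.
have e2 : 0 < e / 2 by lra.
have [l fz] := fd z (ltW zr).
have [d d0 hd] := cdiff_cont fz e2.
pose s := Num.min d (r - nc (z - a)).
have s0 : 0 < s by rewrite lt_min d0 subr_gt0.
have sd : s <= d by rewrite ge_min lexx.
have sr : s <= r - nc (z - a) by rewrite ge_min lexx orbT.
pose P (u v : R) : C := (1 - u)%:C * circle a r v + u%:C * circle z s v.
pose h w := f w / (w - z).
pose K : R := 4 * pi * (r + s) + nc a + nc z + r + s + 1.
have pi0 := pi_ge0 R; have na := nc_ge0 a; have nz := nc_ge0 z.
have K0 : 0 < K by rewrite /K; have : 0 <= 4 * pi * (r + s); [nra|lra].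
have circ_lip c t v v' : 0 < t -> nc (circle c t v - circle c t v') <= 4 * pi * t * `|v - v'|.
  move=> t0; rewrite /circle (_ : _ - _ = t%:C * (eit (2 * pi * v) - eit (2 * pi * v'))); last by ring.
  rewrite ncM nc_real gtr0_norm//.
  have := eit_lip (2 * pi * v) (2 * pi * v').
  rewrite -mulrBr normrM (ger0_norm (_ : 0 <= 2 * pi)); last by lra.
  nra.
have circ_norm c t v : 0 < t -> nc (circle c t v - c) = t.
  by move=> t0; rewrite /circle addDKl ncM nc_eit mulr1 nc_real gtr0_norm.
have circ_bnd c t v : 0 < t -> nc (circle c t v) <= nc c + t.
  move=> t0; have := ncD (circle c t v - c) c; rewrite subrK circ_norm//; lra.
have Plip u v u' v' : 0 <= u <= 1 -> 0 <= v <= 1 -> 0 <= u' <= 1 ->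
    0 <= v' <= 1 -> nc (P u v - P u' v') <= K * (`|u - u'| + `|v - v'|).
  move=> hu hv hu' hv'.
  have -> : P u v - P u' v' = ((1 - u)%:C * (circle a r v - circle a r v') +
     u%:C * (circle z s v - circle z s v')) + (u - u')%:C * (circle z s v' - circle a r v').
    by rewrite /P !rmorphB /= rmorph1; ring.
  have A1 := circ_lip a r v v' r0; have A2 := circ_lip z s v v' s0.
  have A3 := circ_bnd a r v' r0; have A4 := circ_bnd z s v' s0.
  have A5 := ncB (circle z s v') (circle a r v').
  have A6 := ncD ((1 - u)%:C * (circle a r v - circle a r v') +
     u%:C * (circle z s v - circle z s v')) ((u - u')%:C * (circle z s v' - circle a r v')).
  have A7 := ncD ((1 - u)%:C * (circle a r v - circle a r v')) (u%:C * (circle z s v - circle z s v')).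
  move: A6 A7; rewrite !ncM !nc_real (ger0_norm (_ : 0 <= u)); last by case/andP: hu.
  rewrite (ger0_norm (_ : 0 <= 1 - u)); last by move: hu; lra.
  move=> A6 A7.
  have n1 := nc_ge0 (circle a r v - circle a r v'); have n2 := nc_ge0 (circle z s v - circle z s v').
  have n3 := normr_ge0 (u - u'); have n4 := normr_ge0 (v - v').
  have A8 : (1 - u) * nc (circle a r v - circle a r v') <= 4 * pi * r * `|v - v'|.
    by apply: le_trans A1; rewrite ler_piMl//; move: hu; clear; lra.
  have A9 : u * nc (circle z s v - circle z s v') <= 4 * pi * s * `|v - v'|.
    by apply: le_trans A2; rewrite ler_piMl//; move: hu; clear; lra.
  have A10 : `|u - u'| * nc (circle z s v' - circle a r v') <= K * `|u - u'|.
    rewrite mulrC ler_wpM2r//.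
    have : 0 <= 4 * pi * (r + s) by rewrite !mulr_ge0//; move: r0 s0; clear; lra.
    by move: A3 A4 A5; rewrite /K; clear; lra.
  have A11 : 4 * pi * r * `|v - v'| + 4 * pi * s * `|v - v'| <= K * `|v - v'|.
    rewrite -mulrDl ler_wpM2r// /K; move: r0 s0 na nz; clear; lra.
  by move: A6 A7 A8 A9 A10 A11; clear; lra.
have hdiff u v : 0 <= u <= 1 -> 0 <= v <= 1 -> exists l, cdiff h (P u v) l.
  move=> hu _.
  have inD : nc (P u v - a) <= r.
    have -> : P u v - a = (1 - u)%:C * (circle a r v - a) + u%:C * ((circle z s v - z) + (z - a)).
      by rewrite /P rmorphB /= rmorph1; ring.
    have A1 := ncD ((1 - u)%:C * (circle a r v - a)) (u%:C * ((circle z s v - z) + (z - a))).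
    have A2 := ncD (circle z s v - z) (z - a).
    move: A1 A2; rewrite !ncM !nc_real !circ_norm// (ger0_norm (_ : 0 <= u)); last by case/andP: hu.
    rewrite (ger0_norm (_ : 0 <= 1 - u)); last by move: hu; clear; lra.
    move=> A1 A2; move: hu A1 A2 sr (nc_ge0 (circle z s v - z + (z - a))); clear; nra.
  have nz' : P u v - z != 0.
    rewrite -nc_gt0.
    (* With the common direction factored out, the real part (1 - u) r + u s exceeds the modulus (1
       - u) |z - a| of the other term. *)
    have -> : P u v - z = eit (2 * pi * v) *
        (((1 - u) * r + u * s)%:C + (1 - u)%:C * ((a - z) * eit (- (2 * pi * v)))).
      by rewrite /P /circle eitN !(rmorphD, rmorphB, rmorphM) /= rmorph1; field; exact: eit_neq0.
    rewrite ncM nc_eit mul1r.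
    set q := (1 - u)%:C * _; set p := _%:C.
    have A1 := ncB (p + q) q; rewrite addrK in A1.
    have A2 : nc q = (1 - u) * nc (z - a).
      by rewrite /q !ncM nc_eit mulr1 nc_sym nc_real ger0_norm//; move: hu; clear; lra.
    have A3 : nc p = (1 - u) * r + u * s.
      rewrite nc_real ger0_norm// addr_ge0// mulr_ge0 ?(ltW r0) ?(ltW s0)//; move: hu; clear; lra.
    rewrite A2 A3 in A1.
    have [u1|u1] := eqVneq u 1.
      by move: A1; rewrite u1; move: s0; clear; lra.
    have u1' : u < 1 by rewrite lt_neqAle u1; case/andP: hu.
    have A4 : 0 < (1 - u) * (r - nc (z - a)) by rewrite mulr_gt0 ?subr_gt0.
    have A5 : 0 <= u * s by rewrite mulr_ge0 ?(ltW s0)//; case/andP: hu.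
    by move: A1 A4 A5; clear; lra.
  have [l1 hl1] := fd _ inD.
  have hz := @cdiffV _ (fun w => w - z) _ _ nz' (cdiffB (cdiff_id _) (cdiff_cst z _)).
  by exists (l1 * (P u v - z)^-1 + f (P u v) * (- (1 - 0) / (P u v - z) ^+ 2)); exact: cdiffM.
(* The averages carry a factor of modulus at least 8 / N, by [w4] below; a bound 4 e on the
   trapezoid sums leaves e / 2 for the averages. The two extra levels in [k0 + 2] are for
   [sin_dyadic]. *)
have e4 : 0 < 4 * e by rewrite mulr_gt0.
have [k0 hk0] := goursat K0 Plip hdiff e4.
exists (k0 + 2)%N => k kk.
have {}hk0 := hk0 k (leq_trans (leq_addr 2 k0) kk).
have k2 : (2 <= k)%N := leq_trans (leq_addl k0 2) kk.
set N := (2 ^ k)%N.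
have N0 : (0 < N)%N by rewrite expn_gt0.
have NR : N%:R = 2 ^+ k :> R by rewrite natrX.
have Nn : 0 < N%:R :> R by rewrite ltr0n.
move: hk0; rewrite cells_boundary.
have per c t : circle c t 1 = circle c t 0.
  by rewrite /circle mulr1 mulr0 eit0 eit2pi.
have -> : hedge h P k 0 (0 + 1) 1 = hedge h P k 0 0 1.
  suff H : forall x s, hedge h P k x (0 + 1) s = hedge h P k x 0 s by [].
  elim: (k) => [|k' ih] x t /=; last by rewrite !ih.
  by rewrite /P add0r !per.
rewrite addDKl !vedge_sum -/N.
have E1 j : P (0 + 1) (0 + j%:R * (1 / 2 ^+ k)) = node z s N j.
  by rewrite /P !add0r subrr mul0r add0r !mul1r -NR circle_node.
have E2 j : P 0 (0 + j%:R * (1 / 2 ^+ k)) = node a r N j.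
  by rewrite /P add0r subr0 !mul1r mul0r addr0 -NR circle_node.
under eq_bigr do rewrite !E1.
under [X in _ - X]eq_bigr do rewrite !E2.
rewrite !trapz_circle// -mulrBr ncM.
set A := \sum_(j < N) _; set B := \sum_(j < N) _.
have w4 : 4 <= 2^-1 * (nc (eit (2 * pi / N%:R) - eit (- (2 * pi / N%:R))) * N%:R).
  apply: (le_trans (sin_dyadic k2)).
  rewrite -NR mulrCA [leLHS]mulrC mulrA ler_pM2r//.
  have H := nc_Im (eit (2 * pi / N%:R) - eit (- (2 * pi / N%:R))).
  move: H; rewrite ImB (_ : complex.Im _ = sin (2 * pi / N%:R))//.
  rewrite (_ : complex.Im _ = - sin (2 * pi / N%:R)); last by rewrite /= sinN.
  rewrite opprK => H; have := ler_norm (sin (2 * pi / N%:R) + sin (2 * pi / N%:R) : R).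
  by move: H; clear; lra.
move=> hk.
have hAB : nc (N%:R^-1 * (A - B)) <= e / 2.
  rewrite ncM ncV nc_nat mulrC ler_pdivrMr//.
  have := nc_ge0 (A - B); set X := nc (A - B) in hk *.
  set Y := nc (_ - eit _) in hk w4 => X0.
  have : X * 8 <= X * (Y * N%:R) by rewrite ler_wpM2l//; lra.
  have : Y * X * N%:R <= 4 * e * N%:R by rewrite ler_pM2r.
  by move: e0; clear; lra.
have hA : nc (N%:R^-1 * A - f z) <= e / 2.
  have -> : N%:R^-1 * A - f z = N%:R^-1 * \sum_(j < N) (f (node z s N j) - f z).
    rewrite sumrB mulrBr; congr (_ - _).
      congr (_ * _); apply: eq_bigr => j _; rewrite /h mulfVK// subr_eq0.
      apply/eqP => hn; have := node_norm z N j (ltW s0).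
      by rewrite hn subrr nc0 => hs; move: s0; rewrite -hs ltxx.
    by rewrite avg_cst.
  rewrite ncM ncV nc_nat mulrC ler_pdivrMr//.
  apply: (le_trans (nc_sum _ _ _)).
  apply: (@le_trans _ _ (\sum_(j < N) (e / 2))).
    by apply: ler_sum => j _; apply: hd; rewrite node_norm// ltW.
  by rewrite sumr_const card_ord mulr_natr.
have -> : cauchy_sum f a r N z = N%:R^-1 * B.
  by congr (_ * _); apply: eq_bigr => j _; rewrite /h mulrAC.
rewrite (_ : _ - f z = (N%:R^-1 * A - f z) - N%:R^-1 * (A - B)); last by ring.
by have := ncB (N%:R^-1 * A - f z) (N%:R^-1 * (A - B)); lra.
Qed.

End Cauchy.

(** * Limits of complex sequences *)

Section Limits.
Variable R : realType.
Local Open Scope complex_scope.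
Local Notation C := R[i].
Implicit Types (u v : nat -> C) (l : C).

Lemma cto_cst l : cto (fun=> l) l.
Proof. by move=> e e0; exists 0%N => k _; rewrite subrr nc0 ltW. Qed.

Lemma cto_ext u v l : (forall k, u k = v k) -> cto u l -> cto v l.
Proof. by move=> uv ul e /ul[k0 h]; exists k0 => k /h; rewrite uv. Qed.

Lemma ctoD u v l m : cto u l -> cto v m -> cto (fun k => u k + v k) (l + m).
Proof.
move=> ul vm e e0; have e2 : 0 < e / 2 by lra.
have [k1 h1] := ul _ e2; have [k2 h2] := vm _ e2; exists (maxn k1 k2) => k.
rewrite geq_max => /andP[/h1 {}h1 /h2 {}h2].
rewrite (_ : _ - _ = (u k - l) + (v k - m)); last by ring.
by have := ncD (u k - l) (v k - m); lra.
Qed.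

Lemma ctoZ c u l : cto u l -> cto (fun k => c * u k) (c * l).
Proof.
move=> ul e e0; have c0 := nc_ge0 c.
have e1 : 0 < e / (nc c + 1) by rewrite divr_gt0//; lra.
have [k0 h] := ul _ e1; exists k0 => k /h {}h.
rewrite -mulrBr ncM; apply: (@le_trans _ _ ((nc c + 1) * nc (u k - l))).
  by rewrite ler_wpM2r ?nc_ge0//; lra.
by rewrite mulrC -ler_pdivlMr//; lra.
Qed.

Lemma ctoN u l : cto u l -> cto (fun k => - u k) (- l).
Proof. by move=> /(ctoZ (-1)) h; rewrite -mulN1r; apply: cto_ext h => k; rewrite mulN1r. Qed.

Lemma ctoB u v l m : cto u l -> cto v m -> cto (fun k => u k - v k) (l - m).
Proof. by move=> ul /ctoN; exact: ctoD. Qed.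

Lemma cto_bounded u l : cto u l -> exists M, forall k, nc (u k) <= M.
Proof.
move=> ul; have [k0 h] := ul _ ltr01.
exists (\sum_(i < k0) nc (u i) + (nc l + 1)) => k.
have s0 : 0 <= \sum_(i < k0) nc (u i) by apply: sumr_ge0 => i _; exact: nc_ge0.
have l0 := nc_ge0 l.
have [kk|kk] := ltnP k k0.
  move: s0; rewrite (bigD1 (Ordinal kk))//=.
  have : 0 <= \sum_(i < k0 | i != Ordinal kk) nc (u i) by apply: sumr_ge0 => i _; exact: nc_ge0.
  by move: l0; clear; lra.
have := h k kk; have := ncD (u k - l) l; rewrite subrK.
by move: l0 s0; clear; lra.
Qed.

Lemma ctoM u v l m : cto u l -> cto v m -> cto (fun k => u k * v k) (l * m).
Proof.
move=> ul vm; have [M hM] := cto_bounded ul; have M0 := le_trans (nc_ge0 _) (hM 0%N).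
move=> e e0.
have e1 : 0 < e / (2 * (M + 1)) by rewrite divr_gt0//; lra.
have m0 := nc_ge0 m.
have e2 : 0 < e / (2 * (nc m + 1)) by rewrite divr_gt0//; lra.
have [k1 h1] := vm _ e1; have [k2 h2] := ul _ e2; exists (maxn k1 k2) => k.
rewrite geq_max => /andP[/h1 {}h1 /h2 {}h2].
rewrite (_ : _ - _ = u k * (v k - m) + (u k - l) * m); last by ring.
apply: (le_trans (ncD _ _)); rewrite !ncM.
move: h1 h2; rewrite !ler_pdivlMr ?mulr_gt0//; try by lra.
have a1 := hM k; have a2 := nc_ge0 (u k); have a3 := nc_ge0 (v k - m).
have a4 := nc_ge0 (u k - l); move: M0 m0 a1 a2 a3 a4; clear; nra.
Qed.

Lemma cto_uniq u l m : cto u l -> cto u m -> l = m.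
Proof.
move=> ul um; apply/eqP; rewrite -subr_eq0 -nc_eq0 eq_le nc_ge0 andbT.
apply/ler_addgt0Pl => e e0; rewrite addr0.
have [k0 h] := ctoB um ul e0.
by have := h k0 (leqnn _); rewrite subrr sub0r ncN nc_sym.
Qed.

Lemma cto_norm_le u l M : (exists k0, forall k, (k0 <= k)%N -> nc (u k) <= M) -> cto u l -> nc l <= M.
Proof.
move=> [k1 uM] ul; apply/ler_addgt0Pl => e e0.
have [k0 h] := ul _ e0; have := h _ (leq_maxl k0 k1); have := uM _ (leq_maxr k0 k1).
by have := ncB (u (maxn k0 k1)) (u (maxn k0 k1) - l); rewrite opprB addrC subrK; lra.
Qed.

Lemma cto_squeeze u l (a : nat -> R) : (forall k, nc (u k - l) <= a k) ->
  (forall e, 0 < e -> exists k0, forall k, (k0 <= k)%N -> a k <= e) -> cto u l.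
Proof. by move=> ua a0 e /a0[k0 h]; exists k0 => k /h; exact: le_trans. Qed.

Lemma cto_sub u l (g : nat -> nat) : (forall k, (k <= g k)%N) -> cto u l -> cto (u \o g) l.
Proof. by move=> gk ul e /ul[k0 h]; exists k0 => k kk; apply: h; exact: leq_trans (gk k). Qed.

Lemma cto_shift (u : nat -> C) l : cto (fun k => u k.+1) l -> cto u l.
Proof.
move=> ul e /ul[k0 h]; exists k0.+1 => -[//|k]; rewrite ltnS; exact: h.
Qed.

Lemma cto_sum (I : Type) (r : seq I) (F : I -> nat -> C) (L : I -> C) :
  (forall i, cto (F i) (L i)) ->
  cto (fun k => \sum_(i <- r) F i k) (\sum_(i <- r) L i).
Proof.
move=> FL; elim: r => [|i r ih].
  by rewrite big_nil; apply: cto_ext (cto_cst 0) => k; rewrite big_nil.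
by rewrite big_cons; apply: cto_ext (ctoD (FL i) ih) => k; rewrite big_cons.
Qed.

Lemma real_cauchy (u : nat -> R) :
  (forall e, 0 < e -> exists k0, forall k m, (k0 <= k)%N -> (k0 <= m)%N -> `|u k - u m| <= e) ->
  exists l : R, forall e, 0 < e -> exists k0, forall k, (k0 <= k)%N -> `|u k - l| <= e.
Proof.
move=> hu; have : cvgn u.
  apply: cauchy_cvg; apply/cauchy_exP => e e0.
  have e2 : 0 < e / 2 by lra.
  have [k0 h] := hu _ e2; exists (u k0); exists k0 => // k /= kk.
  by rewrite /ball /=; have := h _ _ (leqnn k0) kk; lra.
move=> /cvg_ex[l ul]; exists l => e e0.
move/cvgr_dist_le : ul => /(_ e e0)[k0 _ h]; exists k0 => k kk.
by rewrite distrC; exact: h.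
Qed.

Lemma cto_cauchy u :
  (forall e, 0 < e -> exists k0, forall k m, (k0 <= k)%N -> (k0 <= m)%N -> nc (u k - u m) <= e) ->
  exists l, cto u l.
Proof.
move=> hu.
have [|a ha] := @real_cauchy (fun k => complex.Re (u k)).
  move=> e /hu[k0 h]; exists k0 => k m h1 h2.
  by rewrite -ReB; exact: le_trans (nc_Re _) (h _ _ h1 h2).
have [|b hb] := @real_cauchy (fun k => complex.Im (u k)).
  move=> e /hu[k0 h]; exists k0 => k m h1 h2.
  by rewrite -ImB; exact: le_trans (nc_Im _) (h _ _ h1 h2).
exists (a +i* b) => e e0; have e2 : 0 < e / 2 by lra.
have [k1 h1] := ha _ e2; have [k2 h2] := hb _ e2; exists (maxn k1 k2) => k.
rewrite geq_max => /andP[/h1 {}h1 /h2 {}h2].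
by apply: (le_trans (nc_le_ReIm _)); rewrite ReB ImB /=; lra.
Qed.

Lemma cto_is_cauchy u l : cto u l -> forall e, 0 < e ->
  exists k0, forall k m, (k0 <= k)%N -> (k0 <= m)%N -> nc (u k - u m) <= e.
Proof.
move=> ul e e0; have e2 : 0 < e / 2 by lra.
have [k0 h] := ul _ e2; exists k0 => k m /h h1 /h h2.
rewrite (_ : _ - _ = (u k - l) - (u m - l)); last by ring.
by have := ncB (u k - l) (u m - l); lra.
Qed.

Lemma bernoulli (x : R) n : -1 <= x -> 1 + n%:R * x <= (1 + x) ^+ n.
Proof.
move=> x1; elim: n => [|n ih]; first by rewrite mul0r addr0 expr0.
rewrite exprS -natr1; apply: (@le_trans _ _ ((1 + x) * (1 + n%:R * x))).
  by have : 0 <= n%:R * x ^+ 2 :> R; [rewrite mulr_ge0// sqr_ge0|rewrite expr2; lra].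
by rewrite ler_wpM2l//; lra.
Qed.

Lemma geom_small (t e M : R) : 0 <= t < 1 -> 0 < e -> 0 <= M ->
  exists k0, forall k, (k0 <= k)%N -> M * t ^+ k <= e.
Proof.
move=> /andP[t0 t1] e0 M0.
have [->|tn] := eqVneq t 0.
  by exists 1%N => -[//|k] _; rewrite exprS mul0r mulr0 ltW.
have tp : 0 < t by rewrite lt_neqAle eq_sym tn.
pose x := t^-1 - 1; have x0 : 0 < x by rewrite subr_gt0 invf_gt1.
exists (Num.truncn (M / (e * x))).+1 => k kk.
have hk : M / (e * x) < k%:R.
  by apply: (lt_le_trans (truncnS_gt _)); rewrite ler_nat.
have := @bernoulli x k ltac:(lra); rewrite (_ : 1 + x = t^-1); last by rewrite /x; ring.
move=> hb.
rewrite -[t in t ^+ k]invrK exprVn ler_pdivrMr ?exprn_gt0 ?invr_gt0//.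
move: hk; rewrite ltr_pdivrMr ?mulr_gt0// => hk.
apply: (@le_trans _ _ (e * (1 + k%:R * x))); first by lra.
by rewrite ler_wpM2l// ltW.
Qed.

End Limits.

(** * Taylor series and local-to-global bounds *)

Section PowerSeries.
Variable R : realType.
Local Open Scope complex_scope.
Local Notation C := R[i].
Implicit Types (f : C -> C) (a w z : C) (c : nat -> C).

Definition psum c w n := \sum_(k < n) c k * w ^+ k.

(** A Riemann sum for the k-th Taylor coefficient of f at a. *)
Definition circle_avg f a r N k : C :=
  N%:R^-1 * \sum_(j < N) f (node a r N j) / (node a r N j - a) ^+ k.

Lemma geom_sum (F : comNzRingType) (x : F) n : (1 - x) * \sum_(i < n) x ^+ i = 1 - x ^+ n.
Proof.
elim: n => [|n ih]; first by rewrite big_ord0 expr0 mulr0 subrr.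
by rewrite big_ord_recr /= mulrDr ih exprS; ring.
Qed.

Lemma avg_le (F : nat -> C) N M : (0 < N)%N -> (forall j, nc (F j) <= M) ->
  nc (N%:R^-1 * \sum_(j < N) F j) <= M.
Proof.
move=> N0 FM; rewrite ncM ncV nc_nat mulrC ler_pdivrMr ?ltr0n//.
apply: (le_trans (nc_sum _ _ _)); apply: (@le_trans _ _ (\sum_(j < N) M)).
  by apply: ler_sum => j _; exact: FM.
by rewrite sumr_const card_ord mulr_natr.
Qed.

Lemma circle_avg_le f a r N k M : 0 < r -> (0 < N)%N ->
  (forall w, nc (w - a) = r -> nc (f w) <= M) -> nc (circle_avg f a r N k) <= M / r ^+ k.
Proof.
move=> r0 N0 fM; apply: (avg_le (F := fun j => f (node a r N j) / (node a r N j - a) ^+ k)) => // j.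
rewrite nc_div ncX node_norm ?(ltW r0)// ler_wpM2r ?invr_ge0 ?exprn_ge0 ?(ltW r0)//.
by apply: fM; rewrite node_norm ?(ltW r0).
Qed.

(** The geometric series of 1 / (1 - w / (u - a)) is cut at K under the average; the error term is
    its exact remainder. *)
Lemma cauchy_sum_expand f a r N K w M : 0 < r -> nc w < r -> (0 < N)%N ->
  (forall w, nc (w - a) = r -> nc (f w) <= M) ->
  nc (cauchy_sum f a r N (a + w) - \sum_(i < K) circle_avg f a r N i * w ^+ i)
  <= M * (nc w / r) ^+ K * (r / (r - nc w)).
Proof.
move=> r0 wr N0 fM.
pose F j := f (node a r N j) * (w / (node a r N j - a)) ^+ K *
   ((node a r N j - a) / (node a r N j - a - w)).
rewrite (_ : _ - _ = N%:R^-1 * \sum_(j < N) F j).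
  apply: (avg_le (F := F)) => // j; rewrite /F; set u := node _ _ _ _.
  have nu : nc (u - a) = r by rewrite node_norm ?(ltW r0).
  have M0 : 0 <= M by exact: le_trans (nc_ge0 _) (fM _ nu).
  rewrite !ncM ncX ncM !ncV nu; apply: ler_pM; rewrite ?mulr_ge0 ?nc_ge0//.
  - by rewrite exprn_ge0// divr_ge0 ?nc_ge0 ?(ltW r0).
  - by rewrite (ltW r0).
  - by rewrite invr_ge0 nc_ge0.
  - by apply: ler_wpM2r; [rewrite exprn_ge0// divr_ge0 ?nc_ge0 ?(ltW r0)|exact: fM].
  - rewrite ler_wpM2l ?(ltW r0)// lef_pV2 ?posrE ?subr_gt0//.
      by have := ncB (u - a - w) (- w); rewrite opprK subrK nu ncN; lra.
    have := ncB (u - a - w) (- w); rewrite opprK subrK nu ncN; lra.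
have -> : \sum_(i < K) circle_avg f a r N i * w ^+ i =
   N%:R^-1 * \sum_(j < N) (f (node a r N j) * \sum_(i < K) (w / (node a r N j - a)) ^+ i).
  rewrite /circle_avg; under eq_bigr do rewrite -mulrA mulr_suml.
  rewrite -mulr_sumr exchange_big /=; congr (_ * _); apply: eq_bigr => j _.
  by rewrite mulr_sumr; apply: eq_bigr => i _; rewrite expr_div_n; ring.
rewrite /cauchy_sum -mulrBr -sumrB; congr (_ * _); apply: eq_bigr => j _; rewrite /F.
set u := node _ _ _ _; have nu : nc (u - a) = r by rewrite node_norm ?(ltW r0).
have u0 : u - a != 0 by rewrite -nc_gt0 nu.
have uw : u - a - w != 0.
  by rewrite -nc_gt0; have := ncB (u - a - w) (- w); rewrite opprK subrK nu ncN; lra.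
have := geom_sum (w / (u - a)) K; set S := \sum_(i < K) _ => hS.
have -> : S = (1 - (w / (u - a)) ^+ K) / (1 - w / (u - a)).
  rewrite -hS mulrC mulKf// -[1](@divff _ (u - a))// -mulrBl mulf_neq0// invr_eq0//.
rewrite opprD addrA; set q := (_ / _) ^+ K.
by field; rewrite u0 uw.
Qed.

Lemma tail_small (M t s : R) : 0 <= t < 1 -> 0 <= M -> 0 <= s -> forall e, 0 < e ->
  exists k0, forall k, (k0 <= k)%N -> M * t ^+ k * s <= e.
Proof.
move=> t01 M0 s0 e e0.
have [k0 h] := geom_small t01 e0 (mulr_ge0 M0 s0).
by exists k0 => k /h; rewrite mulrAC.
Qed.

(** Cauchy's formula is a hypothesis here, so that the lemma serves uniform limits as well. That the
    averages defining the k-th coefficient converge is shown by induction on k: the formula at a +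
    x, minus the terms of lower order and divided by x^k, converges, and it is within O(x) of the
    k-th average uniformly in the number of nodes. *)
Lemma power_series_of_cauchy f a r M : 0 < r ->
  (forall w, nc (w - a) = r -> nc (f w) <= M) ->
  (forall z, nc (z - a) < r -> cto (fun k => cauchy_sum f a r (2 ^ k) z) (f z)) ->
  exists c, [/\ forall k, cto (fun n => circle_avg f a r (2 ^ n) k) (c k),
    forall k, nc (c k) * r ^+ k <= M &
    forall w, nc w < r -> cto (psum c w) (f (a + w))].
Proof.
move=> r0 fM fC.
have M0 : 0 <= M.
  apply: le_trans (nc_ge0 _) (fM (a + r%:C) _).
  by rewrite addDKl nc_real gtr0_norm.
have pw n : (0 < 2 ^ n)%N by rewrite expn_gt0.
have lim k : exists l, cto (fun n => circle_avg f a r (2 ^ n) k) l.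
  elim/ltn_ind: k => k ih; apply: cto_cauchy => e e0.
  pose B := M / r ^+ k; have B0 : 0 <= B by rewrite divr_ge0// exprn_ge0 ?(ltW r0).
  (* The remainder of order k + 1, divided by x^k, is at most 2 B x / r, and this x makes it at most
     e / 3. *)
  pose x := Num.min (r / 2) (r * e / (6 * (B + 1))).
  have x0 : 0 < x.
    rewrite lt_min; apply/andP; split; [lra|].
    by rewrite divr_gt0 ?mulr_gt0//; lra.
  have x1 : x <= r / 2 by rewrite ge_min lexx.
  have x2 : x <= r * e / (6 * (B + 1)) by rewrite ge_min lexx orbT.
  have nx : nc x%:C = x by rewrite nc_real gtr0_norm.
  have xr : nc x%:C < r by rewrite nx; lra.
  pose Q n := (cauchy_sum f a r (2 ^ n) (a + x%:C) -
      \sum_(i < k) circle_avg f a r (2 ^ n) i * x%:C ^+ i) / x%:C ^+ k.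
  have [q Qq] : exists q, cto Q q.
    have [L hL] : exists L, forall i : 'I_k, cto (fun n => circle_avg f a r (2 ^ n) i) (L i).
      have /choice[L hL] : forall i : 'I_k, exists l, cto (fun n => circle_avg f a r (2 ^ n) i) l.
        by move=> i; exact: ih.
      by exists L.
    have hz : nc (a + x%:C - a) < r by rewrite addDKl.
    have h1 := ctoB (fC _ hz)
      (cto_sum (index_enum 'I_k) (fun i => ctoZ (x%:C ^+ i) (hL i))).
    exists ((x%:C ^+ k)^-1 * (f (a + x%:C) - \sum_(i <- index_enum 'I_k) x%:C ^+ i * L i)).
    apply: cto_ext (ctoZ _ h1) => n; rewrite /Q [RHS]mulrC; congr (_ * (_ - _)).
    by apply: eq_bigr => i _; rewrite mulrC.
  have hQ n : nc (Q n - circle_avg f a r (2 ^ n) k) <= e / 3.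
    have := @cauchy_sum_expand f a r (2 ^ n) k.+1 x%:C M r0 xr (pw n) fM.
    rewrite big_ord_recr /= opprD addrA nx => h.
    rewrite (_ : _ - _ = (cauchy_sum f a r (2 ^ n) (a + x%:C) -
      \sum_(i < k) circle_avg f a r (2 ^ n) i * x%:C ^+ i -
      circle_avg f a r (2 ^ n) k * x%:C ^+ k) / x%:C ^+ k); last first.
      by rewrite /Q; field; rewrite -nc_gt0 ncX nx exprn_gt0.
    rewrite nc_div ncX nx ler_pdivrMr ?exprn_gt0//; apply: (le_trans h).
    have -> : M * (x / r) ^+ k.+1 * (r / (r - x)) = B * x ^+ k * (x / (r - x)).
      by rewrite /B exprS expr_div_n; field; rewrite expf_neq0 ?gt_eqF//; lra.
    have x3 : x / (r - x) <= 2 * x / r.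
      rewrite ler_pdivrMr; last by lra.
      rewrite mulrAC ler_pdivlMr//; nra.
    have x4 : 2 * x / r * (B + 1) <= e / 3.
      move: x2; rewrite ler_pdivlMr; last by lra.
      by move=> x2; rewrite mulrAC ler_pdivrMr//; lra.
    rewrite mulrAC ler_wpM2r ?exprn_ge0 ?(ltW x0)//.
    apply: le_trans x4; rewrite mulrC.
    have x5 : 0 <= x / (r - x) by rewrite divr_ge0 ?(ltW x0)//; lra.
    by apply: ler_pM => //; lra.
  have e3 : 0 < e / 3 by lra.
  have [k0 hk0] := cto_is_cauchy Qq e3; exists k0 => n m hn hm.
  rewrite (_ : _ - _ = (Q n - Q m) - (Q n - circle_avg f a r (2 ^ n) k)
     + (Q m - circle_avg f a r (2 ^ m) k)); last by ring.
  have h1 := hk0 n m hn hm; have h2 := hQ n; have h3 := hQ m.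
  have h4 := ncD ((Q n - Q m) - (Q n - circle_avg f a r (2 ^ n) k)) (Q m - circle_avg f a r (2 ^ m) k).
  have h5 := ncB (Q n - Q m) (Q n - circle_avg f a r (2 ^ n) k).
  by move: h1 h2 h3 h4 h5; clear; lra.
have [c hc] := choice lim; exists c; split=> // [k|w wr].
  rewrite -ler_pdivlMr ?exprn_gt0//; apply: (cto_norm_le _ (hc k)).
  by exists 0%N => n _; apply: circle_avg_le.
have t01 : 0 <= nc w / r < 1.
  by rewrite divr_ge0 ?nc_ge0 ?(ltW r0)//= ltr_pdivrMr// mul1r.
have s0 : 0 <= r / (r - nc w) by rewrite divr_ge0 ?(ltW r0)// subr_ge0 ltW.
apply: cto_squeeze (tail_small t01 M0 s0) => K.
rewrite nc_sym.
have hz : nc (a + w - a) < r by rewrite addDKl.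
have hlim := ctoB (fC _ hz) (cto_sum (index_enum 'I_K) (fun i : 'I_K => ctoZ (w ^+ i) (hc i))).
have -> : psum c w K = \sum_(i <- index_enum 'I_K) w ^+ i * c i.
  by apply: eq_bigr => i _; rewrite mulrC.
apply: (cto_norm_le _ hlim); exists 0%N => n _.
have := @cauchy_sum_expand f a r (2 ^ n) K w M r0 wr (pw n) fM.
by under eq_bigr do rewrite mulrC.
Qed.

Lemma square_bounded (F : R -> R -> C) :
  (forall u v, 0 <= u <= 1 -> 0 <= v <= 1 -> exists2 d, 0 < d & exists M,
     forall u' v', `|u' - u| <= d -> `|v' - v| <= d -> 0 <= u' <= 1 -> 0 <= v' <= 1 ->
     nc (F u' v') <= M) ->
  exists M, forall u v, 0 <= u <= 1 -> 0 <= v <= 1 -> nc (F u v) <= M.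
Proof.
move=> loc.
pose good (x y h : R) := exists M, forall u v, x <= u <= x + h -> y <= v <= y + h ->
   0 <= u <= 1 -> 0 <= v <= 1 -> nc (F u v) <= M.
suff [M hM] : good 0 0 1.
  by exists M => u v hu hv; apply: hM => //; rewrite add0r.
apply: square_induction => [x y h [m1 h1] [m2 h2] [m3 h3] [m4 h4]|u v hu hv].
  exists (Num.max (Num.max m1 m2) (Num.max m3 m4)) => u v hu hv u01 v01.
  rewrite !le_max; case: (leP u (x + h / 2)) => hu'; case: (leP v (y + h / 2)) => hv'.
  - by rewrite h1//; lra.
  - by rewrite h3 ?orbT//; lra.
  - by rewrite h2 ?orbT//; lra.
  - by rewrite h4 ?orbT//; lra.
have [d d0 [M hM]] := loc u v hu hv; exists d => // x y h /andP[h0 hd] hu1 hv1 x0 xh y0 yh.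
exists M => u' v' hu' hv' u01 v01; apply: hM => //; rewrite ler_norml; lra.
Qed.

(** The hypotheses say that [D] is bounded and closed. The function is extended by 0 to a square
    containing [D]; at a point off [D] the extension vanishes nearby, so it is locally bounded
    everywhere. *)
Lemma compact_bounded f (D : C -> Prop) (L : R) :
  (forall w, D w -> nc w <= L) ->
  (forall w, ~ D w -> exists2 d : R, 0 < d & forall w', nc (w' - w) <= d -> ~ D w') ->
  (forall w, D w -> ccont f w) ->
  exists M, forall w, D w -> nc (f w) <= M.
Proof.
move=> DL Dc fc.
pose A := `|L| + 1; have A0 : 0 < A by rewrite /A; have := normr_ge0 L; lra.
pose P u v : C := (A * (2 * u - 1)) +i* (A * (2 * v - 1)).
pose F u v := if `[< D (P u v) >] then f (P u v) else 0.
have Pd u v u' v' : nc (P u' v' - P u v) <= 2 * A * `|u' - u| + 2 * A * `|v' - v|.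
  apply: (le_trans (nc_le_ReIm _)); rewrite ReB ImB /=.
  rewrite -!mulrBr !normrM (gtr0_norm A0).
  rewrite (_ : 2 * u' - 1 - (2 * u - 1) = 2 * (u' - u)); last by ring.
  rewrite (_ : 2 * v' - 1 - (2 * v - 1) = 2 * (v' - v)); last by ring.
  by rewrite !normrM (ger0_norm (ler0n _ 2)); lra.
have near u v d : 0 < d -> exists2 d', 0 < d' & forall u' v', `|u' - u| <= d' ->
    `|v' - v| <= d' -> nc (P u' v' - P u v) <= d.
  move=> d0; exists (d / (4 * A)) => [|u' v']; first by rewrite divr_gt0// mulr_gt0.
  rewrite !ler_pdivlMr ?mulr_gt0// => h1 h2; apply: (le_trans (Pd _ _ _ _)); lra.
have [M hM] : exists M, forall u v, 0 <= u <= 1 -> 0 <= v <= 1 -> nc (F u v) <= M.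
  apply: square_bounded => u v _ _; have [h|h] := pselect (D (P u v)).
    have [d d0 hd] := fc _ h _ ltr01; have [d' d'0 hd'] := near u v d d0.
    exists d' => //; exists (nc (f (P u v)) + 1) => u' v' h1 h2 _ _.
    rewrite /F; case: asboolP => _; last by rewrite nc0 addr_ge0// nc_ge0.
    have := hd _ (hd' _ _ h1 h2); have := ncD (f (P u' v') - f (P u v)) (f (P u v)).
    by rewrite subrK; lra.
  have [d d0 hd] := Dc _ h; have [d' d'0 hd'] := near u v d d0.
  exists d' => //; exists 0 => u' v' h1 h2 _ _; rewrite /F asboolF ?nc0//.
  exact: hd (hd' _ _ h1 h2).
exists M => w Dw; have hw := DL _ Dw.
pose u := (complex.Re w / A + 1) / 2; pose v := (complex.Im w / A + 1) / 2.
have Pw : P u v = w.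
  by case: (w) @u @v => x y; rewrite /P /=; congr (_ +i* _); field; rewrite gt_eqF.
have r1 := nc_Re w; have r2 := nc_Im w; have := ler_norm L.
have bnd x : `|x| <= nc w -> 0 <= (x / A + 1) / 2 <= 1.
  move=> hx; have : `|x / A| <= 1.
    by rewrite normrM normfV (gtr0_norm A0) ler_pdivrMr// mul1r /A; have := ler_norm L; lra.
  by rewrite ler_norml; lra.
by have := hM u v (bnd _ r1) (bnd _ r2); rewrite /F Pw asboolT.
Qed.

Lemma disc_bounded f a r : (forall w, nc (w - a) <= r -> ccont f w) ->
  exists M, forall w, nc (w - a) <= r -> nc (f w) <= M.
Proof.
move=> fc; apply: (@compact_bounded _ _ (r + nc a)) fc => w.
  by move=> h; have := ncD (w - a) a; rewrite subrK; lra.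
move/negP; rewrite -ltNge => h; exists ((nc (w - a) - r) / 2) => [|w' hw']; [lra|].
apply/negP; rewrite -ltNge; have := ncB (w' - a) (w' - w).
by rewrite (_ : w' - a - (w' - w) = w - a); [lra|ring].
Qed.

Lemma holo_power_series f a r : 0 < r ->
  (forall w, nc (w - a) <= r -> exists l, cdiff f w l) ->
  exists c, [/\ forall k, cto (fun n => circle_avg f a r (2 ^ n) k) (c k),
    exists M, forall k, nc (c k) * r ^+ k <= M &
    forall w, nc w < r -> cto (psum c w) (f (a + w))].
Proof.
move=> r0 fd.
have fc w : nc (w - a) <= r -> ccont f w by move=> /fd[l]; exact: cdiff_cont.
have [M hM] := disc_bounded fc.
have fM w : nc (w - a) = r -> nc (f w) <= M by move=> hw; apply: hM; rewrite hw.
have fC z : nc (z - a) < r -> cto (fun k => cauchy_sum f a r (2 ^ k) z) (f z).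
  by move=> zr; apply: cauchy_formula.
have [c [h1 h2 h3]] := power_series_of_cauchy r0 fM fC.
by exists c; split=> //; exists M.
Qed.

(** If the differences of the coefficients vanish below k, the k-th one is the quotient by x^k of a
    series with sum 0, up to a tail of size O(x); x is then taken small. *)
Lemma psum_unique c c' r : 0 < r ->
  (exists2 r', 0 < r' & exists M, forall k, nc (c k) * r' ^+ k <= M) ->
  (exists2 r', 0 < r' & exists M, forall k, nc (c' k) * r' ^+ k <= M) ->
  (forall w, nc w < r -> exists2 l, cto (psum c w) l & cto (psum c' w) l) ->
  c =1 c'.
Proof.
move=> r0 [r1 r10 [M1 h1]] [r2 r20 [M2 h2]] hl.
pose d k := c k - c' k.
pose s := Num.min r (Num.min r1 r2).
have s0 : 0 < s by rewrite !lt_min r0 r10.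
have sr : s <= r by rewrite ge_min lexx.
have s1 : s <= r1 by rewrite !ge_min lexx orbT.
have s2 : s <= r2 by rewrite !ge_min lexx !orbT.
pose M := M1 + M2.
have dM k : nc (d k) * s ^+ k <= M.
  apply: (@le_trans _ _ (nc (c k) * s ^+ k + nc (c' k) * s ^+ k)).
    by rewrite -mulrDl ler_wpM2r ?exprn_ge0 ?(ltW s0)// ncB.
  apply: lerD; [apply: le_trans (h1 k)|apply: le_trans (h2 k)];
    by rewrite ler_wpM2l ?nc_ge0// lerXn2r// nnegrE ltW.
have M0 : 0 <= M by apply: le_trans (dM 0%N); rewrite expr0 mulr1 nc_ge0.
have d0 w : nc w < r -> cto (psum d w) 0.
  move=> /hl[l ha hb]; have := ctoB ha hb; rewrite subrr; apply: cto_ext => n.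
  by rewrite /psum -sumrB; apply: eq_bigr => i _; rewrite /d; ring.
suff dz k : d k = 0 by move=> k; apply/eqP; rewrite -subr_eq0; apply/eqP; exact: dz.
elim/ltn_ind: k => k ih; apply/eqP; rewrite -nc_eq0 eq_le nc_ge0 andbT.
apply/ler_addgt0Pl => e e0; rewrite addr0.
pose B := M / s ^+ k; have B0 : 0 <= B by rewrite divr_ge0// exprn_ge0 ?(ltW s0).
pose x := Num.min (s / 2) (s * e / (2 * (B + 1))).
have x0 : 0 < x.
  rewrite lt_min; apply/andP; split; [lra|].
  by rewrite divr_gt0 ?mulr_gt0//; lra.
have x1 : x <= s / 2 by rewrite ge_min lexx.
have x2 : x <= s * e / (2 * (B + 1)) by rewrite ge_min lexx orbT.
have nx : nc x%:C = x by rewrite nc_real gtr0_norm.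
have xr : nc x%:C < r by rewrite nx; lra.
have key n : nc (psum d x%:C (k.+1 + n) - d k * x%:C ^+ k) <= 2 * B / s * x ^+ k.+1.
  rewrite /psum big_split_ord big_ord_recr /= big1 ?add0r; last first.
    by move=> i _; rewrite ih ?mul0r.
  rewrite addDKl; apply: (le_trans (nc_sum _ _ _)).
  apply: (@le_trans _ _ (\sum_(i < n) B / s * x ^+ k.+1 * 2^-1 ^+ i)).
    apply: ler_sum => i _; rewrite ncM ncX nx exprD.
    have := dM (k.+1 + i)%N; rewrite -ler_pdivlMr ?exprn_gt0// => hd.
    apply: (@le_trans _ _ (M / s ^+ (k.+1 + i) * (x ^+ k.+1 * x ^+ i))).
      by rewrite ler_wpM2r// mulr_ge0// exprn_ge0 ?(ltW x0).
    have -> : M / s ^+ (k.+1 + i) * (x ^+ k.+1 * x ^+ i) = B / s * x ^+ k.+1 * (x / s) ^+ i.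
      by rewrite /B exprD exprS expr_div_n; field; rewrite !expf_neq0 ?gt_eqF.
    rewrite ler_wpM2l//; first by rewrite !mulr_ge0 ?invr_ge0 ?exprn_ge0 ?(ltW s0) ?(ltW x0).
    rewrite lerXn2r ?nnegrE ?divr_ge0 ?(ltW x0) ?(ltW s0) ?invr_ge0//.
    by rewrite ler_pdivrMr//; lra.
  rewrite -mulr_sumr (_ : 2 * B / s * x ^+ k.+1 = B / s * x ^+ k.+1 * 2); last by ring.
  rewrite ler_wpM2l//; first by rewrite !mulr_ge0 ?invr_ge0 ?exprn_ge0 ?(ltW s0) ?(ltW x0).
  have := geom_sum (2^-1 : R) n.
  by have : 0 <= 2^-1 ^+ n :> R; [rewrite exprn_ge0|lra].
have hlim : cto (fun n => psum d x%:C (k.+1 + n) - d k * x%:C ^+ k) (0 - d k * x%:C ^+ k).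
  apply: ctoB (cto_cst _); apply: (cto_sub (g := fun n => (k.+1 + n)%N)) (d0 _ xr).
  by move=> n; rewrite leq_addl.
have := @cto_norm_le _ _ _ (2 * B / s * x ^+ k.+1) _ hlim.
rewrite sub0r ncN ncM ncX nx => h.
have {}h := h (ex_intro _ 0%N (fun n _ => key n)).
move: h; rewrite exprS mulrA ler_pM2r ?exprn_gt0// => h.
apply: (le_trans h); rewrite mulrAC ler_pdivrMr//.
move: x2; rewrite ler_pdivlMr; last by lra.
nra.
Qed.

Lemma cto_psum_coef_le c r M w : 0 < r -> (forall k, nc (c k) * r ^+ k <= M) -> nc w < r ->
  exists l, cto (psum c w) l.
Proof.
move=> r0 cM wr.
have M0 : 0 <= M by apply: le_trans (cM 0%N); rewrite expr0 mulr1 nc_ge0.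
have t01 : 0 <= nc w / r < 1.
  by rewrite divr_ge0 ?nc_ge0 ?(ltW r0)//= ltr_pdivrMr// mul1r.
have s0 : 0 <= (1 - nc w / r)^-1 by rewrite invr_ge0; lra.
have step m n : nc (psum c w (m + n) - psum c w m) <= M * (nc w / r) ^+ m * (1 - nc w / r)^-1.
  rewrite /psum big_split_ord /= addDKl; apply: (le_trans (nc_sum _ _ _)).
  apply: (@le_trans _ _ (\sum_(i < n) M * (nc w / r) ^+ m * (nc w / r) ^+ i)).
    apply: ler_sum => i _; rewrite ncM ncX -mulrA -exprD expr_div_n.
    have := cM (m + i)%N; rewrite -ler_pdivlMr ?exprn_gt0// => h.
    apply: (@le_trans _ _ (M / r ^+ (m + i) * nc w ^+ (m + i))).
      by rewrite ler_wpM2r ?exprn_ge0 ?nc_ge0.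
    by rewrite mulrAC mulrA.
  rewrite -mulr_sumr ler_wpM2l//; first by rewrite mulr_ge0// exprn_ge0; case/andP: t01.
  rewrite -[leRHS]mul1r ler_pdivlMr; last by lra.
  rewrite mulrC geom_sum; have : 0 <= (nc w / r) ^+ n by rewrite exprn_ge0; case/andP: t01.
  by lra.
apply: cto_cauchy => e e0; have [k0 h] := tail_small t01 M0 s0 e0.
exists k0 => k m hk hm; have [km|/ltnW mk] := leqP k m.
  rewrite nc_sym -(subnKC km); apply: (le_trans (step _ _)); exact: h.
rewrite -(subnKC mk); apply: (le_trans (step _ _)); exact: h.
Qed.

End PowerSeries.

(** * Analytic functions *)

Section ComplexExp.
Variable R : realType.
Local Open Scope complex_scope.
Local Notation C := R[i].
Implicit Types (z w : C).

Lemma cexpE z : cexp z = (expR (complex.Re z))%:C * eit (complex.Im z).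
Proof. by []. Qed.
Lemma cexpD z w : cexp (z + w) = cexp z * cexp w.
Proof. by rewrite !cexpE ReD ImD expRD eitD rmorphM /=; ring. Qed.
Lemma cexp0 : cexp (0 : C) = 1.
Proof. by rewrite cexpE /= expR0 eit0 mulr1. Qed.
Lemma nc_cexp z : nc (cexp z) = expR (complex.Re z).
Proof. by rewrite cexpE ncM nc_eit mulr1 nc_real ger0_norm ?expR_ge0. Qed.
Lemma cexp_neq0 z : cexp z != 0. Proof. by rewrite -nc_gt0 nc_cexp expR_gt0. Qed.
Lemma cexpN z : cexp (- z) = (cexp z)^-1.
Proof. by apply: (mulfI (cexp_neq0 z)); rewrite -cexpD subrr cexp0 divff// cexp_neq0. Qed.
Lemma cexpB z w : cexp (z - w) = cexp z / cexp w.
Proof. by rewrite cexpD cexpN. Qed.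
Lemma cexp_real (x : R) : cexp x%:C = (expR x)%:C.
Proof. by rewrite cexpE /= eit0 mulr1. Qed.
Lemma abs_sin_le (y : R) : `|sin y| <= `|y|.
Proof.
have := @lipschitz1 R sin cos (@is_derive_sin R) _ y 0.
by rewrite sin0 !subr0; apply=> x; rewrite ler_norml cos_geN1 cos_le1.
Qed.

Lemma cos_sub1 (y : R) : `|cos y - 1| <= y ^+ 2.
Proof.
have e : cos y - 1 = - (2 * sin (y / 2) ^+ 2).
  rewrite -[in LHS](_ : y / 2 + y / 2 = y); last by lra.
  by have := cos2Dsin2 (y / 2); rewrite cosD; lra.
rewrite e normrN normrM (ger0_norm (ler0n _ 2)) normrX.
have := abs_sin_le (y / 2); rewrite normrM normfV (ger0_norm (ler0n _ 2)).
rewrite -[y ^+ 2]real_normK ?num_real//.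
have := normr_ge0 (sin (y / 2)); have := normr_ge0 y; nra.
Qed.

Lemma sin_sub (y : R) : `|y| <= 1 -> `|sin y - y| <= y ^+ 2.
Proof.
move=> y1.
have main (x : R) : 0 < x -> x <= 1 -> `|sin x - x| <= x ^+ 2.
  move=> x0 x1.
  have sc : {within `[0, x], continuous (@sin R)}%classic.
    by apply: derivable_within_continuous => t _; exact: ex_derive.
  have [c] := MVT_segment (ltW x0) (fun t _ => is_derive_sin t) sc.
  rewrite in_itv /= sin0 !subr0 => /andP[c0 cx] ->.
  rewrite (_ : _ - x = (cos c - 1) * x); last by ring.
  rewrite normrM (gtr0_norm x0); have := cos_sub1 c; rewrite expr2.
  by move=> h; have := normr_ge0 (cos c - 1); nra.
have [y0|y0|->] := ltgtP y 0; last by rewrite sin0 subrr normr0 expr0n.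
  have := main (- y) ltac:(lra); rewrite sinN sqrrN opprK => h.
  rewrite (_ : sin y - y = - (- sin y + y)); last by ring.
  by rewrite normrN; apply: h; move: y1; rewrite ltr0_norm.
by apply: main => //; move: y1; rewrite gtr0_norm.
Qed.

Lemma expR_sub (x : R) : `|x| <= 1 / 2 -> `|expR x - 1 - x| <= 2 * x ^+ 2.
Proof.
rewrite ler_norml => /andP[x1 x2].
have h1 := expR_ge1Dx x; have h2 := expR_ge1Dx (- x).
have h3 : expR x * expR (- x) = 1 by rewrite -expRD subrr expR0.
have h4 := expR_gt0 x.
rewrite ger0_norm; last by lra.
have : expR x * (1 - x) <= 1 by nra.
rewrite expr2; nra.
Qed.

Lemma cexp_sub z : nc z <= 1 / 2 -> nc (cexp z - 1 - z) <= 20 * nc z ^+ 2.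
Proof.
move=> z1; case: z z1 => x y z1.
have hx := nc_Re (x +i* y); have hy := nc_Im (x +i* y); rewrite /= in hx hy.
set n := nc _ in z1 hx hy *; have n0 : 0 <= n by exact: nc_ge0.
have -> : cexp (x +i* y) - 1 - (x +i* y) =
  (expR x - 1 - x)%:C * eit y + (1 + x)%:C * (eit y - 1 - y *i) + (x * y) *i.
  by rewrite /cexp /eit; simpc; congr (_ +i* _); ring.
have a1 : `|x| <= 1 / 2 by lra.
have a2 : `|y| <= 1 by lra.
have b1 := expR_sub a1; have b2 := cos_sub1 y; have b3 := sin_sub a2.
have x2 : x ^+ 2 <= n ^+ 2 by rewrite -real_normK ?num_real// lerXn2r.
have y2 : y ^+ 2 <= n ^+ 2 by rewrite -real_normK ?num_real// lerXn2r.
have c1 : nc (eit y - 1 - y *i) <= 2 * n ^+ 2.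
  apply: (le_trans (nc_le_ReIm _)); rewrite !ReB !ImB /= !subr0; lra.
have c2 : nc ((x * y) *i) <= n ^+ 2.
  apply: (le_trans (nc_le_ReIm _)); rewrite /= normr0 add0r normrM expr2.
  by apply: ler_pM.
apply: (le_trans (ncD _ _)).
have := ncD ((expR x - 1 - x)%:C * eit y) ((1 + x)%:C * (eit y - 1 - y *i)).
rewrite !ncM nc_eit !nc_real mulr1.
have c3 : `|1 + x| <= 2 by move: a1; rewrite !ler_norml; lra.
have := nc_ge0 (eit y - 1 - y *i); have := normr_ge0 (1 + x).
have : 0 <= n ^+ 2 by rewrite sqr_ge0.
move: c1 c2 c3 x2 b1; clear; nra.
Qed.

Lemma cdiff_cexp z : cdiff (@cexp R) z (cexp z).
Proof.
move=> e e0; have n0 : 0 < nc (cexp z) by rewrite nc_gt0 cexp_neq0.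
pose d := Num.min (1 / 2) (e / (20 * nc (cexp z))).
exists d => [|w]; first by rewrite lt_min; apply/andP; split; [lra|rewrite divr_gt0// mulr_gt0].
rewrite le_min => /andP[h1]; rewrite ler_pdivlMr ?mulr_gt0// => h2.
rewrite (_ : _ - _ = cexp z * (cexp (w - z) - 1 - (w - z))); last first.
  by rewrite cexpB; field; exact: cexp_neq0.
rewrite ncM; have := cexp_sub h1; have := nc_ge0 (w - z); rewrite expr2.
have := nc_ge0 (cexp (w - z) - 1 - (w - z)); nra.
Qed.

End ComplexExp.

(** * Termwise differentiation of power series *)

Section PowerSeriesDiff.
Variable R : realType.
Local Open Scope complex_scope.
Local Notation C := R[i].
Implicit Types (f g : C -> C) (a w z : C) (c : nat -> C).

Definition dcoef c k : C := k.+1%:R * c k.+1.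

(** Bernoulli's inequality k x <= (1 + x)^k dominates k^2 t^k by x^(-2) (t (1 + x)^2)^k, a geometric
    series once x is small. *)
Lemma nat_geom (t : R) : 0 <= t < 1 -> exists2 B, 0 <= B &
  forall n, \sum_(k < n) k%:R ^+ 2 * t ^+ k <= B.
Proof.
move=> /andP[t0 t1].
have [x x0 u1] : exists2 x : R, 0 < x & t * (1 + x) ^+ 2 < 1.
  by exists ((1 - t) / 4); [lra|rewrite expr2; nra].
pose u := t * (1 + x) ^+ 2; have {}u1 : u < 1 by [].
have u0 : 0 <= u by rewrite mulr_ge0// sqr_ge0.
exists (x ^- 2 * (1 - u)^-1) => [|n].
  by rewrite mulr_ge0 ?invr_ge0 ?exprn_ge0 ?(ltW x0)//; lra.
apply: (@le_trans _ _ (\sum_(k < n) x ^- 2 * u ^+ k)).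
  apply: ler_sum => k _; rewrite /u exprMn -exprM mulnC exprM mulrCA [leLHS]mulrC.
  rewrite ler_wpM2l ?exprn_ge0// mulrC ler_pdivlMr ?exprn_gt0// -exprMn.
  have hb := @bernoulli R x k (le_trans (lerN10 R) (ltW x0)).
  rewrite lerXn2r ?nnegrE ?mulr_ge0 ?exprn_ge0//; lra.
rewrite -mulr_sumr ler_wpM2l ?invr_ge0 ?exprn_ge0 ?(ltW x0)//.
rewrite -[leRHS]mul1r ler_pdivlMr; last by lra.
by rewrite mulrC geom_sum; have := exprn_ge0 n u0; lra.
Qed.

(** Second-order Taylor estimate for w^k. The factor rho^2 on the left avoids the exponent k - 2 on
    the right. *)
Lemma pow_taylor2 w z rho k : nc w <= rho -> nc z <= rho ->
  rho ^+ 2 * nc (w ^+ k - z ^+ k - k%:R * z ^+ k.-1 * (w - z)) <=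
  k%:R ^+ 2 * rho ^+ k * nc (w - z) ^+ 2.
Proof.
move=> hw hz; have r0 : 0 <= rho := le_trans (nc_ge0 _) hw.
elim: k => [|k ih].
  by rewrite !expr0 subrr sub0r mul0r mul0r oppr0 nc0 mulr0 expr2 !mul0r.
set D := nc _ in ih; set h2 := nc (w - z) ^+ 2 in ih *.
have h20 : 0 <= h2 by rewrite exprn_ge0 ?nc_ge0.
have -> : w ^+ k.+1 - z ^+ k.+1 - k.+1%:R * z ^+ k.+1.-1 * (w - z) =
   w * (w ^+ k - z ^+ k - k%:R * z ^+ k.-1 * (w - z)) + k%:R * z ^+ k.-1 * (w - z) ^+ 2.
  by case: k {ih D} => [|k] /=; rewrite ?exprS -?natr1; ring.
apply: (@le_trans _ _ (rho ^+ 2 * (rho * D + k%:R * rho ^+ k.-1 * h2))).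
  rewrite ler_wpM2l ?sqr_ge0//; apply: (le_trans (ncD _ _)); apply: lerD.
    by rewrite ncM ler_wpM2r ?nc_ge0.
  rewrite !ncM !ncX nc_nat -/h2 ler_wpM2r// ler_wpM2l//.
  by rewrite lerXn2r ?nnegrE ?nc_ge0.
have -> : rho ^+ 2 * (rho * D + k%:R * rho ^+ k.-1 * h2) =
   rho * (rho ^+ 2 * D) + k%:R * rho ^+ k.+1 * h2.
  by move: D h2 {ih h20}; case: k => [|k] D h2 /=; rewrite ?exprS; ring.
have p0 : 0 <= rho ^+ k.+1 * h2 by rewrite mulr_ge0// exprn_ge0.
have E : rho * (k%:R ^+ 2 * rho ^+ k * h2) = k%:R ^+ 2 * (rho ^+ k.+1 * h2).
  by rewrite (exprS rho k); ring.
have := ler_wpM2l r0 ih; rewrite E; set X := rho * _; set q := rho ^+ k.+1 * h2 in p0 *.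
rewrite -[k%:R * _ * h2]mulrA -[k.+1%:R ^+ 2 * _ * h2]mulrA -/q -natr1 => h.
have kq : 0 <= k%:R * q by rewrite mulr_ge0.
rewrite (_ : (k%:R + 1) ^+ 2 * q = k%:R ^+ 2 * q + 2 * (k%:R * q) + q); last by ring.
lra.
Qed.

Lemma dcoef_bound c r M s : 0 < s -> s < r -> (forall k, nc (c k) * r ^+ k <= M) ->
  exists2 M', 0 <= M' & forall k, nc (dcoef c k) * s ^+ k <= M'.
Proof.
move=> s0 sr cM; have r0 : 0 < r by apply: lt_trans sr.
have M0 : 0 <= M by apply: le_trans (cM 0%N); rewrite expr0 mulr1 nc_ge0.
have [B B0 hB] := @nat_geom (s / r) ltac:(by rewrite divr_ge0 ?(ltW s0) ?(ltW r0)//= ltr_pdivrMr ?mul1r).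
exists (M / s * B) => [|k]; first by rewrite mulr_ge0 ?divr_ge0 ?(ltW s0).
have hk := cM k.+1; rewrite -ler_pdivlMr ?exprn_gt0// in hk.
rewrite /dcoef ncM nc_nat.
apply: (@le_trans _ _ (M / s * (k.+1%:R * (s / r) ^+ k.+1))).
  rewrite (_ : M / s * _ = k.+1%:R * (M / r ^+ k.+1) * s ^+ k); last first.
    by rewrite expr_div_n [s ^+ k.+1]exprS; field; rewrite expf_neq0 ?gt_eqF.
  by rewrite ler_wpM2r ?exprn_ge0 ?(ltW s0)// ler_wpM2l.
rewrite ler_wpM2l ?divr_ge0 ?(ltW s0)//; apply: le_trans (hB k.+2).
rewrite big_ord_recr /=; apply: (@le_trans _ _ (k.+1%:R ^+ 2 * (s / r) ^+ k.+1)).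
  rewrite ler_wpM2r ?exprn_ge0 ?divr_ge0 ?(ltW s0) ?(ltW r0)// expr2.
  by rewrite ler_peMr// ler1n.
rewrite lerDr; apply: sumr_ge0 => i _.
by rewrite mulr_ge0 ?exprn_ge0 ?divr_ge0 ?(ltW s0) ?(ltW r0).
Qed.

Lemma psum_cdiff c r M f : 0 < r -> (forall k, nc (c k) * r ^+ k <= M) ->
  (forall w, nc w < r -> cto (psum c w) (f w)) ->
  exists g, (forall w, nc w < r -> cto (psum (dcoef c) w) (g w)) /\
            (forall w, nc w < r -> cdiff f w (g w)).
Proof.
move=> r0 cM cf.
have M0 : 0 <= M by apply: le_trans (cM 0%N); rewrite expr0 mulr1 nc_ge0.
have lim w : exists l, nc w < r -> cto (psum (dcoef c) w) l.
  have [wr|wr] := ltP (nc w) r; last by exists 0.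
  pose s := (nc w + r) / 2; have nw := nc_ge0 w.
  have s0 : 0 < s by rewrite /s; lra.
  have sr : s < r by rewrite /s; lra.
  have ws : nc w < s by rewrite /s; lra.
  have [M' _ hM'] := dcoef_bound s0 sr cM.
  by have [l hl] := cto_psum_coef_le s0 hM' ws; exists l.
have [g hg] := choice lim; exists g; split=> // z zr.
have nz := nc_ge0 z.
have [rho [rho0 rhor zrho]] : exists rho : R, [/\ 0 < rho, rho < r & nc z < rho].
  by exists ((nc z + r) / 2); split; lra.
have [B B0 hB] := @nat_geom (rho / r) ltac:(by rewrite divr_ge0 ?(ltW rho0) ?(ltW r0)//= ltr_pdivrMr ?mul1r).
pose K := M * B / rho ^+ 2; have K0 : 0 <= K by apply: divr_ge0; [exact: mulr_ge0|apply: exprn_ge0; exact: ltW].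
have key w : nc w <= rho -> nc (f w - f z - g z * (w - z)) <= K * nc (w - z) ^+ 2.
  move=> wrho.
  have wr : nc w < r by lra.
  have h2 := ctoB (ctoB (cto_sub (g := S) (fun k => leqnSn k) (cf w wr))
     (cto_sub (g := S) (fun k => leqnSn k) (cf z zr))) (ctoZ (w - z) (hg z zr)).
  rewrite (mulrC (g z)); apply: (cto_norm_le _ h2); exists 0%N => n _ /=.
  rewrite (_ : _ - _ = \sum_(k < n.+1) c k * (w ^+ k - z ^+ k - k%:R * z ^+ k.-1 * (w - z))).
    apply: (le_trans (nc_sum _ _ _)).
    apply: (@le_trans _ _ (\sum_(k < n.+1) M / rho ^+ 2 * nc (w - z) ^+ 2 * (k%:R ^+ 2 * (rho / r) ^+ k))).
      apply: ler_sum => k _; rewrite ncM.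
      have := cM k; rewrite -ler_pdivlMr ?exprn_gt0// => hk.
      have ht := @pow_taylor2 w z rho k wrho (ltW zrho).
      rewrite mulrC -ler_pdivlMr ?exprn_gt0// in ht.
      apply: (le_trans (ler_pM (nc_ge0 _) (nc_ge0 _) hk ht)).
      rewrite le_eqVlt; apply/orP; left; apply/eqP.
      by rewrite expr_div_n; field; rewrite !expf_neq0 ?gt_eqF.
    rewrite -mulr_sumr (_ : K * _ = M / rho ^+ 2 * nc (w - z) ^+ 2 * B); last first.
      by rewrite /K; ring.
    by rewrite ler_wpM2l// !mulr_ge0 ?invr_ge0 ?sqr_ge0 ?nc_ge0.
  rewrite /psum big_ord_recl [X in _ - X - _]big_ord_recl [RHS]big_ord_recl /=.
  rewrite !expr0 subrr !mul0r subr0 mulr0 add0r.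
  rewrite mulr_sumr opprD addrACA subrr add0r -!sumrB; apply: eq_bigr => i _.
  by rewrite /dcoef /bump /= add1n; ring.
move=> e e0; pose d := Num.min (rho - nc z) (e / (K + 1)).
exists d => [|w]; first by rewrite lt_min subr_gt0 zrho divr_gt0//; lra.
rewrite le_min ler_pdivlMr; last by lra.
move=> /andP[h1 h2]; apply: (le_trans (key w _)).
  by have := ncD (w - z) z; rewrite subrK; lra.
by have := nc_ge0 (w - z); rewrite expr2; nra.
Qed.

End PowerSeriesDiff.

(** * Uniform limits, logarithms, the identity theorem and the Borel-Caratheodory inequality *)

Section Holomorphic.
Variable R : realType.
Local Open Scope complex_scope.
Local Notation C := R[i].
Implicit Types (f g : C -> C) (a w z : C) (c : nat -> C).

Lemma cdiff_shift f a w l : cdiff (fun w => f (a + w)) w l <-> cdiff f (a + w) l.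
Proof.
split=> h e /h[d d0 hd]; exists d => // z hz.
  by have := hd (z - a); rewrite subrKC (_ : z - a - w = z - (a + w)); [apply|ring].
by have := hd (a + z); rewrite (_ : a + z - (a + w) = z - w); [apply|ring].
Qed.

Lemma cauchy_sum_close f g a r N z e : 0 < r -> (0 < N)%N -> nc (z - a) < r ->
  (forall w, nc (w - a) = r -> nc (f w - g w) <= e) ->
  nc (cauchy_sum f a r N z - cauchy_sum g a r N z) <= e * (r / (r - nc (z - a))).
Proof.
move=> r0 N0 zr fg; rewrite /cauchy_sum -mulrBr -sumrB.
apply: (avg_le (F := fun j => f (node a r N j) * (node a r N j - a) / (node a r N j - z) -
   g (node a r N j) * (node a r N j - a) / (node a r N j - z))) => // j.
set u := node _ _ _ _; have nu : nc (u - a) = r by rewrite node_norm ?(ltW r0).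
rewrite -!mulrA -mulrBl !ncM ncV nu; apply: ler_pM; rewrite ?mulr_ge0 ?invr_ge0 ?nc_ge0 ?(ltW r0)//.
  exact: fg.
rewrite ler_wpM2l ?(ltW r0)//.
have h : r - nc (z - a) <= nc (u - z).
  by have := ncB (u - z) (a - z); rewrite (_ : u - z - (a - z) = u - a) ?nu ?(nc_sym a)//; [lra|ring].
by rewrite lef_pV2 ?posrE ?subr_gt0//; lra.
Qed.

(** Weierstrass' theorem: Cauchy's formula for the approximants passes to f, because the Cauchy sums
    depend on the values on the circle with a Lipschitz constant independent of the number of
    nodes. *)
Lemma uniform_limit_power_series f a r : 0 < r ->
  (forall e, 0 < e -> exists2 g, (forall w, nc (w - a) <= r -> exists l, cdiff g w l) &
     forall w, nc (w - a) <= r -> nc (f w - g w) <= e) ->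
  exists c, [/\ forall k, cto (fun n => circle_avg f a r (2 ^ n) k) (c k),
    exists M, forall k, nc (c k) * r ^+ k <= M &
    forall w, nc w < r -> cto (psum c w) (f (a + w))].
Proof.
move=> r0 app.
have [g0 g0d fg0] := app 1 ltr01.
have [M hM] : exists M, forall w, nc (w - a) <= r -> nc (g0 w) <= M.
  by apply: disc_bounded => w /g0d[l]; exact: cdiff_cont.
have fM w : nc (w - a) = r -> nc (f w) <= M + 1.
  move=> hw; have hw' : nc (w - a) <= r by rewrite hw.
  by have := ncD (f w - g0 w) (g0 w); rewrite subrK; have := hM _ hw'; have := fg0 _ hw'; lra.
have fC z : nc (z - a) < r -> cto (fun k => cauchy_sum f a r (2 ^ k) z) (f z).
  move=> zr e e0; pose q := r / (r - nc (z - a)).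
  have q0 : 0 <= q by rewrite /q divr_ge0 ?(ltW r0)// subr_ge0 ltW.
  have e1 : 0 < e / (3 * (q + 1)) by rewrite divr_gt0//; lra.
  have e3 : 0 < e / 3 by lra.
  have [g gd fg] := app _ e1.
  have [k0 hk0] := cauchy_formula r0 zr gd e3.
  exists k0 => k /hk0 h1.
  have h2 := fg z (ltW zr).
  have h3 : nc (cauchy_sum f a r (2 ^ k) z - cauchy_sum g a r (2 ^ k) z) <= e / (3 * (q + 1)) * q.
    by apply: cauchy_sum_close => //; [rewrite expn_gt0|move=> w hw; apply: fg; rewrite hw].
  rewrite (_ : _ - f z = (cauchy_sum f a r (2 ^ k) z - cauchy_sum g a r (2 ^ k) z) +
    (cauchy_sum g a r (2 ^ k) z - g z) - (f z - g z)); last by ring.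
  have h4 : e / (3 * (q + 1)) * q <= e / 3.
    by rewrite mulrAC ler_pdivrMr; [nra|lra].
  have h5 : e / (3 * (q + 1)) <= e / 3.
    by rewrite ler_pdivrMr; [nra|lra].
  have h6 := ncB ((cauchy_sum f a r (2 ^ k) z - cauchy_sum g a r (2 ^ k) z) +
    (cauchy_sum g a r (2 ^ k) z - g z)) (f z - g z).
  have h7 := ncD (cauchy_sum f a r (2 ^ k) z - cauchy_sum g a r (2 ^ k) z)
    (cauchy_sum g a r (2 ^ k) z - g z).
  by move: h1 h2 h3 h4 h5 h6 h7; clear; lra.
have [c [h1 h2 h3]] := power_series_of_cauchy r0 fM fC.
by exists c; split=> //; exists (M + 1).
Qed.

Lemma circle_avg_close f g a r e k (c d : C) : 0 < r ->
  (forall w, nc (w - a) = r -> nc (f w - g w) <= e) ->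
  cto (fun n => circle_avg f a r (2 ^ n) k) c -> cto (fun n => circle_avg g a r (2 ^ n) k) d ->
  nc (c - d) <= e / r ^+ k.
Proof.
move=> r0 fg hc hd; apply: (cto_norm_le _ (ctoB hc hd)); exists 0%N => n _.
rewrite (_ : _ - _ = circle_avg (fun w => f w - g w) a r (2 ^ n) k).
  by apply: circle_avg_le => //; rewrite expn_gt0.
by rewrite /circle_avg -mulrBr -sumrB; congr (_ * _); apply: eq_bigr => j _; rewrite mulrBl.
Qed.

Lemma power_series_cdiff f a c r M : 0 < r -> (forall k, nc (c k) * r ^+ k <= M) ->
  (forall w, nc w < r -> cto (psum c w) (f (a + w))) ->
  exists g, (forall w, nc w < r -> cto (psum (dcoef c) w) (g (a + w))) /\
            (forall z, nc (z - a) < r -> cdiff f z (g z)).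
Proof.
move=> r0 cM cf; have [g [g1 g2]] := psum_cdiff r0 cM cf.
exists (fun z => g (z - a)); split=> [w wr|z zr]; first by rewrite addDKl; exact: g1.
by have /cdiff_shift := g2 _ zr; rewrite subrKC.
Qed.

Lemma holo_deriv f f' a r : 0 < r ->
  (forall z, nc (z - a) <= r -> exists l, cdiff f z l) ->
  (forall z, nc (z - a) < r -> cdiff f z (f' z)) ->
  forall z, nc (z - a) < r -> exists l, cdiff f' z l.
Proof.
move=> r0 fd ff' z zr.
have [c [_ [M cM] cf]] := holo_power_series r0 fd.
have [g [g1 g2]] := power_series_cdiff r0 cM cf.
have [s [s0 sr zs]] : exists s : R, [/\ 0 < s, s < r & nc (z - a) < s].
  by exists ((nc (z - a) + r) / 2); have := nc_ge0 (z - a); split; lra.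
have [M' _ hM'] := dcoef_bound s0 sr cM.
have [|h [_ h2]] := @power_series_cdiff g a (dcoef c) s M' s0 hM'.
  by move=> w ws; apply: g1; exact: lt_trans sr.
exists (h z); apply: (@cdiff_ext _ g _ _ _ ((r - nc (z - a)) / 2)) (h2 _ zs).
  by lra.
move=> w hw; have wr : nc (w - a) < r.
  by have := ncD (w - z) (z - a); rewrite (_ : w - z + (z - a) = w - a); [lra|ring].
exact: cdiff_uniq (g2 _ wr) (ff' _ wr).
Qed.

Lemma psum0 c : cto (psum c 0) (c 0%N).
Proof.
apply: cto_shift; apply: cto_ext (cto_cst _) => k.
rewrite /psum big_ord_recl expr0 mulr1 big1 ?addr0// => i _.
by rewrite exprS mul0r mulr0.
Qed.

Lemma psum_eq (c d : nat -> C) w l : c =1 d -> cto (psum c w) l -> cto (psum d w) l.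
Proof. by move=> cd; apply: cto_ext => n; apply: eq_bigr => i _; rewrite cd. Qed.

Lemma psum_zero w : cto (psum (fun=> 0 : C) w) 0.
Proof. by apply: cto_ext (cto_cst _) => n; rewrite /psum big1// => i _; rewrite mul0r. Qed.

Lemma zero_deriv_const f a r z : 0 < r -> (forall z, nc (z - a) < r -> cdiff f z 0) ->
  nc (z - a) < r -> f z = f a.
Proof.
move=> r0 f0 zr.
have [s [s0 sr zs]] : exists s : R, [/\ 0 < s, s < r & nc (z - a) < s].
  by exists ((nc (z - a) + r) / 2); have := nc_ge0 (z - a); split; lra.
have [c [_ [M cM] cf]] : exists c, [/\ forall k, cto (fun n => circle_avg f a s (2 ^ n) k) (c k),
    exists M, forall k, nc (c k) * s ^+ k <= M &
    forall w, nc w < s -> cto (psum c w) (f (a + w))].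
  by apply: holo_power_series => // w hw; exists 0; apply: f0; lra.
have [g [g1 g2]] := power_series_cdiff s0 cM cf.
have dz : dcoef c =1 (fun=> 0).
  apply: (psum_unique s0).
  - exists (s / 2); first by lra.
    have sa : 0 < s / 2 by lra.
    have sb : s / 2 < s by lra.
    by have [M' _ hM'] := dcoef_bound sa sb cM; exists M'.
  - by exists 1 => //; exists 0 => k; rewrite nc0 mul0r.
  move=> w ws; exists 0; last exact: psum_zero.
  have ws' : nc (a + w - a) < s by rewrite addDKl.
  by rewrite (cdiff_uniq (f0 (a + w) (lt_trans ws' sr)) (g2 _ ws')); exact: g1.
have cz k : c k.+1 = 0.
  by have /eqP := dz k; rewrite /dcoef mulf_eq0 pnatr_eq0 /= => /eqP.
have cf0 w : nc w < s -> f (a + w) = c 0%N.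
  move=> ws; apply: (cto_uniq (cf _ ws)); apply: cto_shift.
  apply: cto_ext (cto_cst _) => k; rewrite /psum big_ord_recl expr0 mulr1 big1 ?addr0// => i _.
  by rewrite /bump /= ?add1n cz mul0r.
have := cf0 _ zs; rewrite subrKC => ->.
by have := cf0 0; rewrite addr0 nc0 => ->.
Qed.

Lemma log_disc f a r s : 0 < s -> s < r ->
  (forall z, nc (z - a) <= r -> exists l, cdiff f z l) ->
  (forall z, nc (z - a) <= r -> f z != 0) ->
  exists c (L : C -> C), [/\ c 0%N = 0, exists M, forall k, nc (c k) * s ^+ k <= M,
    forall w, nc w < s -> cto (psum c w) (L w) &
    forall w, nc w < s -> f (a + w) = f a * cexp (L w)].
Proof.
move=> s0 sr fd fn0; have r0 : 0 < r by exact: lt_trans sr.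
have [c [_ [M cM] cf]] := holo_power_series r0 fd.
have [g [_ g2]] := power_series_cdiff r0 cM cf.
pose h z := g z / f z.
have hd z : nc (z - a) <= s -> exists l, cdiff h z l.
  move=> zs; have zr : nc (z - a) < r by lra.
  have [l gl] := holo_deriv r0 fd g2 zr.
  by exists (l * (f z)^-1 + g z * (- g z / f z ^+ 2)); apply: cdiffM gl (cdiffV (fn0 _ (ltW zr)) (g2 _ zr)).
have [b [_ [B bB] bh]] := holo_power_series s0 hd.
have B0 : 0 <= B by apply: le_trans (bB 0%N); rewrite expr0 mulr1 nc_ge0.
pose c1 k : C := if k is j.+1 then b j / k%:R else 0.
have c1B k : nc (c1 k) * s ^+ k <= B * s.
  case: k => [|k] /=; first by rewrite nc0 mul0r mulr_ge0 ?(ltW s0).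
  rewrite nc_div nc_nat exprSr mulrA ler_wpM2r ?(ltW s0)//.
  apply: le_trans (bB k); rewrite ler_wpM2r ?exprn_ge0 ?(ltW s0)//.
  by rewrite ler_pdivrMr ?ltr0n// ler_peMr ?nc_ge0// ler1n.
have lim w : exists l, nc w < s -> cto (psum c1 w) l.
  have [ws|ws] := ltP (nc w) s; last by exists 0.
  by have [l hl] := cto_psum_coef_le s0 c1B ws; exists l.
have [L hL] := choice lim; exists c1, L; split=> //; first by exists (B * s).
have [g1 [g11 g12]] := psum_cdiff s0 c1B hL.
have dc1 : dcoef c1 =1 b.
  by move=> k; rewrite /dcoef /= mulrC divfK// pnatr_eq0.
have g1h w : nc w < s -> g1 w = h (a + w).
  by move=> ws; apply: cto_uniq (psum_eq dc1 (g11 _ ws)) (bh _ ws).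
have L0 : L 0 = 0.
  by have := cto_uniq (hL 0 ltac:(by rewrite nc0)) (psum0 c1).
move=> w ws.
pose phi w := f (a + w) * cexp (- L w).
have phid z : nc (z - 0) < s -> cdiff phi z 0.
  rewrite subr0 => zs.
  have zr : nc (a + z - a) < r by rewrite addDKl; exact: lt_trans sr.
  have fz := (cdiff_shift f a z _).2 (g2 _ zr).
  have Lz := cdiff_comp (cdiffN (g12 _ zs)) (cdiff_cexp (- L z)).
  have := cdiffM fz Lz; rewrite (_ : _ + _ = 0)//.
  rewrite (g1h _ zs) /h; have := fn0 _ (ltW zr).
  by move=> fz0; field.
have ws' : nc (w - 0) < s by rewrite subr0.
have := zero_deriv_const s0 phid ws'; rewrite /phi addr0 L0 oppr0 cexp0 mulr1 cexpN => <-.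
by rewrite divfK// cexp_neq0.
Qed.

Lemma disc_zero f a r s z : 0 < s -> (forall z, nc (z - a) < r -> exists l, cdiff f z l) ->
  (forall z, nc (z - a) < s -> f z = 0) -> nc (z - a) < r -> f z = 0.
Proof.
move=> s0 fd fz zr.
have [q [q0 qr zq]] : exists q : R, [/\ 0 < q, q < r & nc (z - a) < q].
  by exists ((nc (z - a) + r) / 2); have := nc_ge0 (z - a); split; lra.
have [c [_ [M cM] cf]] : exists c, [/\ forall k, cto (fun n => circle_avg f a q (2 ^ n) k) (c k),
    exists M, forall k, nc (c k) * q ^+ k <= M &
    forall w, nc w < q -> cto (psum c w) (f (a + w))].
  by apply: holo_power_series => // w hw; apply: fd; lra.
have m0 : 0 < Num.min s q by rewrite lt_min s0.
have cz : c =1 (fun=> 0).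
  apply: (psum_unique m0).
  - by exists q => //; exists M.
  - by exists 1 => //; exists 0 => k; rewrite nc0 mul0r.
  move=> w; rewrite lt_min => /andP[ws wq]; exists 0; last exact: psum_zero.
  by rewrite -(fz (a + w)) ?addDKl//; exact: cf.
have := cf _ zq; rewrite subrKC => h.
exact: cto_uniq h (psum_eq (fsym cz) (psum_zero _)).
Qed.

(** Analytic continuation of the zero function along a segment: vanishing near one point propagates
    to the whole disc of holomorphy, and small discs cover the segment. *)
Lemma segment_zero f p q :
  (forall t : R, 0 <= t <= 1 -> exists2 r, 0 < r &
     forall z, nc (z - (p + t%:C * (q - p))) < r -> exists l, cdiff f z l) ->
  (exists2 s, 0 < s & forall z, nc (z - p) < s -> f z = 0) -> f q = 0.
Proof.
move=> fd fp.
pose gam (t : R) : C := p + t%:C * (q - p).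
pose zn t := exists2 s, 0 < s & forall z, nc (z - gam t) < s -> f z = 0.
suff : zn 0 -> zn 1.
  have -> : zn 0 = (exists2 s, 0 < s & forall z, nc (z - p) < s -> f z = 0).
    by rewrite /zn /gam rmorph0 mul0r addr0.
  move=> /(_ fp)[s s0]; rewrite /gam rmorph1 mul1r subrKC => h; apply: h.
  by rewrite subrr nc0.
rewrite -[in zn 1](add0r 1).
(* Bisection in one dimension: the property ignores y, and of the four quarters only the first two
   enter. *)
apply: (@square_induction _ (fun x y h => zn x -> zn (x + h))).
  by move=> x y h h1 h2 _ _ /h1/h2; rewrite -addrA (_ : h / 2 + h / 2 = h)//; lra.
move=> u v hu _; have [r r0 hr] := fd u hu.
have n0 := nc_ge0 (q - p).
exists (r / (4 * (nc (q - p) + 1))) => [|x y h /andP[h0 hd] hx _ _ _ _ _].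
  by rewrite divr_gt0//; lra.
move=> [s s0 hs].
have hd' : h * nc (q - p) <= r / 4.
  move: hd; rewrite ler_pdivlMr; last by lra.
  by nra.
have dist x' : x <= x' <= x + h -> nc (gam x' - gam u) <= r / 4.
  move=> hx'; have -> : gam x' - gam u = (x' - u)%:C * (q - p).
    by rewrite /gam rmorphB /=; ring.
  rewrite ncM nc_real; apply: le_trans hd'; rewrite ler_wpM2r// ler_norml.
  by move: hx hx'; clear; lra.
have dx : nc (gam x - gam u) <= r / 4 by apply: dist; rewrite lexx /=; lra.
have dxh : nc (gam (x + h) - gam u) <= r / 4 by apply: dist; rewrite lexx andbT; lra.
have r2 : 0 < r / 2 by lra.
have fd2 z : nc (z - gam x) < r / 2 + r / 4 -> exists l, cdiff f z l.
  move=> hz; apply: hr; have := ncD (z - gam x) (gam x - gam u).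
  by rewrite (_ : z - gam x + (gam x - gam u) = z - gam u); [lra|ring].
exists (r / 4) => [|z hz]; first by lra.
apply: (disc_zero s0 fd2 hs).
have := ncD (z - gam (x + h)) (gam (x + h) - gam u); have := ncB (z - gam u) (gam x - gam u).
rewrite (_ : z - gam u - (gam x - gam u) = z - gam x); last by ring.
rewrite (_ : z - gam (x + h) + (gam (x + h) - gam u) = z - gam u); last by ring.
by lra.
Qed.

Lemma cto_conj (u : nat -> C) l : cto u l -> cto (fun n => conjc (u n)) (conjc l).
Proof.
move=> ul e /ul[k0 h]; exists k0 => k /h; rewrite -rmorphB /= nc_conj//.
Qed.

Lemma conjc_mul_norm z : conjc z * z = (nc z ^+ 2)%:C.
Proof. by case: z => x y; rewrite nc_sqr /conjc; simpc; congr (_ +i* _); ring. Qed.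

(** The coefficient c_k with k > 0 is the mean of 2 Re L(w) / w^k over the circle, and |Re L| <= 2 A
    - Re L, where Re L has mean Re L(0) = 0. *)
Lemma borel_caratheodory c L r M rho A : 0 < rho -> rho < r -> 0 <= A -> c 0%N = 0 ->
  (forall k, nc (c k) * r ^+ k <= M) -> (forall w, nc w < r -> cto (psum c w) (L w)) ->
  (forall w, nc w = rho -> complex.Re (L w) <= A) ->
  forall k, nc (c k) * rho ^+ k <= 4 * A.
Proof.
move=> p0 pr A0 c00 cM cL ReL [|k0]; first by rewrite c00 nc0 mul0r mulr_ge0.
set k := k0.+1.
have r0 : 0 < r by exact: lt_trans pr.
have [g [_ Ld]] := psum_cdiff r0 cM cL.
have Ld' w : nc (w - 0) <= rho -> exists l, cdiff L w l.
  by rewrite subr0 => wr; exists (g w); apply: Ld; exact: le_lt_trans pr.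
have [d [d1 [M' dM] dL]] := holo_power_series p0 Ld'.
have dc : d =1 c.
  apply: (psum_unique p0); [by exists rho => //; exists M'|by exists r => //; exists M|].
  move=> w wr; exists (L w); last by apply: cL; exact: lt_trans pr.
  by have := dL w wr; rewrite add0r.
have L0 : L 0 = 0.
  by have := cto_uniq (cL 0 ltac:(by rewrite nc0)) (psum0 c); rewrite c00.
have z0 : nc (0 - 0 : C) < rho by rewrite subrr nc0.
have avgE (F : C -> C) N : cauchy_sum F 0 rho N 0 = N%:R^-1 * \sum_(j < N) F (node 0 rho N j).
  congr (_ * _); apply: eq_bigr => j _; rewrite mulfK//.
  by rewrite -nc_gt0 node_norm ?(ltW p0).
have hL := cauchy_formula p0 z0 Ld'; rewrite L0 in hL.
have hF : cto (fun n => cauchy_sum (fun w => L w * w ^+ k) 0 rho (2 ^ n) 0) (L 0 * 0 ^+ k).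
  apply: cauchy_formula => // w wr.
  have [l hl] := Ld' w wr.
  have [m hm] : exists m, cdiff (fun w : C => w ^+ k) w m.
    elim: (k) => [|j [m hm]].
      by exists 0; apply: cdiff_ext ltr01 _ (cdiff_cst 1 w) => v _; rewrite expr0.
    exists (1 * w ^+ j + w * m).
    by apply: cdiff_ext ltr01 _ (cdiffM (cdiff_id w) hm) => v _; rewrite exprS.
  by exists (l * w ^+ k + L w * m); exact: cdiffM.
rewrite L0 mul0r in hF.
(* The added term tends to 0, being the conjugate of an average of L(w) w^k, which vanishes at 0. On
   the circle the conjugate of w is rho^2 / w, so this term is the average of the conjugate of L(w),
   over w^k, and L becomes 2 Re L. *)
have h1 : cto (fun n => circle_avg L 0 rho (2 ^ n) k +
   (rho ^- (2 * k))%:C * conjc (cauchy_sum (fun w => L w * w ^+ k) 0 rho (2 ^ n) 0)) (c k).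
  have := ctoD (d1 k) (ctoZ (rho ^- (2 * k))%:C (cto_conj hF)).
  by rewrite conjc0 mulr0 addr0 dc.
rewrite -ler_pdivlMr ?exprn_gt0//; apply/ler_addgt0Pl => e e0.
pose e1 := e * rho ^+ k / 2.
have e10 : 0 < e1 by rewrite divr_gt0// mulr_gt0// exprn_gt0.
have [n0 hn0] := hL _ e10.
apply: (cto_norm_le _ h1); exists n0 => n hn.
have N0 : (0 < 2 ^ n)%N by rewrite expn_gt0.
set N := (2 ^ n)%N in N0 *.
have E : circle_avg L 0 rho N k + (rho ^- (2 * k))%:C *
   conjc (cauchy_sum (fun w => L w * w ^+ k) 0 rho N 0) =
   N%:R^-1 * \sum_(j < N) (2 * complex.Re (L (node 0 rho N j)))%:C / (node 0 rho N j) ^+ k.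
  rewrite avgE /circle_avg rmorphM rmorph_sum /= conjc_inv conjc_nat.
  rewrite mulrCA -mulrDr mulr_sumr -big_split /=; congr (_ * _); apply: eq_bigr => j _.
  set u := node _ _ _ _; have nu : nc u = rho by rewrite -[u]subr0 node_norm ?(ltW p0).
  have u0 : u != 0 by rewrite -nc_gt0 nu.
  have cu : conjc u = (rho ^+ 2)%:C / u by rewrite -nu -conjc_mul_norm mulfK.
  have hc : conjc (L u * u ^+ k) = conjc (L u) * ((rho ^+ 2)%:C / u) ^+ k.
    by rewrite -cu rmorphM rmorphXn.
  rewrite subr0 hc.
  have -> : (rho ^- (2 * k))%:C = ((rho ^+ 2)%:C ^+ k)^-1 :> C.
    by rewrite fmorphV /= exprM rmorphXn.
  rewrite expr_div_n mulrCA [X in _ + _ * X]mulrA mulVf ?mul1r; last first.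
    by rewrite expf_neq0// -nc_gt0 nc_real gtr0_norm exprn_gt0.
  rewrite -mulrDl; congr (_ / _); case: (L u) => x y; rewrite /conjc; simpc => /=.
  by congr (_ +i* _); ring.
rewrite E.
have hReL j : `|complex.Re (L (node 0 rho N j))| <= 2 * A - complex.Re (L (node 0 rho N j)).
  have := ReL (node 0 rho N j); rewrite -{1}[node _ _ _ _]subr0 node_norm ?(ltW p0)// => /(_ erefl).
  by rewrite ler_norml; lra.
rewrite ncM ncV nc_nat mulrC ler_pdivrMr ?ltr0n//; apply: (le_trans (nc_sum _ _ _)).
apply: (@le_trans _ _ (\sum_(j < N) (2 * (2 * A - complex.Re (L (node 0 rho N j)))) / rho ^+ k)).
  apply: ler_sum => j _; rewrite nc_div ncX -{2}[node _ _ _ _]subr0 node_norm ?(ltW p0)//.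
  rewrite ler_wpM2r ?invr_ge0 ?exprn_ge0 ?(ltW p0)//.
  by rewrite nc_real normrM ger0_norm// ler_wpM2l.
rewrite -mulr_suml -mulr_sumr sumrB sumr_const card_ord -[(2 * A) *+ N]mulr_natl.
have := hn0 n hn; rewrite subr0 avgE -/N => hRe.
have := le_trans (nc_Re _) hRe; rewrite -[N%:R^-1 in X in X -> _](_ : (N%:R^-1)%:C = _); last first.
  by rewrite fmorphV rmorph_nat.
rewrite ReMl Re_sum; set S := \sum_(j < N) _.
rewrite ler_norml => /andP[hS _].
have NR : 0 < N%:R :> R by rewrite ltr0n.
have hS' : - S <= e1 * N%:R.
  have : - (N%:R * (N%:R^-1 * S)) <= e1 * N%:R by rewrite -mulrN mulrC ler_wpM2r ?(ltW NR)//; lra.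
  by rewrite mulVKf ?gt_eqF.
rewrite ler_pdivrMr ?exprn_gt0//.
rewrite (_ : (e + 4 * A / rho ^+ k) * N%:R * rho ^+ k = N%:R * (2 * (2 * A)) + 2 * (e1 * N%:R)).
  by lra.
by rewrite /e1; field; rewrite gt_eqF ?exprn_gt0.
Qed.

End Holomorphic.

(** * The zeta function and the sums of the Moebius function *)

Section Conversions.
Variable R : realType.
Local Open Scope complex_scope.
Local Notation C := R[i].

Lemma norm_nc (z : C) : `|z| = (nc z)%:C.
Proof. by rewrite normc_def ncE. Qed.

Lemma cto_cvg (u : nat -> C) (l : C) :
  cto u l <-> ((u n : C^o) @[n --> \oo] --> (l : C^o))%classic.
Proof.
split=> [ul|/cvgrPdist_le ul e e0].
  apply/cvgrPdist_le => e e0.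
  have eE : e = (complex.Re e)%:C by rewrite RRe_real// gtr0_real.
  move: e0; rewrite eE ltcR => /ul[k0 hk]; exists k0 => // k /= kk.
  by rewrite norm_nc lecR nc_sym; exact: hk.
have e0' : (0 : C) < e%:C by rewrite ltcR.
have [k0 _ hk] := ul _ e0'; exists k0 => k kk.
by have := hk k kk; rewrite norm_nc lecR nc_sym.
Qed.

Lemma cdiff_derivable (f : C -> C) z l : cdiff f z l -> derivable (f : C^o -> C^o) z 1.
Proof.
move=> fz; apply/cvg_ex; exists l; apply/cvgrPdist_le => e e0.
have eE : e = (complex.Re e)%:C by rewrite RRe_real// gtr0_real.
move: e0; rewrite eE ltcR => /fz[d d0 hd].
have d0' : (0 : C) < d%:C by rewrite ltcR.
exists d%:C => // h /=; rewrite sub0r normrN norm_nc ltcR => hd1 h0.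
have := hd (h + z); rewrite addrK => /(_ (ltW hd1)) H.
rewrite norm_nc lecR nc_sym.
rewrite (_ : h *: 1 + z = h + z); last by rewrite /GRing.scale /= mulr1.
rewrite (_ : _ - l = (f (h + z) - f z - l * h) / h); last first.
  by rewrite /GRing.scale /=; field.
by rewrite nc_div ler_pdivrMr// nc_gt0.
Qed.

Lemma derivable_cdiff (f : C -> C) z : derivable (f : C^o -> C^o) z 1 -> exists l, cdiff f z l.
Proof.
move=> /cvg_ex[l /= /cvgrPdist_le fz]; exists l => e e0.
have e0' : (0 : C) < e%:C by rewrite ltcR.
have [d' /= d0 hd] := fz _ e0'.
have dE : d' = (complex.Re d')%:C by rewrite RRe_real// gtr0_real.
move: d0 hd; rewrite dE ltcR; set d := complex.Re d' => d0 hd.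
exists (d / 2) => [|w hw]; first by rewrite divr_gt0.
have [->|wz] := eqVneq w z; first by rewrite !subrr mulr0 subr0 nc0 mulr0.
have wz0 : w - z != 0 by rewrite subr_eq0.
have := hd (w - z); rewrite /= sub0r normrN norm_nc ltcR => /(_ ltac:(lra) wz0).
rewrite norm_nc lecR nc_sym (_ : (w - z) *: 1 + z = w); last first.
  by rewrite /GRing.scale /= mulr1 subrK.
rewrite (_ : _ - l = (f w - f z - l * (w - z)) / (w - z)); last first.
  by rewrite /GRing.scale /=; field.
by rewrite nc_div ler_pdivrMr// nc_gt0.
Qed.

End Conversions.

(** * Real powers of integers and their sums *)

Section PowerFacts.
Variable R : realType.

Lemma powRDp (x a b : R) : 0 < x -> x `^ (a + b) = x `^ a * x `^ b.
Proof. by move=> x0; apply: powRD; apply/implyP => _; rewrite gt_eqF. Qed.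

Lemma powRE (x a : R) : 0 < x -> x `^ a = expR (a * ln x).
Proof. by move=> x0; rewrite /powR gt_eqF. Qed.

Lemma powR_small (a e : R) : 0 < a -> 0 < e ->
  exists n0, forall n, (n0 <= n)%N -> n.+1%:R `^ (- a) <= e.
Proof.
move=> a0 e0.
exists (Num.truncn (e^-1 `^ a^-1)).+1 => n nn.
rewrite powRN -[e]invrK lef_pV2 ?posrE ?invr_gt0 ?powR_gt0//.
have h : e^-1 `^ a^-1 <= n.+1%:R.
  by apply/ltW/(lt_le_trans (truncnS_gt _)); rewrite ler_nat; exact: leq_trans nn _.
rewrite -[leLHS](_ : (e^-1 `^ a^-1) `^ a = _); last first.
  by rewrite -powRrM mulVf ?gt_eqF// powRr1// invr_ge0 ltW.
by rewrite ge0_ler_powR// ?nnegrE ?powR_ge0 ?(ltW a0).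
Qed.

Lemma ler_powR_neg (x y a : R) : 0 < x -> x <= y -> 0 <= a -> y `^ (- a) <= x `^ (- a).
Proof.
move=> x0 xy a0; have y0 := lt_le_trans x0 xy.
rewrite !powRN lef_pV2 ?posrE ?powR_gt0//.
by rewrite ge0_ler_powR// nnegrE ltW.
Qed.

Lemma ln_sub1_le (x : R) : 0 < x -> ln x <= x - 1.
Proof.
by move=> x0; have := @le_ln1Dx R (x - 1); rewrite (addrC 1) subrK; apply; lra.
Qed.

(** A discrete derivative of n^(-a), from ln x <= x - 1; summed, it telescopes and bounds tails of
    zeta-like series as an integral would. *)
Lemma powR_diff (a : R) n : 0 < a -> (0 < n)%N ->
  a * n.+1%:R `^ (- a - 1) <= n%:R `^ (- a) - n.+1%:R `^ (- a).
Proof.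
move=> a0 n0; have nn : 0 < n%:R :> R by rewrite ltr0n.
have n1 : 0 < n.+1%:R :> R by rewrite ltr0n.
have q0 : 0 < n%:R / n.+1%:R :> R by rewrite divr_gt0.
have hln : ln (n%:R / n.+1%:R) <= - n.+1%:R^-1 :> R.
  apply: (le_trans (ln_sub1_le q0)); rewrite -[n.+1%:R]natr1.
  rewrite le_eqVlt; apply/orP; left; apply/eqP; field.
  by rewrite natr1 pnatr_eq0.
have -> : n%:R `^ (- a) = n.+1%:R `^ (- a) * (n%:R / n.+1%:R) `^ (- a) :> R.
  rewrite -powRM ?(ltW n1) ?(ltW q0)//; congr (_ `^ _).
  by rewrite mulrCA mulfV ?mulr1// gt_eqF.
have h : 1 + a / n.+1%:R <= (n%:R / n.+1%:R) `^ (- a) :> R.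
  rewrite powRE//; apply: le_trans (expR_ge1Dx _); rewrite lerD2l.
  by rewrite mulNr lerNr -mulrN ler_wpM2l ?(ltW a0).
rewrite powRDp// powR_inv1 ?(ltW n1)//.
by have := ler_wpM2l (powR_ge0 n.+1%:R (- a) : 0 <= _) h; rewrite mulrDr mulr1 lerBrDl mulrCA.
Qed.

Lemma powR_sum_tail (a : R) m n : 0 < a -> (0 < m)%N ->
  \sum_(m <= k < m + n) k.+1%:R `^ (- a - 1) <= m%:R `^ (- a) / a.
Proof.
move=> a0 m0; rewrite ler_pdivlMr//.
suff : (\sum_(m <= k < m + n) k.+1%:R `^ (- a - 1)) * a <= m%:R `^ (- a) - (m + n)%:R `^ (- a).
  by have := powR_ge0 (m + n)%:R (- a) : 0 <= _ :> R; lra.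
elim: n => [|n ih]; first by rewrite addn0 big_geq// mul0r subrr.
rewrite addnS big_nat_recr ?leq_addr//= mulrDl.
have := @powR_diff a (m + n) a0 ltac:(by rewrite addn_gt0 m0); lra.
Qed.

End PowerFacts.

(** * Continuation of zeta to Re s > 0 *)

Section Zeta.
Variable R : realType.
Local Open Scope complex_scope.
Local Notation C := R[i].
Local Notation dm := (@dirichlet_monomial R).
Implicit Types (s w z : C).

Lemma nc_dm s n : (0 < n)%N -> nc (dm s n) = n%:R `^ (- complex.Re s).
Proof.
move=> n0; rewrite /dirichlet_monomial nc_cexp powRE ?ltr0n// mulrC ReMl ReN.
by rewrite mulrC.
Qed.

Lemma dm1 s : dm s 1 = 1.
Proof. by rewrite /dirichlet_monomial ln1 mulr0 cexp0. Qed.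

Lemma dmM s m n : (0 < m)%N -> (0 < n)%N -> dm s (m * n) = dm s m * dm s n.
Proof.
move=> m0 n0; rewrite /dirichlet_monomial natrM lnM ?posrE ?ltr0n//.
by rewrite rmorphD /= mulrDr cexpD.
Qed.

Lemma dmD s w n : dm (s + w) n = dm s n * dm w n.
Proof. by rewrite /dirichlet_monomial opprD mulrDl cexpD. Qed.

Lemma dm_sub1 s n : (0 < n)%N -> dm (s - 1) n = n%:R * dm s n.
Proof.
move=> n0; rewrite dmD mulrC; congr (_ * _).
by rewrite /dirichlet_monomial opprK mul1r cexp_real lnK ?posrE ?ltr0n// rmorph_nat.
Qed.

Lemma cdiff_dm s n : cdiff (fun s => dm s n) s (- (ln n%:R)%:C * dm s n).
Proof.
have h := cdiffM (cdiffN (cdiff_id s)) (cdiff_cst (ln n%:R : R)%:C s).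
have := cdiff_comp h (cdiff_cexp (- s * (ln n%:R)%:C)).
rewrite /dirichlet_monomial (_ : cexp _ * _ = - (ln n%:R)%:C * cexp (- s * (ln n%:R)%:C))//.
by ring.
Qed.

(* [f(n+1) - f(n) - f'(n)] for [f(x) = x^(1-s)]: with 1 added, the sum over [n >= 1] represents
   [(s - 1) zeta(s)] on the half-plane [Re s > 0]. *)
Definition vterm n s : C := (s - 1) * dm s n + dm (s - 1) n.+1 - dm (s - 1) n.

Definition Epart s N : C := 1 + \sum_(k < N) vterm k.+1 s.

Lemma EpartE s N : Epart s N = (s - 1) * \sum_(k < N) dm s k.+1 + dm (s - 1) N.+1.
Proof.
rewrite /Epart; elim: N => [|N ih]; first by rewrite !big_ord0 mulr0 dm1 addr0 add0r.
by rewrite !big_ord_recr /= addrA ih /vterm; ring.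
Qed.

Definition vbound s : R := 40 * (nc (s - 1) ^+ 2 + nc (s - 1)).

(** With z = (1 - s) ln(1 + 1/n), the term is n^(1-s) (e^z - 1 + (s - 1) / n). If |z| <= 1/2 the
    expansion of the exponential to second order applies; otherwise |s - 1| / n > 1/2, and the
    quadratic bound is larger than the trivial one. *)
Lemma vterm_bound n s : (0 < n)%N -> 0 <= complex.Re s ->
  nc (vterm n s) <= vbound s * n%:R `^ (- complex.Re s - 1).
Proof.
move=> n0 s0; have nn : 1 <= n%:R :> R by rewrite ler1n.
have n0' : 0 < n%:R :> R by rewrite ltr0n.
set q := n%:R^-1 : R; have q0 : 0 < q by rewrite invr_gt0.
have q1 : q <= 1 by rewrite invf_le1.
pose d := ln (1 + q).
have d1 : d <= q by apply: le_ln1Dx; lra.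
have d2 : q - q ^+ 2 <= d.
  have h : 0 < (1 + q)^-1 by rewrite invr_gt0; lra.
  have := ln_sub1_le h; rewrite lnV ?posrE; last by lra.
  rewrite -/d; have : (1 + q)^-1 - 1 <= q ^+ 2 - q.
    by rewrite lerBlDr invf_ple ?posrE ?ler_pdivrMr; (try nra); rewrite -[leLHS]mul1r ler_pdivrMr; nra.
  by lra.
have d0 : 0 <= d by rewrite ln_ge0//; lra.
pose z := (1 - s) * d%:C.
have E : vterm n s = dm (s - 1) n * (cexp z - 1 + (s - 1) * q%:C).
  have dz : dm (s - 1) n.+1 = dm (s - 1) n * cexp z.
    rewrite /dirichlet_monomial -cexpD; congr cexp.
    have -> : (n.+1%:R : R) = n%:R * (1 + q) by rewrite -natr1 /q; field; rewrite gt_eqF.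
    rewrite lnM ?posrE//; last by lra.
    by rewrite -/d rmorphD /= /z; ring.
  rewrite /vterm dz {1}(_ : dm s n = dm (s - 1) n * q%:C); first by ring.
  rewrite dm_sub1// mulrAC /q fmorphV /= rmorph_nat mulfV ?mul1r//.
  by rewrite pnatr_eq0 -lt0n.
have hA : nc (dm (s - 1) n) = n%:R `^ (1 - complex.Re s) by rewrite nc_dm// ReB /= opprB.
have hB : n%:R `^ (- complex.Re s - 1) = n%:R `^ (1 - complex.Re s) * q ^+ 2.
  rewrite (_ : - complex.Re s - 1 = (1 - complex.Re s) + - 2); last by ring.
  by rewrite (powRDp (1 - _) _ n0') powRN powR_mulrn ?(ltW n0')// exprVn.
rewrite E ncM hA hB mulrCA ler_wpM2l ?powR_ge0//.
set a := nc (s - 1).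
have a0 : 0 <= a by exact: nc_ge0.
have nz : nc z = a * d by rewrite ncM nc_sym nc_real ger0_norm.
have nsq : nc ((s - 1) * q%:C) = a * q by rewrite ncM nc_real gtr0_norm.
rewrite /vbound -/a.
have [zs|zl] := leP (nc z) (1 / 2).
  have h1 := cexp_sub zs.
  rewrite (_ : _ + _ = (cexp z - 1 - z) - (s - 1) * (d - q)%:C); last first.
    by rewrite /z rmorphB /=; ring.
  apply: (le_trans (ncB _ _)); rewrite ncM nc_real -/a.
  have h2 : `|d - q| <= q ^+ 2 by rewrite ler_norml; lra.
  have h3 : nc z ^+ 2 <= a ^+ 2 * q ^+ 2.
    by rewrite nz -exprMn lerXn2r ?nnegrE ?mulr_ge0 ?(ltW q0)// ler_wpM2l.
  have h4 : a * `|d - q| <= a * q ^+ 2 by rewrite ler_wpM2l.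
  have : 0 <= a ^+ 2 * q ^+ 2 by rewrite mulr_ge0// sqr_ge0.
  have : 0 <= a * q ^+ 2 by rewrite mulr_ge0// sqr_ge0.
  by move: h1 h3 h4; clear; lra.
have aq : 1 / 2 < a * q by apply: (lt_le_trans zl); rewrite nz ler_wpM2l.
apply: (le_trans (ncD _ _)); have h1 := ncB (cexp z) 1.
rewrite nsq; move: h1; rewrite nc1 nc_cexp.
have h2 : expR (complex.Re z) <= 2.
  have -> : complex.Re z = (1 - complex.Re s) * d by rewrite /z mulrC ReMl ReB /= mulrC.
  apply: (@le_trans _ _ (expR d)).
    rewrite ler_expR; apply: ler_piMl => //; lra.
  by rewrite /d lnK ?posrE; lra.
have h3 : 1 / 4 <= (a * q) ^+ 2 by rewrite expr2; nra.
have h4 : a * q <= 2 * (a * q) ^+ 2 by rewrite expr2; nra.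
have h5 : 0 <= a * q ^+ 2 by rewrite mulr_ge0// sqr_ge0.
by move: h2 h3 h4 h5; rewrite exprMn; clear; lra.
Qed.

Lemma Epart_cauchy s m n : 0 < complex.Re s -> (0 < m)%N ->
  nc (Epart s (m + n) - Epart s m) <= vbound s * (m%:R `^ (- complex.Re s) / complex.Re s).
Proof.
move=> s0 m0; rewrite /Epart big_split_ord /= opprD addrACA subrr add0r addrAC subrr add0r.
apply: (le_trans (nc_sum _ _ _)).
have vb0 : 0 <= vbound s.
  by rewrite /vbound mulr_ge0// addr_ge0 ?nc_ge0// exprn_ge0// nc_ge0.
apply: (@le_trans _ _ (vbound s * \sum_(m <= k < m + n) k.+1%:R `^ (- complex.Re s - 1))).
  rewrite -[X in \sum_(X <= _ < _) _]add0n big_addn addKn big_mkord mulr_sumr.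
  by apply: ler_sum => i _; rewrite addnC; apply: vterm_bound => //; exact: ltW.
by rewrite ler_wpM2l// powR_sum_tail.
Qed.

(** For Re s > 0 the limit exists, by [Efun_lim], and it is (s - 1) zeta(s). *)
Definition Efun s : C := xget 0 [set l | cto (Epart s) l].

Lemma vbound_ge0 s : 0 <= vbound s.
Proof. by rewrite /vbound mulr_ge0// addr_ge0 ?nc_ge0// exprn_ge0// nc_ge0. Qed.

Lemma Efun_lim s : 0 < complex.Re s -> cto (Epart s) (Efun s).
Proof.
move=> s0; rewrite /Efun.
suff [l hl] : exists l, cto (Epart s) l by case: xgetP => [y -> //|/(_ l)].
apply: cto_cauchy => e e0; have vb := vbound_ge0 s.
have e1 : 0 < e * complex.Re s / (2 * (vbound s + 1)).
  by rewrite divr_gt0 ?mulr_gt0//; lra.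
have [k0 hk0] := powR_small s0 e1.
have h k : nc (Epart s (k0.+1 + k) - Epart s k0.+1) <= e / 2.
  apply: (le_trans (@Epart_cauchy s k0.+1 k s0 isT)).
  have := hk0 k0 (leqnn _); rewrite ler_pdivlMr; last by lra.
  have p0 := powR_ge0 k0.+1%:R (- complex.Re s) : 0 <= _.
  by move=> h; rewrite mulrA ler_pdivrMr//; nra.
exists k0.+1 => k m hk hm.
rewrite -(subnKC hk) -(subnKC hm).
have h1 := h (k - k0.+1)%N; have h2 := h (m - k0.+1)%N.
rewrite (_ : _ - _ = (Epart s (k0.+1 + (k - k0.+1)) - Epart s k0.+1) -
   (Epart s (k0.+1 + (m - k0.+1)) - Epart s k0.+1)); last by ring.
by apply: (le_trans (ncB _ _)); lra.
Qed.

Lemma Efun_tail s m : 0 < complex.Re s -> (0 < m)%N ->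
  nc (Efun s - Epart s m) <= vbound s * (m%:R `^ (- complex.Re s) / complex.Re s).
Proof.
move=> s0 m0.
have h := ctoB (cto_sub (g := fun n => (m + n)%N) (fun n => leq_addl m n) (Efun_lim s0)) (cto_cst (Epart s m)).
by apply: cto_norm_le h; exists 0%N => n _; exact: Epart_cauchy.
Qed.

Lemma Efun_bound s : 0 < complex.Re s ->
  nc (Efun s) <= 1 + vbound s * (1 + (complex.Re s)^-1).
Proof.
move=> s0; have h1 := @Efun_tail s 1 s0 isT.
have h2 : nc (Epart s 1) <= 1 + vbound s.
  rewrite /Epart big_ord1; apply: (le_trans (ncD _ _)); rewrite nc1 lerD2l.
  by have := @vterm_bound 1 s isT (ltW s0); rewrite powR1 mulr1.
move: h1; rewrite powR1 mul1r => h1.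
by have := ncD (Efun s - Epart s 1) (Epart s 1); rewrite subrK; lra.
Qed.

Lemma cdiff_sum (I : Type) (r : seq I) (F : I -> C -> C) z :
  (forall i, exists l, cdiff (F i) z l) -> exists l, cdiff (fun s => \sum_(i <- r) F i s) z l.
Proof.
move=> Fd; elim: r => [|i r [l ih]].
  by exists 0; apply: cdiff_ext ltr01 _ (cdiff_cst 0 z) => w _; rewrite big_nil.
have [m hm] := Fd i; exists (m + l).
by apply: cdiff_ext ltr01 _ (cdiffD hm ih) => w _; rewrite big_cons.
Qed.

Lemma cdiff_Epart N z : exists l, cdiff (fun s => Epart s N) z l.
Proof.
have [l hl] : exists l, cdiff (fun s => \sum_(k < N) vterm k.+1 s) z l.
  apply: cdiff_sum => k.
  have s1 := cdiffB (cdiff_id z) (cdiff_cst 1 z).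
  have h1 := cdiffM s1 (cdiff_dm z k.+1).
  have h2 := cdiff_comp s1 (cdiff_dm (z - 1) k.+2).
  have h3 := cdiff_comp s1 (cdiff_dm (z - 1) k.+1).
  by have := cdiffB (cdiffD h1 h2) h3; eexists; eassumption.
by exists (0 + l); apply: cdiffD hl; exact: cdiff_cst.
Qed.

(** On the disc of radius Re z / 2 the tail bound is uniform, so [Efun] is there a uniform limit of
    the differentiable [Epart]. *)
Lemma cdiff_Efun z : 0 < complex.Re z -> exists l, cdiff Efun z l.
Proof.
move=> z0; pose t := complex.Re z / 2; have t0 : 0 < t by rewrite /t; lra.
have Re_disc w : nc (w - z) <= t -> t <= complex.Re w.
  by move=> h; have := le_trans (nc_Re _) h; rewrite ReB ler_norml /t; lra.
pose B := 40 * ((t + nc (z - 1)) ^+ 2 + (t + nc (z - 1))).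
have vB w : nc (w - z) <= t -> vbound w <= B.
  move=> h; have h1 : nc (w - 1) <= t + nc (z - 1).
    by have := ncD (w - z) (z - 1); rewrite (_ : w - z + (z - 1) = w - 1); [lra|ring].
  by rewrite /vbound /B ler_wpM2l// lerD// lerXn2r// nnegrE ?nc_ge0//; have := nc_ge0 (w - 1); lra.
have B0 : 0 <= B by apply: le_trans (vbound_ge0 z) (vB z _); rewrite subrr nc0 ltW.
have [|c [_ [M cM] cE]] := @uniform_limit_power_series R Efun z t t0.
  move=> e e0.
  have e1 : 0 < e * t / (B + 1) by rewrite divr_gt0 ?mulr_gt0//; lra.
  have [k0 hk0] := powR_small t0 e1.
  exists (fun s => Epart s k0.+1) => [w _|w hw]; first exact: cdiff_Epart.
  have w0 := Re_disc w hw.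
  apply: (le_trans (@Efun_tail w k0.+1 (lt_le_trans t0 w0) isT)).
  have h1 : k0.+1%:R `^ (- complex.Re w) <= k0.+1%:R `^ (- t) by rewrite ler_powR ?ler1n ?lerN2.
  have h2 := hk0 k0 (leqnn _); rewrite ler_pdivlMr in h2; last by lra.
  have p0 := powR_ge0 k0.+1%:R (- complex.Re w) : 0 <= _.
  apply: (@le_trans _ _ (B * (k0.+1%:R `^ (- t) / t))).
    apply: ler_pM; rewrite ?vbound_ge0 ?vB ?divr_ge0//; first by lra.
    apply: ler_pM; rewrite ?invr_ge0//; first by lra.
    by rewrite lef_pV2 ?posrE//; lra.
  rewrite mulrA ler_pdivrMr//; have := powR_ge0 k0.+1%:R (- t) : 0 <= _; nra.
have [g [_ g2]] := power_series_cdiff t0 cM cE.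
by exists (g z); apply: g2; rewrite subrr nc0.
Qed.

Lemma Efun1 : Efun 1 = 1.
Proof.
apply: (cto_uniq (Efun_lim _)); first by rewrite /=.
apply: cto_ext (cto_cst 1) => k; rewrite /Epart big1 ?addr0// => i _.
by rewrite /vterm subrr mul0r add0r /dirichlet_monomial oppr0 !mul0r subrr.
Qed.

Definition zeta0 s : C := Efun s / (s - 1).

Lemma cdiff_zeta0 z : 0 < complex.Re z -> z != 1 -> exists l, cdiff zeta0 z l.
Proof.
move=> z0 z1; have [l hl] := cdiff_Efun z0.
have z1' : z - 1 != 0 by rewrite subr_eq0.
have h := @cdiffV _ (fun w => w - 1) z _ z1' (cdiffB (cdiff_id z) (cdiff_cst 1 z)).
by have := cdiffM hl h; eexists; eassumption.
Qed.

Lemma Re_neq1 s : 1 < complex.Re s -> s - 1 != 0.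
Proof.
by move=> s1; rewrite subr_eq0; apply/eqP => h; move: s1; rewrite h /= ltxx.
Qed.

Lemma zeta_series s : 1 < complex.Re s -> cto (fun N => \sum_(k < N) dm s k.+1) (zeta0 s).
Proof.
move=> s1; have s0 : 0 < complex.Re s by lra.
have hz : cto (fun N => dm (s - 1) N.+1) 0.
  move=> e e0; have s1' : 0 < complex.Re s - 1 by lra.
  have [k0 hk0] := powR_small s1' e0; exists k0 => k /hk0.
  by rewrite subr0 nc_dm// ReB.
have := ctoZ (s - 1)^-1 (ctoB (Efun_lim s0) hz); rewrite subr0 mulrC.
apply: cto_ext => N; rewrite EpartE addrK mulKf//; exact: Re_neq1.
Qed.

Lemma zeta0_is_zeta : is_riemann_zeta (@zeta0).
Proof.
split=> [s s0 s1|s s1].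
  by have [l hl] := cdiff_zeta0 s0 s1; exact: cdiff_derivable hl.
apply/cto_cvg; apply: cto_shift; apply: cto_ext (zeta_series s1) => N.
by rewrite big_add1 big_mkord.
Qed.

End Zeta.

(** * The Moebius function *)

Section Moebius.

Lemma moebius1 : moebius 1 = 1.
Proof. by []. Qed.

Lemma moebius_mul_prime p n : prime p -> (0 < n)%N ->
  moebius (p * n) = if (p %| n)%N then 0 else - moebius n.
Proof.
move=> pp n0; have p0 := prime_gt0 pp.
have pn0 : (0 < p * n)%N by rewrite muln_gt0 p0.
have memp q : (q \in primes (p * n)) = (q == p) || (q \in primes n).
  by rewrite primesM// primes_prime// inE.
rewrite /moebius pn0 n0 /=; case: (boolP (p %| n)%N) => [pn|npn].
  case: ifPn => // H; move: (seq.allP H p).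
  rewrite memp eqxx /= => /(_ isT); rewrite lognM// logn_prime// eqxx add1n eqSS => /eqP h.
  by have := logn_gt0 p n; rewrite h mem_primes pp n0 pn.
have np : p \notin primes n by rewrite mem_primes pp n0.
have pe : perm_eq (primes (p * n)) (p :: primes n).
  by apply: uniq_perm; rewrite ?primes_uniq//= ?np ?primes_uniq.
rewrite (perm_size pe) /= exprS mulN1r.
rewrite (perm_all _ pe) /= lognM// logn_prime// eqxx add1n eqSS.
have -> : logn p n = 0%N by apply/eqP; rewrite -leqn0 leqNgt logn_gt0.
rewrite /=; set A := all _ _; set B := all _ _; suff -> : A = B by case: ifP; rewrite ?oppr0.
apply: eq_in_all => q qn; rewrite lognM// logn_prime; last first.
  by move: qn; rewrite mem_primes => /andP[].
by case: (eqVneq q p) => // qp; move: np; rewrite -qp qn.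
Qed.

Lemma moebius_norm n : (`|moebius n| <= 1)%R.
Proof. by rewrite /moebius; case: ifP => // _; rewrite normrX normrN1 expr1n. Qed.

(** Fix a prime p dividing n = p m. The divisors p e of n cancel against the divisors e of m prime
    to p, as mu(p e) = - mu(e), and mu(p e) = 0 if p divides e. *)
Lemma sum_moebius n : (0 < n)%N -> \sum_(d <- divisors n) moebius d = (n == 1)%N%:R.
Proof.
move=> n0; have [->|n1] := eqVneq n 1%N; first by rewrite big_cons big_nil addr0.
have n2 : (1 < n)%N by rewrite ltn_neqAle eq_sym n1.
have [p pp pn] := pdivP n2; have p0 := prime_gt0 pp.
have [m nE] : exists m, n = (p * m)%N by move/dvdnP: pn => [m ->]; exists m; rewrite mulnC.
have m0 : (0 < m)%N by move: n0; rewrite nE muln_gt0 => /andP[].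
rewrite (bigID (fun d => p %| d)%N) /=.
have E1 : \sum_(d <- divisors n | (p %| d)%N) moebius d =
          \sum_(e <- divisors m) moebius (p * e).
  rewrite -[RHS](big_map (muln p) predT moebius) -[LHS]big_filter; apply: perm_big.
  apply: uniq_perm; rewrite ?filter_uniq ?divisors_uniq ?map_inj_uniq ?divisors_uniq//.
    by move=> x y /eqP; rewrite eqn_pmul2l// => /eqP.
  move=> d; rewrite mem_filter -dvdn_divisors//; apply/andP/mapP.
    move=> [/dvdnP[e ->]]; rewrite nE mulnC dvdn_pmul2l// => em.
    by exists e; rewrite -?dvdn_divisors// mulnC.
  by move=> [e]; rewrite -dvdn_divisors// => em ->; rewrite dvdn_mulr// nE dvdn_pmul2l.
have E2 : \sum_(d <- divisors n | ~~ (p %| d)%N) moebius d =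
          \sum_(d <- divisors m | ~~ (p %| d)%N) moebius d.
  rewrite -big_filter -[RHS]big_filter; apply: perm_big.
  apply: uniq_perm; rewrite ?filter_uniq ?divisors_uniq// => d.
  rewrite !mem_filter -!dvdn_divisors//; case: (boolP (p %| d)%N) => //= pd.
  by rewrite nE Gauss_dvdr// coprime_sym prime_coprime.
rewrite E1 E2 [X in X + _](_ : _ = \sum_(e <- divisors m | ~~ (p %| e)%N) - moebius e).
  by rewrite -big_split /= big1// => e _; rewrite addNr.
rewrite [RHS]big_mkcond /= !big_seq; apply: eq_bigr => e em.
rewrite moebius_mul_prime//; first by case: (p %| e)%N.
by rewrite -dvdn_divisors// in em; exact: dvdn_gt0 em.
Qed.

End Moebius.

(** * Dirichlet convolutions and sums over squarefree products *)

Section Sums.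

(** Both variables may run up to X independently, because [Phi] kills the products beyond X; the
    pairs are then grouped by their product. *)
Lemma conv_sum (V : comNzRingType) (a b Phi : nat -> V) X :
  (forall k, (X < k)%N -> Phi k = 0) ->
  \sum_(1 <= m < X.+1) \sum_(1 <= n < X.+1) a m * b n * Phi (m * n)%N =
  \sum_(1 <= k < X.+1) (\sum_(d <- divisors k) a d * b (k %/ d)%N) * Phi k.
Proof.
move=> PhiX.
have inner k m : (k \in index_iota 1 X.+1) -> (m \in index_iota 1 X.+1) ->
    \sum_(1 <= n < X.+1) (if (m * n == k)%N then a m * b n else 0) =
    if (m %| k)%N then a m * b (k %/ m)%N else 0.
  rewrite !mem_index_iota => /andP[k1 kX] /andP[m1 mX].
  case: ifPn => [mk|nmk]; last first.
    rewrite big1// => n _; case: eqP => // e; case/negP: nmk; rewrite -e; exact: dvdn_mulr.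
  have kmE : (m * (k %/ m) = k)%N by rewrite mulnC divnK.
  rewrite (bigD1_seq (k %/ m)%N) ?iota_uniq//=; last first.
    rewrite mem_index_iota divn_gt0// (dvdn_leq k1 mk) /=.
    by apply: leq_ltn_trans kX; exact: leq_div.
  rewrite kmE eqxx big1 ?addr0// => n nk; case: eqP => // e; case/eqP: nk.
  by rewrite -e mulKn.
transitivity (\sum_(1 <= k < X.+1) \sum_(1 <= m < X.+1) \sum_(1 <= n < X.+1)
   (if (m * n == k)%N then a m * b n else 0) * Phi k).
  rewrite [RHS]exchange_big /=; apply: eq_big_seq => m; rewrite mem_index_iota => /andP[m1 _].
  rewrite [RHS]exchange_big /=; apply: eq_big_seq => n; rewrite mem_index_iota => /andP[n1 _].
  have [hX|hX] := boolP ((m * n)%N \in index_iota 1 X.+1).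
    rewrite (bigD1_seq (m * n)%N) ?iota_uniq//= ?eqxx big1 ?addr0// => k.
    by rewrite eq_sym => /negbTE->; rewrite mul0r.
  rewrite big_seq big1; last first.
    move=> k hk; case: eqP => [e|_]; last by rewrite mul0r.
    by move: hX; rewrite e hk.
  by rewrite PhiX ?mulr0//; move: hX; rewrite mem_index_iota muln_gt0 m1 n1 /= -leqNgt.
apply: eq_big_seq => k hk; have := hk; rewrite mem_index_iota => /andP[k1 kX].
under eq_bigr do rewrite -mulr_suml.
rewrite -mulr_suml; congr (_ * _).
rewrite (eq_big_seq _ (fun m hm => inner k m hk hm)) -big_mkcond -big_filter /=.
apply: perm_big; apply: uniq_perm; rewrite ?divisors_uniq ?filter_uniq ?iota_uniq// => m.
rewrite mem_filter mem_index_iota -dvdn_divisors//; case: (boolP (m %| k)%N) => //= mk.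
by rewrite (dvdn_gt0 k1 mk) /=; apply: leq_ltn_trans kX; exact: dvdn_leq.
Qed.

(* The sum of [y n * phi n] over the squarefree products [n] of the primes in [ps],
   with [phi] extended multiplicatively. *)
Fixpoint msum (V : comNzRingType) (ps : seq nat) (y phi : nat -> V) : V :=
  if ps is p :: ps' then msum ps' y phi + phi p * msum ps' (fun n => y (p * n)%N) phi
  else y 1%N.

Fixpoint sqfree_prods (ps : seq nat) : seq nat :=
  if ps is p :: ps' then sqfree_prods ps' ++ map (muln p) (sqfree_prods ps') else [:: 1%N].

Lemma mem_sqfree_prods ps : uniq ps -> all prime ps -> forall n,
  (n \in sqfree_prods ps) = [&& (0 < n)%N, moebius n != 0 & all (mem ps) (primes n)].
Proof.
elim: ps => [_ _ n|p ps ih /= /andP[pps ups] /andP[pp aps] n].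
  rewrite /= inE; case: n => [//|[//|n]] /=.
  have /pdivP[p pp pn] : (1 < n.+2)%N by [].
  symmetry; apply/negbTE; rewrite negb_and; apply/orP; right.
  apply/negP => /seq.allP /(_ p); rewrite mem_primes pp pn /= => /(_ isT).
  by rewrite in_nil.
have p0 := prime_gt0 pp.
rewrite mem_cat ih//; apply/orP/idP => [[/and3P[n0 nm al]|/mapP[m]]|/and3P[n0 nm al]].
- rewrite n0 nm /=; apply/seq.allP => q /(seq.allP al) /=; rewrite inE => ->; exact: orbT.
- rewrite ih// => /and3P[m0 mm al] ->; rewrite muln_gt0 p0 m0 moebius_mul_prime//=.
  have npm : ~~ (p %| m)%N.
    apply/negP => pm; have : p \in primes m by rewrite mem_primes pp m0.
    by move=> /(seq.allP al) /=; rewrite (negbTE pps).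
  rewrite (negbTE npm) oppr_eq0 mm /=; apply/seq.allP => q.
  rewrite primesM// primes_prime// !inE => /orP[->//|/(seq.allP al) /= ->].
  exact: orbT.
have [pn|pn] := boolP (p %| n)%N; last first.
  left; rewrite n0 nm /=; apply/seq.allP => q qn; have := seq.allP al q qn; rewrite /= inE.
  by case: eqP => //= qp; move: qn; rewrite qp mem_primes (negbTE pn) !andbF.
right; have /dvdnP[m nE] := pn; rewrite mulnC in nE.
have m0 : (0 < m)%N by move: n0; rewrite nE muln_gt0 => /andP[].
move: nm; rewrite nE moebius_mul_prime//; case: ifPn => [|npm]; first by rewrite eqxx.
rewrite oppr_eq0 => mm; apply/mapP; exists m => //; rewrite ih// m0 mm /=.
apply/seq.allP => q qm; have := seq.allP al q.
rewrite nE primesM// qm orbT => /(_ isT) /=; rewrite inE.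
by case: eqP => //= qp; move: qm; rewrite qp mem_primes (negbTE npm) !andbF.
Qed.

Lemma uniq_sqfree_prods ps : uniq ps -> all prime ps -> uniq (sqfree_prods ps).
Proof.
elim: ps => [//|p ps ih /= /andP[pps ups] /andP[pp aps]].
have p0 := prime_gt0 pp.
rewrite cat_uniq ih// map_inj_uniq ?ih//; last first.
  by move=> x y /eqP; rewrite eqn_pmul2l// => /eqP.
rewrite andbT /=; apply/hasPn => _ /mapP[m hm ->].
rewrite mem_sqfree_prods//; apply/negP => /and3P[pm0 _ /seq.allP /(_ p)].
rewrite mem_primes pp pm0 dvdn_mulr// => /(_ isT) /=.
by rewrite (negbTE pps).
Qed.

Lemma msum_prods (V : comNzRingType) ps (y phi : nat -> V) : uniq ps -> all prime ps ->
  msum ps y phi = \sum_(n <- sqfree_prods ps) y n * \prod_(p <- primes n) phi p.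
Proof.
elim: ps y => [y _ _|p ps ih y /= /andP[pps ups] /andP[pp aps]].
  by rewrite /= big_seq1 big_nil mulr1.
rewrite !ih// big_cat big_map /=; congr (_ + _); rewrite mulr_sumr; apply: eq_big_seq => m.
rewrite mem_sqfree_prods// => /and3P[m0 _ al].
have npm : p \notin primes m by apply/negP => /(seq.allP al) /=; rewrite (negbTE pps).
have pe : perm_eq (primes (p * m)) (p :: primes m).
  apply: uniq_perm; rewrite ?primes_uniq//= ?npm ?primes_uniq// => q.
  by rewrite primesM ?(prime_gt0 pp)// primes_prime// !inE.
by rewrite (perm_big _ pe) big_cons /=; ring.
Qed.

Definition primes_upto N := [seq p <- iota 1 N | prime p].

Lemma uniq_primes_upto N : uniq (primes_upto N).
Proof. by rewrite filter_uniq// iota_uniq. Qed.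
Lemma all_primes_upto N : all prime (primes_upto N).
Proof. exact: filter_all. Qed.
Lemma mem_primes_upto N p : (p \in primes_upto N) = prime p && (p <= N)%N.
Proof.
rewrite mem_filter mem_iota add1n ltnS; case: (boolP (prime p)) => //= pp.
by rewrite (prime_gt0 pp).
Qed.

Lemma mem_sqfree_upto N n : (0 < n <= N)%N -> (n \in sqfree_prods (primes_upto N)) = (moebius n != 0).
Proof.
move=> /andP[n0 nN]; rewrite mem_sqfree_prods ?uniq_primes_upto ?all_primes_upto// n0 /=.
rewrite andbC (_ : all _ _ = true)//; apply/seq.allP => p; rewrite mem_primes n0 /= => /andP[pp pn].
by rewrite /= mem_primes_upto pp (leq_trans (dvdn_leq n0 pn)).
Qed.

Lemma msum_upto (V : comNzRingType) N (y phi : nat -> V) : (forall n, (N < n)%N -> y n = 0) ->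
  msum (primes_upto N) y phi =
  \sum_(1 <= n < N.+1) y n * ((`|moebius n|)%:~R * \prod_(p <- primes n) phi p).
Proof.
move=> yN; rewrite msum_prods ?uniq_primes_upto ?all_primes_upto//.
rewrite (bigID (fun n => n <= N)%N) /= [X in _ + X]big1 ?addr0; last first.
  by move=> n; rewrite -ltnNge => /yN ->; rewrite mul0r.
rewrite [RHS](bigID (fun n => moebius n != 0)) /= [X in _ = _ + X]big1 ?addr0; last first.
  by move=> n; rewrite negbK => /eqP ->; rewrite normr0 mul0r mulr0.
rewrite -big_filter -[RHS]big_filter.
rewrite (perm_big [seq n <- index_iota 1 N.+1 | moebius n != 0]); last first.
  apply: uniq_perm; rewrite ?filter_uniq ?uniq_sqfree_prods ?iota_uniq ?uniq_primes_upto ?all_primes_upto//.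
  move=> n; rewrite !mem_filter mem_index_iota ltnS.
  case: (posnP n) => [->|n0].
    by rewrite /= mem_sqfree_prods ?uniq_primes_upto ?all_primes_upto//= andbF.
  have [nN|nN] := leqP n N; last by rewrite /= andbF.
  by rewrite mem_sqfree_upto ?n0 ?nN//= ?andbT.
apply: eq_big_seq => n; rewrite mem_filter => /andP[nm _].
suff -> : `|moebius n| = 1 by rewrite mul1r.
by move: nm; rewrite /moebius; case: ifP => // _ _; rewrite normrX normrN1 expr1n.
Qed.

Lemma moebius_sqfree (V : comNzRingType) n : (0 < n)%N ->
  (`|moebius n|)%:~R * \prod_(p <- primes n) (-1 : V) = (moebius n)%:~R.
Proof.
move=> n0; rewrite big_const_seq count_predT iter_mulr mulr1 /moebius n0 /=.
case: ifP => _; last by rewrite normr0 mul0r.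
by rewrite normrX normrN1 expr1n mul1r rmorphXn rmorphN1.
Qed.

(** The Euler product of a finite sum. The factor n records the primes already selected in the
    induction. *)
Lemma msum_completely (V : comNzRingType) ps (y phi : nat -> V) n :
  (forall p m, p \in ps -> y (p * m)%N = y p * y m) -> y 1%N = 1 ->
  (forall m, y (n * m)%N = y n * y m) ->
  msum ps (fun m => y (n * m)%N) phi = y n * \prod_(p <- ps) (1 + phi p * y p).
Proof.
elim: ps n => [|p ps ih] n yM y1 yn /=; first by rewrite big_nil yn y1.
have yM' q m : q \in ps -> y (q * m)%N = y q * y m.
  by move=> qp; rewrite yM// inE qp orbT.
have yp m : y (p * m)%N = y p * y m by rewrite yM// mem_head.
rewrite big_cons ih//.
have -> : msum ps (fun m => y (n * (p * m))%N) phi = msum ps (fun m => y (n * p * m)%N) phi.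
  by congr msum; apply/funext => m; rewrite mulnA.
rewrite ih//; last by move=> m; rewrite -mulnA !yn yp mulrA.
by rewrite yn; ring.
Qed.

Lemma msum_linear (V : comNzRingType) ps (y z phi : nat -> V) c :
  msum ps (fun n => y n + c * z n) phi = msum ps y phi + c * msum ps z phi.
Proof. by elim: ps y z => [//|p ps ih] y z /=; rewrite !ih; ring. Qed.

End Sums.

(** * The series of 1/zeta, the Euler product and the line Re s = 1 *)

Section MoebiusSeries.
Variable R : realType.
Local Open Scope complex_scope.
Local Notation C := R[i].
Local Notation dm := (@dirichlet_monomial R).
Implicit Types (s w z : C).

Lemma tannery (c : nat -> C) (t : nat -> nat -> C) (B : R) :
  (forall e, 0 < e -> exists m0, forall n, \sum_(k < n) nc (c (m0 + k)%N) <= e) ->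
  (forall X m, nc (t X m) <= B) -> (forall m, cto (fun X => t X m) 0) ->
  cto (fun X => \sum_(m < X) c m * t X m) 0.
Proof.
move=> cs tB t0 e e0; have B0 : 0 <= B := le_trans (nc_ge0 _) (tB 0%N 0%N).
have e1 : 0 < e / (2 * (B + 1)) by rewrite divr_gt0//; lra.
have [m0 hm0] := cs _ e1.
have h0 : cto (fun X => \sum_(m <- index_enum 'I_m0) c m * t X m) 0.
  have := cto_sum (index_enum 'I_m0) (fun m : 'I_m0 => ctoZ (c m) (t0 m)).
  by rewrite big1// => i _; rewrite mulr0.
have e2 : 0 < e / 2 by lra.
have [k0 hk0] := h0 _ e2.
exists (maxn m0 k0) => X; rewrite geq_max => /andP[mX kX]; rewrite subr0.
rewrite -(subnKC mX) big_split_ord /=; apply: (le_trans (ncD _ _)).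
have -> : e = e / 2 + e / 2 by lra.
apply: lerD; first by have := hk0 X kX; rewrite subr0 subnKC.
apply: (le_trans (nc_sum _ _ _)).
apply: (@le_trans _ _ (\sum_(k < X - m0) nc (c (m0 + k)%N) * B)).
  by apply: ler_sum => k _; rewrite ncM ler_wpM2l ?nc_ge0.
rewrite -mulr_suml; apply: (@le_trans _ _ (e / (2 * (B + 1)) * B)).
  by rewrite ler_wpM2r.
rewrite mulrAC ler_pdivrMr; last by lra.
by nra.
Qed.

Lemma powR_tail_small (a : R) : 1 < a -> forall e, 0 < e ->
  exists m0, forall n, \sum_(k < n) (m0 + k).+1%:R `^ (- a) <= e.
Proof.
move=> a1 e e0; have b0 : 0 < a - 1 by lra.
have e1 : 0 < e * (a - 1) by rewrite mulr_gt0.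
have [k0 hk0] := powR_small b0 e1; exists k0.+1 => n.
have := @powR_sum_tail R (a - 1) k0.+1 n b0 isT.
rewrite -[X in \sum_(X <= _ < _) _]add0n big_addn addKn big_mkord => h.
apply: (@le_trans _ _ (k0.+1%:R `^ (- (a - 1)) / (a - 1))); last first.
  by rewrite ler_pdivrMr// hk0.
apply: le_trans h; rewrite le_eqVlt; apply/orP; left; apply/eqP.
by apply: eq_bigr => i _; rewrite [(i + _)%N]addnC; congr (_ `^ _); ring.
Qed.

Definition muC n : C := (moebius n)%:~R.

Lemma muC_cases n : [\/ muC n = 0, muC n = 1 | muC n = -1].
Proof.
rewrite /muC /moebius; case: ifP => _; last by apply: Or31.
rewrite -signr_odd; case: odd; last by apply: Or32.
by apply: Or33; rewrite expr1 rmorphN1.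
Qed.

Lemma nc_muC n : nc (muC n) <= 1.
Proof. by case: (muC_cases n) => ->; rewrite ?ncN ?nc0 ?nc1. Qed.

Definition Dseries s N : C := \sum_(k < N) muC k.+1 * dm s k.+1.

Lemma divisors_moebius_sum X (Phi : nat -> C) : (forall k, (X < k)%N -> Phi k = 0) -> (0 < X)%N ->
  \sum_(1 <= m < X.+1) \sum_(1 <= n < X.+1) muC m * Phi (m * n)%N = Phi 1%N.
Proof.
move=> PhiX X0.
have := @conv_sum C muC (fun=> 1) Phi X PhiX.
under eq_bigr do under eq_bigr do rewrite mulr1.
move=> ->; rewrite big_nat_recl// [X in _ + X]big1_seq ?addr0.
  rewrite big_cons big_nil addr0 mulr1.
  by rewrite /muC moebius1 mul1r.
move=> k /=; rewrite mem_index_iota => /andP[k1 _].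
under eq_bigr do rewrite mulr1.
have -> : \sum_(d <- divisors k.+1) muC d = (\sum_(d <- divisors k.+1) moebius d)%:~R.
  by rewrite rmorph_sum.
rewrite sum_moebius// eqSS; case: eqP k1 => [->//|_ _].
by rewrite rmorph0 mul0r.
Qed.

(** The sum of mu(m) m^(-s) Z(X/m) over m <= X, with Z the partial sums of zeta, is exactly 1;
    Tannery's theorem replaces Z(X/m) by zeta(s). *)
Lemma Dseries_zeta s : 1 < complex.Re s ->
  cto (fun X => zeta0 s * Dseries s X) 1.
Proof.
move=> s1; have hz := zeta_series s1.
pose Z y := \sum_(k < y) dm s k.+1.
have [B hB] : exists B, forall y, nc (Z y - zeta0 s) <= B.
  have [M hM] := cto_bounded hz; exists (M + nc (zeta0 s)) => y.
  by apply: (le_trans (ncB _ _)); rewrite lerD2r; exact: hM.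
have Zlim : cto (fun X => \sum_(m < X) (muC m.+1 * dm s m.+1) * (Z (X %/ m.+1)%N - zeta0 s)) 0.
  apply: (@tannery (fun m => muC m.+1 * dm s m.+1) (fun X m => Z (X %/ m.+1)%N - zeta0 s) B) => //.
  - move=> e e0; have [m0 hm0] := powR_tail_small s1 e0; exists m0 => n.
    apply: le_trans (hm0 n); apply: ler_sum => k _; rewrite ncM nc_dm//.
    by rewrite ler_piMl ?powR_ge0 ?nc_muC.
  move=> m e e0; have [k0 hk0] := hz e e0; exists (k0 * m.+1)%N => X hX; rewrite subr0.
  by apply: hk0; rewrite leq_divRL.
have main X : (0 < X)%N -> \sum_(m < X) muC m.+1 * dm s m.+1 * Z (X %/ m.+1)%N = 1.
  move=> X0; pose Phi k := if (k <= X)%N then dm s k else 0.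
  have PX k : (X < k)%N -> Phi k = 0 by rewrite /Phi ltnNge => /negbTE->.
  have := divisors_moebius_sum PX X0; rewrite /Phi X0 dm1 => <-.
  rewrite big_add1 /= big_mkord; apply: eq_bigr => m _.
  rewrite big_add1 /= big_mkord /Z mulr_sumr.
  rewrite (bigID (fun n : 'I_X => (m.+1 * n.+1 <= X)%N)) /= [X in _ + X]big1 ?addr0; last first.
    by move=> n /negbTE ->; rewrite mulr0.
  have dX : (X %/ m.+1 <= X)%N by exact: leq_div.
  rewrite (big_ord_widen _ (fun n => muC m.+1 * dm s m.+1 * dm s n.+1) dX).
  have E (n : 'I_X) : (m.+1 * n.+1 <= X)%N = (n < X %/ m.+1)%N by rewrite mulnC leq_divRL.
  apply: eq_big => [n|n]; first by rewrite E.
  by rewrite -E => ->; rewrite dmM// mulrA.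
have := ctoB (cto_cst 1) Zlim; rewrite subr0; move=> h e e0.
have [k0 hk0] := h e e0; exists k0.+1 => -[//|X] kX.
have := hk0 X.+1 (ltnW kX); congr (nc (_ - _) <= _).
under eq_bigr do rewrite mulrBr.
by rewrite sumrB main// opprB addrC subrK /Dseries -mulr_suml mulrC.
Qed.

Lemma zeta0_neq0 s : 1 < complex.Re s -> zeta0 s != 0.
Proof.
move=> s1; apply/eqP => z0; have := cto_uniq (Dseries_zeta s1).
move=> /(_ 0) H; have /H/eqP : cto (fun X => zeta0 s * Dseries s X) 0.
  by apply: cto_ext (cto_cst 0) => X; rewrite z0 mul0r.
by rewrite oner_eq0.
Qed.

Lemma Dseries_lim s : 1 < complex.Re s -> cto (Dseries s) (zeta0 s)^-1.
Proof.
move=> s1; have := ctoZ (zeta0 s)^-1 (Dseries_zeta s1); rewrite mulr1.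
by apply: cto_ext => X; rewrite mulKf// zeta0_neq0.
Qed.

Lemma sum_uniq_le (l : seq nat) (F : nat -> R) a b : uniq l -> (forall n, 0 <= F n) ->
  (forall n, n \in l -> (a <= n < b)%N) -> \sum_(n <- l) F n <= \sum_(a <= n < b) F n.
Proof.
move=> ul F0 lab.
rewrite (perm_big [seq n <- index_iota a b | n \in l]); last first.
  apply: uniq_perm => //; first by rewrite filter_uniq// iota_uniq.
  move=> n; rewrite mem_filter mem_index_iota; case: (boolP (n \in l)) => //= nl.
  by rewrite lab.
rewrite big_filter [leRHS](bigID (fun n => n \in l)) /= lerDl.
by apply: sumr_ge0.
Qed.

(** The value at 0 makes the monomial completely multiplicative on all naturals; [dm s 0] is 1,
    because [ln 0] is 0. *)
Definition dm0 s n : C := if n == 0%N then 0 else dm s n.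

(** Expanded, the product runs over all squarefree products of primes up to N. Those up to N give
    [Dseries s N], and the others lie in the tail of an absolutely convergent series. *)
Lemma euler_product s : 1 < complex.Re s ->
  cto (fun N => \prod_(p <- primes_upto N) (1 - dm s p)) (zeta0 s)^-1.
Proof.
move=> s1.
have dmM0 m n : dm0 s (m * n) = dm0 s m * dm0 s n.
  rewrite /dm0 muln_eq0; case: (eqVneq m 0%N) => [->|m0] /=; first by rewrite mul0r.
  case: (eqVneq n 0%N) => [_|n0] /=; first by rewrite mulr0.
  by rewrite dmM// lt0n.
have E N : \prod_(p <- primes_upto N) (1 - dm s p) = msum (primes_upto N) (dm0 s) (fun=> -1).
  have -> : dm0 s = (fun m => dm0 s (1 * m)%N) by apply/funext => m; rewrite mul1n.
  have d1 : dm0 s 1 = 1 by rewrite /dm0 /= dm1.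
  rewrite (@msum_completely _ _ (dm0 s) _ _ (fun p m _ => dmM0 p m) d1 (dmM0 1%N)).
  rewrite d1 mul1r; apply: eq_big_seq => p.
  rewrite mem_primes_upto => /andP[pp _]; rewrite /dm0 eqn0Ngt prime_gt0//=.
  by rewrite mulN1r.
apply: cto_ext (fun N => esym (E N)) _.
move=> e e0; have e2 : 0 < e / 2 by lra.
have [k0 hk0] := Dseries_lim s1 e2.
have [m0 hm0] := powR_tail_small s1 e2.
exists (maxn k0 m0) => N; rewrite geq_max => /andP[kN mN].
pose y1 n := if (n <= N)%N then dm0 s n else 0.
pose y2 n := if (n <= N)%N then 0 else dm0 s n.
have -> : dm0 s = (fun n => y1 n + 1 * y2 n).
  by apply/funext => n; rewrite /y1 /y2; case: ifP => _; rewrite mul1r ?addr0 ?add0r.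
rewrite msum_linear mul1r msum_upto; last by move=> n; rewrite /y1 ltnNge => /negbTE->.
have -> : \sum_(1 <= n < N.+1) y1 n * (`|moebius n|%:~R * \prod_(p <- primes n) -1) = Dseries s N.
  rewrite big_add1 /= big_mkord; apply: eq_bigr => k _.
  by rewrite moebius_sqfree// mulrC /y1 ltn_ord /dm0.
rewrite addrAC; apply: (le_trans (ncD _ _)).
have -> : e = e / 2 + e / 2 by lra.
apply: lerD; first exact: hk0.
rewrite msum_prods ?uniq_primes_upto ?all_primes_upto//.
set l := sqfree_prods _; have ul : uniq l by rewrite uniq_sqfree_prods ?uniq_primes_upto ?all_primes_upto.
rewrite (bigID (fun n => n <= N)%N) /= big1 ?add0r; last first.
  by move=> n; rewrite /y2 => ->; rewrite mul0r.
apply: (le_trans (nc_sum _ _ _)).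
apply: (@le_trans _ _ (\sum_(n <- [seq n <- l | ~~ (n <= N)%N]) n%:R `^ (- complex.Re s))).
  rewrite big_filter; apply: ler_sum => n nN; rewrite ncM.
  have n0 : (0 < n)%N by case: n nN.
  rewrite /y2 (negbTE nN) /dm0 eqn0Ngt n0 /= nc_dm//.
  rewrite ler_piMr ?powR_ge0// big_const_seq count_predT iter_mulr mulr1.
  by rewrite ncX ncN nc1 expr1n.
pose b := (\max_(n <- l) n).+1.
have lb n : n \in [seq n <- l | ~~ (n <= N)%N] -> (m0.+1 <= n < b)%N.
  rewrite mem_filter -ltnNge => /andP[nN nl]; apply/andP; split.
    by apply: leq_ltn_trans nN.
  by rewrite ltnS; apply: leq_bigmax_seq.
apply: (le_trans (sum_uniq_le (filter_uniq _ ul) _ lb)) => [n|]; first exact: powR_ge0.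
rewrite big_add1 /=; have [mb|bm] := leqP m0 b.-1; last by rewrite big_geq ?(ltW e2)// ltnW.
rewrite -[X in \sum_(X <= _ < _) _]add0n big_addn big_mkord.
by apply: le_trans (hm0 (b.-1 - m0)%N); apply: ler_sum => i _; rewrite addnC.
Qed.

(** The series is that of log(1 - z), its term k = 0 being zero since the inverse of 0 is 0. The
    function (1 - z) exp(-L(z)) has derivative 0. *)
Lemma cexp_log_series z : nc z < 1 ->
  exists L, cto (psum (fun k => - k%:R^-1) z) L /\ cexp L = 1 - z.
Proof.
move=> z1.
pose c (k : nat) : C := - k%:R^-1.
have c1 k : nc (c k) * 1 ^+ k <= 1.
  rewrite expr1n mulr1 /c ncN ncV nc_nat; case: k => [|k]; first by rewrite invr0.
  by rewrite invf_le1 ?ltr0n// ler1n.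
have lim w : exists l, nc w < 1 -> cto (psum c w) l.
  have [ws|ws] := ltP (nc w) 1; last by exists 0.
  by have [l hl] := cto_psum_coef_le ltr01 c1 ws; exists l.
have [L hL] := choice lim; exists (L z); split; first exact: hL.
have [g [g1 g2]] := psum_cdiff ltr01 c1 hL.
have gE w : nc w < 1 -> g w * (1 - w) = -1.
  move=> w1; have nz : 1 - w != 0.
    by rewrite subr_eq0; apply/eqP => e; move: w1; rewrite -e nc1 ltxx.
  apply: (mulIf (x := (1 - w)^-1)); rewrite ?invr_eq0// mulfK//.
  apply: cto_uniq (g1 w w1) _.
  have t01 : 0 <= nc w < 1 by rewrite nc_ge0.
  have h e : 0 < e -> exists k0, forall k, (k0 <= k)%N -> nc (- w ^+ k / (1 - w) * -1) <= e.
    move=> e0; have e1 : 0 < e * nc (1 - w) by rewrite mulr_gt0// nc_gt0.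
    have [k0 hk0] := geom_small t01 e1 ler01; exists k0 => k /hk0; rewrite mul1r => hk.
    by rewrite ncM ncN nc1 mulr1 nc_div ncN ncX ler_pdivrMr ?nc_gt0.
  move=> e /h[k0 hk0]; exists k0 => k /hk0; congr (nc _ <= _).
  have -> : psum (dcoef c) w k = - \sum_(i < k) w ^+ i.
    rewrite /psum -sumrN; apply: eq_bigr => i _.
    by rewrite /dcoef /c mulrN mulfV ?mulN1r// pnatr_eq0.
  have := geom_sum w k; set S := \sum_(i < k) _ => hS.
  have -> : S = (1 - w ^+ k) / (1 - w) by rewrite -hS mulrC mulKf.
  by field.
pose phi w := (1 - w) * cexp (- L w).
have phid w : nc (w - 0) < 1 -> cdiff phi w 0.
  rewrite subr0 => w1.
  have := cdiffM (cdiffB (cdiff_cst 1 w) (cdiff_id w)) (cdiff_comp (cdiffN (g2 _ w1)) (cdiff_cexp (- L w))).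
  rewrite (_ : _ + _ = 0)//; have := gE w w1.
  set E := cexp _ => h; transitivity (- E * (1 + g w * (1 - w))); first by ring.
  by rewrite h subrr mulr0.
have L0 : L 0 = 0.
  have := cto_uniq (hL 0 ltac:(by rewrite nc0)) (psum0 c).
  by rewrite /c invr0 oppr0.
have z1' : nc (z - 0) < 1 by rewrite subr0.
have := zero_deriv_const ltr01 phid z1'; rewrite /phi L0 !oppr0 cexp0 addr0 mulr1 cexpN.
by move=> /(congr1 ( *%R^~ (cexp (L z)))); rewrite divfK ?cexp_neq0// mul1r.
Qed.

(** In the logarithms every power of r appears with the factor -(3 + 4 cos x + cos 2x) = -2 (1 + cos
    x)^2 <= 0. *)
Lemma mertens_341 (r t : R) : 0 <= r < 1 ->
  nc (1 - r%:C) ^+ 3 * nc (1 - r%:C * eit t) ^+ 4 * nc (1 - r%:C * eit (2 * t)) <= 1.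
Proof.
move=> /andP[r0 r1].
have n1 : nc r%:C < 1 by rewrite nc_real ger0_norm.
have n2 : nc (r%:C * eit t) < 1 by rewrite ncM nc_eit mulr1.
have n3 : nc (r%:C * eit (2 * t)) < 1 by rewrite ncM nc_eit mulr1.
have [L1 [h1 <-]] := cexp_log_series n1.
have [L2 [h2 <-]] := cexp_log_series n2.
have [L3 [h3 <-]] := cexp_log_series n3.
rewrite !nc_cexp -!expRM_natl -!expRD -[leRHS]expR0 ler_expR.
have h := ctoD (ctoD (ctoZ 3%:R h1) (ctoZ 4%:R h2)) h3.
rewrite -[X in X <= _](_ : complex.Re (3%:R * L1 + 4%:R * L2 + L3) = _); last first.
  by rewrite !ReD -!(rmorph_nat (real_complex R)) !ReMl.
apply/ler_addgt0Pl => e e0; rewrite addr0.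
have [k0 hk0] := h e e0; have := le_trans (nc_Re _) (hk0 k0 (leqnn _)).
set P := _ + psum _ (_ * eit (2 * t)) _; rewrite ReB ler_norml => /andP[H _].
suff : complex.Re P <= 0 by lra.
rewrite /P /psum !mulr_sumr -!big_split /= Re_sum; apply: sumr_le0 => k _.
have -> : (3%:R * (- k%:R^-1 * r%:C ^+ k) + 4%:R * (- k%:R^-1 * (r%:C * eit t) ^+ k) +
    - k%:R^-1 * (r%:C * eit (2 * t)) ^+ k : C) =
    (- (k%:R^-1 * r ^+ k))%:C * (3%:R + 4%:R * eit (k%:R * t) + eit (k%:R * (2 * t))).
  rewrite !exprMn !eitX rmorphN rmorphM fmorphV rmorph_nat rmorphXn /=; ring.
rewrite ReMl mulNr oppr_le0 mulr_ge0 ?mulr_ge0 ?invr_ge0 ?exprn_ge0//.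
rewrite !ReD -!(rmorph_nat (real_complex R)) ReMl /=.
have -> : k%:R * (2 * t) = k%:R * t + k%:R * t by ring.
rewrite cosD; have := cos2Dsin2 (k%:R * t).
set x := cos _; set y := sin _; rewrite !expr2 => hxy.
have : 0 <= 2 * (1 + x) ^+ 2 by rewrite mulr_ge0// sqr_ge0.
rewrite expr2; lra.
Qed.

Lemma zeta_341 (sg t : R) : 1 < sg ->
  1 <= nc (zeta0 sg%:C) ^+ 3 * nc (zeta0 (sg +i* t)) ^+ 4 * nc (zeta0 (sg +i* (2 * t))).
Proof.
move=> s1.
have z1 : zeta0 sg%:C != 0 by exact: zeta0_neq0.
have z2 : zeta0 (sg +i* t) != 0 by exact: zeta0_neq0.
have z3 : zeta0 (sg +i* (2 * t)) != 0 by exact: zeta0_neq0.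
have e1 := @euler_product sg%:C s1.
have e2 := @euler_product (sg +i* t) s1.
have e3 := @euler_product (sg +i* (2 * t)) s1.
have pw u (l : C) n : cto u l -> cto (fun k => u k ^+ n) (l ^+ n).
  move=> ul; elim: n => [|n ih]; first by apply: cto_ext (cto_cst 1) => k; rewrite expr0.
  by rewrite exprS; apply: cto_ext (ctoM ul ih) => k; rewrite exprS.
have h := ctoM (ctoM (pw _ _ 3%N e1) (pw _ _ 4%N e2)) e3.
have : nc ((zeta0 sg%:C)^-1 ^+ 3 * (zeta0 (sg +i* t))^-1 ^+ 4 * (zeta0 (sg +i* (2 * t)))^-1) <= 1.
  apply: (cto_norm_le _ h); exists 0%N => N _; rewrite -!prodrXl -!big_split /=.
  rewrite big_seq; elim/big_ind: _ => [|x y hx hy|p]; first by rewrite nc1.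
    by rewrite ncM mulr_ile1 ?nc_ge0.
  rewrite mem_primes_upto => /andP[pp _]; have p0 := prime_gt0 pp.
  pose r : R := p%:R `^ (- sg).
  have r01 : 0 <= r < 1.
    rewrite powR_ge0 /= /r powRN invf_lt1 ?powR_gt0 ?ltr0n//.
    apply: (@lt_le_trans _ _ p%:R); first by rewrite ltr1n prime_gt1.
    by rewrite le1r_powR ?ler1n// ltW.
  have dE u : dm (sg +i* u) p = r%:C * eit (- (u * ln p%:R)).
    rewrite /dirichlet_monomial cexpE ReM ImM /= /r powRE ?ltr0n//.
    by congr ((expR _)%:C * eit _); ring.
  have -> : dm sg%:C p = r%:C by rewrite (dE 0) mul0r oppr0 eit0 mulr1.
  rewrite !dE ncM ncM ncX ncX.
  have -> : - (2 * t * ln p%:R) = 2 * (- (t * ln p%:R)) :> R by ring.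
  exact: mertens_341.
rewrite ncM ncM ncX ncX !ncV !exprVn -!invfM invf_le1//.
by rewrite !mulr_gt0 ?exprn_gt0 ?nc_gt0.
Qed.

(** At abscissa 1 + h, a zero at 1 + it would bound the 3-4-1 product by a constant times h^(-3) h^4
    = h, whereas [zeta_341] keeps it at least 1. *)
Lemma Efun_neq0_line (t : R) : t != 0 -> Efun (1 +i* t) != 0.
Proof.
move=> t0; apply/eqP => E0.
have [l hl] := @cdiff_Efun R (1 +i* t) ltr01.
have [d d0 hd] := hl 1 ltr01.
have [l2 /cdiff_cont hl2] := @cdiff_Efun R (1 +i* (2 * t)) ltr01.
have [l1 /cdiff_cont hl1] := @cdiff_Efun R 1 ltr01.
have [d1 d10 hd1] := hl1 1 ltr01.
have [d2 d20 hd2] := hl2 1 ltr01.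
pose B1 := nc (Efun (1 : C)) + 1; pose B2 := (nc (Efun (1 +i* (2 * t))) + 1) / `|2 * t|.
pose B := (nc l + 1) / `|t|.
have t1 : 0 < `|t| by rewrite normr_gt0.
have t2 : 0 < `|2 * t| by rewrite normr_gt0 mulf_neq0.
have B10 : 0 <= B1 by rewrite addr_ge0 ?nc_ge0.
have B00 : 0 <= B by rewrite divr_ge0 ?addr_ge0 ?nc_ge0.
have B20 : 0 <= B2 by rewrite divr_ge0 ?addr_ge0 ?nc_ge0.
pose K := B1 ^+ 3 * B ^+ 4 * B2; have K0 : 0 <= K.
  by apply: mulr_ge0 => //; apply: mulr_ge0; exact: exprn_ge0.
have [h [h0 hd' hdd1 hdd2 hK]] : exists h : R, [/\ 0 < h, h <= d, h <= d1, h <= d2 & h * K < 1].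
  exists (Num.min (Num.min d d1) (Num.min d2 (2 * (K + 1))^-1)).
  have K1 : 0 < (2 * (K + 1))^-1 by rewrite invr_gt0; lra.
  rewrite !lt_min d0 d10 d20 K1 !ge_min !lexx ?orbT; split=> //.
  apply: (@le_lt_trans _ _ ((2 * (K + 1))^-1 * K)).
    by rewrite ler_wpM2r// !ge_min lexx !orbT.
  by rewrite mulrC ltr_pdivrMr; lra.
have := @zeta_341 (1 + h) t ltac:(lra); apply/negP; rewrite -ltNge.
apply: le_lt_trans hK.
have sub1 u : ((1 + h) +i* u) - 1 = h +i* u :> C by simpc; congr (_ +i* _); ring.
have cl u : nc ((1 + h) +i* u - 1 +i* u : C) = h.
  have -> : (1 + h) +i* u - 1 +i* u = h%:C :> C by simpc; congr (_ +i* _); ring.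
  by rewrite nc_real gtr0_norm.
have n1 : nc (zeta0 (1 + h)%:C) <= B1 / h.
  rewrite /zeta0 nc_div (sub1 0) nc_real gtr0_norm// ler_wpM2r ?invr_ge0 ?(ltW h0)//.
  have := hd1 ((1 + h)%:C); rewrite (cl 0) => /(_ hdd1).
  by have := ncD (Efun (1 + h)%:C - Efun 1) (Efun 1); rewrite subrK /B1; lra.
have n2 : nc (zeta0 ((1 + h) +i* t)) <= B * h.
  have h1 := hd ((1 + h) +i* t); rewrite cl E0 subr0 in h1; have {}h1 := h1 hd'.
  set w := (1 + h) +i* t in h1 *; set q := w - _ in h1.
  have nq : nc q = h by exact: cl.
  have h2 : nc (Efun w) <= (nc l + 1) * h.
    by have := ncD (Efun w - l * q) (l * q); rewrite subrK ncM nq; lra.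
  rewrite /zeta0 nc_div /B mulrAC; apply: ler_pM; rewrite ?nc_ge0 ?invr_ge0 ?nc_ge0//.
  rewrite sub1 lef_pV2 ?posrE//; first by have := nc_Im (h +i* t).
  by apply: lt_le_trans t1 _; have := nc_Im (h +i* t).
have n3 : nc (zeta0 ((1 + h) +i* (2 * t))) <= B2.
  rewrite /zeta0 nc_div /B2; apply: ler_pM; rewrite ?nc_ge0 ?invr_ge0 ?nc_ge0//.
    have := hd2 ((1 + h) +i* (2 * t)); rewrite cl => /(_ hdd2).
    have := ncD (Efun ((1 + h) +i* (2 * t)) - Efun (1 +i* (2 * t))) (Efun (1 +i* (2 * t))).
    by rewrite subrK; lra.
  rewrite sub1 lef_pV2 ?posrE//; first by have := nc_Im (h +i* (2 * t)).
  by apply: lt_le_trans t2 _; have := nc_Im (h +i* (2 * t)).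
apply: (@le_trans _ _ ((B1 / h) ^+ 3 * (B * h) ^+ 4 * B2)).
  apply: ler_pM; rewrite ?mulr_ge0 ?exprn_ge0 ?nc_ge0//.
  apply: ler_pM; rewrite ?exprn_ge0 ?nc_ge0//.
    by rewrite lerXn2r ?nnegrE ?nc_ge0 ?divr_ge0 ?(ltW h0).
  have Bh : 0 <= B * h := mulr_ge0 B00 (ltW h0).
  by rewrite lerXn2r ?nnegrE ?nc_ge0.
rewrite le_eqVlt; apply/orP; left; apply/eqP; rewrite /K exprMn exprVn exprMn.
by field; rewrite gt_eqF.
Qed.

Lemma Efun_neq0 s : 1 <= complex.Re s -> Efun s != 0.
Proof.
rewrite le_eqVlt => /orP[/eqP s1|s1]; last first.
  by have := zeta0_neq0 s1; rewrite /zeta0 mulf_eq0 negb_or => /andP[].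
case: s s1 => x t /= <-; have [->|t0] := eqVneq t 0; last exact: Efun_neq0_line.
have -> : 1 +i* 0 = 1 :> C by [].
by rewrite Efun1 oner_neq0.
Qed.

End MoebiusSeries.

(** * Consequences of the Riemann hypothesis *)

Section InverseZetaGrowth.
Variable R : realType.
Local Open Scope complex_scope.
Local Notation C := R[i].
Implicit Types (s w z : C).

Lemma powR_sum_le2 (a : R) N : 2 <= a -> \sum_(k < N) k.+1%:R `^ (- a) <= 2 :> R.
Proof.
move=> a2; case: N => [|N]; first by rewrite big_ord0.
rewrite big_ord_recl /= powR1; have a1 : 0 < a - 1 by lra.
have := @powR_sum_tail R (a - 1) 1 N a1 isT; rewrite powR1 big_add1 /= big_mkord => h.
have e : \sum_(i < N) i.+2%:R `^ (- (a - 1) - 1) = \sum_(i < N) (bump 0 i).+1%:R `^ (- a) :> R.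
  by apply: eq_bigr => i _; congr (_ `^ _); ring.
rewrite e in h; have : 1 / (a - 1) <= 1 by rewrite ler_pdivrMr; lra.
by lra.
Qed.

Lemma zeta0_le2 s : 2 <= complex.Re s -> nc (zeta0 s) <= 2.
Proof.
move=> s2; have s1 : 1 < complex.Re s by lra.
apply: (cto_norm_le _ (zeta_series s1)); exists 0%N => N _.
apply: (le_trans (nc_sum _ _ _)); apply: le_trans (powR_sum_le2 N s2).
by apply: ler_sum => k _; rewrite nc_dm.
Qed.

Lemma zeta0V_le2 s : 2 <= complex.Re s -> nc (zeta0 s)^-1 <= 2.
Proof.
move=> s2; have s1 : 1 < complex.Re s by lra.
apply: (cto_norm_le _ (Dseries_lim s1)); exists 0%N => N _.
apply: (le_trans (nc_sum _ _ _)); apply: le_trans (powR_sum_le2 N s2).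
by apply: ler_sum => k _; rewrite ncM nc_dm// ler_piMl ?powR_ge0 ?nc_muC.
Qed.

Lemma zeta0_poly s : 1 / 2 <= complex.Re s -> 1 <= nc (s - 1) ->
  nc (zeta0 s) <= 300 * nc (s - 1) ^+ 2.
Proof.
move=> s2 s1; have s0 : 0 < complex.Re s by lra.
have x0 : 0 < nc (s - 1) by lra.
rewrite /zeta0 nc_div ler_pdivrMr//; apply: (le_trans (Efun_bound s0)).
have v0 := vbound_ge0 s.
have : (complex.Re s)^-1 <= 2 by rewrite invf_ple ?posrE//; lra.
rewrite /vbound in v0 *; set x := nc _ in s1 x0 v0 *; set y := _^-1 => hy.
have x2 : x <= x ^+ 2 by rewrite expr2; nra.
have x3 : x ^+ 2 <= x ^+ 2 * x by rewrite expr2; nra.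
apply: (@le_trans _ _ (1 + 40 * (x ^+ 2 + x) * 3)); first by rewrite lerD2l ler_wpM2l//; lra.
by lra.
Qed.

(** The first K coefficients are estimated by B and the others by the geometric decay with constant
    A. In the application only A depends on the height t, and q^K makes its weight small. *)
Lemma psum_norm_split c (rho q A B : R) K w l : 0 < rho -> 0 <= q < 1 -> 0 <= A -> 0 <= B ->
  (forall k, nc (c k) <= B) -> (forall k, nc (c k) * rho ^+ k <= A) -> nc w <= q * rho ->
  cto (psum c w) l -> nc l <= B * \sum_(k < K) rho ^+ k + A * q ^+ K / (1 - q).
Proof.
move=> p0 /andP[q0 q1] A0 B0 cB cA wq; apply: cto_norm_le; exists K => n Kn.
rewrite -(subnKC Kn) /psum big_split_ord /=; apply: (le_trans (ncD _ _)); apply: lerD.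
  apply: (le_trans (nc_sum _ _ _)); rewrite mulr_sumr; apply: ler_sum => k _.
  rewrite ncM ncX; apply: ler_pM; rewrite ?exprn_ge0 ?nc_ge0//.
  rewrite lerXn2r ?nnegrE ?nc_ge0 ?(ltW p0)//; apply: (le_trans wq).
  by rewrite ler_piMl ?(ltW p0) ?(ltW q1).
apply: (le_trans (nc_sum _ _ _)).
apply: (@le_trans _ _ (\sum_(i < n - K) A * q ^+ K * q ^+ i)).
  apply: ler_sum => i _; rewrite ncM ncX -mulrA -exprD.
  apply: (@le_trans _ _ (nc (c (K + i)%N) * (q * rho) ^+ (K + i))).
    rewrite ler_wpM2l ?nc_ge0// lerXn2r ?nnegrE ?nc_ge0// mulr_ge0 ?(ltW p0)//.
  by rewrite exprMn mulrCA mulrC ler_wpM2r ?exprn_ge0.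
rewrite -mulr_sumr ler_wpM2l//; first by rewrite mulr_ge0 ?exprn_ge0.
rewrite -[leRHS]mul1r ler_pdivlMr; last by lra.
by rewrite mulrC geom_sum; have := exprn_ge0 (n - K) q0; lra.
Qed.

(** The quotient has no singularity at the pole s = 1 of zeta, unlike the inverse of [zeta0]. *)
Definition invzeta s : C := (s - 1) / Efun s.

Hypothesis RH : forall s, 1 / 2 < complex.Re s -> complex.Re s < 1 -> Efun s != 0.

Lemma Efun_neq0_half s : 1 / 2 < complex.Re s -> Efun s != 0.
Proof. by move=> h; have [/RH|/Efun_neq0//] := ltP (complex.Re s) 1; apply. Qed.

Lemma cdiff_invzeta s : 1 / 2 < complex.Re s -> exists l, cdiff invzeta s l.
Proof.
move=> h; have [l hl] := @cdiff_Efun R s ltac:(lra).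
have := cdiffM (cdiffB (cdiff_id s) (cdiff_cst 1 s)) (cdiffV (Efun_neq0_half h) hl).
by move=> H; eexists; exact: H.
Qed.

Lemma invzetaE s : invzeta s = (zeta0 s)^-1.
Proof. by rewrite /invzeta /zeta0 invf_div. Qed.

(* Borel-Caratheodory on the disc of radius [rho] bounds the Taylor coefficients of log zeta
   at 3 + it by a multiple of log t, while those on the unit disc are bounded: splitting the
   Taylor series far enough makes the factor of log t arbitrarily small. *)
Lemma invzeta_growth_high (d eps : R) : 0 < d -> d <= 1 / 8 -> 0 < eps ->
  exists2 K, 0 <= K & forall x t : R, 1 / 2 + 3 * d <= x -> x <= 3 -> 4 <= `|t| ->
    nc (invzeta (x +i* t)) <= K * (1 + `|t|) `^ eps.
Proof.
move=> d0 d8 e0.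
(* Nested radii about 3 + it: the disc of radius [r] stays in Re s > 1/2, where zeta has a logarithm
   on radius [s1]; Borel-Caratheodory is applied at [rho], and the points to be estimated lie within
   [rho']. *)
pose r := 5 / 2 - d; pose rho := 5 / 2 - 2 * d; pose rho' := 5 / 2 - 3 * d.
have r0 : 0 < r by rewrite /r; lra.
pose s1 := 5 / 2 - 3 / 2 * d.
have s10 : 0 < s1 by rewrite /s1; lra.
have s11 : 1 < s1 by rewrite /s1; lra.
have s1r : s1 < r by rewrite /s1 /r; lra.
have p0 : 0 < rho by rewrite /rho; lra.
have ps : rho < s1 by rewrite /rho /s1; lra.
pose q := rho' / rho.
have q01 : 0 <= q < 1.
  by rewrite /q divr_ge0 ?(ltW p0) ?ltr_pdivrMr //= /rho' /rho; lra.
have [q0 q1] := andP q01.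
(* With this K0 the tail 4 A q^K0 / (1 - q) is at most eps A / 2, and A = ln C0 + 2 ln T, so that
   log zeta costs only eps ln T. *)
have [K0 hK0] := @geom_small R q (eps * (1 - q)) 8 q01 ltac:(rewrite mulr_gt0//; lra) ltac:(by []).
have {}hK0 := hK0 K0 (leqnn _).
(* 300 comes from [zeta0_poly], 25 from |a + w - 1| <= 5 T, and 2 from the bound on 1/zeta(a). *)
have [C0 C0E] : exists x : R, x = 300 * 25 * 2 by eexists.
have C01 : 1 <= C0 by rewrite C0E; clear; lra.
pose S := \sum_(k < K0) rho ^+ k.
pose KK := 2 * expR (8 * ln 4 * S + eps * ln C0).
exists KK => [|x t hx hx3 t4]; first by rewrite mulr_ge0// expR_ge0.
pose a : C := 3 +i* t.
have Rew w : nc w <= r -> 1 / 2 < complex.Re (a + w) /\ 1 <= nc (a + w - 1).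
  move=> wr; have h1 := le_trans (nc_Re _) wr; have h2 := le_trans (nc_Im _) wr.
  split; first by move: h1; rewrite ReD ler_norml /= /r; lra.
  apply: le_trans (nc_Im _); rewrite ImB ImD /= subr0.
  have h3 := ler_normB (t + complex.Im w) (complex.Im w); rewrite addrK in h3.
  by move: h2; rewrite /r; lra.
have fd z : nc (z - a) <= r -> exists l, cdiff (@zeta0 R) z l.
  move=> hz; have [h1 h2] := Rew _ hz; rewrite subrKC in h1 h2.
  apply: cdiff_zeta0; first by lra.
  by apply/eqP => z1; move: h2; rewrite z1 subrr nc0; lra.
have fn0 z : nc (z - a) <= r -> zeta0 z != 0.
  move=> hz; have [h1 h2] := Rew _ hz; rewrite subrKC in h1 h2.
  rewrite /zeta0 mulf_neq0 ?Efun_neq0_half// invr_eq0 -nc_gt0; lra.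
have [c [L [c0 [M cM] cL fL]]] := log_disc s10 s1r fd fn0.
have a2 : 2 <= complex.Re a by rewrite /=; lra.
have aV := zeta0V_le2 a2.
have za0 : 0 < nc (zeta0 a) by rewrite nc_gt0 fn0// subrr nc0 ltW.
have ReL w : nc w < s1 -> complex.Re (L w) = ln (nc (zeta0 (a + w)) / nc (zeta0 a)).
  by move=> ws; rewrite fL// ncM nc_cexp mulrAC mulfV ?mul1r ?expRK// gt_eqF.
have zw0 w : nc w < s1 -> 0 < nc (zeta0 (a + w)).
  by move=> ws; rewrite nc_gt0 fn0// addDKl (ltW (lt_trans ws s1r)).
have ln4 : 0 <= ln (4 : R) by rewrite ln_ge0// ler1n.
have B1 k : nc (c k) <= 4 * ln 4.
  have := @borel_caratheodory R c L s1 M 1 (ln 4) ltr01 s11 ln4 c0 cM cL.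
  move=> H; have := H _ k; rewrite expr1n mulr1; apply=> w w1.
  have ws : nc w < s1 by rewrite w1.
  rewrite (ReL _ ws) ler_ln ?posrE; [|exact: divr_gt0 (zw0 _ ws) za0|exact: ltr0n].
  have h2 : nc (zeta0 (a + w)) <= 2.
    by apply: zeta0_le2; have := nc_Re w; rewrite w1 ReD ler_norml /=; clear; lra.
  have : nc (zeta0 (a + w)) * nc (zeta0 a)^-1 <= 2 * 2.
    by apply: ler_pM; rewrite ?nc_ge0.
  by rewrite ncV; move: (nc _) (nc _) => u v; clear; lra.
pose T := 1 + `|t|; have T1 : 1 <= T by rewrite /T lerDl.
have CT : 1 <= C0 * T ^+ 2.
  by rewrite -[leLHS]mulr1; apply: ler_pM => //; rewrite exprn_ege1.
have [A AE] : exists x : R, x = ln (C0 * T ^+ 2) by eexists.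
have A0 : 0 <= A by rewrite AE ln_ge0.
have B2 k : nc (c k) * rho ^+ k <= 4 * A.
  apply: (@borel_caratheodory R c L s1 M rho A p0 ps A0 c0 cM cL) => w wr.
  have ws : nc w < s1 by rewrite wr.
  rewrite (ReL _ ws) AE ler_ln ?posrE; [|exact: divr_gt0 (zw0 _ ws) za0|exact: lt_le_trans ltr01 CT].
  have [h1 h2] := Rew w ltac:(by rewrite wr; exact: ltW (lt_trans ps s1r)).
  have h3 := zeta0_poly (ltW h1) h2.
  have h4 : nc (a + w - 1) <= 5 * T.
    have h5 := ncD (2 +i* t) w; have h6 := nc_le_ReIm (2 +i* t : C).
    have -> : a + w - 1 = (2 +i* t) + w.
      by rewrite addrAC /a; congr (_ + _); simpc; congr (_ +i* _); ring.
    by move: h5 h6; rewrite wr /= ger0_norm// /T /rho; move: d0 t4; clear; lra.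
  have h5 : nc (a + w - 1) ^+ 2 <= 25 * T ^+ 2.
    by rewrite (_ : 25 * T ^+ 2 = (5 * T) ^+ 2) ?lerXn2r ?nnegrE ?nc_ge0 ?mulr_ge0 ?(le_trans ler01 T1)//; ring.
  have : nc (zeta0 (a + w)) * nc (zeta0 a)^-1 <= 300 * 25 * T ^+ 2 * 2.
    by apply: ler_pM; rewrite ?nc_ge0//; apply: (le_trans h3); move: h5; clear; lra.
  by rewrite ncV C0E; move: (nc _) => z; clear; lra.
pose w : C := (x - 3)%:C.
have aw : x +i* t = a + w by rewrite /a /w; simpc; congr (_ +i* _); ring.
have wq : nc w <= q * rho.
  rewrite /q divfK ?gt_eqF// /w nc_real ler_norml /rho'; move: hx hx3 d0 d8; clear; lra.
have ws : nc w < s1.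
  by apply: (le_lt_trans wq); rewrite /q divfK ?gt_eqF// /rho' /s1; move: d0; clear; lra.
have B40 : 0 <= 4 * ln (4 : R) by rewrite mulr_ge0.
have A40 : 0 <= 4 * A by rewrite mulr_ge0.
have hL := @psum_norm_split c rho q (4 * A) (4 * ln 4) K0 w (L w) p0 q01 A40 B40 B1 B2 wq (cL _ ws).
have hA : 4 * A * q ^+ K0 / (1 - q) <= eps * A / 2.
  have q1' : 0 < 1 - q by rewrite subr_gt0.
  rewrite ler_pdivrMr//.
  by have := ler_wpM2l A0 hK0; clear; lra.
have hA2 : A = ln C0 + 2 * ln T.
  have T0 := lt_le_trans ltr01 T1.
  by rewrite AE lnM ?posrE ?exprn_gt0 ?(lt_le_trans ltr01 C01)// lnXn// [in RHS]mulr_natl.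
have lC0 : 0 <= ln C0 by rewrite ln_ge0.
have lT : 0 <= ln T by rewrite ln_ge0.
have SS : 0 <= S by apply: sumr_ge0 => i _; rewrite exprn_ge0// ltW.
have reL : - complex.Re (L w) <= 8 * ln 4 * S + eps * ln C0 + eps * ln T.
  have := le_trans (nc_Re _) hL; rewrite ler_norml => /andP[h _].
  have h1 : 0 <= ln 4 * S by rewrite mulr_ge0.
  have h2 : 0 <= eps * ln C0 by rewrite mulr_ge0 ?(ltW e0).
  by move: h hA; rewrite hA2 -/S; move: h1 h2; clear; lra.
rewrite aw invzetaE fL// invfM ncM -cexpN nc_cexp ReN.
rewrite powRE; last exact: lt_le_trans ltr01 T1.
rewrite /KK -[2 * _ * _]mulrA -expRD; apply: ler_pM; rewrite ?nc_ge0 ?expR_ge0//.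
by rewrite ler_expR.
Qed.

(** Three regions: Re s > 3, where 1/zeta is at most 2; height at least 4, treated above; and a
    compact rectangle, where continuity is enough. *)
Lemma invzeta_growth (th eps : R) : 1 / 2 < th -> 0 < eps ->
  exists2 K, 0 <= K & forall s, th <= complex.Re s -> nc (invzeta s) <= K * (1 + nc s) `^ eps.
Proof.
move=> th2 e0; pose d := Num.min (1 / 8) ((th - 1 / 2) / 3).
have d0 : 0 < d by rewrite lt_min; apply/andP; split; lra.
have d8 : d <= 1 / 8 by rewrite ge_min lexx.
have dth : 1 / 2 + 3 * d <= th.
  have : d <= (th - 1 / 2) / 3 by rewrite ge_min lexx orbT.
  by lra.
have [K1 K10 hK1] := invzeta_growth_high d0 d8 e0.
pose D s := [/\ th <= complex.Re s, complex.Re s <= 3, - 4 <= complex.Im s & complex.Im s <= 4].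
have [K2 hK2] : exists M, forall w, D w -> nc (invzeta w) <= M.
  apply: (@compact_bounded R _ D 7).
  - move=> w [h1 h2 h3 h4]; apply: (le_trans (nc_le_ReIm _)).
    have : `|complex.Re w| <= 3 by rewrite ler_norml; lra.
    have : `|complex.Im w| <= 4 by rewrite ler_norml; lra.
    by lra.
  - move=> w nD; apply: contrapT => nex; apply: nD.
    (* The rectangle is closed, one condition at a time: a 1-Lipschitz function that is nonnegative
       on [D] cannot be negative at a point all of whose neighbourhoods meet [D]. *)
    have key (P : C -> R) : (forall u v, P u - P v <= nc (u - v)) ->
        (forall v, D v -> 0 <= P v) -> 0 <= P w.
      move=> PL PD; rewrite leNgt; apply/negP => Pw; apply: nex.
      exists (- P w / 2) => [|w' hw' /PD h]; first by lra.
      by have := PL w' w; lra.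
    split.
    + rewrite -subr_ge0; apply: (key (fun w => complex.Re w - th)) => [u v|v []]; last by lra.
      by have := nc_Re (u - v); rewrite ReB ler_norml; lra.
    + rewrite -subr_ge0; apply: (key (fun w => 3 - complex.Re w)) => [u v|v []]; last by lra.
      by have := nc_Re (u - v); rewrite ReB ler_norml; lra.
    + rewrite -subr_ge0; apply: (key (fun w => complex.Im w - (- 4))) => [u v|v []]; last by lra.
      by have := nc_Im (u - v); rewrite ImB ler_norml; lra.
    + rewrite -subr_ge0; apply: (key (fun w => 4 - complex.Im w)) => [u v|v []]; last by lra.
      by have := nc_Im (u - v); rewrite ImB ler_norml; lra.
  move=> w [h1 _ _ _]; have [l] := @cdiff_invzeta w ltac:(lra); exact: cdiff_cont.
have p1 s : 1 <= (1 + nc s) `^ eps.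
  apply: (@le_trans _ _ (1 `^ eps)); first by rewrite powR1.
  apply: ge0_ler_powR; rewrite ?nnegrE ?(ltW e0)//.
    by rewrite addr_ge0 ?nc_ge0.
  by rewrite lerDl nc_ge0.
exists (2 + K1 + `|K2|) => [|s hs]; first by rewrite !addr_ge0.
have k2 : K2 <= `|K2| by exact: ler_norm.
have k20 : 0 <= `|K2| by [].
have ps := p1 s.
have [s3|s3] := ltP 3 (complex.Re s).
  have := @zeta0V_le2 s ltac:(lra); rewrite -invzetaE => h.
  by move: h ps K10 k20; clear; nra.
have [t4|t4] := leP 4 `|complex.Im s|.
  have := hK1 (complex.Re s) (complex.Im s) ltac:(lra) s3 t4.
  have -> : complex.Re s +i* complex.Im s = s by case: (s).
  move=> h; apply: (le_trans h).
  have : (1 + `|complex.Im s|) `^ eps <= (1 + nc s) `^ eps.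
    apply: ge0_ler_powR; rewrite ?nnegrE ?(ltW e0) ?addr_ge0 ?nc_ge0//.
    by rewrite lerD2l nc_Im.
  have := powR_ge0 (1 + `|complex.Im s|) eps.
  by move: ps K10 k20; clear; nra.
have Ds : D s by move: t4; rewrite ltr_norml => /andP[? ?]; split; lra.
have := hK2 s Ds; move: ps K10 k20 k2; clear; nra.
Qed.

End InverseZetaGrowth.

(** * The exponential series and tails of the Poisson law *)

Section PoissonTails.
Variable R : realType.
Local Open Scope complex_scope.
Local Notation C := R[i].

(** The exponential equals its derivative, so its Taylor coefficients satisfy (k + 1) c_(k+1) = c_k
    by uniqueness. *)
Lemma cexp_series (z : C) : cto (fun n => \sum_(i < n) z ^+ i / (i`!)%:R) (cexp z).
Proof.
have nz := nc_ge0 z.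
pose r := nc z + 1; have r0 : 0 < r by rewrite /r; lra.
have [c [_ [M cM] cf]] : exists c, [/\ forall k, cto (fun n => circle_avg (@cexp R) 0 r (2 ^ n) k) (c k),
    exists M, forall k, nc (c k) * r ^+ k <= M &
    forall w, nc w < r -> cto (psum c w) (cexp (0 + w))].
  by apply: holo_power_series => // w _; exists (cexp w); exact: cdiff_cexp.
have [g [g1 g2]] := power_series_cdiff r0 cM cf.
have r20 : 0 < r / 2 by lra.
have r2r : r / 2 < r by lra.
have [M' _ hM'] := dcoef_bound r20 r2r cM.
have dc : dcoef c =1 c.
  apply: (psum_unique r0); [by exists (r / 2) => //; exists M'|by exists r => //; exists M|].
  move=> w wr; exists (cexp w); last by have := cf w wr; rewrite add0r.
  have := g1 w wr; rewrite add0r (cdiff_uniq (g2 w _) (cdiff_cexp w))//.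
  by rewrite subr0.
have c0 : c 0%N = 1.
  have := cf 0; rewrite nc0 addr0 cexp0 => /(_ r0) h.
  exact: cto_uniq (psum0 c) h.
have cE k : c k = (k`!)%:R^-1.
  elim: k => [|k ih]; first by rewrite c0 fact0 invr1.
  have := dc k; rewrite /dcoef ih factS natrM => h.
  have k0 : k.+1%:R != 0 :> C by rewrite pnatr_eq0.
  by rewrite invfM -h mulrA mulVf// mul1r.
have := cf z; rewrite add0r => /(_ ltac:(rewrite /r; lra)); apply: cto_ext => n.
by apply: eq_bigr => i _; rewrite cE mulrC.
Qed.

Definition pterm (y : R) i : R := y ^+ i / (i`!)%:R.
Definition psumR (y : R) n : R := \sum_(i < n) pterm y i.

Lemma pterm_ge0 y i : 0 <= y -> 0 <= pterm y i.
Proof. by move=> y0; rewrite divr_ge0 ?exprn_ge0. Qed.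

Lemma psumR_lim y e : 0 < e -> exists n0, forall n, (n0 <= n)%N -> `|psumR y n - expR y| <= e.
Proof.
move=> e0; have [n0 hn] := cexp_series y%:C e0; exists n0 => n /hn.
rewrite cexp_real (_ : \sum_(i < n) _ = (psumR y n)%:C) -?rmorphB /= ?nc_real//.
rewrite /psumR rmorph_sum; apply: eq_bigr => i _.
by rewrite /pterm rmorphM fmorphV rmorphXn /= rmorph_nat.
Qed.

Lemma psumR_mono y m n : 0 <= y -> (m <= n)%N -> psumR y m <= psumR y n.
Proof.
move=> y0 mn; rewrite -(subnKC mn) /psumR big_split_ord /= lerDl.
by apply: sumr_ge0 => i _; exact: pterm_ge0.
Qed.

Lemma psumR_le y n : 0 <= y -> psumR y n <= expR y.
Proof.
move=> y0; apply/ler_addgt0Pl => e e0; have [n0 hn] := @psumR_lim y e e0.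
have := hn _ (leq_maxr n n0); have := psumR_mono y0 (leq_maxl n n0).
by rewrite ler_norml; lra.
Qed.

Definition pvar (y : R) n : R := \sum_(i < n) (i%:R - y) ^+ 2 * pterm y i.

(** An exact formula for the truncated variance of the Poisson law. Its last term is nonpositive
    once n >= y, which gives [pvar_le] and then Chebyshev's inequality in both directions. *)
Lemma pvarE y n : pvar y n = y * psumR y n + n%:R * (y - n%:R) * pterm y n.
Proof.
elim: n => [|n ih]; first by rewrite /pvar /psumR !big_ord0 mulr0 !mul0r addr0.
rewrite /pvar /psumR !big_ord_recr /= -/(pvar y n) -/(psumR y n) ih.
have -> : pterm y n.+1 = y * pterm y n / n.+1%:R.
  by rewrite /pterm exprS factS natrM invfM; ring.
rewrite -natr1; field; rewrite natr1 pnatr_eq0//.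
Qed.

Lemma pvar_le y n : 0 <= y -> pvar y n <= y * expR y.
Proof.
move=> y0; pose m := maxn n (Num.truncn y).+1.
have ym : y <= m%:R.
  by apply/ltW/(lt_le_trans (truncnS_gt y)); rewrite ler_nat leq_maxr.
apply: (@le_trans _ _ (pvar y m)).
  have nm : (n <= m)%N by rewrite leq_maxl.
  rewrite -(subnKC nm) /pvar big_split_ord /= lerDl.
  by apply: sumr_ge0 => i _; rewrite mulr_ge0 ?sqr_ge0// pterm_ge0.
rewrite pvarE; have := ler_wpM2l y0 (@psumR_le y m y0).
have my : 0 <= m%:R - y by rewrite subr_ge0.
have : 0 <= m%:R * (m%:R - y) * pterm y m.
  by apply: mulr_ge0 (pterm_ge0 _ y0); apply: mulr_ge0.
by lra.
Qed.

(* [pois k y] is the probability that a Poisson variable of mean y is at most k. *)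
Definition pois k (y : R) : R := expR (- y) * psumR y k.+1.

Lemma pois_ge0 k y : 0 <= y -> 0 <= pois k y.
Proof.
by move=> y0; rewrite mulr_ge0 ?expR_ge0//; apply: sumr_ge0 => i _; exact: pterm_ge0.
Qed.

Lemma pois_le1 k y : 0 <= y -> pois k y <= 1.
Proof.
move=> y0; rewrite /pois mulrC expRN ler_pdivrMr ?expR_gt0// mul1r.
exact: psumR_le.
Qed.

Lemma pois_upper k y : k%:R < y -> pois k y <= y / (y - k%:R) ^+ 2.
Proof.
move=> ky; have y0 : 0 <= y by apply: le_trans (ltW ky).
have d0 : 0 < (y - k%:R) ^+ 2 by rewrite exprn_gt0// subr_gt0.
rewrite /pois mulrC expRN ler_pdivrMr ?expR_gt0// mulrAC ler_pdivlMr//.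
apply: le_trans (@pvar_le y k.+1 y0); rewrite mulrC /psumR mulr_sumr.
apply: ler_sum => i _; rewrite ler_wpM2r ?pterm_ge0//.
rewrite -[leRHS]sqrrN opprB lerXn2r ?nnegrE ?subr_ge0 ?(ltW ky)//.
  by apply: le_trans (ltW ky); rewrite ler_nat -ltnS.
by rewrite lerB// ler_nat -ltnS.
Qed.

Lemma pois_lower k y : 0 <= y -> y < k%:R -> 1 - pois k y <= y / (k%:R - y) ^+ 2.
Proof.
move=> y0 yk; have d0 : 0 < (k%:R - y) ^+ 2 by rewrite exprn_gt0// subr_gt0.
have e0 := expR_gt0 y.
have E : 1 - pois k y = (expR y - psumR y k.+1) / expR y.
  by rewrite /pois expRN; field; rewrite gt_eqF.
rewrite E ler_pdivrMr// mulrAC ler_pdivlMr//.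
have key n : (k < n)%N -> (psumR y n - psumR y k.+1) * (k%:R - y) ^+ 2 <= y * expR y.
  move=> kn; apply: le_trans (@pvar_le y n y0).
  rewrite -(subnKC kn) /psumR /pvar !big_split_ord /= [X in X - _]addrC addrK mulr_suml.
  rewrite -[leLHS]add0r; apply: lerD.
    by apply: sumr_ge0 => i _; rewrite mulr_ge0 ?sqr_ge0 ?pterm_ge0.
  apply: ler_sum => i _; rewrite mulrC ler_wpM2r ?pterm_ge0//.
  rewrite lerXn2r ?nnegrE ?subr_ge0 ?(ltW yk)//.
    by apply: (le_trans (ltW yk)); rewrite ler_nat addSn ltnW// ltnS leq_addr.
  by rewrite lerB// ler_nat addSn ltnW// ltnS leq_addr.
apply/ler_addgt0Pl => e ep.
have e1 : 0 < e / (k%:R - y) ^+ 2 by rewrite divr_gt0.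
have [n0 hn] := @psumR_lim y _ e1.
have := key _ (leq_maxl k.+1 n0); have := hn _ (leq_maxr k.+1 n0).
rewrite ler_norml ler_pdivlMr// => /andP[h1 _].
set P := psumR y (maxn _ _) in h1 *; set d := (k%:R - y) ^+ 2 in h1 d0 *.
have : - (e / d) <= P - expR y by rewrite lerBrDl; move: (hn _ (leq_maxr k.+1 n0)); rewrite -/P ler_norml lerBrDl => /andP[].
move=> h2; have : (expR y - P) * d <= e.
  by rewrite -ler_pdivlMr//; lra.
by lra.
Qed.

(** For i <= k one has y^i <= 2^k (y / 2)^i, and the exponential series at y / 2 remains. *)
Lemma pois_chernoff k y : 0 <= y -> pois k y <= 2 ^+ k * expR (- (y / 2)).
Proof.
move=> y0; have y20 : 0 <= y / 2 by lra.
rewrite /pois (_ : - y = - (y / 2) + - (y / 2)); last by lra.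
rewrite expRD mulrC mulrA ler_wpM2r ?expR_ge0//.
rewrite expRN ler_pdivrMr ?expR_gt0//.
apply: (@le_trans _ _ (2 ^+ k * psumR (y / 2) k.+1)).
  rewrite /psumR mulr_sumr; apply: ler_sum => i _; rewrite /pterm.
  rewrite mulrA ler_wpM2r ?invr_ge0// expr_div_n mulrCA ler_peMr ?exprn_ge0//.
  by rewrite ler_pdivlMr ?exprn_gt0// mul1r ler_eXn2l ?ltr1n// -ltnS.
by rewrite ler_wpM2l ?exprn_ge0// psumR_le.
Qed.

End PoissonTails.

(** * The coefficients of n^(-s) / s at a large real point *)

Section PostWidder.
Variable R : realType.
Local Open Scope complex_scope.
Local Notation C := R[i].
Local Notation dm := (@dirichlet_monomial R).
Variable sg : R.
Hypothesis sg0 : 0 < sg.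

(** The k-th Taylor coefficient of n^(-s) / s at s = sg. For large sg the Poisson factor is close to
    1 if sg ln n < k and close to 0 if sg ln n > k, so these coefficients cut a Dirichlet series
    sharply at n = exp(k / sg). *)
Definition pwcoef n k : C := (-1) ^+ k * (sg ^- k.+1 * pois k (sg * ln n%:R))%:C.

(** After multiplication by sg + w the coefficients telescope, as consecutive Poisson probabilities
    differ by one term, to those of the exponential series of -w ln n. *)
Lemma pwcoef_series n (w : C) : (0 < n)%N -> nc w < sg ->
  cto (psum (pwcoef n) w) (dm (sg%:C + w) n / (sg%:C + w)).
Proof.
move=> n0 wsg; set L := ln n%:R : R; have L0 : 0 <= L by rewrite ln_ge0// ler1n.
pose y := sg * L; have y0 : 0 <= y by rewrite mulr_ge0// ltW.
have sw : sg%:C + w != 0.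
  rewrite -nc_gt0; have := ncB (sg%:C + w) w; rewrite addrK nc_real gtr0_norm//.
  by lra.
have sgn : sg%:C != 0 :> C by rewrite -nc_gt0 nc_real gtr0_norm.
have rec j : sg%:C * pwcoef n j.+1 + pwcoef n j = (expR (- y))%:C * ((- L%:C) ^+ j.+1 / (j.+1)`!%:R).
  have hr : sg * (sg ^- j.+2 * pois j.+1 y) - sg ^- j.+1 * pois j y = expR (- y) * (L ^+ j.+1 / (j.+1)`!%:R).
    rewrite /pois [psumR y j.+2]big_ord_recr /= -/(psumR y j.+1) /pterm [y ^+ j.+1]exprMn.
    by rewrite [sg ^+ j.+2]exprS; field; rewrite pnatr_eq0 -lt0n fact_gt0 expf_neq0 ?gt_eqF.
  transitivity ((-1) ^+ j.+1 * (expR (- y) * (L ^+ j.+1 / (j.+1)`!%:R))%:C).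
    by rewrite -hr /pwcoef -/L -/y rmorphB rmorphM /= exprS; ring.
  rewrite [(- L%:C) ^+ _]exprNn rmorphM /= rmorphM /= fmorphV rmorphXn /= rmorph_nat.
  by ring.
have E0 : sg%:C * pwcoef n 0 = (expR (- y))%:C.
  rewrite /pwcoef /pois /psumR big_ord1 /pterm -/L -/y !expr0 fact0 expr1 divr1 mulr1 mul1r.
  by rewrite -rmorphM /= mulVKf// gt_eqF.
have E J : (sg%:C + w) * psum (pwcoef n) w J.+1 =
   (expR (- y))%:C * \sum_(i < J.+1) (- w * L%:C) ^+ i / (i`!)%:R + pwcoef n J * w ^+ J.+1.
  elim: J => [|J ih].
    rewrite /psum !big_ord1 !expr0 fact0 divr1 !mulr1 expr1 mulrDl E0; ring.
  rewrite /psum big_ord_recr mulrDr -/(psum (pwcoef n) w J.+1) ih.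
  rewrite [in RHS]big_ord_recr /=; set A := \sum_(i < J.+1) _.
  have := rec J; rewrite (_ : - w * L%:C = w * - L%:C); last by ring.
  rewrite exprMn; set T := _ / _ => hT.
  rewrite (_ : w ^+ J.+1 * (- L%:C) ^+ J.+1 / (J.+1)`!%:R = w ^+ J.+1 * T); last by rewrite mulrA.
  rewrite [RHS](_ : _ = (expR (- y))%:C * A + w ^+ J.+1 * ((expR (- y))%:C * T) + pwcoef n J.+1 * w ^+ J.+2); last by ring.
  by rewrite -hT [w ^+ J.+2]exprS; ring.
have hz : cto (fun J => pwcoef n J * w ^+ J.+1) 0.
  have t01 : 0 <= nc w / sg < 1 by rewrite divr_ge0 ?nc_ge0 ?(ltW sg0)//= ltr_pdivrMr// mul1r.
  move=> e e0; have [k0 hk0] := geom_small t01 e0 ler01.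
  exists k0 => k kk; rewrite subr0 ncM ncX /pwcoef ncM ncX ncN nc1 expr1n mul1r nc_real.
  rewrite ger0_norm; last by rewrite mulr_ge0 ?pois_ge0// invr_ge0 exprn_ge0// ltW.
  have := hk0 k.+1 (leqW kk); rewrite mul1r expr_div_n; apply: le_trans.
  rewrite mulrC ler_wpM2l ?exprn_ge0 ?nc_ge0//.
  by rewrite ler_piMr ?pois_le1// invr_ge0 exprn_ge0// ltW.
apply: cto_shift.
have h := ctoZ (sg%:C + w)^-1 (ctoD (ctoZ (expR (- y))%:C (cto_sub (g := S) (fun k => leqnSn k)
   (cexp_series (- w * L%:C)))) hz).
rewrite addr0 in h.
have -> : dm (sg%:C + w) n / (sg%:C + w) = (sg%:C + w)^-1 * ((expR (- y))%:C * cexp (- w * L%:C)).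
  rewrite mulrC; congr (_ * _); rewrite -cexp_real -cexpD /dirichlet_monomial; congr cexp.
  by rewrite /y rmorphN rmorphM /= -/L; ring.
by apply: cto_ext h => J /=; rewrite -E mulKf.
Qed.

End PostWidder.

(** * The mean of 1 / |w| over a circle passing close to 0 *)

Section CircleMean.
Variable R : realType.
Local Open Scope complex_scope.
Local Notation C := R[i].

Lemma sin_ge_lin (x : R) : 0 <= x <= pi / 2 -> x / 8 <= sin x.
Proof.
move=> /andP[x0 x1]; have [h|h] := leP x (1 / 2).
  have h1 : `|x| <= 1 by rewrite ger0_norm//; lra.
  by have := sin_sub h1; rewrite ler_norml expr2; nra.
have h1 : `|1 / 2 : R| <= 1 by rewrite ger0_norm; lra.
have := sin_sub h1; rewrite ler_norml => /andP[h2 _].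
have h3 : sin (1 / 2) <= sin x.
  have pi2 := pi_ge2 R.
  rewrite leNgt; apply/negP; rewrite ltr_sin ?in_itv /=; [lra| |].
  - by apply/andP; split; lra.
  - by apply/andP; split; lra.
by have := pihalf_lt2 R; lra.
Qed.

(** The point lies on the circle about sg at angle psi from its leftmost point th. Its squared
    modulus is th^2 + 4 sg (sg - th) sin^2(psi / 2), and the sine is at least linear. *)
Lemma circle_lower (sg th psi : R) : 0 < th -> 2 * th <= sg -> 0 <= psi <= pi ->
  (th + sg * psi / 16) / 2 <= nc (sg%:C - (sg - th)%:C * eit psi).
Proof.
move=> th0 ths /andP[p0 p1].
have hs := @sin_ge_lin (psi / 2) ltac:(lra).
have s0 : 0 <= sg * psi by rewrite mulr_ge0//; lra.
rewrite -(ler_pXn2r (_ : (0 < 2)%N)) ?nnegrE ?nc_ge0//; last by lra.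
have E : nc (sg%:C - (sg - th)%:C * eit psi) ^+ 2 = th ^+ 2 + 4 * sg * (sg - th) * sin (psi / 2) ^+ 2.
  rewrite nc_sqr ReB ImB ReMl ImMl /= -[in cos psi](_ : psi / 2 + psi / 2 = psi); last by lra.
  rewrite -[in sin psi](_ : psi / 2 + psi / 2 = psi); last by lra.
  rewrite cosD sinD; have := cos2Dsin2 (psi / 2); set c := cos _; set s := sin _ => h.
  have hc : c ^+ 2 = 1 - s ^+ 2 by lra.
  transitivity (sg ^+ 2 - 2 * sg * (sg - th) * (c ^+ 2 - s ^+ 2) + (sg - th) ^+ 2 * (c ^+ 2 + s ^+ 2) ^+ 2); first by ring.
  rewrite hc; ring.
rewrite E.
have h1 : (psi / 16) ^+ 2 <= sin (psi / 2) ^+ 2.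
  by rewrite lerXn2r ?nnegrE//; lra.
have h2 : 2 * sg * sg * (psi / 16) ^+ 2 <= 4 * sg * (sg - th) * sin (psi / 2) ^+ 2.
  apply: ler_pM; rewrite ?sqr_ge0//; nra.
apply: (@le_trans _ _ (th ^+ 2 + 2 * sg * sg * (psi / 16) ^+ 2)); last by rewrite lerD2l.
set q := sg * psi / 16; have -> : 2 * sg * sg * (psi / 16) ^+ 2 = 2 * q ^+ 2 by rewrite /q; ring.
have := sqr_ge0 (th - q); rewrite !expr2; nra.
Qed.

Lemma circle_lowerN (sg th psi : R) : 0 < th -> 2 * th <= sg -> 0 <= psi <= pi ->
  (th + sg * psi / 16) / 2 <= nc (sg%:C - (sg - th)%:C * eit (- psi)).
Proof.
move=> h1 h2 h3; apply: le_trans (circle_lower h1 h2 h3) _.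
rewrite -nc_conj le_eqVlt; apply/orP; left; apply/eqP; congr nc.
by rewrite /eit cosN sinN /conjc; simpc.
Qed.

Lemma harmonic_log (th H : R) n : 0 < th -> 0 < H ->
  \sum_(i < n) H / (th + i.+1%:R * H) <= ln ((th + n%:R * H) / th).
Proof.
move=> th0 H0; elim: n => [|n ih]; first by rewrite big_ord0 mul0r addr0 divff ?ln1// gt_eqF.
rewrite big_ord_recr /=; set a := th + n%:R * H in ih *; set b := th + n.+1%:R * H.
have a0 : 0 < a by rewrite ltr_pwDl// mulr_ge0// ltW.
have bE : b = a + H by rewrite /b /a -natr1; ring.
have b0 : 0 < b by rewrite bE addr_gt0.
have -> : b / th = (a / th) * (b / a) by field; rewrite !gt_eqF.
rewrite lnM ?posrE ?divr_gt0//; apply: lerD => //.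
have := @ln_sub1_le R (a / b) ltac:(by rewrite divr_gt0).
rewrite -[a / b]invf_div lnV ?posrE ?divr_gt0// invf_div => h.
have : a / b - 1 = - (H / b) by rewrite bE; field; rewrite -bE gt_eqF.
by lra.
Qed.

(** Both half circles are run through from the point nearest to 0; by [circle_lower] the inverse
    moduli form a harmonic sum, of logarithmic size. The gain 1 / sg offsets the extra power of sg
    in the Taylor coefficients; the mesh is fine enough for the nearest node to be harmless. *)
Lemma mean_inv_circle (sg th : R) m : 1 / 2 <= th -> 2 * th <= sg -> (0 < m)%N -> sg <= 2 ^+ m ->
  (2 ^ m)%:R^-1 * \sum_(j < 2 ^ m) (nc (node sg%:C (sg - th) (2 ^ m) j))^-1 <=
  (8 + 16 * ln (1 + 2 * sg)) / sg.
Proof.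
move=> th2 ths m0 sm; have th0 : 0 < th by lra.
have sg0 : 0 < sg by lra.
case: m m0 sm => // m _ sm; set h := (2 ^ m)%N; have -> : (2 ^ m.+1 = h + h)%N by rewrite expnS mul2n addnn.
have h0 : (0 < h)%N by rewrite expn_gt0.
have hR : 0 < h%:R :> R by rewrite ltr0n.
have [N NN] : exists N, (h + h)%N = N by exists (h + h)%N.
rewrite NN; have NE : N%:R = 2 * h%:R :> R by rewrite -NN natrD; ring.
have N0 : 0 < N%:R :> R by rewrite NE mulr_gt0.
have sN : sg <= N%:R by rewrite NE /h natrX -exprS.
have pi2 := pi_ge2 R.
have [H HE] : exists H, H = sg * pi / (8 * N%:R) by eexists.
have H0 : 0 < H by rewrite HE !divr_gt0 ?mulr_gt0// pi_gt0.
pose g i : R := 2 / (th + i%:R * H).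
have low i (psi : R) : (i <= h)%N -> psi = i%:R * (2 * pi / N%:R) ->
    (nc (sg%:C - (sg - th)%:C * eit psi))^-1 <= g i /\ (nc (sg%:C - (sg - th)%:C * eit (- psi)))^-1 <= g i.
  move=> ih psiE.
  have psi01 : 0 <= psi <= pi.
    rewrite psiE mulr_ge0 ?divr_ge0 ?mulr_ge0 ?(ltW N0) ?pi_ge0//=.
    rewrite mulrA ler_pdivrMr// NE; have : i%:R <= h%:R :> R by rewrite ler_nat.
    by have := pi_ge0 R; nra.
  have e : sg * psi / 16 = i%:R * H by rewrite psiE HE; field; rewrite gt_eqF.
  have d0 : 0 < th + i%:R * H by rewrite ltr_pwDl// mulr_ge0// ltW.
  have gE : g i = ((th + i%:R * H) / 2)^-1 by rewrite /g invf_div.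
  have c1 := circle_lower th0 ths psi01; have c2 := circle_lowerN th0 ths psi01.
  rewrite e in c1 c2; rewrite gE; split; rewrite lef_pV2 ?posrE ?divr_gt0//.
    by apply: lt_le_trans c1; rewrite divr_gt0.
  by apply: lt_le_trans c2; rewrite divr_gt0.
have epi : eit pi = -1 :> C by rewrite /eit cospi sinpi; simpc.
have n1 (j : 'I_h) : node sg%:C (sg - th) N j = sg%:C - (sg - th)%:C * eit (- ((h - j)%:R * (2 * pi / N%:R))).
  rewrite /node -mulrN; congr (_ + _ * _).
  have -> : j%:R * (2 * pi / N%:R) = pi + - ((h - j)%:R * (2 * pi / N%:R)) :> R.
    have hj : (j <= h)%N by exact: ltnW.
    by rewrite (natrB _ hj) NE; field; rewrite gt_eqF.
  by rewrite eitD epi mulN1r.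
have n2 (j : 'I_h) : node sg%:C (sg - th) N (h + j)%N = sg%:C - (sg - th)%:C * eit (j%:R * (2 * pi / N%:R)).
  rewrite /node -mulrN; congr (_ + _ * _).
  have -> : (h + j)%:R * (2 * pi / N%:R) = pi + j%:R * (2 * pi / N%:R) :> R.
    by rewrite natrD NE; field; rewrite gt_eqF.
  by rewrite eitD epi mulN1r.
have gp i : 0 <= g i by rewrite divr_ge0// addr_ge0 ?(ltW th0)// mulr_ge0// ltW.
pose S := \sum_(i < h) g i.+1.
have S1 : \sum_(j < h) (nc (node sg%:C (sg - th) N j))^-1 <= S.
  rewrite /S [leRHS](reindex_inj rev_ord_inj) /=; apply: ler_sum => j _.
  rewrite subnSK// n1; exact: (low (h - j)%N _ (leq_subr _ _) erefl).2.
have S2 : \sum_(j < h) (nc (node sg%:C (sg - th) N (h + j)))^-1 <= g 0%N + S.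
  apply: (@le_trans _ _ (\sum_(j < h.+1) g j)); last by rewrite big_ord_recl.
  rewrite big_ord_recr /=; apply: ler_wpDr => //; apply: ler_sum => j _.
  by rewrite n2; exact: (low j _ (ltnW (ltn_ord j)) erefl).1.
have SE : S <= 2 / H * ln (1 + 2 * sg).
  have := @harmonic_log th H h th0 H0.
  have -> : S = 2 / H * \sum_(i < h) H / (th + i.+1%:R * H).
    rewrite mulr_sumr; apply: eq_bigr => i _; rewrite /g; field.
    rewrite !gt_eqF// ltr_pwDl// mulr_ge0// ltW//.
  move=> hl; rewrite ler_wpM2l ?divr_ge0 ?(ltW H0)//; apply: (le_trans hl).
  have hH : h%:R * H <= sg.
    rewrite HE NE (_ : h%:R * _ = sg * pi / 16); last by field; rewrite gt_eqF.
    have := pihalf_lt2 R; nra.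
  have nn : 0 <= h%:R * H by rewrite mulr_ge0 ?(ltW hR) ?(ltW H0).
  rewrite ler_ln ?posrE; [|by rewrite divr_gt0//; lra|lra].
  by rewrite ler_pdivrMr//; nra.
rewrite -(big_mkord xpredT (fun j => (nc (node sg%:C (sg - th) N j))^-1)) -[X in index_iota _ X]NN big_mkord big_split_ord /=.
apply: (@le_trans _ _ (N%:R^-1 * (g 0%N + 2 * S))).
  rewrite ler_wpM2l ?invr_ge0 ?(ltW N0)//; move: S1 S2; clear; lra.
have L0 : 0 <= ln (1 + 2 * sg) by rewrite ln_ge0//; lra.
have g0 : g 0%N <= 4.
  by rewrite /g mul0r addr0 ler_pdivrMr//; lra.
rewrite ler_pdivlMr//.
apply: (@le_trans _ _ (N%:R^-1 * (4 + 4 / H * ln (1 + 2 * sg)) * sg)).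
  rewrite ler_wpM2r ?(ltW sg0)// ler_wpM2l ?invr_ge0 ?(ltW N0)//.
  move: g0 SE; set a := 2 / H * _; have -> : 4 / H * ln (1 + 2 * sg) = 2 * a by rewrite /a; ring.
  by lra.
rewrite mulrDr mulrDl; apply: lerD.
  by rewrite -mulrA ler_pdivrMl//; lra.
have -> : N%:R^-1 * (4 / H * ln (1 + 2 * sg)) * sg = 32 / pi * ln (1 + 2 * sg).
  have [q qE] : exists q, q = pi :> R by exists pi.
  by rewrite HE -qE; field; rewrite !gt_eqF// qE pi_gt0.
by rewrite ler_wpM2r// ler_pdivrMr ?pi_gt0//; lra.
Qed.

End CircleMean.

(** * The Poisson weights approximate the indicator of n <= N *)

Section PoissonWindow.
Variable R : realType.

Lemma sum_indicator (X m : nat) (c : R) : 0 <= c ->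
  \sum_(i < X) (i.+1 <= m)%:R * c <= m%:R * c.
Proof.
move=> c0; elim: X => [|X ih]; first by rewrite big_ord0 mulr_ge0.
rewrite big_ord_recr /=; case: ltnP => [Xm|mX]; last by rewrite mul0r addr0.
rewrite mul1r; apply: (@le_trans _ _ (X.+1%:R * c)); last by rewrite ler_wpM2r// ler_nat.
rewrite -natr1 mulrDl mul1r lerD2r.
apply: (@le_trans _ _ (\sum_(i < X) c)); last by rewrite sumr_const card_ord mulr_natl.
by apply: ler_sum => i _; case: leqP => _; rewrite ?mul1r ?mul0r.
Qed.

(** Since ln n and ln N differ by at least 1/N or 1/n, Chebyshev's inequality separates the integers
    near N as soon as sg >= N^12; beyond N^3 the exponential bound gives a convergent tail. *)
Lemma poisson_window (N k : nat) (sg : R) X : (2 <= N)%N -> k%:R = sg * ln N%:R -> N%:R ^+ 12 <= sg ->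
  \sum_(i < X) `|pois k (sg * ln i.+1%:R) - (i.+1 <= N)%N%:R| <= 5.
Proof.
move=> N2 kE sN.
have NR : 2 <= N%:R :> R by rewrite (ler_nat R 2 N).
have N0 : 0 < N%:R :> R by lra.
have sg0 : 0 < sg by apply: lt_le_trans sN; rewrite exprn_gt0.
have lnle n : (0 < n)%N -> ln n%:R <= n%:R :> R.
  by move=> n0; have := @ln_sub1_le R n%:R; rewrite ltr0n => /(_ n0); lra.
have ln_quot (a b : R) : 0 < a -> 0 < b -> 1 - a / b <= ln b - ln a.
  move=> a0 b0; have := @ln_sub1_le R (a / b) ltac:(by rewrite divr_gt0).
  by rewrite ln_div ?posrE//; lra.
(* The four terms serve n < N, n = N, N < n <= N^3 and n > N^3; their sums over n are at most 1, 1,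
   1 and 2. *)
pose b n : R := (n <= N)%:R * N%:R^-1 + (n == N)%:R
   + (n <= N ^ 3)%:R * N%:R ^- 3 + n%:R `^ (- 2).
have term n : (0 < n)%N -> `|pois k (sg * ln n%:R) - (n <= N)%N%:R| <= b n.
  move=> n00; have nR : 1 <= n%:R :> R by rewrite ler1n.
  have n0 : 0 < n%:R :> R by lra.
  have ln0 : 0 <= ln n%:R :> R by rewrite ln_ge0.
  set y := sg * ln n%:R; have y0 : 0 <= y by rewrite mulr_ge0// ltW.
  have p0 := pois_ge0 k y0; have p1 := pois_le1 k y0.
  have q1 : 0 <= N%:R^-1 :> R by rewrite invr_ge0 ltW.
  have q2 : 0 <= N%:R ^- 3 :> R by rewrite invr_ge0 exprn_ge0 ?ltW.
  have q3 := powR_ge0 n%:R (- 2 : R).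
  have t3 : 0 <= (n <= N ^ 3)%:R * N%:R ^- 3 :> R by rewrite mulr_ge0.
  rewrite /b; have [nN|nN|nN] := ltngtP n N.
  - rewrite /= ?mulr1n; rewrite ler0_norm; last by lra.
    suff : 1 - pois k y <= N%:R^-1 by move: t3 q3; rewrite /= ?mulr1n ?mulr0n ?mul1r ?mul0r; clear; lra.
    have nNR : n.+1%:R <= N%:R :> R by rewrite ler_nat.
    have gap : N%:R^-1 <= ln N%:R - ln n%:R :> R.
      apply: le_trans (ln_quot _ _ n0 N0); rewrite lerBrDr -[X in X + _]mul1r -mulrDl ler_pdivrMr// mul1r.
      by move: nNR; rewrite -natr1; clear; lra.
    have d0 : 0 < sg / N%:R by rewrite divr_gt0.
    have dd : sg / N%:R <= k%:R - y by rewrite kE /y -mulrBr ler_wpM2l// ltW.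
    have yk : y < k%:R by rewrite -subr_gt0 (lt_le_trans d0 dd).
    have kp : 0 < k%:R - y by rewrite subr_gt0.
    apply: (le_trans (pois_lower y0 yk)).
    have h : (sg / N%:R) ^+ 2 <= (k%:R - y) ^+ 2 by rewrite lerXn2r// nnegrE ltW.
    apply: (@le_trans _ _ (sg * N%:R / (sg / N%:R) ^+ 2)).
      apply: ler_pM; rewrite ?invr_ge0 ?sqr_ge0//.
        rewrite /y ler_wpM2l ?(ltW sg0)//; apply: (le_trans (lnle n n00)).
        by rewrite ler_nat ltnW.
      by rewrite lef_pV2 ?posrE ?exprn_gt0.
    rewrite (_ : _ / _ = N%:R ^+ 3 / sg); last by field; rewrite !gt_eqF.
    rewrite ler_pdivrMr// mulrC ler_pdivlMr// -exprSr; apply: le_trans sN.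
    by rewrite ler_eXn2l//; lra.
  - rewrite /= ?mulr0n subr0 ger0_norm//.
    have [n3|n3] := leqP n (N ^ 3).
      suff : pois k y <= N%:R ^- 3 by move: q3; rewrite /= ?mulr1n ?mulr0n ?mul0r ?mul1r; clear; lra.
      have nNR : N.+1%:R <= n%:R :> R by rewrite ler_nat.
      have gap : n%:R^-1 <= ln n%:R - ln N%:R :> R.
        apply: le_trans (ln_quot _ _ N0 n0); rewrite lerBrDr -[X in X + _]mul1r -mulrDl ler_pdivrMr// mul1r.
        by move: nNR; rewrite -natr1; clear; lra.
      have d0 : 0 < sg / n%:R by rewrite divr_gt0.
      have dd : sg / n%:R <= y - k%:R by rewrite kE /y -mulrBr ler_wpM2l// ltW.
      have yk : k%:R < y by rewrite -subr_gt0 (lt_le_trans d0 dd).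
      have kp : 0 < y - k%:R by rewrite subr_gt0.
      apply: (le_trans (pois_upper yk)).
      have h : (sg / n%:R) ^+ 2 <= (y - k%:R) ^+ 2 by rewrite lerXn2r// nnegrE ltW.
      apply: (@le_trans _ _ (sg * n%:R / (sg / n%:R) ^+ 2)).
        apply: ler_pM; rewrite ?invr_ge0 ?sqr_ge0//.
          by rewrite /y ler_wpM2l ?(ltW sg0)//; exact: lnle.
        by rewrite lef_pV2 ?posrE ?exprn_gt0.
      rewrite (_ : _ / _ = n%:R ^+ 3 / sg); last by field; rewrite !gt_eqF.
      rewrite ler_pdivrMr// mulrC ler_pdivlMr ?exprn_gt0//; apply: le_trans sN.
      have h3 : n%:R <= N%:R ^+ 3 :> R by rewrite -natrX ler_nat.
      have h4 : n%:R ^+ 3 <= N%:R ^+ 9 :> R.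
        by rewrite (_ : N%:R ^+ 9 = (N%:R ^+ 3) ^+ 3) ?lerXn2r ?nnegrE// -?exprM// exprn_ge0// ltW.
      rewrite (_ : N%:R ^+ 12 = N%:R ^+ 9 * N%:R ^+ 3); last by rewrite -exprD.
      by rewrite ler_wpM2r// exprn_ge0// ltW.
    suff : pois k y <= n%:R `^ (- 2) by move: t3; rewrite /= ?mulr0n ?mul0r; clear; lra.
    apply: (le_trans (pois_chernoff k y0)).
    have h2k : 2 ^+ k <= expR (k%:R) :> R.
      rewrite -[k%:R]mulr1 expRM_natl lerXn2r ?nnegrE ?expR_ge0//.
      by have := expR_ge1Dx (1 : R); lra.
    have l3 : ln N%:R <= ln n%:R / 3 :> R.
      have : ln (N%:R ^+ 3) <= ln n%:R :> R.
        by rewrite ler_ln ?posrE ?exprn_gt0// -natrX ler_nat ltnW.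
      by rewrite lnXn// -[_ *+ 3]mulr_natl; lra.
    apply: (@le_trans _ _ (expR k%:R * expR (- (y / 2)))).
      by rewrite ler_wpM2r ?expR_ge0.
    rewrite -expRD powRE// ler_expR kE /y.
    have s12 : 12 <= sg.
      apply: le_trans sN; apply: (@le_trans _ _ (2 ^+ 12)); last by rewrite lerXn2r ?nnegrE//; lra.
      by rewrite -natrX ler_nat.
    have := ler_wpM2l (ltW sg0) l3; nra.
  rewrite /= ?mulr1n.
  have : `|pois k y - 1| <= 1 by rewrite ler_norml; lra.
  by move: t3 q1 q3; rewrite -nN ?mul1r; clear; lra.
apply: (@le_trans _ _ (\sum_(i < X) b i.+1)); first by apply: ler_sum => i _; exact: term.
rewrite /b !big_split /=.
have s1 := @sum_indicator X N N%:R^-1 ltac:(by rewrite invr_ge0 ltW).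
have s3 := @sum_indicator X (N ^ 3) (N%:R ^- 3) ltac:(by rewrite invr_ge0 exprn_ge0 ?ltW).
have s4 := @powR_sum_le2 R 2 X (lexx _).
have s2 : \sum_(i < X) (i.+1 == N)%:R <= 1 :> R.
  elim: (X) => [|Y ih]; first by rewrite big_ord0.
  rewrite big_ord_recr /=; case: eqP => [YN|_]; last by rewrite addr0.
  rewrite big1 ?add0r// => i _; case: eqP => // iN.
  by have := ltn_ord i; rewrite -ltnS iN YN ltnn.
move: s1 s3; rewrite natrX !mulfV ?gt_eqF ?exprn_gt0// => s1 s3.
by move: s1 s2 s3 s4; clear; lra.
Qed.

End PoissonWindow.

(** * The bound for the sums of the Moebius function *)

Section MertensBound.
Variable R : realType.
Local Open Scope complex_scope.
Local Notation C := R[i].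
Local Notation dm := (@dirichlet_monomial R).
Hypothesis RH : forall s : C, 1 / 2 < complex.Re s -> complex.Re s < 1 -> Efun s != 0.

Lemma powR_tail_small_ge (a : R) : 1 < a -> forall e : R, 0 < e ->
  exists m0, forall m n, (m0 <= m)%N -> \sum_(k < n) (m + k).+1%:R `^ (- a) <= e.
Proof.
move=> a1 e e0; have [m0 hm] := powR_tail_small a1 e0; exists m0 => m n mm.
apply: le_trans (hm (m - m0 + n)%N); rewrite big_split_ord /=.
rewrite [leLHS](_ : _ = \sum_(k < n) (m0 + (m - m0 + k)).+1%:R `^ (- a)); last first.
  by apply: eq_bigr => k _; rewrite addnA subnKC.
by rewrite lerDr; apply: sumr_ge0 => k _; exact: powR_ge0.
Qed.

Lemma Dseries_uniform (e : R) : 0 < e -> exists X0, forall X s, (X0 <= X)%N ->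
  2 <= complex.Re s -> nc (invzeta s - Dseries s X) <= e.
Proof.
move=> e0; have [X0 hX] := @powR_tail_small_ge 2 ltac:(lra) e e0; exists X0 => X s XX s2.
have s1 : 1 < complex.Re s by lra.
rewrite invzetaE; apply: (@cto_norm_le _ (fun n => Dseries s n - Dseries s X)); last first.
  exact: ctoB (Dseries_lim s1) (cto_cst _).
exists X => n Xn; rewrite -(subnKC Xn) /Dseries big_split_ord /= [X in X - _]addrC addrK.
apply: (le_trans (nc_sum _ _ _)); apply: le_trans (hX X (n - X)%N XX).
apply: ler_sum => k _; rewrite ncM nc_dm//; apply: (@le_trans _ _ (1 * (X + k).+1%:R `^ (- complex.Re s))).
  by rewrite ler_wpM2r ?powR_ge0 ?nc_muC.
by rewrite mul1r ler_powR ?ler1n// lerN2.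
Qed.

Lemma nc_pwcoef (sg : R) n k : 0 < sg -> nc (pwcoef sg n.+1 k) * sg ^+ k <= sg^-1.
Proof.
move=> sg0; have l0 : 0 <= sg * ln n.+1%:R by rewrite mulr_ge0 ?(ltW sg0)// ln_ge0// ler1n.
rewrite /pwcoef ncM ncX ncN nc1 expr1n mul1r nc_real ger0_norm; last first.
  by rewrite mulr_ge0 ?pois_ge0// invr_ge0 exprn_ge0// ltW.
have -> : sg ^- k.+1 * pois k (sg * ln n.+1%:R) * sg ^+ k = sg^-1 * pois k (sg * ln n.+1%:R).
  by rewrite exprSr; field; rewrite gt_eqF// expf_neq0// gt_eqF.
by rewrite ler_piMr ?invr_ge0 ?(ltW sg0)// pois_le1.
Qed.

(** One Taylor coefficient of 1 / (s zeta(s)) at sg, computed twice: on a circle of radius r that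
    comes close to the line Re s = 1/2, and on the unit circle about sg, where Re s >= 2 and the
    Moebius series converges uniformly. *)
Lemma invzeta_coef (sg r : R) k : 3 <= sg -> 1 < r -> r < sg - 1 / 2 ->
  exists c, cto (fun n => circle_avg (fun s => invzeta s / s) sg%:C r (2 ^ n) k) c /\
    cto (fun X => \sum_(i < X) muC R i.+1 * pwcoef sg i.+1 k) c.
Proof.
move=> s3 r1 rs; have r0 : 0 < r by lra.
have sg0 : 0 < sg by lra.
have one0 : 0 < 1 :> R by [].
have Rebound (w : C) (t : R) : nc (w - sg%:C) <= t -> sg - t <= complex.Re w.
  move=> h; have := nc_Re (w - sg%:C); rewrite ReB /= ler_norml => /andP[h1 _].
  by move: h h1; clear; lra.
have neq0 (w : C) : 0 < complex.Re w -> w != 0 by move=> w0; apply/eqP => e; rewrite e /= ltxx in w0.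
have dG (w : C) : 1 / 2 < complex.Re w -> exists l, cdiff (fun s => invzeta s / s) w l.
  move=> hw; have [l hl] := cdiff_invzeta RH hw.
  have w0 : w != 0 by apply: neq0; lra.
  by eexists; exact: cdiffM hl (cdiffV w0 (cdiff_id w)).
have dD X (w : C) : 0 < complex.Re w -> exists l, cdiff (fun s => Dseries s X / s) w l.
  move=> hw; have [l hl] : exists l, cdiff (fun s => Dseries s X) w l.
    by apply: cdiff_sum => i; eexists; exact: cdiffM (cdiff_cst _ w) (cdiff_dm _ _).
  by eexists; exact: cdiffM hl (cdiffV (neq0 _ hw) (cdiff_id w)).
have [c [ca [M cM] cf]] := @holo_power_series _ (fun s => invzeta s / s) sg%:C r r0
  (fun w hw => dG w ltac:(have := Rebound _ _ hw; lra)).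
have [c1 [ca1 [M1 cM1] cf1]] := @holo_power_series _ (fun s => invzeta s / s) sg%:C 1 one0
  (fun w hw => dG w ltac:(have := Rebound _ _ hw; lra)).
have cc1 : c =1 c1.
  apply: (psum_unique one0); [by exists r => //; exists M|by exists 1 => //; exists M1|].
  move=> w w1; exists (invzeta (sg%:C + w) / (sg%:C + w)); last exact: cf1.
  by apply: cf; lra.
exists (c k); split => // e e0; have [X0 hX] := Dseries_uniform e0; exists X0 => X XX.
have [cX [caX [MX cMX] cfX]] := @holo_power_series _ (fun s => Dseries s X / s) sg%:C 1 one0
  (fun w hw => dD X w ltac:(have := Rebound _ _ hw; lra)).
have cXE : cX =1 (fun k => \sum_(i < X) muC R i.+1 * pwcoef sg i.+1 k).
  apply: (psum_unique one0); first by exists 1 => //; exists MX.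
    exists sg => //; exists (X%:R * sg^-1) => j.
    apply: (@le_trans _ _ (\sum_(i < X) sg^-1)); last by rewrite sumr_const card_ord mulr_natl.
    apply: le_trans (ler_wpM2r _ (nc_sum _ _ _)) _; first by rewrite exprn_ge0// ltW.
    rewrite mulr_suml; apply: ler_sum => i _; apply: le_trans (nc_pwcoef i j sg0).
    rewrite ler_wpM2r ?exprn_ge0 ?(ltW sg0)// ncM -[leRHS]mul1r ler_wpM2r ?nc_ge0//.
    exact: nc_muC.
  move=> w w1; exists (Dseries (sg%:C + w) X / (sg%:C + w)); first exact: cfX.
  have ws : nc w < sg by lra.
  have := @cto_sum R 'I_X (index_enum _) (fun i n => muC R i.+1 * psum (pwcoef sg i.+1) w n)
    (fun i => muC R i.+1 * (dm (sg%:C + w) i.+1 / (sg%:C + w)))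
    (fun i => ctoZ _ (pwcoef_series sg0 (isT : (0 < i.+1)%N) ws)).
  rewrite /Dseries mulr_suml; under eq_bigr => i _ do rewrite mulrA.
  apply: cto_ext => n; rewrite /psum; under eq_bigr => i _ do rewrite mulr_sumr.
  by rewrite exchange_big /=; apply: eq_bigr => j _; rewrite mulr_suml; apply: eq_bigr => i _; rewrite mulrA.
rewrite -cXE cc1 nc_sym -[e]divr1 -[X in _ / X](expr1n _ k).
apply: circle_avg_close one0 _ (ca1 k) (caX k) => w w1.
have w2 : 2 <= complex.Re w by have := @Rebound w 1; rewrite w1 lexx => /(_ isT); lra.
have nw : 1 <= nc w.
  by have := nc_Re w; have := ler_norm (complex.Re w); lra.
rewrite -mulrBl ncM ncV -[e]mulr1; apply: ler_pM; rewrite ?invr_ge0 ?nc_ge0//.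
  exact: hX.
by rewrite invf_le1//; lra.
Qed.

(** The series side of [invzeta_coef], rescaled by sg^(k+1), is the Moebius sum up to N within 5, by
    [poisson_window]. The other side is estimated on the circle of radius sg - th, by the growth of
    1/zeta and the mean of 1 / |s|. *)
Lemma mertens_coef (th eps : R) : 1 / 2 < th -> th <= 1 -> 0 < eps -> exists2 K : R, 0 <= K &
  forall N k (sg : R), (2 <= N)%N -> k%:R = sg * ln N%:R -> N%:R ^+ 12 <= sg ->
  nc (\sum_(i < N) muC R i.+1) <=
  5 + K * (sg / (sg - th)) ^+ k * (1 + 2 * sg) `^ eps * (8 + 16 * ln (1 + 2 * sg)).
Proof.
move=> th1 thle eps0; have [K K0 hK] := invzeta_growth RH th1 eps0; exists K => // N k sg N2 kE Nsg.
have NR : 2 <= N%:R :> R by rewrite (ler_nat R 2 N).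
have s12 : 12 <= sg.
  apply: le_trans Nsg; apply: (@le_trans _ _ (2 ^+ 12)); last by rewrite lerXn2r ?nnegrE//; lra.
  by rewrite -natrX ler_nat.
have [r rE] : exists r, r = sg - th by eexists.
have r1 : 1 < r by lra.
have r0 : 0 < r by lra.
have rs : r < sg - 1 / 2 by lra.
have sg0 : 0 < sg by lra.
have [c [c1 c2]] := @invzeta_coef sg r k ltac:(lra) r1 rs.
have sk0 : 0 < sg ^+ k.+1 by rewrite exprn_gt0.
have h1 : nc ((-1) ^+ k * (sg ^+ k.+1)%:C * c - \sum_(i < N) muC R i.+1) <= 5.
  apply: (@cto_norm_le _ (fun X => (-1) ^+ k * (sg ^+ k.+1)%:C * (\sum_(i < X) muC R i.+1 * pwcoef sg i.+1 k)
     - \sum_(i < N) muC R i.+1)); last by apply: ctoB; [exact: ctoZ|exact: cto_cst].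
  exists N => X NX; apply: le_trans (@poisson_window R N k sg X N2 kE Nsg).
  have -> : \sum_(i < N) muC R i.+1 = \sum_(i < X) muC R i.+1 * ((i < N)%N%:R)%:C.
    rewrite -(subnKC NX) big_split_ord /= [X in _ + X]big1 ?addr0 => [|i _].
      by apply: eq_bigr => i _; rewrite ltn_ord mulr1.
    by rewrite ltnNge leq_addr /= mulr0.
  rewrite mulr_sumr -sumrB; apply: (le_trans (nc_sum _ _ _)); apply: ler_sum => i _.
  have -> : (-1) ^+ k * (sg ^+ k.+1)%:C * (muC R i.+1 * pwcoef sg i.+1 k) - muC R i.+1 * ((i < N)%N%:R)%:C
     = muC R i.+1 * (pois k (sg * ln i.+1%:R) - (i < N)%N%:R)%:C.
    rewrite /pwcoef rmorphB /= mulrBr; congr (_ - _).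
    have e1 : (-1) ^+ k * (-1) ^+ k = 1 :> C by rewrite -exprD -signr_odd oddD addbb.
    have e2 : (sg ^+ k.+1)%:C * (sg ^- k.+1)%:C = 1.
      by rewrite -rmorphM /= mulfV// gt_eqF.
    rewrite rmorphM /=.
    transitivity (((-1) ^+ k * (-1) ^+ k) * ((sg ^+ k.+1)%:C * (sg ^- k.+1)%:C) * (muC R i.+1 * (pois k (sg * ln i.+1%:R))%:C)); first by ring.
    by rewrite e1 e2 !mul1r.
  by rewrite ncM nc_real -[leRHS]mul1r ler_wpM2r// nc_muC.
have A1 : 1 <= 1 + 2 * sg by lra.
have A0 : 0 < 1 + 2 * sg by lra.
have h2 : nc c <= K * (1 + 2 * sg) `^ eps * r ^- k * ((8 + 16 * ln (1 + 2 * sg)) / sg).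
  apply: cto_norm_le c1.
  have [m0 hm] : exists m0, sg <= 2 ^+ m0.
    by exists (Num.truncn sg).+1; apply: le_trans (ltW (truncnS_gt sg)) _; rewrite -natrX ler_nat ltnW// ltn_expl.
  exists m0.+1 => m mm.
  have sm : sg <= 2 ^+ m.
    by apply: (le_trans hm); rewrite ler_eXn2l ?ltr1n//; exact: ltnW.
  have := @mean_inv_circle R sg th m ltac:(lra) ltac:(lra) (leq_ltn_trans (leq0n _) mm) sm.
  rewrite -rE => hmean; have K1 : 0 <= K * (1 + 2 * sg) `^ eps * r ^- k.
    by rewrite !mulr_ge0 ?powR_ge0// invr_ge0 exprn_ge0// ltW.
  apply: le_trans (ler_wpM2l K1 hmean).
  rewrite /circle_avg ncM ncV nc_nat mulrCA ler_wpM2l ?invr_ge0 ?ler0n//.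
  apply: (le_trans (nc_sum _ _ _)); rewrite mulr_sumr; apply: ler_sum => j _.
  set w := node _ _ _ _; have wr : nc (w - sg%:C) = r by rewrite node_norm// ltW.
  rewrite ncM ncV ncX wr ncM ncV [leRHS]mulrAC ler_wpM2r ?invr_ge0 ?exprn_ge0 ?(ltW r0)//.
  rewrite ler_wpM2r ?invr_ge0 ?nc_ge0//.
  have wth : th <= complex.Re w.
    have := nc_Re (w - sg%:C); rewrite ReB /= wr ler_norml => /andP[q1 _].
    by move: q1 rE; clear; lra.
  apply: (le_trans (hK w wth)); apply: ler_wpM2l => //.
  have wA : 1 + nc w <= 1 + 2 * sg.
    rewrite lerD2l; have := ncD (w - sg%:C) sg%:C; rewrite subrK wr nc_real ger0_norm ?(ltW sg0)//.
    by move: rE th1; clear; lra.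
  have w0 : 0 <= 1 + nc w by rewrite addr_ge0 ?nc_ge0.
  by apply: ge0_ler_powR => //; rewrite ?nnegrE// ltW.
have h3 : nc (\sum_(i < N) muC R i.+1) <= 5 + sg ^+ k.+1 * nc c.
  have := ncB ((-1) ^+ k * (sg ^+ k.+1)%:C * c) ((-1) ^+ k * (sg ^+ k.+1)%:C * c - \sum_(i < N) muC R i.+1).
  rewrite opprB addrCA subrr addr0 2!ncM ncX ncN nc1 expr1n mul1r nc_real (ger0_norm (ltW sk0)).
  by move: h1; clear; lra.
apply: (le_trans h3); rewrite lerD2l; apply: (le_trans (ler_wpM2l (ltW sk0) h2)).
rewrite le_eqVlt; apply/orP; left; apply/eqP.
rewrite -rE expr_div_n exprS; field; rewrite expf_neq0 ?gt_eqF//.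
Qed.

(** With k = N^13 and sg = k / ln N, the quantity (sg / (sg - th))^k is about exp(th k / sg) =
    N^th. *)
Lemma mertens_bound (e : R) : 0 < e -> e <= 1 -> exists2 K : R, 0 <= K &
  forall N, `|\sum_(i < N) (moebius i.+1)%:~R| <= K * N%:R `^ (1 / 2 + e) :> R.
Proof.
(* The base 1 + 2 sg is at most N^16, and its power d occurs twice, once for the growth and once
   absorbing the logarithm: 32 d = e / 2. The other half of e is in [th]. *)
move=> e0 e1; have [d dE] : exists d, d = e / 64 by eexists.
have [th thE] : exists th, th = 1 / 2 + e / 2 by eexists.
have d0 : 0 < d by rewrite dE; lra.
have [K K0 hK] := @mertens_coef th d ltac:(lra) ltac:(lra) d0.
have [B BE] : exists B, B = 8 + 16 / d by eexists.
have B0 : 0 <= B by rewrite BE addr_ge0// divr_ge0// ltW.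
exists (6 + K * expR 1 * B); first by rewrite addr_ge0// !mulr_ge0 ?expR_ge0.
have KB : 0 <= K * expR 1 * B by rewrite !mulr_ge0 ?expR_ge0.
case=> [|[|N]].
- by rewrite big_ord0 normr0 mulr_ge0 ?powR_ge0// addr_ge0.
- rewrite big_ord_recl big_ord0 addr0 powR1 mulr1 -intr_norm.
  by apply: (@le_trans _ _ 1); [rewrite lerz1 moebius_norm|lra].
have [n [<- n2]] : exists n, n = N.+2 /\ (2 <= n)%N by exists N.+2.
have NR : 2 <= n%:R :> R by rewrite (ler_nat R 2 n).
have N0 : 0 < n%:R :> R by lra.
have l0 : 1 / 2 <= ln n%:R :> R.
  have := @ln_sub1_le R (n%:R^-1) ltac:(by rewrite invr_gt0); rewrite lnV ?posrE//.
  have : n%:R^-1 <= 2^-1 :> R by rewrite lef_pV2 ?posrE.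
  by lra.
have ln0 : 0 < ln n%:R :> R by lra.
have lN : ln n%:R <= n%:R :> R by have := @ln_sub1_le R n%:R N0; lra.
have [sg sE] : exists sg, sg = n%:R ^+ 13 / ln n%:R :> R by eexists.
have [k kn] : exists k, k = (n ^ 13)%N by eexists.
have kE : k%:R = sg * ln n%:R by rewrite kn sE natrX mulfVK// gt_eqF.
have s12 : n%:R ^+ 12 <= sg.
  by rewrite sE ler_pdivlMr// [leRHS]exprSr ler_wpM2l// exprn_ge0// ltW.
have s13 : sg <= 2 * n%:R ^+ 13.
  rewrite sE ler_pdivrMr// mulrAC; have : 0 < n%:R ^+ 13 :> R by rewrite exprn_gt0.
  by move: l0; clear; nra.
have sgl : 2 <= sg.
  apply: le_trans s12; apply: (@le_trans _ _ (2 ^+ 12)); last by rewrite lerXn2r ?nnegrE//; lra.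
  by rewrite -natrX ler_nat.
have sln : 2 * ln n%:R <= sg.
  apply: le_trans s12; apply: (@le_trans _ _ (n%:R * n%:R ^+ 11)); last by rewrite -exprS.
  have : 2 <= n%:R ^+ 11 :> R.
    by apply: (le_trans NR); rewrite -[leLHS]expr1 ler_eXn2l//; lra.
  by move: lN NR; clear; nra.
set A := 1 + 2 * sg.
have A1 : 1 <= A by rewrite /A; move: sgl; clear; lra.
have A0 : 0 < A by lra.
have A16 : A <= n%:R `^ 16%:R.
  rewrite powR_mulrn ?(ltW N0)//; apply: (@le_trans _ _ (n%:R ^+ 3 * n%:R ^+ 13)); last by rewrite -exprD.
  have p0 : 1 <= n%:R ^+ 13 :> R by rewrite exprn_ege1//; lra.
  have p3 : 2 ^+ 3 <= n%:R ^+ 3 :> R by rewrite lerXn2r ?nnegrE//; lra.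
  rewrite -natrX in p3; rewrite /A; move: s13 p0 p3; clear; nra.
have Ad : 8 + 16 * ln A <= B * A `^ d.
  have P1 : 1 <= A `^ d by rewrite -(powRr0 A) ler_powR// ltW.
  have : d * ln A <= A `^ d by rewrite -ln_powR; have := @ln_sub1_le R (A `^ d) ltac:(by rewrite powR_gt0); lra.
  rewrite mulrC -ler_pdivlMr// => h.
  have -> : B * A `^ d = 8 * A `^ d + 16 * (A `^ d / d) by rewrite BE; ring.
  by lra.
have Apow : A `^ d * A `^ d <= n%:R `^ (e / 2).
  rewrite -powRDp//; have -> : e / 2 = 16%:R * (d + d) by rewrite dE; field.
  by rewrite powRrM ge0_ler_powR ?nnegrE ?powR_ge0 ?(ltW A0)//; lra.
have tsg : th < sg by lra.
have quot : (sg / (sg - th)) ^+ k <= expR 1 * n%:R `^ th.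
  have q0 : 0 < sg - th by rewrite subr_gt0.
  have -> : sg / (sg - th) = 1 + th / (sg - th) by field; rewrite gt_eqF.
  apply: (@le_trans _ _ (expR (th / (sg - th)) ^+ k)).
    rewrite lerXn2r ?nnegrE ?expR_ge0 ?expR_ge1Dx// addr_ge0// divr_ge0 ?(ltW q0)//.
    by rewrite thE; lra.
  rewrite -expRM_natl powRE// -expRD ler_expR kE.
  have -> : sg * ln n%:R * (th / (sg - th)) = th * ln n%:R + th * th * ln n%:R / (sg - th) by field; rewrite gt_eqF.
  rewrite addrC lerD2r ler_pdivrMr// mul1r.
  have : th * th <= 1 by rewrite thE; nra.
  by move: sln ln0 sgl; nra.
have main := hK n _ sg n2 kE s12; rewrite -/A in main.
have nE : nc (\sum_(i < n) muC R i.+1) = `|\sum_(i < n) (moebius i.+1)%:~R|.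
  rewrite (_ : \sum_(i < n) _ = (\sum_(i < n) (moebius i.+1)%:~R)%:C) ?nc_real//.
  by rewrite rmorph_sum; apply: eq_bigr => i _; rewrite /muC rmorph_int.
rewrite -nE; apply: (le_trans main).
have pe : n%:R `^ (1 / 2 + e) = n%:R `^ th * n%:R `^ (e / 2) by rewrite -powRDp//; congr (_ `^ _); rewrite thE; field.
have p1 : 1 <= n%:R `^ (1 / 2 + e).
  rewrite -[X in X <= _](powRr0 n%:R) ler_powR ?ler1n ?(ltnW n2)//.
  by move: e0; clear; lra.
have key : K * (sg / (sg - th)) ^+ k * A `^ d * (8 + 16 * ln A) <= K * expR 1 * B * n%:R `^ (1 / 2 + e).
  apply: (@le_trans _ _ (K * (expR 1 * n%:R `^ th) * A `^ d * (B * A `^ d))).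
    have q0 : 0 <= sg / (sg - th) by apply: divr_ge0; [lra|rewrite subr_ge0 ltW].
    apply: ler_pM.
    - by rewrite !mulr_ge0 ?powR_ge0 ?exprn_ge0.
    - by rewrite addr_ge0// mulr_ge0// ln_ge0.
    - by rewrite ler_wpM2r ?powR_ge0// ler_wpM2l.
    - exact: Ad.
  rewrite pe [leLHS](_ : _ = K * expR 1 * B * (n%:R `^ th * (A `^ d * A `^ d))); last by ring.
  by rewrite ler_wpM2l// ler_wpM2l ?powR_ge0.
by move: key p1 KB; clear; nra.
Qed.

End MertensBound.

(** * The duality of the zeros under s -> 1 - s *)

Section PeriodicSeries.
Variable R : realType.
Local Open Scope complex_scope.
Local Notation C := R[i].
Local Notation dm := (@dirichlet_monomial R).
Implicit Types (s w z : C).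

(* The sequence 0, 1, -2, 1 of period 4: it is proportional to its own discrete Fourier transform. *)
Definition e4 (n : nat) : R := 1 - 3 * (2 %| n)%N%:R + 2 * (4 %| n)%N%:R.

Definition e4sum s N : C := \sum_(k < N) (e4 k.+1)%:C * dm s k.+1.

Definition e4factor s : C := 1 - 3 * dm s 2 + 2 * dm s 4.

Lemma e4_block k : [/\ e4 (4 * k + 1) = 1, e4 (4 * k + 2) = - 2, e4 (4 * k + 3) = 1 & e4 (4 * k + 4) = 0].
Proof.
have d2 : (2 %| 4 * k)%N by rewrite dvdn_mulr.
have d4 : (4 %| 4 * k)%N by rewrite dvdn_mulr.
rewrite /e4 !(dvdn_addr _ d2) !(dvdn_addr _ d4) /=.
by split; rewrite ?mulr1n ?mulr0n; lra.
Qed.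

Lemma e4_bound n : `|e4 n| <= 2.
Proof.
rewrite /e4; have : ((4 %| n)%N ==> (2 %| n)%N) by apply/implyP; apply: dvdn_trans.
by case: (2 %| n)%N; case: (4 %| n)%N => //= _; rewrite ?mulr1n ?mulr0n ler_norml; lra.
Qed.

Lemma sum_dvdn (V : comNzRingType) d N (F : nat -> V) : (0 < d)%N ->
  \sum_(k < d * N) (d %| k.+1)%N%:R * F k.+1 = \sum_(j < N) F (d * j.+1)%N.
Proof.
case: d => // d _; elim: N => [|N ih]; first by rewrite muln0 !big_ord0.
have -> : (d.+1 * N.+1 = d.+1 * N + d.+1)%N by rewrite mulnS addnC.
rewrite big_split_ord /= ih big_ord_recr [RHS]big_ord_recr /=; congr (_ + _).
rewrite big1 ?add0r => [|i _].
  have -> : (d.+1 * N + d).+1 = (d.+1 * N.+1)%N by rewrite mulnS -addnS addnC.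
  by rewrite dvdn_mulr// mul1r.
rewrite -addnS dvdn_addr ?dvdn_mulr// gtnNdvd ?mul0r//.
by rewrite ltnS.
Qed.

(** First-order Euler-Maclaurin summation: zeta is approximated by its partial sum with the main
    term N^(1-s) / (1 - s) removed. *)
Lemma dm_partial_sum s N : 0 < complex.Re s -> (0 < N)%N ->
  nc ((s - 1) * (\sum_(k < N) dm s k.+1) - (Efun s - dm (s - 1) N)) <=
  (vbound s / complex.Re s + vbound s + nc (s - 1)) * N%:R `^ (- complex.Re s).
Proof.
move=> s0 N0; have tail := Efun_tail s0 N0; have vb := @vterm_bound R N s N0 (ltW s0).
have -> : (s - 1) * (\sum_(k < N) dm s k.+1) - (Efun s - dm (s - 1) N) =
  - (Efun s - Epart s N) - vterm N s + (s - 1) * dm s N.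
  by rewrite EpartE /vterm; ring.
have p0 := powR_ge0 N%:R (- complex.Re s).
have v0 := vbound_ge0 s.
have n1 := ncD (- (Efun s - Epart s N) - vterm N s) ((s - 1) * dm s N).
have n2 := ncB (- (Efun s - Epart s N)) (vterm N s); rewrite ncN in n2.
have n3 : nc ((s - 1) * dm s N) = nc (s - 1) * N%:R `^ (- complex.Re s) by rewrite ncM nc_dm.
have n4 : nc (vterm N s) <= vbound s * N%:R `^ (- complex.Re s).
  apply: (le_trans vb); rewrite ler_wpM2l// ler_powR ?ler1n//; lra.
have n5 : vbound s * (N%:R `^ (- complex.Re s) / complex.Re s) = vbound s / complex.Re s * N%:R `^ (- complex.Re s) by ring.
rewrite n5 in tail; rewrite [leRHS]mulrDl [X in _ <= X + _]mulrDl; apply: (le_trans n1); rewrite n3 lerD2r.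
by apply: (le_trans n2); exact: lerD.
Qed.

Lemma e4sum_blocks s N : e4sum s (4 * N) = \sum_(k < 4 * N) dm s k.+1
  - 3 * dm s 2 * \sum_(k < 2 * N) dm s k.+1 + 2 * dm s 4 * \sum_(k < N) dm s k.+1.
Proof.
have h2 : dm s 2 * \sum_(k < 2 * N) dm s k.+1 = \sum_(k < 4 * N) (2 %| k.+1)%N%:R * dm s k.+1.
  have -> : (4 * N = 2 * (2 * N))%N by rewrite mulnA.
  by rewrite (@sum_dvdn _ 2 (2 * N) (dm s))// mulr_sumr; apply: eq_bigr => i _; rewrite dmM.
have h4 : dm s 4 * \sum_(k < N) dm s k.+1 = \sum_(k < 4 * N) (4 %| k.+1)%N%:R * dm s k.+1.
  by rewrite (@sum_dvdn _ 4 N (dm s))// mulr_sumr; apply: eq_bigr => i _; rewrite dmM.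
rewrite -(mulrA 3) -(mulrA 2) h2 h4 !mulr_sumr -sumrB -big_split /=; apply: eq_bigr => k _.
by rewrite /e4 rmorphD rmorphB !rmorphM /= !rmorph_nat; ring.
Qed.

Lemma e4factorE s : e4factor s = (1 - dm s 2) * (1 - 2 * dm s 2).
Proof. by rewrite /e4factor (_ : 4 = 2 * 2)%N// dmM//; ring. Qed.

Lemma dm2_neq1 s : complex.Re s != 0 -> dm s 2 != 1.
Proof.
move=> s0; apply/eqP => h; have : nc (dm s 2) = 1 by rewrite h nc1.
rewrite nc_dm// powRE// => h1.
have /expR_inj /eqP : expR (- complex.Re s * ln 2%:R) = expR 0 by rewrite expR0.
rewrite mulf_eq0 oppr_eq0 (negbTE s0) /=.
by rewrite gt_eqF//; apply: ln_gt0; rewrite (ltr_nat R 1 2).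
Qed.

Lemma e4factor_neq0 s : complex.Re s != 0 -> complex.Re s != 1 -> e4factor s != 0.
Proof.
move=> s0 s1; rewrite e4factorE mulf_neq0//; first by rewrite subr_eq0 eq_sym dm2_neq1.
rewrite -[2]/(2%:R) -dm_sub1// subr_eq0 eq_sym dm2_neq1// ReB /= subr_eq0//.
Qed.

(** At multiples of 4 the sum combines three partial sums of zeta, of lengths 4M, 2M and M; their
    main terms enter with total weight 4 - 6 + 2 = 0. At most three more terms complete N. *)
Lemma e4sum_bound s : 0 < complex.Re s -> s != 1 -> exists2 K : R, 0 <= K &
  forall N, (0 < N)%N -> nc (e4sum s N - e4factor s * zeta0 s) <= K * N%:R `^ (- complex.Re s).
Proof.
move=> s0 s1; have s10 : s - 1 != 0 by rewrite subr_eq0.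
have [B BE] : exists B, B = vbound s / complex.Re s + vbound s + nc (s - 1) by eexists.
have B0 : 0 <= B by rewrite BE !addr_ge0 ?nc_ge0 ?vbound_ge0// divr_ge0 ?vbound_ge0// ltW.
have [A AE] : exists A, A = nc (s - 1)^-1 by eexists.
have A0 : 0 <= A by rewrite AE nc_ge0.
set L := e4factor s * zeta0 s.
have blk M : (0 < M)%N -> nc (e4sum s (4 * M) - L) <= 6 * A * B * M%:R `^ (- complex.Re s).
  move=> M0; have M2 : (0 < 2 * M)%N by rewrite muln_gt0.
  have M4 : (0 < 4 * M)%N by rewrite muln_gt0.
  have h1 := dm_partial_sum s0 M0; have h2 := dm_partial_sum s0 M2; have h4 := dm_partial_sum s0 M4.
  rewrite -BE in h1 h2 h4; have p0 := powR_ge0 M%:R (- complex.Re s).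
  have MR : 0 < M%:R :> R by rewrite ltr0n.
  have mono d : (0 < d)%N -> (d * M)%:R `^ (- complex.Re s) <= M%:R `^ (- complex.Re s).
    by move=> d0; rewrite (ler_powR_neg MR _ (ltW s0))// ler_nat leq_pmull.
  have nd2 d : (0 < d)%N -> nc (dm s d) <= 1.
    by move=> d0; rewrite nc_dm// -[leRHS](powRr0 d%:R) ler_powR ?ler1n//; lra.
  set Z1 := \sum_(k < M) _ in h1 *; set Z2 := \sum_(k < 2 * M) _ in h2 *; set Z4 := \sum_(k < 4 * M) _ in h4 *.
  set X1 := _ - _ in h1; set X2 := _ - _ in h2; set X4 := _ - _ in h4.
  have E : e4sum s (4 * M) - L = (s - 1)^-1 * (X4 - 3 * (dm s 2 * X2) + 2 * (dm s 4 * X1)).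
    rewrite e4sum_blocks -/Z1 -/Z2 -/Z4 /X1 /X2 /X4 /L /e4factor /zeta0 !dmM// !dm_sub1//.
    by rewrite (_ : 4 = 2 * 2)%N// dmM// natrM; field.
  rewrite E ncM -AE; have -> : 6 * A * B * M%:R `^ (- complex.Re s) = A * (6 * (B * M%:R `^ (- complex.Re s))) by ring.
  rewrite ler_wpM2l//.
  apply: (le_trans (ncD _ _)); have := ncB X4 (3 * (dm s 2 * X2)).
  have -> : nc (3 * (dm s 2 * X2)) = 3 * (nc (dm s 2) * nc X2) by rewrite ncM (ncM (dm s 2)) -[3]/(3%:R) nc_nat.
  have -> : nc (2 * (dm s 4 * X1)) = 2 * (nc (dm s 4) * nc X1) by rewrite ncM (ncM (dm s 4)) -[2]/(2%:R) nc_nat.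
  have q2 : nc (dm s 2) * nc X2 <= B * M%:R `^ (- complex.Re s).
    rewrite -[leRHS]mul1r ler_pM ?nc_ge0 ?nd2//; apply: (le_trans h2).
    by rewrite ler_wpM2l// mono.
  have q1 : nc (dm s 4) * nc X1 <= B * M%:R `^ (- complex.Re s).
    by rewrite -[leRHS]mul1r ler_pM ?nc_ge0 ?nd2.
  have q4 : nc X4 <= B * M%:R `^ (- complex.Re s).
    by apply: (le_trans h4); rewrite ler_wpM2l// mono.
  by move: q1 q2 q4; clear; lra.
have [K1 K1E] : exists K1, K1 = (6 * A * B + nc L) * 2 `^ complex.Re s + 6 by eexists.
have K10 : 0 <= K1 by rewrite K1E addr_ge0// mulr_ge0 ?powR_ge0// addr_ge0 ?nc_ge0// !mulr_ge0.
exists (K1 * 4 `^ complex.Re s); first by rewrite mulr_ge0 ?powR_ge0.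
move=> N N0; set M := (N %/ 4)%N.
have key : nc (e4sum s N - L) <= K1 * M.+1%:R `^ (- complex.Re s).
  have NE : (N = 4 * M + N %% 4)%N by rewrite mulnC -divn_eq.
  have Mp : 0 < M.+1%:R :> R by rewrite ltr0n.
  have pM := powR_ge0 M.+1%:R (- complex.Re s).
  have h1 : nc (e4sum s (4 * M) - L) <= (6 * A * B + nc L) * 2 `^ complex.Re s * M.+1%:R `^ (- complex.Re s).
    have M12 : 1 <= 2 `^ complex.Re s :> R by rewrite -[leLHS](powRr0 2) ler_powR ?ler1n// ltW.
    have AB : 0 <= 6 * A * B by rewrite !mulr_ge0.
    have nL := nc_ge0 L.
    have [M0|M0] := posnP M.
      rewrite M0 muln0 /e4sum big_ord0 sub0r ncN powR1 mulr1; nra.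
    apply: (le_trans (blk M M0)).
    have hM : M%:R `^ (- complex.Re s) <= 2 `^ complex.Re s * M.+1%:R `^ (- complex.Re s).
      have -> : 2 `^ complex.Re s = (2^-1) `^ (- complex.Re s).
        by rewrite -powR_inv1// -powRrM mulN1r opprK.
      rewrite -powRM ?invr_ge0 ?ler0n//.
      apply: ler_powR_neg (ltW s0); first by rewrite mulr_gt0 ?invr_gt0.
      rewrite mulrC ler_pdivrMr// -natr1; have : 1 <= M%:R :> R by rewrite ler1n.
      by lra.
    apply: (le_trans (ler_wpM2l AB hM)); rewrite mulrA ler_wpM2r//.
    by rewrite ler_wpM2r ?powR_ge0// lerDl.
  have h2 : nc (e4sum s N - e4sum s (4 * M)) <= 6 * M.+1%:R `^ (- complex.Re s).
    rewrite [in e4sum s N]NE /e4sum big_split_ord /= [X in X - _]addrC addrK.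
    apply: (le_trans (nc_sum _ _ _)).
    apply: (@le_trans _ _ (\sum_(i < N %% 4) 2 * M.+1%:R `^ (- complex.Re s))).
      apply: ler_sum => i _; rewrite ncM nc_real nc_dm// ler_pM ?powR_ge0 ?e4_bound//.
      rewrite (ler_powR_neg Mp _ (ltW s0))// ler_nat ltnS (leq_trans _ (leq_addr _ _))// leq_pmull//.
    rewrite sumr_const card_ord -[leLHS]mulr_natl mulrA ler_wpM2r//.
    have : (N %% 4)%:R <= 3 :> R by rewrite (ler_nat R _ 3) -ltnS ltn_mod.
    by lra.
  have := ncD (e4sum s N - e4sum s (4 * M)) (e4sum s (4 * M) - L); rewrite addrA subrK => h.
  by apply: (le_trans h); rewrite K1E mulrDl addrC; apply: lerD.
apply: (le_trans key); rewrite -mulrA ler_wpM2l//.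
have -> : 4 `^ complex.Re s = (4^-1) `^ (- complex.Re s) :> R.
  by rewrite -powR_inv1// -powRrM mulN1r opprK.
rewrite -powRM ?invr_ge0//; apply: ler_powR_neg (ltW s0).
  by rewrite mulr_gt0 ?invr_gt0 ?ltr0n.
rewrite mulrC ler_pdivrMr ?ltr0n// -natrM ler_nat.
by rewrite [X in (X <= _)%N](divn_eq N 4) -/M mulSn addnC leq_add2r ltnW// ltn_mod.
Qed.

End PeriodicSeries.

(** * The tent function and its finite Fourier expansion *)

Section Tent.
Variable R : realType.
Local Open Scope complex_scope.
Local Notation C := R[i].
Local Notation e4 := (@e4 R).

Definition cosn (M c : nat) : R := cos (c%:R * (2 * pi / M%:R)).

(** Replaces [pi] by a variable, an atom for the arithmetic tactics. *)
Lemma pi_opaque : exists2 p : R, p = pi & 0 < p.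
Proof. by exists pi => //; exact: pi_gt0. Qed.

Lemma cosn_period M c k : (0 < M)%N -> cosn M (c + k * M) = cosn M c.
Proof.
move=> M0; elim: k => [|k ih]; first by rewrite mul0n addn0.
rewrite mulSn addnCA addnC -ih /cosn natrD.
have -> : ((c + k * M)%:R + M%:R) * (2 * pi / M%:R) = (c + k * M)%:R * (2 * pi / M%:R) + pi *+ 2 :> R.
  have M1 : M%:R != 0 :> R by rewrite pnatr_eq0 -lt0n.
  by have [p <- p0] := pi_opaque; rewrite mulr2n; field.
exact: cosD2pi.
Qed.

Lemma cosn0 M : cosn M 0 = 1.
Proof. by rewrite /cosn mul0r cos0. Qed.

Lemma cosn_mulM M k : (0 < M)%N -> cosn M (k * M) = 1.
Proof. by move=> M0; rewrite -[(k * M)%N]add0n cosn_period// cosn0. Qed.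

Lemma cosn_prod M a b k : (0 < M)%N -> (b <= M)%N ->
  cosn M (k * a) * cosn M (k * b) = (cosn M (k * (a + b)) + cosn M (k * (a + (M - b)))) / 2.
Proof.
move=> M0 bM.
have E : cosn M (k * (a + (M - b))) = cos ((k * a)%:R * (2 * pi / M%:R) - (k * b)%:R * (2 * pi / M%:R)).
  have -> : (k * (a + (M - b)) = k * a + k * (M - b))%N by rewrite mulnDr.
  rewrite -mulrBl; have -> : (k * a)%:R - (k * b)%:R = (k * a + k * (M - b))%:R - k%:R * M%:R :> R.
    by rewrite !natrM natrD !natrM natrB//; ring.
  have [p pE p0] := pi_opaque; rewrite /cosn -pE.
  have M1 : M%:R != 0 :> R by rewrite pnatr_eq0 -lt0n.
  have -> : ((k * a + k * (M - b))%:R - k%:R * M%:R) * (2 * p / M%:R) =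
    (k * a + k * (M - b))%:R * (2 * p / M%:R) - k%:R * (2 * p) by field.
  have -> : k%:R * (2 * p) = pi *+ 2 *+ k by rewrite pE -(mulr_natl (pi *+ 2) k) -(mulr_natl pi 2).
  by have := @periodicn _ _ cos (pi *+ 2) (@cosD2pi R) k ((k * a + k * (M - b))%:R * (2 * p / M%:R) - pi *+ 2 *+ k); rewrite subrK.
rewrite E cosB mulnDr /cosn (natrD _ (k * a) (k * b)) (mulrDl (k * a)%:R (k * b)%:R) cosD; lra.
Qed.

Lemma cosn_lt1 M k : (0 < k < M)%N -> cosn M k < 1.
Proof.
move=> /andP[k0 kM]; have M0 : 0 < M%:R :> R by rewrite ltr0n (leq_ltn_trans _ kM).
have kR : 0 < k%:R :> R by rewrite ltr0n.
have kMR : k%:R < M%:R :> R by rewrite ltr_nat.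
have sp : 0 < sin (k%:R * (pi / M%:R) : R).
  apply: sin_gt0_pi; rewrite mulr_gt0 ?divr_gt0 ?pi_gt0//= mulrA ltr_pdivrMr//.
  by rewrite mulrC ltr_pM2l ?pi_gt0.
rewrite /cosn; have -> : k%:R * (2 * pi / M%:R) = k%:R * (pi / M%:R) + k%:R * (pi / M%:R) :> R by ring.
rewrite cosD; have := cos2Dsin2 (k%:R * (pi / M%:R) : R); rewrite -expr2 => h.
by have := mulr_gt0 sp sp; rewrite -!expr2; lra.
Qed.

Lemma cosn_sum M c : (0 < M)%N -> \sum_(k < M) cosn M (k * c) = M%:R * (M %| c)%N%:R.
Proof.
move=> M0; have [/dvdnP[d ->]|Mc] := boolP (M %| c)%N.
  under eq_bigr => k _ do rewrite mulnA cosn_mulM//.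
  by rewrite sumr_const card_ord mulr1.
rewrite mulr0; pose z : C := eit (c%:R * (2 * pi / M%:R)).
have M1 : M%:R != 0 :> R by rewrite pnatr_eq0 -lt0n.
have zM : z ^+ M = 1.
  rewrite /z eitX; have [p pE p0] := pi_opaque; rewrite -pE.
  have -> : M%:R * (c%:R * (2 * p / M%:R)) = c%:R * (2 * p) by field.
  by rewrite -eitX pE eit2pi expr1n.
have z1 : 1 - z != 0.
  apply/eqP => h; have : complex.Re z = 1 by rewrite -[z](subKr 1) h subr0.
  rewrite /z /= -[cos _]/(cosn M c) (divn_eq c M) addnC cosn_period// => h1.
  have : (0 < c %% M < M)%N by rewrite ltn_mod M0 lt0n andbT; move: Mc; rewrite /dvdn.
  by move=> /cosn_lt1; rewrite h1 ltxx.
have S0 : \sum_(k < M) z ^+ k = 0.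
  by apply: (mulfI z1); rewrite mulr0 geom_sum zM subrr.
transitivity (complex.Re (\sum_(k < M) z ^+ k)); last by rewrite S0.
rewrite Re_sum; apply: eq_bigr => k _.
by rewrite /z eitX /cosn (natrM _ k c) -(mulrA k%:R).
Qed.

(** Here e4(k) = cos(pi k / 2) - cos(pi k), written on the grid of step 1/q. Together with
    [e4_shift], which writes the same sequence as a combination of shifted combs, this shows it to
    be its own transform. *)
Lemma e4_cosn q k : (0 < q)%N -> e4 k = cosn (4 * q) (k * q) - cosn (4 * q) (k * (2 * q)).
Proof.
move=> q0; have M0 : (0 < 4 * q)%N by rewrite muln_gt0.
have q1 : q%:R != 0 :> R by rewrite pnatr_eq0 -lt0n.
have red a : cosn (4 * q) (k * (a * q)) = cosn (4 * q) ((k %% 4) * (a * q)).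
  rewrite {1}(divn_eq k 4) mulnDl addnC.
  have -> : (k %/ 4 * 4 * (a * q) = (k %/ 4 * a) * (4 * q))%N by lia.
  by rewrite cosn_period.
have val r : cosn (4 * q) (r * q) = cos (r%:R * (pi / 2)).
  rewrite /cosn !natrM; have [p pE p0] := pi_opaque; rewrite -pE; congr cos; field.
  by rewrite q1.
have := red 1%N; rewrite mul1n => ->; rewrite (red 2%N) mulnA !val.
have c0 : cos (0 * (pi / 2)) = 1 :> R by rewrite mul0r cos0.
have c1 : cos (1 * (pi / 2)) = 0 :> R by rewrite mul1r cos_pihalf.
have c2 : cos (2 * (pi / 2)) = -1 :> R.
  by have [p pE p0] := pi_opaque; rewrite -pE (_ : 2 * (p / 2) = p) ?pE ?cospi//; field.
have c3 : cos (3 * (pi / 2)) = 0 :> R.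
  have -> : 3 * (pi / 2) = pi / 2 + pi :> R by have [p <- p0] := pi_opaque; field.
  by rewrite cosDpi cos_pihalf oppr0.
have c4 : cos (4 * (pi / 2)) = 1 :> R.
  have -> : 4 * (pi / 2) = pi *+ 2 :> R by have [p <- p0] := pi_opaque; rewrite mulr2n; field.
  by rewrite cos2pi.
have c6 : cos (6 * (pi / 2)) = -1 :> R.
  have -> : 6 * (pi / 2) = pi + pi *+ 2 :> R by have [p <- p0] := pi_opaque; rewrite mulr2n; field.
  by rewrite cosD2pi cospi.
have [E1 E2 E3 E4] := e4_block R (k %/ 4).
have E0 : e4 (4 * (k %/ 4)) = 1 - 3 + 2.
  by rewrite /e4 !dvdn_mulr// !mulr1.
have := divn_eq k 4; rewrite mulnC => kE; rewrite {1}kE.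
have : (k %% 4 < 4)%N by rewrite ltn_mod.
case: (k %% 4)%N => [|[|[|[|//]]]] _.
- by rewrite addn0 E0 mul0n c0; lra.
- by rewrite E1 mul1n c1 c2; lra.
- by rewrite E2 -[(2 * 2)%N]/4%N c2 c4; lra.
- by rewrite E3 -[(3 * 2)%N]/6%N c3 c6; lra.
Qed.

Lemma e4_shift n : e4 n = (4 %| n + 1)%N%:R + (4 %| n + 3)%N%:R - 2 * (4 %| n + 2)%N%:R.
Proof.
have := divn_eq n 4; rewrite mulnC; move: (ltn_mod n 4); move: (n %/ 4)%N (n %% 4)%N => i r r4 ->.
have [E1 E2 E3 E4] := e4_block R i.
have E0 : e4 (4 * i) = 1 - 3 + 2 by rewrite /e4 !dvdn_mulr// !mulr1.
have d4 : (4 %| 4 * i)%N by rewrite dvdn_mulr.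
rewrite -!(addnA (4 * i)) !(dvdn_addr _ d4).
case: r r4 => [|[|[|[|//]]]] _ /=.
- by rewrite addn0 E0; lra.
- by rewrite E1; lra.
- by rewrite E2; lra.
- by rewrite E3; lra.
Qed.

(* At [u = j / q] this is [q] times the sum of [e4 n * (u - n)^+], a tent of period 4. *)
Definition tent q N j : R := \sum_(n < N) e4 n.+1 * (j - n.+1 * q)%N%:R.

(** The second difference in j multiplies 1 - cos(j x) by -(2 - 2 cos x) up to a constant, and the
    denominator inverts this. At k = 0 the denominator is 0, but so is e4(0). *)
Definition tentF q j : R :=
  \sum_(k < 4 * q) e4 k * (1 - cosn (4 * q) (j * k)) / (2 - 2 * cosn (4 * q) k).

Lemma e40 : e4 0 = 0.
Proof.
by rewrite /e4 !dvdn0 !mulr1; lra.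
Qed.

(** Each product of cosines becomes a sum of two, and orthogonality leaves three combs, which
    [e4_shift] assembles into e4 again. *)
Lemma comb_sum q a : (0 < q)%N ->
  \sum_(k < 4 * q) e4 k * cosn (4 * q) (a * k) = 2 * q%:R * (if (q %| a)%N then e4 (a %/ q) else 0).
Proof.
move=> q0; have M0 : (0 < 4 * q)%N by rewrite muln_gt0.
have h (k : 'I_(4 * q)) : e4 k * cosn (4 * q) (a * k) =
   (cosn (4 * q) (k * (a + q)) + cosn (4 * q) (k * (a + 3 * q)) - 2 * cosn (4 * q) (k * (a + 2 * q))) / 2.
  rewrite (e4_cosn k q0) mulrBl [(a * k)%N]mulnC.
  rewrite [X in X - _]mulrC [X in _ - X]mulrC !cosn_prod//; try lia.
  have -> : (4 * q - q = 3 * q)%N by lia.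
  have -> : (4 * q - 2 * q = 2 * q)%N by lia.
  by lra.
rewrite (eq_bigr _ (fun k _ => h k)) -mulr_suml sumrB big_split /= -mulr_sumr !cosn_sum//.
have [/dvdnP[n ->]|qa] := boolP (q %| a)%N; last first.
  have nd b : (4 * q %| a + b * q)%N = false.
    apply/negP => /(dvdn_trans (dvdn_mull 4 (dvdnn q))).
    by rewrite dvdn_addl ?dvdn_mull// (negbTE qa).
  by have := nd 1%N; rewrite mul1n => ->; rewrite !nd; lra.
rewrite mulnK// e4_shift.
have nd b : (4 * q %| n * q + b * q)%N = (4 %| n + b)%N by rewrite -mulnDl dvdn_pmul2r.
by have := nd 1%N; rewrite mul1n => ->; rewrite !nd natrM; lra.
Qed.

Lemma tentF_diff q j : (0 < q)%N ->
  tentF q j.+2 - 2 * tentF q j.+1 + tentF q j = 2 * q%:R * (if (q %| j.+1)%N then e4 (j.+1 %/ q) else 0).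
Proof.
move=> q0; have M0 : (0 < 4 * q)%N by rewrite muln_gt0.
rewrite -comb_sum// /tentF mulr_sumr -sumrB -big_split /=; apply: eq_bigr => k _.
have [k0|k0] := posnP k; first by rewrite k0 e40; lra.
have := @cosn_lt1 (4 * q) k; rewrite k0 ltn_ord => /(_ isT) c1.
have pr : cosn (4 * q) (j.+2 * k) + cosn (4 * q) (j * k) = 2 * cosn (4 * q) (j.+1 * k) * cosn (4 * q) k.
  have := @cosn_prod (4 * q) j.+1 1 k M0 M0; rewrite !muln1 addn1.
  have -> : (k * (j.+1 + (4 * q - 1)) = j * k + k * (4 * q))%N by nia.
  rewrite cosn_period// [(k * _)%N]mulnC [(k * j.+2)%N]mulnC.
  by lra.
have -> : cosn (4 * q) (j.+2 * k) = 2 * cosn (4 * q) (j.+1 * k) * cosn (4 * q) k - cosn (4 * q) (j * k).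
  by rewrite -pr; ring.
by field; apply/eqP => hh; move: c1; lra.
Qed.

Lemma tent_diff q N j : (0 < q)%N -> (j < N)%N ->
  tent q N j.+2 - 2 * tent q N j.+1 + tent q N j = (if (q %| j.+1)%N then e4 (j.+1 %/ q) else 0).
Proof.
move=> q0 jN; rewrite /tent mulr_sumr -sumrB -big_split /=.
have t (n : nat) : e4 n.+1 * (j.+2 - n.+1 * q)%N%:R - 2 * (e4 n.+1 * (j.+1 - n.+1 * q)%N%:R) + e4 n.+1 * (j - n.+1 * q)%N%:R
   = if (n.+1 * q == j.+1)%N then e4 n.+1 else 0.
  set m := (n.+1 * q)%N.
  have [h|h|h] := ltngtP m j.+1.
  - have mj : (m <= j)%N by [].
    rewrite (natrB _ mj) (natrB _ (leqW mj)) (natrB _ (leqW (leqW mj))) -[j.+2%:R]natr1 -natr1; ring.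
  - have -> : (j.+2 - m = 0)%N by lia.
    have -> : (j.+1 - m = 0)%N by lia.
    have -> : (j - m = 0)%N by lia.
    by lra.
  - have -> : (j.+2 - m = 1)%N by lia.
    have -> : (j.+1 - m = 0)%N by lia.
    have -> : (j - m = 0)%N by lia.
    by lra.
under eq_bigr => i _ do rewrite t.
case: ifP => [/dvdnP[d dE]|nd].
  have d0 : (0 < d)%N by case: (d) dE.
  rewrite dE mulnK//.
  have dN : (d.-1 < N)%N by rewrite prednK//; nia.
  rewrite (bigD1 (Ordinal dN)) //= prednK// eqxx big1 ?addr0// => i /eqP ii.
  rewrite eqn_pmul2r//; case: eqP => // e; case: ii; apply: val_inj => /=.
  by rewrite -e.
by rewrite big1// => i _; case: eqP => // e; rewrite -e dvdn_mull in nd.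
Qed.

(** Both sides have proportional second differences, by [tentF_diff] and [tent_diff], and vanish at
    j = 0 and j = 1. *)
Lemma tentFE q N j : (0 < q)%N -> (j <= N)%N -> tentF q j = 2 * q%:R * tent q N j.
Proof.
move=> q0; have M0 : (0 < 4 * q)%N by rewrite muln_gt0.
have F0 : tentF q 0 = 0.
  by rewrite /tentF big1// => k _; rewrite mul0n cosn0 subrr mulr0 mul0r.
have F1 : tentF q 1 = 0.
  have := comb_sum 0 q0; rewrite dvdn0 div0n e40 mulr0 => h.
  have := h; under eq_bigr => k _ do rewrite mul0n cosn0 mulr1.
  move=> h2; rewrite -[RHS](mul0r 2^-1) -h2 mulr_suml /tentF; apply: eq_bigr => k _.
  have [k0|k0] := posnP k; first by rewrite k0 e40 !mul0r.
  have := @cosn_lt1 (4 * q) k; rewrite k0 ltn_ord => /(_ isT) c1.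
  by rewrite mul1n; field; apply/eqP => hh; move: c1; lra.
have T0 : tent q N 0 = 0 by rewrite /tent big1// => n _; rewrite sub0n mulr0.
have T1 : tent q N 1 = 0.
  by rewrite /tent big1// => n _; rewrite (_ : (1 - _ = 0)%N) ?mulr0//; nia.
suff hs i : (i.+1 <= N)%N -> tentF q i = 2 * q%:R * tent q N i /\ tentF q i.+1 = 2 * q%:R * tent q N i.+1.
  by case: j => [|j] jN; [rewrite F0 T0 mulr0|have [] := hs j jN].
elim: i => [|i ih] iN; first by rewrite F0 F1 T0 T1 mulr0.
have [h1 h2] := ih (ltnW iN); split => //.
have := tentF_diff i q0; have := @tent_diff q N i q0 (ltnW iN).
rewrite h1 h2 => <-; set a := tent q N i; set b := tent q N i.+1; set c := tent q N i.+2.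
by move=> e; lra.
Qed.

End Tent.

(** * Periodicity and truncations of the tent function *)

Section TentFourier.
Variable R : realType.
Local Open Scope complex_scope.
Local Notation e4 := (@e4 R).
Local Notation tent := (@tent R).
Local Notation tentF := (@tentF R).
Local Notation cosn := (@cosn R).

Lemma tent_ext q N N' j : (N <= N')%N -> (j <= N.+1 * q)%N -> tent q N' j = tent q N j.
Proof.
move=> NN jN; rewrite /tent -(subnKC NN) big_split_ord /= [X in _ + X]big1 ?addr0// => i _.
rewrite (_ : (j - _ = 0)%N) ?mulr0//; apply/eqP; rewrite subn_eq0 (leq_trans jN)//.
by rewrite leq_mul2r ltnS leq_addr orbT.
Qed.

(** For q > 0 the terms n > j are zero, so j terms give the full sum. *)
Definition Tent q j : R := tent q j j.

Lemma TentE q N j : (0 < q)%N -> (j <= N)%N -> tent q N j = Tent q j.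
Proof. by move=> q0 jN; apply: tent_ext => //; nia. Qed.

Lemma tentF_Tent q j : (0 < q)%N -> tentF q j = 2 * q%:R * Tent q j.
Proof.
by move=> q0; rewrite (tentFE R q0 (leqnn j)).
Qed.

Lemma tentF_period q j k : (0 < q)%N -> tentF q (j + k * (4 * q)) = tentF q j.
Proof.
move=> q0; apply: eq_bigr => i _; congr (_ * (_ - _) / _).
by rewrite mulnDl mulnAC cosn_period// muln_gt0.
Qed.

(** The period 4q is visible only on the Fourier side; within one period at most three terms of the
    sum are nonzero. *)
Lemma Tent_bound q j : (0 < q)%N -> `|Tent q j| <= 24 * q%:R.
Proof.
move=> q0; have qR : 0 < q%:R :> R by rewrite ltr0n.
have M0 : (0 < 4 * q)%N by rewrite muln_gt0.
have -> : Tent q j = Tent q (j %% (4 * q)).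
  have q2 : 2 * q%:R != 0 :> R by rewrite gt_eqF// mulr_gt0.
  apply: (mulfI q2); rewrite -!tentF_Tent// [in LHS](divn_eq j (4 * q)) addnC.
  exact: tentF_period.
set i := (j %% _)%N; have iM : (i < 4 * q)%N by rewrite ltn_mod.
have -> : Tent q i = tent q 3 i.
  rewrite /Tent; case: (leqP 3 i) => h; first by rewrite (@tent_ext q 3)// ltnW.
  by rewrite -(@tent_ext q i 3)//; [exact: ltnW|nia].
apply: (le_trans (ler_norm_sum _ _ _)).
apply: (@le_trans _ _ (\sum_(n < 3) 2 * (4 * q%:R))); last first.
  by rewrite sumr_const card_ord -[leLHS]mulr_natl; lra.
apply: ler_sum => n _; rewrite normrM ler_pM ?e4_bound// ger0_norm// -natrM ler_nat.
by rewrite (leq_trans (leq_subr _ _))// ltnW.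
Qed.

(** On a block of four, the weights 1, -2, 1, 0 annihilate linear functions of n. *)
Lemma tent_vanish q n j : (4 * n * q <= j)%N -> tent q (4 * n) j = 0.
Proof.
move=> h; have E m : (m <= n)%N ->
   tent q (4 * m) j = 0.
  elim: m => [|m ih] mn; first by rewrite /tent muln0 big_ord0.
  have -> : (4 * m.+1 = 4 * m + 4)%N by rewrite mulnS addnC.
  rewrite /tent big_split_ord /= -/(tent q (4 * m) j) ih ?(ltnW mn)// add0r.
  have [E1 E2 E3 E4] := e4_block R m.
  rewrite !big_ord_recl big_ord0 /= /bump /= !add1n.
  have -> : (4 * m + 0).+1 = (4 * m + 1)%N by rewrite addn0 addn1.
  rewrite -!addnS E1 E2 E3 E4.
  have l1 : ((4 * m + 1) * q <= j)%N by nia.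
  have l2 : ((4 * m + 2) * q <= j)%N by nia.
  have l3 : ((4 * m + 3) * q <= j)%N by nia.
  by rewrite (natrB _ l1) (natrB _ l2) (natrB _ l3) !natrM !natrD; ring.
exact: E.
Qed.

Lemma Tent_trunc q n j : (0 < q)%N -> (0 < n)%N ->
  Tent q j = tent q (4 * n) j \/ ((4 * n * q <= j)%N /\ `|Tent q j - tent q (4 * n) j| <= 24 * q%:R).
Proof.
move=> q0 n0; case: (leqP j (4 * n * q)) => h; [left|right].
  rewrite /Tent; case: (leqP j (4 * n)) => h2; last by rewrite (@tent_ext q (4 * n))//; nia.
  by rewrite -(@tent_ext q j (4 * n))//; nia.
split; first exact: ltnW.
by rewrite tent_vanish ?subr0 ?Tent_bound// ltnW.
Qed.

Lemma Tent_scale q j m : (0 < q)%N -> (0 < m)%N -> Tent (q * m) (j * m) = m%:R * Tent q j.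
Proof.
move=> q0 m0; have jm : (j <= j * m)%N by rewrite leq_pmulr.
rewrite -(TentE q0 jm) /Tent /tent mulr_sumr; apply: eq_bigr => n _.
by rewrite mulnA -mulnBl natrM; ring.
Qed.

(** The N-th partial sum of the Fourier series at j / q of the tent function of period 4. *)
Definition fourier q j N : R :=
  \sum_(k < N) 4 / pi ^+ 2 * (e4 k.+1 * (1 - cosn (4 * q) (j * k.+1)) / k.+1%:R ^+ 2).

(** The terms are symmetric under k -> 4q - k. Folding leaves only angles up to pi, where 2 - 2 cos
    y is comparable to y^2. *)
Lemma tentF_fold q j : (0 < q)%N ->
  tentF q j = 2 * \sum_(k < (2 * q).-1) e4 k.+1 * (1 - cosn (4 * q) (j * k.+1)) / (2 - 2 * cosn (4 * q) k.+1)
    + e4 (2 * q) * (1 - cosn (4 * q) (j * (2 * q))) / (2 - 2 * cosn (4 * q) (2 * q)).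
Proof.
move=> q0; have M0 : (0 < 4 * q)%N by rewrite muln_gt0.
pose F k := e4 k * (1 - cosn (4 * q) (j * k)) / (2 - 2 * cosn (4 * q) k).
have F0 : F 0%N = 0 by rewrite /F e40 !mul0r.
have cosnN k i : (k <= 4 * q)%N -> cosn (4 * q) (i * (4 * q - k)) = cosn (4 * q) (i * k).
  move=> kM; have := @cosn_prod R (4 * q) 0 k i M0 kM.
  have := @cosn_prod R (4 * q) k 0 i M0 (leq0n _).
  rewrite !add0n !muln0 !cosn0 !addn0 subn0 mulnDr cosn_period//; lra.
have Fs k : (k <= 4 * q)%N -> F (4 * q - k)%N = F k.
  move=> kM; rewrite /F cosnN//; have := cosnN k 1%N kM; rewrite !mul1n => ->.
  congr (_ * _ / _); rewrite !(e4_cosn R _ q0) ![((4 * q - k) * _)%N]mulnC !cosnN//.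
  by rewrite ![(k * _)%N]mulnC.
rewrite /tentF -[LHS]/(\sum_(k < 4 * q) F k).
have [X XE] : exists X, (2 * q)%N = X.+1 by exists (2 * q).-1; rewrite prednK// muln_gt0.
have M2 : (4 * q = X.+1 + X.+1)%N by rewrite -XE; lia.
rewrite -[X in \sum_(k < X) F _]/(4 * q)%N.
have -> : \sum_(k < 4 * q) F k = \sum_(k < X.+1 + X.+1) F k by rewrite -M2.
rewrite big_split_ord /= big_ord_recl /= F0 add0r.
rewrite XE /= [X in _ + X](reindex_inj rev_ord_inj) /=.
have -> : \sum_(k < X.+1) F (X.+1 + (X.+1 - k.+1))%N = \sum_(k < X.+1) F k.+1.
  apply: eq_bigr => k _; rewrite -(Fs k.+1); last by rewrite M2 (leq_trans (ltn_ord k)) ?leq_addr.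
  by congr F; rewrite M2 addnBA// ltn_ord.
by rewrite big_ord_recr /= /bump /= -/(F X.+1) (eq_bigr (fun k : 'I_X => F k.+1))//; ring.
Qed.

Lemma quot_bound (y : R) : 0 < y -> y < pi ->
  `|y ^+ 2 / (2 - 2 * cos y) - 1| <= 64 /\ (y <= 2 -> `|y ^+ 2 / (2 - 2 * cos y) - 1| <= 200 * y).
Proof.
move=> y0 yp; have [x xE] : exists x, y = x + x by exists (y / 2); lra.
have x0 : 0 < x by lra.
have s1 := @sin_ge_lin R x ltac:(lra).
have [s sE] : exists s, s = sin x by eexists.
rewrite -sE in s1; have s0 : 0 < s by lra.
have -> : 2 - 2 * cos y = 4 * s ^+ 2.
  by rewrite xE cosD sE; have := cos2Dsin2 x; rewrite !expr2; lra.
have -> : y ^+ 2 / (4 * s ^+ 2) - 1 = (x - s) * (x + s) / s ^+ 2.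
  by rewrite xE; field; rewrite gt_eqF.
have ss : (x / 8) ^+ 2 <= s ^+ 2 by rewrite lerXn2r ?nnegrE//; lra.
have s20 : 0 < s ^+ 2 by rewrite exprn_gt0.
have sx : s <= x by have := abs_sin_le x; rewrite -sE !gtr0_norm.
have q0 : 0 <= (x - s) * (x + s) / s ^+ 2.
  by rewrite divr_ge0 ?(ltW s20)// mulr_ge0; lra.
rewrite ger0_norm//; split=> [|y2]; rewrite ler_pdivrMr//.
  by move: ss; rewrite !expr2; nra.
have x1 : `|x| <= 1 by rewrite gtr0_norm//; lra.
have := sin_sub x1; rewrite -sE distrC => /(le_trans (ler_norm _)) h.
have h2 : (x - s) * (x + s) <= x ^+ 2 * (2 * x).
  by apply: ler_pM => //; lra.
apply: (le_trans h2); have h3 : x * (x / 8) ^+ 2 <= x * s ^+ 2 by rewrite ler_wpM2l// ltW.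
have x3 : 0 <= x * x * x by rewrite !mulr_ge0 ?(ltW x0).
by rewrite xE; move: h3; rewrite !expr2; lra.
Qed.

End TentFourier.

(** * Uniform convergence of the Fourier series of the tent *)

Section FourierTail.
Variable R : realType.
Local Open Scope complex_scope.
Local Notation C := R[i].
Local Notation e4 := (@e4 R).
Local Notation Tent := (@Tent R).
Local Notation tentF := (@tentF R).
Local Notation cosn := (@cosn R).
Local Notation fourier := (@fourier R).

Lemma cosn_scale M c m : (0 < M)%N -> (0 < m)%N -> cosn (M * m) (c * m) = cosn M c.
Proof.
move=> M0 m0; rewrite /cosn !natrM; congr cos; have [p <- p0] := pi_opaque R.
by field; rewrite !pnatr_eq0 -!lt0n M0 m0.
Qed.

Lemma e4_mul4 n : e4 (4 * n) = 0.
Proof. by rewrite /e4 !dvdn_mulr// !mulr1; lra. Qed.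

Lemma one_sub_cosn M c : 0 <= 1 - cosn M c <= 2.
Proof. by have := cos_le1 (c%:R * (2 * pi / M%:R) : R); have := cos_geN1 (c%:R * (2 * pi / M%:R) : R); rewrite /cosn; lra. Qed.

Lemma fourier_coef_bound q j k : `|4 / pi ^+ 2 * (e4 k.+1 * (1 - cosn (4 * q) (j * k.+1)))| <= 4.
Proof.
have := one_sub_cosn (4 * q) (j * k.+1); set x := 1 - _ => hx.
have := e4_bound R k.+1; rewrite ler_norml => he.
have [p pE p0] := pi_opaque R; have p2 : 2 <= p by rewrite pE pi_ge2.
rewrite -pE normrM ger0_norm ?divr_ge0 ?sqr_ge0//.
have -> : 4 = 1 * 4 :> R by rewrite mul1r.
apply: ler_pM => //; first by rewrite divr_ge0 ?sqr_ge0.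
  by rewrite ler_pdivrMr ?exprn_gt0// expr2; nra.
rewrite normrM; have -> : 4 = 2 * 2 :> R by lra.
by apply: ler_pM => //; [rewrite ler_norml; lra|rewrite ler_norml; lra].
Qed.

(** Refining the grid does not change the tent, by [Tent_scale], whereas the discrete coefficients 1
    / (2 - 2 cos y) approach 1 / y^2. Tannery's theorem applies, [quot_bound] giving the domination
    and the pointwise limit. *)
Lemma fourier_near q j (e : R) : (0 < q)%N -> 0 < e -> exists m0, forall m, (m0 <= m)%N ->
  `|Tent q j / q%:R - fourier q j (4 * q * m)| <= e.
Proof.
move=> q0 e0.
pose w k : R := 4 / pi ^+ 2 * (e4 k.+1 * (1 - cosn (4 * q) (j * k.+1))).
pose Y X k : R := k.+1%:R * (pi / X.+1%:R).
pose D y : R := y ^+ 2 / (2 - 2 * cos y) - 1.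
pose t X k : C := if (k < X)%N then (w k * D (Y X k))%:C else 0.
have Y0 X k : 0 < Y X k by rewrite mulr_gt0 ?divr_gt0 ?pi_gt0.
have Ypi X k : (k < X)%N -> Y X k < pi.
  move=> kX; rewrite /Y mulrA ltr_pdivrMr// mulrC ltr_pM2l ?pi_gt0// ltr_nat ltnS; exact: kX.
have wb : forall k, `|w k| <= 4 by move=> k; exact: fourier_coef_bound.
have tl0 : forall e' : R, 0 < e' -> exists m0, forall n, \sum_(k < n) nc ((m0 + k).+1%:R `^ (- 2))%:C <= e'.
  move=> e' e'0; have [m0 hm] := @powR_tail_small R 2 ltac:(lra) e' e'0; exists m0 => n.
  by apply: le_trans (hm n); apply: ler_sum => k _; rewrite nc_real ger0_norm ?powR_ge0.
have tb X k : nc (t X k) <= 4 * 64.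
  rewrite /t; case: ifP => kX; last by rewrite nc0 mulr_ge0 ?ler0n.
  rewrite nc_real normrM ler_pM//; exact: (quot_bound (Y0 X k) (Ypi X k kX)).1.
have t0 k : cto (fun X => t X k) 0.
  move=> e' e'0; have [N NE] : exists N : R, N = 800 by eexists.
  have N0 : 0 < N by rewrite NE ltr0n.
  have f0 : 0 <= N / e' by apply: divr_ge0; exact: ltW.
  pose A := 4 * k.+1%:R * (1 + N / e').
  exists (Num.truncn A) => X AX; rewrite subr0 /t; case: ifP => kX; last by rewrite nc0 ltW.
  have X1 : A <= X.+1%:R.
    by apply: (le_trans (ltW (truncnS_gt A))); rewrite ler_nat ltnS.
  have p4 := pihalf_lt2 R.
  have k1 : 0 < k.+1%:R :> R by rewrite ltr0n.
  have y1 : Y X k * (1 + N / e') <= 1.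
    rewrite /Y mulrA mulrAC ler_pdivrMr// mul1r; apply: le_trans X1.
    have : 0 <= k.+1%:R * (1 + N / e').
      by apply: mulr_ge0; [exact: ltW|apply: addr_ge0].
    by rewrite /A; move: p4; clear; nra.
  have yp := Y0 X k.
  have y2 : Y X k <= 2.
    by move: y1 yp f0; clear; nra.
  have := (quot_bound yp (Ypi X k kX)).2 y2 => hD.
  rewrite nc_real normrM; apply: (@le_trans _ _ (4 * (200 * Y X k))).
    by apply: ler_pM.
  have : Y X k * (N / e') <= 1 by move: y1 yp; clear; lra.
  by rewrite mulrA ler_pdivrMr// mul1r NE; clear; lra.
have [X0 hX] := tannery (c := fun k => (k.+1%:R `^ (- 2))%:C) tl0 tb t0 e0.
exists X0.+1 => m mX; have m0 : (0 < m)%N by exact: leq_trans mX.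
have M0 : (0 < 4 * q * m)%N by rewrite !muln_gt0 q0.
pose X := (4 * q * m).-1; have XE : X.+1 = (4 * q * m)%N by rewrite prednK.
have XX : (X0 <= X)%N.
  by rewrite -ltnS XE (leq_trans mX)// leq_pmull// muln_gt0.
have := hX X XX; rewrite subr0.
have -> : \sum_(k < X) (k.+1%:R `^ (- 2))%:C * t X k = (Tent q j / q%:R - fourier q j (4 * q * m))%:C; last by rewrite nc_real.
have [q' q'E] : exists q', q' = (q * (2 * m))%N by eexists.
have q'0 : (0 < q')%N by rewrite q'E !muln_gt0 q0.
have X2 : (2 * q' = X.+1)%N by rewrite XE q'E; lia.
have TE : Tent q j / q%:R = tentF q' (j * (2 * m)) / (2 * q'%:R ^+ 2).
  rewrite tentF_Tent// q'E Tent_scale ?muln_gt0// !natrM.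
  by field; rewrite !pnatr_eq0 -!lt0n q0 m0.
rewrite TE tentF_fold// X2 [e4 _](_ : _ = 0); last by rewrite XE -mulnA e4_mul4.
rewrite !mul0r addr0 -XE /fourier big_ord_recr /= [e4 X.+1](_ : _ = 0); last by rewrite XE -mulnA e4_mul4.
rewrite !mul0r mulr0 addr0; set S1 := (X in 2 * X / _).
have -> : 2 * S1 / (2 * q'%:R ^+ 2) = S1 / q'%:R ^+ 2 by field; rewrite pnatr_eq0 -lt0n.
rewrite /S1 mulr_suml -sumrB rmorph_sum; apply: eq_bigr => k _.
rewrite /t ltn_ord -rmorphM; congr (_%:C).
have q'ne : q'%:R != 0 :> R by rewrite pnatr_eq0 -lt0n.
have q'R : 2 * q'%:R = X.+1%:R :> R by rewrite -X2 natrM.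
have cY : cosn (4 * q') k.+1 = cos (Y X k).
  rewrite /cosn /Y natrM; congr cos; rewrite -q'R; have [p <- p0] := pi_opaque R.
  by field; exact: q'ne.
have cJ : cosn (4 * q') (j * (2 * m) * k.+1) = cosn (4 * q) (j * k.+1).
  rewrite q'E mulnA [(j * (2 * m) * _)%N]mulnAC cosn_scale// ?muln_gt0//.
rewrite cY cJ /w /D powRE ?ltr0n//.
have -> : expR (- 2 * ln k.+1%:R) = k.+1%:R ^- 2 :> R.
  by rewrite mulNr expRN -[2]/(2%:R) expRM_natl lnK ?posrE.
have Yne : 2 - 2 * cos (Y X k) != 0.
  have := @cosn_lt1 R (4 * q') k.+1; rewrite cY /= => h.
  have kk : (k.+1 < 4 * q')%N.
    by apply: (@leq_ltn_trans X); rewrite // -ltnS -X2; lia.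
  by apply/eqP => hh; move: (h kk); lra.
have q'2 : q'%:R = X.+1%:R / 2 :> R by rewrite -q'R; lra.
rewrite q'2; set c := cos (Y X k) in Yne *; rewrite /Y; have [p <- p0] := pi_opaque R.
have pne : p != 0 by rewrite gt_eqF.
have X1 : X.+1%:R != 0 :> R by rewrite pnatr_eq0.
have k1 : k.+1%:R != 0 :> R by rewrite pnatr_eq0.
by field; rewrite !nat1r k1 pne X1 Yne.
Qed.

Lemma inv_sqr_differences (x : R) : 0 < x ->
  0 <= x ^- 2 - 2 * (x + 1) ^- 2 + (x + 2) ^- 2 <= 6 * x ^- 4 /\
  (0 <= (x + 1) ^- 2 - (x + 2) ^- 2 /\ (x + 1) * ((x + 1) ^- 2 - (x + 2) ^- 2) <= 2 * x ^- 2).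
Proof.
move=> x0; have x1 : 0 < x + 1 by lra.
have x2 : 0 < x + 2 by lra.
have n0 := lt0r_neq0 x0; have n1 := lt0r_neq0 x1; have n2 := lt0r_neq0 x2.
have q0 := ltW (exprn_gt0 2 x0); have c0 := ltW (exprn_gt0 3 x0).
split; [apply/andP; split|split].
- have -> : x ^- 2 - 2 * (x + 1) ^- 2 + (x + 2) ^- 2 =
    (6 * x ^+ 2 + 12 * x + 4) / (x ^+ 2 * (x + 1) ^+ 2 * (x + 2) ^+ 2) by field; rewrite ?n0 ?n1 ?n2.
  apply: divr_ge0; first lra.
  by rewrite !mulr_ge0 ?exprn_ge0 ?ltW.
- rewrite -subr_ge0.
  have -> : 6 * x ^- 4 - (x ^- 2 - 2 * (x + 1) ^- 2 + (x + 2) ^- 2) =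
    (24 * x ^+ 3 + 74 * x ^+ 2 + 72 * x + 24) / (x ^+ 4 * (x + 1) ^+ 2 * (x + 2) ^+ 2).
    by field; rewrite ?n0 ?n1 ?n2.
  apply: divr_ge0; first lra.
  by rewrite !mulr_ge0 ?exprn_ge0 ?ltW.
- have -> : (x + 1) ^- 2 - (x + 2) ^- 2 = (2 * x + 3) / ((x + 1) ^+ 2 * (x + 2) ^+ 2).
    by field; rewrite ?n0 ?n1 ?n2.
  apply: divr_ge0; first lra.
  by rewrite !mulr_ge0 ?exprn_ge0 ?ltW.
- rewrite -subr_ge0.
  have -> : 2 * x ^- 2 - (x + 1) * ((x + 1) ^- 2 - (x + 2) ^- 2) =
    (7 * x ^+ 2 + 16 * x + 8) / (x ^+ 2 * (x + 1) * (x + 2) ^+ 2) by field; rewrite ?n0 ?n1 ?n2.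
  apply: divr_ge0; first lra.
  by rewrite !mulr_ge0 ?exprn_ge0 ?ltW.
Qed.

(** The weights 1, -2, 1 turn a block of the Fourier series into this second difference. Of the two
    bounds, the first is better for small th and the second for large th. *)
Lemma second_difference (th : R) (n : nat) : (0 < n)%N ->
  let g k := (1 - cos (k%:R * th)) / k%:R ^+ 2 in
  `|g n - 2 * g n.+1 + g n.+2| <= 12 * th ^+ 2 / n%:R ^+ 2 /\ `|g n - 2 * g n.+1 + g n.+2| <= 8 / n%:R ^+ 2.
Proof.
move=> n0 g; have [x xE] : exists x : R, x = n%:R by eexists.
have x1 : 1 <= x by rewrite xE ler1n.
have x0 : 0 < x by lra.
have E1 : n.+1%:R = x + 1 by rewrite xE natr1.
have E2 : n.+2%:R = x + 2 by rewrite xE -!natr1; ring.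
rewrite /g E1 E2 -xE; set f0 := 1 - cos (x * th); set f1 := 1 - cos ((x + 1) * th); set f2 := 1 - cos ((x + 2) * th).
have f02 (y : R) : 0 <= 1 - cos y <= 2 by have := cos_le1 y; have := cos_geN1 y; lra.
have B0 := f02 (x * th); have B1 := f02 ((x + 1) * th); have B2 := f02 ((x + 2) * th).
rewrite -/f0 in B0; rewrite -/f1 in B1; rewrite -/f2 in B2.
have b1 : (x + 1) ^- 2 <= x ^- 2 by rewrite lef_pV2 ?posrE ?exprn_gt0 ?lerXn2r ?nnegrE//; lra.
have b2 : (x + 2) ^- 2 <= x ^- 2 by rewrite lef_pV2 ?posrE ?exprn_gt0 ?lerXn2r ?nnegrE//; lra.
have i0 : 0 < x ^- 2 by rewrite invr_gt0 exprn_gt0.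
have i1 : 0 < (x + 1) ^- 2 by rewrite invr_gt0 exprn_gt0//; lra.
have i2 : 0 < (x + 2) ^- 2 by rewrite invr_gt0 exprn_gt0//; lra.
split; last first.
  rewrite ler_norml; move: B0 B1 B2 b1 b2 i0 i1 i2.
  set a := x ^- 2; set b := (x + 1) ^- 2; set c := (x + 2) ^- 2; clear; nra.
have D : `|f0 - 2 * f1 + f2| <= 2 * th ^+ 2.
  have -> : f0 - 2 * f1 + f2 = - (2 * cos ((x + 1) * th) * (cos th - 1)).
    have e0 : x * th = (x + 1) * th - th by ring.
    have e2 : (x + 2) * th = (x + 1) * th + th by ring.
    by rewrite /f0 /f2 e0 e2 cosB cosD /f1; ring.
  rewrite normrN normrM; apply: ler_pM => //; last exact: cos_sub1.
  by rewrite normrM ger0_norm// ler_piMr// ler_norml cos_geN1 cos_le1.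
have F0 : f0 <= x ^+ 2 * th ^+ 2.
  by have := cos_sub1 (x * th); rewrite exprMn ler_norml /f0; lra.
have F20 : `|f2 - f0| <= 2 * (x + 1) * th ^+ 2.
  have -> : f2 - f0 = 2 * sin ((x + 1) * th) * sin th.
    have e0 : x * th = (x + 1) * th - th by ring.
    have e2 : (x + 2) * th = (x + 1) * th + th by ring.
    by rewrite /f0 /f2 e0 e2 cosB cosD; ring.
  rewrite -mulrA normrM ger0_norm// -mulrA ler_wpM2l// normrM.
  have -> : (x + 1) * th ^+ 2 = `|(x + 1) * th| * `|th|.
    by rewrite -normrM expr2 mulrA ger0_norm// -mulrA mulr_ge0// -?expr2 ?sqr_ge0//; lra.
  by apply: ler_pM => //; exact: abs_sin_le.
have t2 := sqr_ge0 th.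
have -> : f0 / x ^+ 2 - 2 * (f1 / (x + 1) ^+ 2) + f2 / (x + 2) ^+ 2 =
   (f0 - 2 * f1 + f2) / (x + 1) ^+ 2 + f0 * (x ^- 2 - 2 * (x + 1) ^- 2 + (x + 2) ^- 2)
   + (f2 - f0) * ((x + 2) ^- 2 - (x + 1) ^- 2) by ring.
have P1 : `|(f0 - 2 * f1 + f2) / (x + 1) ^+ 2| <= 2 * th ^+ 2 * x ^- 2.
  by rewrite normrM (gtr0_norm i1); apply: ler_pM => //; exact: ltW.
have [/andP[S1 S2] [S3 S4]] := inv_sqr_differences x0.
have P2 : `|f0 * (x ^- 2 - 2 * (x + 1) ^- 2 + (x + 2) ^- 2)| <= 6 * th ^+ 2 * x ^- 2.
  rewrite normrM (ger0_norm S1) ger0_norm; last by case/andP: B0.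
  have -> : 6 * th ^+ 2 * x ^- 2 = x ^+ 2 * th ^+ 2 * (6 * x ^- 4) by field; rewrite gt_eqF.
  by apply: ler_pM => //; case/andP: B0.
have P3 : `|(f2 - f0) * ((x + 2) ^- 2 - (x + 1) ^- 2)| <= 4 * th ^+ 2 * x ^- 2.
  rewrite normrM [X in _ * X]distrC (ger0_norm S3).
  apply: (le_trans (ler_wpM2r S3 F20)).
  have -> : 4 * th ^+ 2 * x ^- 2 = 2 * th ^+ 2 * (2 * x ^- 2) by ring.
  have -> : 2 * (x + 1) * th ^+ 2 * ((x + 1) ^- 2 - (x + 2) ^- 2) =
     2 * th ^+ 2 * ((x + 1) * ((x + 1) ^- 2 - (x + 2) ^- 2)) by ring.
  by rewrite ler_wpM2l// mulr_ge0.
apply: (le_trans (ler_normD _ _)); apply: (@le_trans _ _ (2 * th ^+ 2 * x ^- 2 + 6 * th ^+ 2 * x ^- 2 + 4 * th ^+ 2 * x ^- 2)).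
  by apply: lerD => //; apply: (le_trans (ler_normD _ _)); exact: lerD.
by rewrite le_eqVlt; apply/orP; left; apply/eqP; ring.
Qed.

Lemma sum_inv_sqr K n : (0 < K)%N -> \sum_(i < n) (K + i).+1%:R ^- 2 <= K%:R^-1 :> R.
Proof.
move=> K0; have KR : 0 < K%:R :> R by rewrite ltr0n.
suff : \sum_(i < n) (K + i).+1%:R ^- 2 <= K%:R^-1 - (K + n)%:R^-1 :> R.
  by move=> h; apply: (le_trans h); rewrite gerBl invr_ge0.
elim: n => [|n ih]; first by rewrite big_ord0 addn0 subrr.
rewrite big_ord_recr /= addnS; have m0 : 0 < (K + n)%:R :> R by rewrite ltr0n addn_gt0 K0.
set m := (K + n)%:R in ih m0 *; have -> : (K + n).+1%:R = m + 1 by rewrite /m natr1.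
have : (m + 1) ^- 2 <= m^-1 - (m + 1)^-1.
  have -> : m^-1 - (m + 1)^-1 = (m * (m + 1))^-1 by field; rewrite !gt_eqF//; lra.
  by rewrite lef_pV2 ?posrE ?mulr_gt0 ?exprn_gt0//; [rewrite expr2 ler_wpM2r|..]; lra.
by lra.
Qed.

(** Blocks of four are O(u^2 / i^2) and O(1 / i^2) with u = j / q; they telescope from K to the
    limit found in [fourier_near]. The shapes u^2 and u of the two bounds are the hypotheses of
    [lam_le], with constants independent of q. *)
Lemma fourier_tail q j K : (0 < q)%N -> (0 < K)%N ->
  `|Tent q j / q%:R - fourier q j (4 * K)| <= 48 * (j%:R / q%:R) ^+ 2 / K%:R /\
  `|Tent q j / q%:R - fourier q j (4 * K)| <= 48 * (j%:R / q%:R) / K%:R.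
Proof.
move=> q0 K0; have KR : 0 < K%:R :> R by rewrite ltr0n.
have qR : 0 < q%:R :> R by rewrite ltr0n.
have [u uE] : exists u : R, u = j%:R / q%:R by eexists.
have u0 : 0 <= u by rewrite uE divr_ge0.
have [th thE] : exists th : R, th = j%:R * (2 * pi / (4 * q)%:R) by eexists.
have thu : th ^+ 2 <= 4 * u ^+ 2.
  have -> : 4 * u ^+ 2 = (2 * u) ^+ 2 by ring.
  have t0 : 0 <= th by rewrite thE mulr_ge0// divr_ge0// mulr_ge0// pi_ge0.
  rewrite lerXn2r ?nnegrE ?mulr_ge0// thE uE natrM.
  have := pihalf_lt2 R; have [p <- p0] := pi_opaque R => p4.
  have -> : j%:R * (2 * p / (4 * q%:R)) = p / 2 * (j%:R / q%:R) by field; rewrite gt_eqF.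
  by rewrite ler_wpM2r ?divr_ge0// ltW.
pose g k : R := (1 - cos (k%:R * th)) / k%:R ^+ 2.
have blk i : fourier q j (4 * i.+1) - fourier q j (4 * i) =
    4 / pi ^+ 2 * (g (4 * i + 1)%N - 2 * g (4 * i + 2)%N + g (4 * i + 3)%N).
  have -> : (4 * i.+1 = 4 * i + 4)%N by rewrite mulnS addnC.
  rewrite /fourier big_split_ord /= [LHS]addrC addKr !big_ord_recl big_ord0 /= /bump /= !add1n addn0 addr0.
  rewrite -!(addnS (4 * i)) ?addn1.
  have [E1 E2 E3 E4] := e4_block R i; rewrite addn1 in E1; rewrite E1 E2 E3 E4 mul0r mul0r mulr0 addr0.
  have cE k : cosn (4 * q) (j * k) = cos (k%:R * th).
    by rewrite /cosn thE (natrM _ j k); congr cos; ring.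
  by rewrite !cE /g; ring.
have p41 : 0 <= 4 / (pi : R) ^+ 2 <= 1.
  rewrite divr_ge0 ?sqr_ge0//= ler_pdivrMr ?exprn_gt0 ?pi_gt0// expr2.
  by have := pi_ge2 R; nra.
have blkb i : `|fourier q j (4 * i.+1) - fourier q j (4 * i)| <= 48 * u ^+ 2 * i.+1%:R ^- 2 /\
   `|fourier q j (4 * i.+1) - fourier q j (4 * i)| <= 8 * i.+1%:R ^- 2.
  have n0 : (0 < 4 * i + 1)%N by rewrite addn1.
  have [h1 h2] := second_difference th n0; rewrite /= -/(g _) -addnS -/(g _) -!addnS -/(g _) in h1 h2.
  have ii : (4 * i + 1)%:R ^- 2 <= i.+1%:R ^- 2 :> R.
    rewrite lef_pV2 ?posrE ?exprn_gt0 ?ltr0n// lerXn2r ?nnegrE// ler_nat.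
    by rewrite addn1 ltnS leq_pmull.
  rewrite blk normrM (ger0_norm (andP p41).1).
  set G := `|_| in h1 h2 *; have G0 : 0 <= G by rewrite normr_ge0.
  have GG : 4 / pi ^+ 2 * G <= G by rewrite ler_piMl// (andP p41).2.
  split; apply: (le_trans GG); [apply: (le_trans h1)|apply: (le_trans h2)].
    have -> : 48 * u ^+ 2 = 12 * (4 * u ^+ 2) by ring.
    have t1 : 0 <= 12 * th ^+ 2 by rewrite mulr_ge0 ?sqr_ge0.
    have t2 : 0 <= (4 * i + 1)%:R ^- 2 :> R by rewrite invr_ge0 exprn_ge0.
    have t3 : 12 * th ^+ 2 <= 12 * (4 * u ^+ 2) by rewrite ler_wpM2l.
    exact: ler_pM.
  by rewrite ler_wpM2l.
have tel (B : R) : (forall i, `|fourier q j (4 * i.+1) - fourier q j (4 * i)| <= B * i.+1%:R ^- 2) -> 0 <= B ->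
    forall n, `|fourier q j (4 * (K + n)) - fourier q j (4 * K)| <= B / K%:R.
  move=> hB B0 n; apply: (@le_trans _ _ (B * \sum_(i < n) (K + i).+1%:R ^- 2)); last first.
    by rewrite ler_wpM2l// sum_inv_sqr.
  elim: n => [|n ih]; first by rewrite addn0 subrr normr0 big_ord0 mulr0.
  rewrite big_ord_recr /= mulrDr [leRHS]addrC addnS -(subrK (fourier q j (4 * (K + n))) (fourier q j _)) -addrA.
  by apply: (le_trans (ler_normD _ _)); apply: lerD; [exact: hB|exact: ih].
have fin (B : R) : (forall i, `|fourier q j (4 * i.+1) - fourier q j (4 * i)| <= B * i.+1%:R ^- 2) -> 0 <= B ->
    `|Tent q j / q%:R - fourier q j (4 * K)| <= B / K%:R.
  move=> hB B0; apply/ler_addgt0Pl => e e0; have [m0 hm] := fourier_near j q0 e0.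
  pose m := (m0 + K)%N; have := hm m (leq_addr _ _).
  have Kq : (K <= q * m)%N by rewrite (@leq_trans m) ?leq_addl// leq_pmull.
  have := tel B hB B0 (q * m - K)%N; rewrite subnKC// mulnA => h1 h2.
  rewrite -(subrK (fourier q j (4 * q * m)) (Tent q j / _)) -addrA.
  by apply: (le_trans (ler_normD _ _)); apply: lerD.
have b1 := fin _ (fun i => (blkb i).1) (mulr_ge0 (ler0n R 48) (sqr_ge0 u)).
have b2 := fin _ (fun i => (blkb i).2) (ler0n R 8).
rewrite -uE; split => //; have [u1|u1] := leP u 1.
  apply: (le_trans b1); rewrite ler_wpM2r ?invr_ge0 ?(ltW KR)// ler_wpM2l//.
  by rewrite expr2 ler_piMr.
apply: (le_trans b2); rewrite ler_wpM2r ?invr_ge0 ?(ltW KR)//; move: u1; clear; lra.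
Qed.

End FourierTail.

(** * A discrete Mellin transform *)

Section FunctionalEquation.
Variable R : realType.
Local Open Scope complex_scope.
Local Notation C := R[i].
Local Notation dm := (@dirichlet_monomial R).
Implicit Types (s w z : C).

Lemma cto_absolute (a : nat -> C) (b : nat -> R) : (forall k, nc (a k) <= b k) ->
  (forall e : R, 0 < e -> exists m0, forall m n, (m0 <= m)%N -> \sum_(k < n) b (m + k)%N <= e) ->
  exists l, cto (fun J => \sum_(k < J) a k) l.
Proof.
move=> ab hb; apply: cto_cauchy => e e0; have [m0 hm] := hb e e0.
have key m n : (m0 <= m)%N -> (m <= n)%N -> nc (\sum_(k < n) a k - \sum_(k < m) a k) <= e.
  move=> mm mn; rewrite -(subnKC mn) big_split_ord /= addDKl.
  apply: (le_trans (nc_sum _ _ _)); apply: le_trans (hm m (n - m)%N mm).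
  by apply: ler_sum => k _; exact: ab.
exists m0 => m n mm nn; have [mn|nm] := leqP m n; last exact: key (ltnW nm).
by rewrite nc_sym; exact: key.
Qed.

Lemma powR_sum_small (a : R) q : 0 < a -> a < 1 ->
  \sum_(j < q) j.+1%:R `^ (- a) <= 2 / (1 - a) * q%:R `^ (1 - a).
Proof.
move=> a0 a1; have b0 : 0 < 1 - a by lra.
elim: q => [|q ih]; first by rewrite big_ord0 mulr_ge0 ?powR_ge0// divr_ge0// ltW.
rewrite big_ord_recr /=; have [n nE'] : exists n : R, n = q.+1%:R by eexists.
rewrite -nE'; have n0 : 0 < n by rewrite nE' ltr0n.
have n1 : 1 <= n by rewrite nE' ler1n.
suff : n `^ (- a) <= 2 / (1 - a) * (n `^ (1 - a) - q%:R `^ (1 - a)) by move: ih; lra.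
have nE : n `^ (1 - a) = n * n `^ (- a) by rewrite powRDp// powRr1// ltW.
have qn : q%:R `^ (1 - a) <= n `^ (1 - a) * (1 - (1 - a) / (2 * n)).
  have [->|q0] := posnP q.
    rewrite powR0 ?gt_eqF// mulr_ge0 ?powR_ge0// subr_ge0 ler_pdivrMr ?mulr_gt0//; lra.
  have qR : 0 < q%:R :> R by rewrite ltr0n.
  rewrite powRE// (powRE _ n0).
  have h : (1 - a) * ln q%:R <= (1 - a) * ln n - (1 - a) / n.
    have := @ln_sub1_le R (q%:R / n) ltac:(by rewrite divr_gt0); rewrite ln_div ?posrE//.
    have -> : q%:R / n - 1 = - n^-1 by rewrite nE' -natr1; field; rewrite natr1 pnatr_eq0.
    by move=> h; have := ler_wpM2l (ltW b0) h; lra.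
  apply: (@le_trans _ _ (expR ((1 - a) * ln n - (1 - a) / n))); first by rewrite ler_expR.
  rewrite expRD ler_wpM2l ?expR_ge0//; set x := (1 - a) / n.
  have x0 : 0 < x by rewrite divr_gt0.
  have x1 : x <= 1 by rewrite ler_pdivrMr//; lra.
  have -> : (1 - a) / (2 * n) = x / 2 by rewrite /x; field; rewrite gt_eqF.
  rewrite expRN -[X in X <= _]mul1r ler_pdivrMr ?expR_gt0//.
  have e1 := expR_ge1Dx x; have x2 : 0 <= 1 - x / 2 by lra.
  by apply: le_trans (ler_wpM2l x2 e1); nra.
rewrite -ler_pdivrMl ?divr_gt0// invf_div.
have -> : (1 - a) / 2 * n `^ (- a) = n `^ (1 - a) * ((1 - a) / (2 * n)).
  by rewrite nE; field; rewrite gt_eqF.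
by move: qn; lra.
Qed.

Lemma cos_sum_diff (x y : R) : cos (x + y) - cos (x - y) = - (2 * (sin x * sin y)).
Proof.
by rewrite cosD cosB; ring.
Qed.

Lemma dm_step w m : (0 < m)%N -> 0 <= complex.Re w ->
  nc (dm w m.+1 - dm w m) <= (vbound (w + 1) + nc w) * m%:R `^ (- complex.Re w - 1).
Proof.
move=> m0 w0; have := @vterm_bound R m (w + 1) m0; rewrite ReD /= => h.
have -> : dm w m.+1 - dm w m = vterm m (w + 1) - w * dm (w + 1) m.
  by rewrite /vterm addrK; ring.
apply: (le_trans (ncB _ _)); rewrite mulrDl; apply: lerD.
  apply: le_trans (h _) _; first by lra.
  rewrite ler_wpM2l ?vbound_ge0// ler_powR ?ler1n//; lra.
by rewrite ncM nc_dm// ReD /= opprD.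
Qed.

Lemma dmNK s n : (0 < n)%N -> dm (- s) n * dm s n = 1.
Proof.
by move=> n0; rewrite -dmD addNr /dirichlet_monomial oppr0 mul0r cexp0.
Qed.

Lemma sum_blocks (V : nmodType) (F : nat -> V) k I :
  \sum_(j < k * I) F j = \sum_(i < I) \sum_(t < k) F (k * i + t)%N.
Proof.
elim: I => [|I ih]; first by rewrite muln0 !big_ord0.
by rewrite mulnS addnC big_split_ord /= ih big_ord_recr.
Qed.

Variable s : C.
Hypothesis s0 : 0 < complex.Re s.
Hypothesis s1 : complex.Re s < 1.
Local Notation sg := (complex.Re s).
Local Notation w := (s + 2).

(* A discrete Mellin transform: up to normalization it maps [(j - n q)^+] to [n^(-s)]
   and [1 - cos (pi j k / (2 q))] to [k^(s+1)]. *)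
Definition lam_sum (h : nat -> R) J : C := \sum_(j < J) (h j.+1)%:C * dm w j.+1.

Definition lam h : C := xget 0 [set l | cto (lam_sum h) l]%classic.

Lemma Re_w : complex.Re w = sg + 2.
Proof.
by rewrite ReD.
Qed.

Lemma Re_s1 : complex.Re (s + 1) = sg + 1.
Proof.
by rewrite ReD.
Qed.

Lemma nc_lam_term (h : nat -> R) j : nc ((h j.+1)%:C * dm w j.+1) = `|h j.+1| * j.+1%:R `^ (- sg - 2).
Proof.
have sp := s0; have sl := s1.
by rewrite ncM nc_real nc_dm// Re_w opprD.
Qed.

Lemma powR_up (x : R) : 0 < x -> x * x `^ (- sg - 2) = x `^ (- sg - 1).
Proof.
have sp := s0; have sl := s1.
move=> x0; have -> : - sg - 1 = 1 + (- sg - 2) by ring.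
by rewrite [RHS]powRDp// powRr1 ?(ltW x0).
Qed.

Lemma powR_up2 (x : R) : 0 < x -> x ^+ 2 * x `^ (- sg - 2) = x `^ (- sg).
Proof.
have sp := s0; have sl := s1.
move=> x0; rewrite expr2 -mulrA powR_up//; rewrite [in RHS](_ : - sg = 1 + (- sg - 1)); last by ring.
by rewrite [RHS]powRDp// powRr1 ?(ltW x0).
Qed.

Lemma lamP (h : nat -> R) (c : R) : 0 <= c -> (forall j, `|h j| <= c * j%:R) -> cto (lam_sum h) (lam h).
Proof.
have sp := s0; have sl := s1.
move=> c0 hc; have [l hl] : exists l, cto (lam_sum h) l.
  apply: (@cto_absolute (fun j => (h j.+1)%:C * dm w j.+1) (fun j => c * j.+1%:R `^ (- (sg + 1)))) => [k|e e0].
    rewrite nc_lam_term; have -> : - (sg + 1) = - sg - 1 by ring.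
    by rewrite -powR_up// mulrA ler_wpM2r ?powR_ge0.
  have c1 : 0 < c + 1 by lra.
  have [m0 hm] := @powR_tail_small_ge R (sg + 1) ltac:(lra) (e / (c + 1)) ltac:(by rewrite divr_gt0).
  exists m0 => m n mm; rewrite -mulr_sumr; apply: (@le_trans _ _ (c * (e / (c + 1)))).
    by rewrite ler_wpM2l// hm.
  by rewrite mulrA ler_pdivrMr//; nra.
by rewrite /lam; case: xgetP => [y _ //|/(_ l)].
Qed.

Definition lam_const : R := 2 / (1 - sg) + sg^-1.

Lemma lam_const_ge0 : 0 <= lam_const.
Proof.
have sp := s0; have sl := s1.
by rewrite addr_ge0 ?invr_ge0 ?(ltW s0)// divr_ge0//; lra.
Qed.

(** The sum is split at j = q. Below, the quadratic bound leaves the terms j^(-Re s), whose sum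
    grows; above, the linear one leaves j^(-Re s - 1), whose series converges. The strip 0 < Re s <
    1 is used on both sides. *)
Lemma lam_le (h : nat -> R) (c : R) q : (0 < q)%N -> 0 <= c ->
  (forall j, `|h j| <= c * (j%:R / q%:R) ^+ 2) -> (forall j, `|h j| <= c * (j%:R / q%:R)) ->
  nc (lam h) <= c * lam_const * q%:R `^ (- sg - 1).
Proof.
have sp := s0; have sl := s1.
move=> q0 c0 h2 h1; have qR : 0 < q%:R :> R by rewrite ltr0n.
have hP : cto (lam_sum h) (lam h).
  apply: (@lamP _ (c / q%:R)); first by rewrite divr_ge0 ?(ltW qR).
  by move=> j; apply: (le_trans (h1 j)); rewrite mulrA mulrAC.
apply: cto_norm_le hP; exists q => J qJ; rewrite /lam_sum -(subnKC qJ) big_split_ord /=.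
apply: (le_trans (ncD _ _)).
have -> : c * lam_const * q%:R `^ (- sg - 1) = c * q%:R ^- 2 * (2 / (1 - sg) * q%:R `^ (1 - sg))
   + c / q%:R * (q%:R `^ (- sg) / sg).
  have -> : q%:R `^ (1 - sg) = q%:R ^+ 2 * q%:R `^ (- sg - 1).
    have -> : 1 - sg = 2 + (- sg - 1) by ring.
    by rewrite powRDp// -[X in _ `^ X]/(2%:R) powR_mulrn ?(ltW qR).
  have -> : q%:R `^ (- sg) = q%:R * q%:R `^ (- sg - 1).
    by rewrite -[in LHS](subrK 1 (- sg)) addrC powRDp// powRr1// ltW.
  rewrite /lam_const; field; rewrite !gt_eqF//; lra.
apply: lerD.
  apply: (le_trans (nc_sum _ _ _)); apply: (@le_trans _ _ (\sum_(j < q) c * q%:R ^- 2 * j.+1%:R `^ (- sg))).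
    apply: ler_sum => j _; rewrite nc_lam_term -powR_up2// mulrA ler_wpM2r ?powR_ge0//.
    by apply: (le_trans (h2 _)); rewrite expr_div_n mulrA mulrAC.
  by rewrite -mulr_sumr ler_wpM2l ?powR_sum_small// mulr_ge0// invr_ge0 exprn_ge0// ltW.
apply: (le_trans (nc_sum _ _ _)).
apply: (@le_trans _ _ (\sum_(j < J - q) c / q%:R * (q + j).+1%:R `^ (- sg - 1))).
  apply: ler_sum => j _; rewrite nc_lam_term -powR_up// mulrA ler_wpM2r ?powR_ge0//.
  by apply: (le_trans (h1 _)); rewrite mulrA mulrAC.
rewrite -mulr_sumr ler_wpM2l ?divr_ge0 ?(ltW qR)//.
apply: le_trans (@powR_sum_tail R sg q (J - q) s0 q0).
by rewrite -[X in \sum_(X <= _ < _) _]add0n big_addn addKn big_mkord le_eqVlt; apply/orP; left;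
  apply/eqP; apply: eq_bigr => i _; rewrite [(i + _)%N]addnC.
Qed.

Lemma lam_lin (I : Type) (r : seq I) (a : I -> R) (H : I -> nat -> R) (c : I -> R) h :
  (forall i, 0 <= c i) -> (forall i j, `|H i j| <= c i * j%:R) ->
  (forall j, h j = \sum_(i <- r) a i * H i j) ->
  lam h = \sum_(i <- r) (a i)%:C * lam (H i).
Proof.
have sp := s0; have sl := s1.
move=> c0 cH hE; have h1 : cto (lam_sum h) (\sum_(i <- r) (a i)%:C * lam (H i)).
  have := cto_sum r (fun i => ctoZ (a i)%:C (lamP (c0 i) (cH i))).
  apply: cto_ext => J; rewrite /lam_sum; under eq_bigr => i _ do rewrite mulr_sumr.
  rewrite exchange_big /=; apply: eq_bigr => j _; rewrite hE rmorph_sum mulr_suml.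
  by apply: eq_bigr => i _; rewrite rmorphM mulrA.
by rewrite /lam; case: xgetP => [y _ hy|/(_ _ h1)//]; exact: cto_uniq hy h1.
Qed.

Lemma lamB (h h' : nat -> R) (c c' : R) : 0 <= c -> 0 <= c' ->
  (forall j, `|h j| <= c * j%:R) -> (forall j, `|h' j| <= c' * j%:R) ->
  lam h - lam h' = lam (fun j => h j - h' j).
Proof.
have sp := s0; have sl := s1.
move=> c0 c0' hc hc'.
have h1 : cto (lam_sum (fun j => h j - h' j)) (lam h - lam h').
  have := ctoB (lamP c0 hc) (lamP c0' hc'); apply: cto_ext => J.
  rewrite /lam_sum -sumrB; apply: eq_bigr => j _; rewrite rmorphB mulrBl//.
by apply/esym; rewrite {1}/lam; case: xgetP => [y _ hy|/(_ _ h1)//]; exact: cto_uniq hy h1.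
Qed.

(** The discrete form of the integral of (x - Q) x^(-s-2) over x > Q, which is Q^(-s) / (s (s + 1)).
    The sum is expressed by tails of zeta(s + 1) and zeta(s + 2), to which [dm_partial_sum]
    applies. *)
Lemma lam_shift : exists2 K : R, 0 <= K & forall Q, (0 < Q)%N ->
  nc (dm (- s) Q * lam (fun j => (j - Q)%N%:R) - (s * (s + 1))^-1) <= K / Q%:R.
Proof.
have sp := s0; have sl := s1.
have nz : s != 0 by apply/eqP => e; move: s0; rewrite e /= ltxx.
have nz1 : s + 1 != 0.
  by apply/eqP => /(congr1 (@complex.Re R)); rewrite Re_s1 /= => e; lra.
have R1 : 0 < complex.Re (s + 1) by rewrite Re_s1; lra.
have R2 : 0 < complex.Re w by rewrite Re_w; lra.
pose K1 := vbound (s + 1) / complex.Re (s + 1) + vbound (s + 1) + nc (s + 1 - 1).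
pose K2 := vbound w / complex.Re w + vbound w + nc (w - 1).
have K10 : 0 <= K1 by rewrite !addr_ge0 ?nc_ge0 ?vbound_ge0// divr_ge0 ?vbound_ge0// ltW.
have K20 : 0 <= K2 by rewrite !addr_ge0 ?nc_ge0 ?vbound_ge0// divr_ge0 ?vbound_ge0// ltW.
pose N := nc (s * (s + 1))^-1; have N0 : 0 <= N by rewrite nc_ge0.
exists (N * (nc (s + 1) * K1 + nc s * K2)); first by rewrite mulr_ge0// addr_ge0// mulr_ge0// nc_ge0.
move=> Q Q0; have QR : 0 < Q%:R :> R by rewrite ltr0n.
pose Z v J : C := \sum_(k < J) dm v k.+1.
have lamE : lam (fun j => (j - Q)%N%:R) = (zeta0 (s + 1) - Z (s + 1) Q) - Q%:R * (zeta0 w - Z w Q).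
  have hP : cto (lam_sum (fun j => (j - Q)%N%:R)) (lam (fun j => (j - Q)%N%:R)).
    by apply: (@lamP _ 1) => // j; rewrite ger0_norm// mul1r ler_nat leq_subr.
  apply: cto_uniq hP _.
  have c1 := ctoB (@zeta_series R (s + 1) ltac:(rewrite Re_s1; lra)) (cto_cst (Z (s + 1) Q)).
  have c2 := ctoZ (Q%:R : C) (ctoB (@zeta_series R w ltac:(rewrite Re_w; lra)) (cto_cst (Z w Q))).
  move=> e e0; have [J0 hJ] := ctoB c1 c2 e0; exists (maxn J0 Q) => J; rewrite geq_max => /andP[JJ QJ].
  have -> : lam_sum (fun j => (j - Q)%N%:R) J = Z (s + 1) J - Z (s + 1) Q - Q%:R * (Z w J - Z w Q).
    rewrite /lam_sum /Z -(subnKC QJ) !big_split_ord /= big1 ?add0r => [|i _].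
      rewrite 2!addDKl mulr_sumr -sumrB; apply: eq_bigr => j _.
      have -> : s + 1 = w - 1 by ring.
      rewrite dm_sub1// -mulrBl; congr (_ * _); rewrite rmorph_nat natrB// -addnS leq_addr//.
    by rewrite (_ : (i.+1 - Q = 0)%N) ?mul0r//; apply/eqP; rewrite subn_eq0.
  exact: hJ.
have h1 := dm_partial_sum R1 Q0; have h2 := dm_partial_sum R2 Q0; rewrite -/K1 in h1; rewrite -/K2 in h2.
have E1 : Efun (s + 1) = s * zeta0 (s + 1).
  by rewrite /zeta0 addrK mulrC divfK.
have E2 : Efun w = (s + 1) * zeta0 w.
  by rewrite /zeta0 (_ : w - 1 = s + 1) 1?mulrC ?divfK//; ring.
set X1 := _ - _ in h1; set X2 := _ - _ in h2.
have X1E : X1 = s * Z (s + 1) Q - (s * zeta0 (s + 1) - dm s Q) by rewrite /X1 E1 addrK.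
have X2E : X2 = (s + 1) * Z w Q - ((s + 1) * zeta0 w - dm (s + 1) Q).
  by rewrite /X2 E2 (_ : w - 1 = s + 1)//; ring.
have -> : dm (- s) Q * lam (fun j => (j - Q)%N%:R) - (s * (s + 1))^-1 =
   (s * (s + 1))^-1 * (dm (- s) Q * (- (s + 1) * X1 + Q%:R * (s * X2))).
  have q1 : dm s Q = Q%:R * dm (s + 1) Q by rewrite -dm_sub1// addrK.
  have q2 := dmNK s Q0; rewrite lamE X1E X2E q1; rewrite q1 in q2.
  set a := dm (- s) Q in q2 *; set b := dm (s + 1) Q in q2 *.
  have e : (s * (s + 1))^-1 = (s * (s + 1))^-1 * (a * (Q%:R * b)) by rewrite q2 mulr1.
  rewrite [X in _ - X]e.
  by field; rewrite nz nz1.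
rewrite ncM -/N -[leRHS]mulrA ler_wpM2l// ncM nc_dm//.
have -> : complex.Re (- s) = - sg by case: (s).
rewrite opprK; apply: (@le_trans _ _ (Q%:R `^ sg * ((nc (s + 1) * K1 + nc s * K2) * Q%:R `^ (- sg - 1)))).
  rewrite ler_wpM2l ?powR_ge0//; apply: (le_trans (ncD _ _)); rewrite mulrDl; apply: lerD.
    by rewrite ncM ncN -mulrA ler_wpM2l ?nc_ge0// (le_trans h1)// ReD /= opprD.
  rewrite ncM nc_nat ncM mulrCA -mulrA ler_wpM2l ?nc_ge0//.
  rewrite -powR_up// mulrCA ler_wpM2l ?(ltW QR)//; apply: (le_trans h2).
  by rewrite Re_w opprD.
have -> : - sg - 1 = - (1 + sg) by ring.
rewrite mulrCA -powRDp// (_ : sg + - (1 + sg) = - 1) ?powR_inv1 ?(ltW QR)//; ring.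
Qed.

Definition gam (al : R) : C := lam (fun j => 1 - cos (j%:R * al)).

Lemma gam_lin (al : R) : 0 <= al -> forall j : nat, `|1 - cos (j%:R * al)| <= al * j%:R + 2 * j%:R.
Proof.
have sp := s0; have sl := s1.
move=> a0 j; have c1 := cos_le1 (j%:R * al); have c2 := cos_geN1 (j%:R * al).
rewrite ger0_norm; last by lra.
case: j c1 c2 => [|j] c1 c2; first by rewrite mul0r cos0 !mulr0; lra.
have j1 : 1 <= j.+1%:R :> R by rewrite ler1n.
have : 0 <= al * j.+1%:R by rewrite mulr_ge0.
by move: c1 c2; lra.
Qed.

Lemma gamP (al : R) : 0 <= al -> cto (lam_sum (fun j => 1 - cos (j%:R * al))) (gam al).
Proof.
have sp := s0; have sl := s1.
move=> a0; apply: (@lamP _ (al + 2)); first by lra.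
by move=> j; rewrite mulrDl; exact: gam_lin.
Qed.

Lemma gam_bound q (al : R) : (0 < q)%N -> 0 <= al -> al <= 2 / q%:R ->
  nc (gam al) <= 4 * lam_const * q%:R `^ (- sg - 1).
Proof.
have sp := s0; have sl := s1.
move=> q0 a0 aq; have qR : 0 < q%:R :> R by rewrite ltr0n.
have b (j : nat) : `|1 - cos (j%:R * al)| <= 4 * (j%:R / q%:R) ^+ 2.
  have := cos_sub1 (j%:R * al); rewrite distrC => /le_trans; apply.
  have -> : 4 * (j%:R / q%:R) ^+ 2 = (j%:R * (2 / q%:R)) ^+ 2 :> R by ring.
  by rewrite lerXn2r ?nnegrE ?mulr_ge0 ?divr_ge0 ?(ltW qR)// ler_wpM2l.
apply: lam_le => // j; have u0 : 0 <= j%:R / q%:R :> R by rewrite divr_ge0 ?(ltW qR).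
have [u1|u1] := leP (j%:R / q%:R) (1 : R).
  apply: (le_trans (b j)); rewrite ler_wpM2l// expr2 ler_piMr//.
have c1 := cos_le1 (j%:R * al); have c2 := cos_geN1 (j%:R * al).
by rewrite ger0_norm; lra.
Qed.

(** Homogeneity of degree s + 1 up to O(al^2). Each block of k consecutive terms is compared with k
    copies of its last term, and those sum to the transform at angle k al. The Gamma factor thus
    enters only through [gam al], which [gam_bound] controls. *)
Lemma gam_scale k : (0 < k)%N -> exists2 K : R, 0 <= K & forall al : R, 0 <= al ->
  nc (dm (- (s + 1)) k * gam al - gam (k%:R * al)) <= K * al ^+ 2.
Proof.
have sp := s0; have sl := s1.
move=> k0; have kR : 0 < k%:R :> R by rewrite ltr0n.
pose Kw := vbound (w + 1) + nc w; have Kw0 : 0 <= Kw by rewrite addr_ge0 ?vbound_ge0 ?nc_ge0.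
pose A : R := k%:R ^+ 2 + k%:R ^+ 3 * Kw; have A0 : 0 <= A by rewrite addr_ge0 ?mulr_ge0 ?exprn_ge0.
pose P : R := k%:R `^ (sg + 1); have P0 : 0 <= P by rewrite powR_ge0.
have Rw : 0 <= complex.Re w by rewrite Re_w; lra.
exists (P * (k%:R * A * (1 + sg^-1))).
  by rewrite !mulr_ge0// addr_ge0// invr_ge0 ltW.
move=> al a0; have ka0 : 0 <= k%:R * al by rewrite mulr_ge0.
have c1 := ctoZ (dm (- (s + 1)) k) (gamP a0); have c2 := gamP ka0.
have c3 : cto (fun I => dm (- (s + 1)) k * lam_sum (fun j => 1 - cos (j%:R * al)) (k * I)%N
   - lam_sum (fun j => 1 - cos (j%:R * (k%:R * al))) I) (dm (- (s + 1)) k * gam al - gam (k%:R * al)).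
  apply: ctoB c2; apply: (cto_sub (g := fun I => (k * I)%N) _ c1) => I; exact: leq_pmull.
apply: cto_norm_le c3; exists 0%N => I _.
pose f m : R := 1 - cos (m%:R * al).
have stepw m t : (0 < m)%N -> nc (dm w (m + t) - dm w m) <= t%:R * Kw * m%:R `^ (- sg - 3).
  move=> m0; elim: t => [|t ih]; first by rewrite addn0 subrr nc0 !mul0r.
  rewrite addnS -(subrK (dm w (m + t)) (dm w (m + t).+1)) -addrA.
  apply: (le_trans (ncD _ _)); rewrite -[t.+1%:R]natr1 2!mulrDl mul1r [leRHS]addrC; apply: lerD => //.
  have mt : (0 < m + t)%N by rewrite addn_gt0 m0.
  apply: (le_trans (dm_step mt Rw)); rewrite -/Kw ler_wpM2l// Re_w.
  have -> : - (sg + 2) - 1 = - (sg + 3) by ring.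
  have -> : - sg - 3 = - (sg + 3) by ring.
  by apply: ler_powR_neg; rewrite ?ltr0n ?ler_nat ?leq_addr//; lra.
have term i (t : nat) : (t < k)%N ->
   nc ((f (k * i + t).+1)%:C * dm w (k * i + t).+1 - (f (k * i.+1)%N)%:C * dm w (k * i.+1)) <=
   A * al ^+ 2 * i.+1%:R `^ (- sg - 1).
  move=> tk; set m := (k * i + t).+1; have iR : 0 < i.+1%:R :> R by rewrite ltr0n.
  have im : (i.+1 <= m)%N by rewrite ltnS (leq_trans _ (leq_addr _ _))// leq_pmull.
  have mk : (m <= k * i.+1)%N by rewrite /m mulnS; move: tk; clear; lia.
  have -> : (f m)%:C * dm w m - (f (k * i.+1)%N)%:C * dm w (k * i.+1) =
    (f m - f (k * i.+1)%N)%:C * dm w m - (f (k * i.+1)%N)%:C * (dm w (k * i.+1) - dm w m).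
    have hC : (f m - f (k * i.+1)%N)%:C = (f m)%:C - (f (k * i.+1)%N)%:C :> C by rewrite rmorphB.
    by rewrite hC; ring.
  apply: (le_trans (ncB _ _)); rewrite (ncM (f m - _)%:C) (ncM (f (k * i.+1)%N)%:C) !nc_real /A 2!mulrDl; apply: lerD.
    rewrite nc_dm// Re_w -powR_up// mulrA; apply: ler_pM; rewrite ?normr_ge0 ?powR_ge0//.
      have mE : m%:R * al = (k * i.+1)%:R * al - (k * i.+1 - m)%N%:R * al by rewrite natrB//; ring.
      set a := (k * i.+1)%:R * al in mE *; set b := (k * i.+1 - m)%N%:R * al in mE.
      have a00 : 0 <= a by rewrite mulr_ge0.
      have b0 : 0 <= b by rewrite mulr_ge0.
      have ma0 : 0 <= m%:R * al by rewrite mulr_ge0.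
      have ba : b <= a by rewrite -subr_ge0 -mE.
      have -> : f m - f (k * i.+1)%N = cos a - cos (a - b) by rewrite /f mE -/a; ring.
      have -> : cos a - cos (a - b) = - (2 * (sin (a - b / 2) * sin (b / 2))).
        have e1 : cos a = cos ((a - b / 2) + b / 2) by congr cos; ring.
        have e2 : cos (a - b) = cos ((a - b / 2) - b / 2) by congr cos; field.
        by rewrite e1 e2 cos_sum_diff.
      rewrite normrN normrM ger0_norm// normrM.
      apply: (@le_trans _ _ (2 * (a * (b / 2)))).
        rewrite ler_wpM2l//; apply: ler_pM => //.
          by apply: (le_trans (abs_sin_le _)); rewrite ger0_norm; lra.
        by apply: (le_trans (abs_sin_le _)); rewrite ger0_norm; lra.
      have -> : 2 * (a * (b / 2)) = a * b by field.
      have bk : b <= k%:R * al.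
        rewrite /b ler_wpM2r// ler_nat /m mulnS; move: tk; clear; lia.
      apply: (@le_trans _ _ (a * (k%:R * al))); first by rewrite ler_wpM2l.
      by rewrite /a natrM expr2 le_eqVlt; apply/orP; left; apply/eqP; ring.
    have -> : - sg - 2 = - (sg + 2) by ring.
    by apply: ler_powR_neg; rewrite ?ler_nat//; lra.
  apply: (@le_trans _ _ ((k%:R * i.+1%:R * al) ^+ 2 * (k%:R * Kw * i.+1%:R `^ (- sg - 3)))).
    apply: ler_pM => //; first exact: nc_ge0.
      by rewrite -(natrM _ k); have := cos_sub1 ((k * i.+1)%:R * al : R); rewrite distrC.
    rewrite -{1}(subnKC mk); apply: (le_trans (stepw m _ isT)).
    have -> : - sg - 3 = - (sg + 3) by ring.
    apply: ler_pM; rewrite ?mulr_ge0 ?powR_ge0//.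
      by rewrite ler_wpM2r// ler_nat /m mulnS; move: tk; clear; lia.
    by apply: ler_powR_neg; rewrite ?ler_nat//; lra.
  have -> : i.+1%:R `^ (- sg - 1) = i.+1%:R ^+ 2 * i.+1%:R `^ (- sg - 3).
    have -> : - sg - 1 = 2 + (- sg - 3) by ring.
    by rewrite powRDp// -[X in _ `^ X]/(2%:R) powR_mulrn.
  by rewrite le_eqVlt; apply/orP; left; apply/eqP; ring.
have LE : lam_sum (fun j => 1 - cos (j%:R * al)) (k * I)%N =
    \sum_(i < I) \sum_(t < k) (1 - cos ((k * i + t).+1%:R * al))%:C * dm w (k * i + t).+1.
  exact: (sum_blocks (fun j => (1 - cos (j.+1%:R * al))%:C * dm w j.+1)).
rewrite LE.
have -> : dm (- (s + 1)) k * (\sum_(i < I) \sum_(t < k) (1 - cos ((k * i + t).+1%:R * al))%:C * dm w (k * i + t).+1)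
   - lam_sum (fun j => 1 - cos (j%:R * (k%:R * al))) I =
   dm (- (s + 1)) k * (\sum_(i < I) \sum_(t < k) ((f (k * i + t).+1)%:C * dm w (k * i + t).+1 - (f (k * i.+1)%N)%:C * dm w (k * i.+1))).
  rewrite !mulr_sumr -sumrB; apply: eq_bigr => i _; rewrite sumrB mulrBr; congr (_ - _).
  rewrite sumr_const card_ord -[X in _ = _ * X]mulr_natl dmM// /f (natrM _ k i.+1).
  have -> : i.+1%:R * (k%:R * al) = k%:R * i.+1%:R * al by ring.
  have e1 : dm (- (s + 1)) k * (k%:R * dm w k) = 1.
    by rewrite -dm_sub1// (_ : w - 1 = s + 1) ?dmNK//; ring.
  set x := (1 - cos _)%:C; transitivity ((dm (- (s + 1)) k * (k%:R * dm w k)) * (x * dm w i.+1)); first by rewrite e1 mul1r.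
  by ring.
rewrite ncM nc_dm//.
have -> : complex.Re (- (s + 1)) = - (sg + 1) by case: (s) => a b /=.
rewrite opprK -/P -mulrA ler_wpM2l//.
apply: (le_trans (nc_sum _ _ _)).
apply: (@le_trans _ _ (\sum_(i < I) k%:R * (A * al ^+ 2) * i.+1%:R `^ (- sg - 1))).
  apply: ler_sum => i _; apply: (le_trans (nc_sum _ _ _)).
  apply: (@le_trans _ _ (\sum_(t < k) A * al ^+ 2 * i.+1%:R `^ (- sg - 1))).
    by apply: ler_sum => t _; exact: term.
  by rewrite sumr_const card_ord -[leLHS]mulr_natl mulrA.
rewrite -mulr_sumr.
have -> : k%:R * A * (1 + sg^-1) * al ^+ 2 = k%:R * (A * al ^+ 2) * (1 + sg^-1) by ring.
rewrite ler_wpM2l ?mulr_ge0 ?sqr_ge0//.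
case: I {LE} => [|I]; first by rewrite big_ord0 addr_ge0// invr_ge0 ltW.
rewrite big_ord_recl powR1 lerD2l.
have := @powR_sum_tail R sg 1 I s0 isT; rewrite powR1 big_add1 /= big_mkord mul1r => h.
by apply: le_trans h; apply: ler_sum.
Qed.

End FunctionalEquation.

(** * Transfer of zeros from 1 - s to s *)

Section FunctionalEquationZeros.
Variable R : realType.
Local Open Scope complex_scope.
Local Notation C := R[i].
Local Notation dm := (@dirichlet_monomial R).
Local Notation e4 := (@e4 R).

Lemma inv_small (c e : R) : 0 <= c -> 0 < e -> exists n0, forall n, (n0 <= n)%N -> c / n.+1%:R <= e.
Proof.
move=> c0 e0; exists (Num.truncn (c / e)) => n nn.
have n1 : c / e < n.+1%:R by apply: (lt_le_trans (truncnS_gt _)); rewrite ler_nat ltnS.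
by rewrite ler_pdivrMr ?ltr0n// mulrC -ler_pdivrMr// ltW.
Qed.

(** The tent [hW] is compared with its truncation [hN] to 4N terms, whose transform gives the sum at
    s, and with its truncated Fourier series [hF], whose transform gives the sum at 1 - s times a
    bounded factor. The multiplier [Qs] = q^(s+1) normalizes all transforms. B must not depend on N
    and K, while A may, because q tends to infinity first. *)
Lemma zeta0_duality (s : C) : 0 < complex.Re s -> complex.Re s < 1 -> exists2 B : R, 0 <= B &
  forall N K, (0 < N)%N -> (0 < K)%N -> exists2 A : R, 0 <= A & forall q, (0 < q)%N ->
  nc (e4sum s (4 * N) / (s * (s + 1))) <= B / N%:R + B / K%:R + B * nc (e4sum (1 - s) (4 * K))
    + A / q%:R + A * q%:R `^ (complex.Re s - 1).
Proof.
move=> s0 s1; have [D D0 hD] := lam_shift s0 s1.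
have L0 := lam_const_ge0 s0 s1; set L := lam_const s in L0.
exists (48 * L); first by rewrite mulr_ge0.
move=> N K N0 K0; have NR : 0 < N%:R :> R by rewrite ltr0n.
have KR : 0 < K%:R :> R by rewrite ltr0n.
have [Ck Ck0 hCk] : exists2 Ck : R, 0 <= Ck & forall (k : nat) (al : R), (k < 4 * K)%N -> 0 <= al ->
    nc (dm (- (s + 1)) k.+1 * gam s al - gam s (k.+1%:R * al)) <= Ck * al ^+ 2.
  elim: (4 * K)%N => [|m [c c0 hc]]; first by exists 0.
  have [c' c0' hc'] := gam_scale s0 s1 (ltn0Sn m).
  exists (c + c'); first by rewrite addr_ge0.
  move=> k al; rewrite ltnS leq_eqVlt mulrDl => /orP[/eqP -> al0|km al0].
    by apply: (le_trans (hc' al al0)); rewrite lerDr mulr_ge0 ?sqr_ge0.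
  by apply: (le_trans (hc k al km al0)); rewrite lerDl mulr_ge0 ?sqr_ge0.
exists (8 * N%:R * D + 32 * K%:R * Ck).
  by rewrite addr_ge0 ?mulr_ge0.
move=> q q0; have qR : 0 < q%:R :> R by rewrite ltr0n.
have q1 : 1 <= q%:R :> R by rewrite ler1n.
pose hW j : R := Tent R q j / q%:R.
pose Qs := dm (- (s + 1)) q.
have nQ : nc Qs * q%:R `^ (- complex.Re s - 1) = 1.
  rewrite nc_dm// (_ : complex.Re (- (s + 1)) = - (complex.Re s + 1)); last by case: (s).
  by rewrite opprK -powRDp// (_ : _ + _ = 0) ?powRr0//; ring.
have nQ0 : 0 <= nc Qs by rewrite nc_ge0.
have nQlam (h : nat -> R) (c : R) : nc (lam s h) <= c * L * q%:R `^ (- complex.Re s - 1) -> nc (Qs * lam s h) <= c * L.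
  move=> h1; rewrite ncM; apply: (le_trans (ler_wpM2l nQ0 h1)).
  by rewrite mulrCA nQ mulr1.
have WB j : `|hW j| <= 24 * j%:R.
  rewrite /hW normrM [X in _ * X]ger0_norm ?invr_ge0 ?(ltW qR)// ler_pdivrMr//.
  have [j0|j0] := posnP j; first by rewrite j0 /Tent /tent big_ord0 normr0 mulr0 mul0r.
  apply: (le_trans (Tent_bound R j q0)); rewrite ler_wpM2r ?(ltW qR)//.
  by rewrite ler_peMr// ler1n.
pose hN j : R := tent R q (4 * N) j / q%:R.
have hNE j : hN j = \sum_(n < 4 * N) (e4 n.+1 / q%:R) * (j - n.+1 * q)%N%:R.
  by rewrite /hN /tent mulr_suml; apply: eq_bigr => n _; rewrite mulrAC.
have trB (m j : nat) : `|(j - m)%N%:R : R| <= 1 * j%:R by rewrite ger0_norm// mul1r ler_nat leq_subr.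
have NB j : `|hN j| <= (8 * N%:R / q%:R) * j%:R.
  rewrite hNE; apply: (le_trans (ler_norm_sum _ _ _)).
  apply: (@le_trans _ _ (\sum_(n < 4 * N) 2 / q%:R * j%:R)).
    apply: ler_sum => n _; rewrite 2!normrM [X in _ * X * _]ger0_norm ?invr_ge0 ?(ltW qR)//.
    apply: ler_pM; rewrite ?mulr_ge0 ?invr_ge0 ?normr_ge0 ?(ltW qR)//.
      by rewrite ler_wpM2r ?invr_ge0 ?(ltW qR)// e4_bound.
    by have := trB (n.+1 * q)%N j; rewrite mul1r.
  rewrite sumr_const card_ord -[leLHS]mulr_natl natrM le_eqVlt; apply/orP; left; apply/eqP; ring.
have lamN : nc (Qs * lam s hN - e4sum s (4 * N) / (s * (s + 1))) <= 8 * N%:R * D / q%:R.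
  rewrite (@lam_lin _ _ s0 s1 _ (index_enum 'I_(4 * N)) (fun n => e4 n.+1 / q%:R)
    (fun (n : 'I_(4 * N)) j => (j - n.+1 * q)%N%:R) (fun=> 1) hN)//.
  rewrite /e4sum mulr_sumr mulr_suml -sumrB; apply: (le_trans (nc_sum _ _ _)).
  apply: (@le_trans _ _ (\sum_(n < 4 * N) 2 * (D / q%:R))); last first.
    by rewrite sumr_const card_ord -[leLHS]mulr_natl natrM le_eqVlt; apply/orP; left; apply/eqP; ring.
  apply: ler_sum => n _; have nq : (0 < n.+1 * q)%N by rewrite muln_gt0.
  set X := lam s _; have hX := hD _ nq; rewrite -/X in hX.
  have -> : Qs * ((e4 n.+1 / q%:R)%:C * X) - (e4 n.+1)%:C * dm s n.+1 / (s * (s + 1)) =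
     (e4 n.+1)%:C * (dm s n.+1 * (dm (- s) (n.+1 * q) * X - (s * (s + 1))^-1)).
    have e1 : Qs = q%:R * dm (- s) q * (q%:R)^-1 * q%:R.
      have qne : q%:R != 0 :> C by rewrite pnatr_eq0 -lt0n.
      by rewrite divfK// /Qs (_ : - (s + 1) = - s - 1) ?dm_sub1//; ring.
    have e2 := dmNK s (ltn0Sn n).
    have e3 : (e4 n.+1 / q%:R)%:C = (e4 n.+1)%:C * q%:R^-1 by rewrite rmorphM fmorphV /= rmorph_nat.
    have qne : q%:R != 0 :> C by rewrite pnatr_eq0 -lt0n.
    rewrite e3 e1 dmM//; set a := dm (- s) n.+1 in e2 *; set b := dm s n.+1 in e2 *.
    rewrite 2!mulrBr; congr (_ - _); last by rewrite mulrA.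
    transitivity ((a * b) * ((e4 n.+1)%:C * (dm (- s) q * X))); last by ring.
    by rewrite e2; field.
  rewrite ncM nc_real; apply: ler_pM; rewrite ?normr_ge0 ?nc_ge0 ?e4_bound// ncM.
  rewrite -[leRHS]mul1r; apply: ler_pM; rewrite ?nc_ge0//.
    rewrite nc_dm// -[leRHS](powRr0 n.+1%:R) ler_powR ?ler1n//; lra.
  apply: (le_trans hX); rewrite ler_wpM2l// lef_pV2 ?posrE ?ltr0n// ler_nat leq_pmull//.
have lamWN : nc (Qs * (lam s hW - lam s hN)) <= 6 / N%:R * L.
  rewrite (@lamB _ _ s0 s1 hW hN 24 (8 * N%:R / q%:R))//.
  apply: nQlam; have c0 : 0 <= 6 / N%:R :> R by rewrite divr_ge0.
  have diff j : hW j - hN j = 0 \/ (4 * N%:R <= j%:R / q%:R :> R /\ `|hW j - hN j| <= 24).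
    rewrite /hW /hN -mulrBl; have [->|[h1 h2]] := Tent_trunc R j q0 N0.
      by left; rewrite subrr mul0r.
    right; split; first by rewrite ler_pdivlMr// -!natrM ler_nat.
    by rewrite normrM [X in _ * X]ger0_norm ?invr_ge0 ?(ltW qR)// ler_pdivrMr.
  have N1 : 1 <= N%:R :> R by rewrite ler1n.
  have d1 j : `|hW j - hN j| <= 6 / N%:R * (j%:R / q%:R).
    have [->|[h1 h2]] := diff j; first by rewrite normr0 mulr_ge0// divr_ge0 ?(ltW qR).
    apply: (le_trans h2); rewrite mulrAC ler_pdivlMr//; lra.
  apply: (lam_le s0 s1) => // j; have [->|[h1 h2]] := diff j; first by rewrite normr0 mulr_ge0 ?sqr_ge0.
  apply: (le_trans (d1 j)); rewrite ler_wpM2l// expr2 ler_peMl//; lra.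
have [al alE] : exists al : R, al = 2 * pi / (4 * q)%:R by eexists.
have al0 : 0 <= al by rewrite alE divr_ge0// mulr_ge0// pi_ge0.
have alq : al <= 2 / q%:R.
  rewrite alE natrM; have := pihalf_lt2 R; have [p <- p0] := pi_opaque R => p4.
  have -> : 2 * p / (4 * q%:R) = (p / 2) / q%:R by field; rewrite gt_eqF.
  by rewrite ler_wpM2r ?invr_ge0 ?(ltW qR)// ltW.
pose cf k : R := 4 / pi ^+ 2 * (e4 k.+1 / k.+1%:R ^+ 2).
pose hF j : R := fourier R q j (4 * K).
have hFE j : hF j = \sum_(k < 4 * K) cf k * (1 - cos (j%:R * (k.+1%:R * al))).
  apply: eq_bigr => k _; rewrite /cf /cosn (natrM _ j k.+1) -alE.
  have -> : j%:R * (k.+1%:R * al) = j%:R * k.+1%:R * al by ring.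
  ring.
have cfb k : `|cf k| <= 2 / k.+1%:R ^+ 2.
  have p41 : 0 <= 4 / (pi : R) ^+ 2 <= 1.
    rewrite divr_ge0 ?sqr_ge0//= ler_pdivrMr ?exprn_gt0 ?pi_gt0// expr2.
    by have := pi_ge2 R; nra.
  rewrite /cf normrM (ger0_norm (andP p41).1) normrM [Num.norm (k.+1%:R ^- 2)]ger0_norm ?invr_ge0 ?exprn_ge0//.
  rewrite -[leRHS]mul1r; apply: ler_pM; [exact: (andP p41).1| |exact: (andP p41).2|].
    by rewrite mulr_ge0 ?invr_ge0 ?exprn_ge0.
  by rewrite ler_wpM2r ?invr_ge0 ?exprn_ge0 ?e4_bound.
have gb (k : nat) j : `|1 - cos (j%:R * (k.+1%:R * al))| <= (k.+1%:R * al + 2) * j%:R.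
  by rewrite mulrDl; apply: (gam_lin s0 s1); rewrite mulr_ge0.
have FB : exists2 c : R, 0 <= c & forall j, `|hF j| <= c * j%:R.
  exists (\sum_(k < 4 * K) `|cf k| * (k.+1%:R * al + 2)).
    by apply: sumr_ge0 => k _; rewrite mulr_ge0// addr_ge0// mulr_ge0.
  move=> j; rewrite hFE; apply: (le_trans (ler_norm_sum _ _ _)); rewrite mulr_suml; apply: ler_sum => k _.
  by rewrite normrM -mulrA ler_wpM2l.
have lamWF : nc (Qs * (lam s hW - lam s hF)) <= 48 / K%:R * L.
  have [c c0 hc] := FB; rewrite (@lamB _ _ s0 s1 hW hF 24 c)//.
  apply: nQlam; apply: (lam_le s0 s1); rewrite ?divr_ge0// => j; have [h1 h2] := fourier_tail R j q0 K0.
    by apply: (le_trans h1); rewrite mulrAC.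
  by apply: (le_trans h2); rewrite mulrAC.
pose G := Qs * gam s al.
have nG : nc G <= 4 * L by apply: nQlam; exact: gam_bound.
have lamF : nc (Qs * lam s hF - (4 / pi ^+ 2)%:C * (G * e4sum (1 - s) (4 * K))) <=
    32 * K%:R * Ck * q%:R `^ (complex.Re s - 1).
  rewrite (@lam_lin _ _ s0 s1 _ (index_enum 'I_(4 * K)) (fun k => cf k)
    (fun (k : 'I_(4 * K)) j => 1 - cos (j%:R * (k.+1%:R * al))) (fun k => k.+1%:R * al + 2) hF)//; last first.
    by move=> k; rewrite addr_ge0// mulr_ge0.
  rewrite /e4sum mulr_sumr [X in _ * X]mulr_sumr mulr_sumr -sumrB; apply: (le_trans (nc_sum _ _ _)).
  apply: (@le_trans _ _ (\sum_(k < 4 * K) 2 * (Ck * 4 * q%:R `^ (complex.Re s - 1)))); last first.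
    by rewrite sumr_const card_ord -[leLHS]mulr_natl natrM le_eqVlt; apply/orP; left; apply/eqP; ring.
  apply: ler_sum => k _; have hk := hCk k al (ltn_ord k) al0.
  have e1 : dm (- (s + 1)) k.+1 = k.+1%:R ^+ 2 * dm (1 - s) k.+1.
    by rewrite (_ : - (s + 1) = 1 - s - 1 - 1) ?dm_sub1// ?expr2 ?mulrA//; ring.
  have e2 : (cf k)%:C = (4 / pi ^+ 2)%:C * ((e4 k.+1)%:C / k.+1%:R ^+ 2).
    by rewrite /cf !rmorphM /= !fmorphV /= !rmorphXn /= !rmorph_nat.
  have kne : k.+1%:R != 0 :> C by rewrite pnatr_eq0.
  have -> : Qs * ((cf k)%:C * lam s (fun j => 1 - cos (j%:R * (k.+1%:R * al))))
      - (4 / pi ^+ 2)%:C * (G * ((e4 k.+1)%:C * dm (1 - s) k.+1)) =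
     - (Qs * ((cf k)%:C * (dm (- (s + 1)) k.+1 * gam s al - gam s (k.+1%:R * al)))).
    rewrite /G e1 e2 /gam; set p := (4 / pi ^+ 2)%:C; set g := lam s _; set g' := lam s _; set d := dm _ _.
    move: kne; set k1 : C := k.+1%:R; move: k1 p g g' d => k1 p g g' d kne.
    by field.
  rewrite ncN ncM ncM nc_real mulrCA; apply: ler_pM; rewrite ?mulr_ge0 ?nc_ge0//.
    apply: (le_trans (cfb k)); rewrite ler_pdivrMr ?exprn_gt0// ler_peMr// exprn_ege1// ler1n//.
  apply: (le_trans (ler_wpM2l nQ0 hk)).
  have a2 : al ^+ 2 <= 4 * q%:R ^- 2.
    have -> : 4 * q%:R ^- 2 = (2 / q%:R) ^+ 2 :> R by rewrite expr_div_n; congr (_ / _); ring.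
    by rewrite lerXn2r ?nnegrE// divr_ge0 ?(ltW qR).
  have -> : q%:R `^ (complex.Re s - 1) = nc Qs * q%:R ^- 2.
    rewrite nc_dm// (_ : complex.Re (- (s + 1)) = - (complex.Re s + 1)); last by case: (s).
    rewrite opprK -powR_mulrn ?(ltW qR)// -powRN -powRDp//; congr (_ `^ _); ring.
  have -> : Ck * 4 * (nc Qs * q%:R ^- 2) = nc Qs * (Ck * (4 * q%:R ^- 2)) by ring.
  by rewrite ler_wpM2l// ler_wpM2l.
have p41 : nc ((4 / pi ^+ 2)%:C : C) <= 1.
  rewrite nc_real ger0_norm ?divr_ge0 ?sqr_ge0// ler_pdivrMr ?exprn_gt0 ?pi_gt0// expr2.
  by have := pi_ge2 R; nra.
set S := e4sum s (4 * N) / _ in lamN *; set S' := e4sum (1 - s) _ in lamF *.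
set P := (4 / pi ^+ 2)%:C in p41 lamF *.
have nP : nc (P * (G * S')) <= 4 * L * nc S'.
  rewrite ncM -[leRHS]mul1r; apply: ler_pM; rewrite ?nc_ge0// ncM ler_wpM2r ?nc_ge0//.
have -> : S = - (Qs * lam s hN - S) - Qs * (lam s hW - lam s hN) + Qs * (lam s hW - lam s hF)
   + (Qs * lam s hF - P * (G * S')) + P * (G * S') by ring.
apply: (le_trans (ncD _ _)).
have t1 := ncD (- (Qs * lam s hN - S) - Qs * (lam s hW - lam s hN) + Qs * (lam s hW - lam s hF)) (Qs * lam s hF - P * (G * S')).
have t2 := ncD (- (Qs * lam s hN - S) - Qs * (lam s hW - lam s hN)) (Qs * (lam s hW - lam s hF)).
have t3 := ncB (- (Qs * lam s hN - S)) (Qs * (lam s hW - lam s hN)); rewrite ncN in t3.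
have u1 : 6 / N%:R * L <= 48 * L / N%:R.
  by rewrite mulrAC ler_wpM2r ?invr_ge0 ?(ltW NR)// ler_wpM2r// ler_nat.
have u2 : 48 / K%:R * L = 48 * L / K%:R by ring.
have u3 : 4 * L * nc S' <= 48 * L * nc S' by rewrite ler_wpM2r ?nc_ge0// ler_wpM2r// ler_nat.
have u4 : 8 * N%:R * D / q%:R <= (8 * N%:R * D + 32 * K%:R * Ck) / q%:R.
  by rewrite ler_wpM2r ?invr_ge0 ?(ltW qR)// lerDl !mulr_ge0.
have u5 : 32 * K%:R * Ck * q%:R `^ (complex.Re s - 1) <= (8 * N%:R * D + 32 * K%:R * Ck) * q%:R `^ (complex.Re s - 1).
  by rewrite ler_wpM2r ?powR_ge0// lerDr !mulr_ge0.
move: lamN lamWN lamWF lamF nP t1 t2 t3 u1 u3 u4 u5; rewrite u2; clear; lra.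
Qed.

Lemma zeta0_dual_zero (s : C) : 0 < complex.Re s -> complex.Re s < 1 ->
  zeta0 (1 - s) = 0 -> zeta0 s = 0.
Proof.
move=> s0 s1 z0; have [B B0 hB] := zeta0_duality s0 s1.
have sn0 : s != 0 by apply/eqP => e; move: s0; rewrite e /= ltxx.
have sn1 : s != 1 by apply/eqP => e; move: s1; rewrite e /= ltxx.
have sn2 : s + 1 != 0.
  by apply/eqP => /(congr1 (@complex.Re R)); rewrite ReD /= => e; lra.
have Re1s : complex.Re (1 - s) = 1 - complex.Re s by rewrite ReB.
have [K1 K10 h1] := e4sum_bound s0 sn1.
have [K2 K20 h2] := @e4sum_bound R (1 - s) ltac:(rewrite Re1s; lra)
  ltac:(by rewrite -subr_eq0 addrAC subrr sub0r oppr_eq0).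
have f0 := e4factor_neq0 (s := s) ltac:(by rewrite gt_eqF) ltac:(by rewrite lt_eqF).
set L := e4factor s * zeta0 s in h1; rewrite z0 mulr0 in h2.
have c0 : s * (s + 1) != 0 by rewrite mulf_neq0.
suff : nc (L / (s * (s + 1))) <= 0.
  move=> h; have : nc (L / (s * (s + 1))) == 0 by rewrite eq_le h nc_ge0.
  by rewrite nc_eq0 mulf_eq0 invr_eq0 (negbTE c0) orbF mulf_eq0 (negbTE f0) /= => /eqP.
have [Z ZE] : exists Z, Z = nc (s * (s + 1))^-1 by eexists.
have Z0 : 0 <= Z by rewrite ZE nc_ge0.
suff key (e : R) : 0 < e -> nc (L / (s * (s + 1))) <= e.
  by apply/ler_addgt0Pl => e e0; rewrite addr0; exact: key.
move=> e0.
(* Six errors: the five terms of [zeta0_duality] and the passage from the partial sum at s to its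
   limit. N and K are fixed before q, as A depends on them. *)
have e6 : 0 < e / 6 by lra.
have [n1 hn1] := inv_small B0 e6.
have d1 : 0 < e / 6 / (K1 * Z + 1) by rewrite divr_gt0// ltr_wpDl// mulr_ge0.
have d2 : 0 < e / 6 / (B * K2 + 1) by rewrite divr_gt0// ltr_wpDl// mulr_ge0.
have [n2 hn2] := powR_small s0 d1.
have [n3 hn3] := @powR_small R (1 - complex.Re s) _ ltac:(lra) d2.
pose N := (n1 + n2).+1; pose K := (n1 + n3).+1.
have [A A0 hA] := hB N K isT isT.
have d3 : 0 < e / 6 / (A + 1) by rewrite divr_gt0// ltr_wpDl.
have [n4 hn4] := inv_small A0 e6.
have [n5 hn5] := @powR_small R (1 - complex.Re s) _ ltac:(lra) d3.
have := hA (n4 + n5).+1 isT.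
have a1 : B / N%:R <= e / 6 by rewrite hn1// leq_addr.
have a2 : B / K%:R <= e / 6 by rewrite hn1// leq_addr.
have a4 : A / (n4 + n5).+1%:R <= e / 6 by rewrite hn4// leq_addr.
have a5 : A * (n4 + n5).+1%:R `^ (complex.Re s - 1) <= e / 6.
  apply: (@le_trans _ _ (A * (e / 6 / (A + 1)))).
    by rewrite ler_wpM2l// -opprB hn5// leq_addl.
  by rewrite mulrA ler_pdivrMr ?ltr_wpDl//; nra.
have a3 : B * nc (e4sum (1 - s) (4 * K)) <= e / 6.
  apply: (@le_trans _ _ (B * (K2 * (e / 6 / (B * K2 + 1))))).
    rewrite ler_wpM2l//; have := h2 (4 * K)%N isT; rewrite subr0 => /le_trans; apply.
    rewrite ler_wpM2l// Re1s; apply: le_trans (hn3 (n1 + n3)%N (leq_addl _ _)).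
    by apply: ler_powR_neg; rewrite ?ltr0n// ?ler_nat ?leq_pmull//; lra.
  rewrite !mulrA ler_pdivrMr ?ltr_wpDl ?mulr_ge0//.
  by have := mulr_ge0 B0 K20; nra.
have a6 : nc (L / (s * (s + 1)) - e4sum s (4 * N) / (s * (s + 1))) <= e / 6.
  rewrite -mulrBl ncM -ZE nc_sym; apply: (@le_trans _ _ (K1 * (e / 6 / (K1 * Z + 1)) * Z)).
    rewrite ler_wpM2r//; apply: (le_trans (h1 (4 * N)%N isT)); rewrite ler_wpM2l//.
    apply: le_trans (hn2 (n1 + n2)%N (leq_addl _ _)).
    by apply: ler_powR_neg; rewrite ?ltr0n// ?ler_nat ?leq_pmull//; lra.
  rewrite mulrAC mulrA ler_pdivrMr ?ltr_wpDl ?mulr_ge0//.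
  by have := mulr_ge0 K10 Z0; nra.
have := ncD (L / (s * (s + 1)) - e4sum s (4 * N) / (s * (s + 1))) (e4sum s (4 * N) / (s * (s + 1))).
rewrite subrK; move: a1 a2 a3 a4 a5 a6; clear.
move: (B / N%:R) (B / K%:R) (B * nc _) (A * _) (A / _) (nc (_ - _)) (nc (e4sum _ _ / _)) (nc (L / _)) => x1 x2 x3 x5 x4 x6 x7 x8.
lra.
Qed.

End FunctionalEquationZeros.

(** * The Riemann hypothesis in terms of [Efun] *)

Section ZetaZeros.
Variable R : realType.
Local Open Scope complex_scope.
Local Notation C := R[i].

Lemma RH_Efun : RiemannHypothesis R ->
  forall s : C, 1 / 2 < complex.Re s -> complex.Re s < 1 -> Efun s != 0.
Proof.
move=> RH s s1 s2; apply/eqP => E0.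
have s01 : 0 < complex.Re s < 1 by apply/andP; split; lra.
have z0 : zeta0 s = 0 by rewrite /zeta0 E0 mul0r.
have := RH _ (zeta0_is_zeta R) s s01 z0; lra.
Qed.

Lemma zeta_series_unique (Z : C -> C) (s : C) : is_riemann_zeta Z -> 1 < complex.Re s -> Z s = zeta0 s.
Proof.
move=> [_ hZ] s1; have /cto_cvg c1 := hZ s s1; apply: cto_uniq c1 _; apply: cto_shift.
by have := zeta_series s1; apply: cto_ext => N; rewrite big_add1 big_mkord.
Qed.

(** Any continuation Z agrees with [zeta0] near a point of real part 2, and the agreement is
    propagated along a segment to s. *)
Lemma zeta_zero_Efun (Z : C -> C) (s : C) : is_riemann_zeta Z -> 0 < complex.Re s < 1 -> Z s = 0 -> Efun s = 0.
Proof.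
move=> hZ /andP[s0 s1] zs.
have sn1 : s != 1 by apply/eqP => e; move: s1; rewrite e /= ltxx.
pose f z := Z z - zeta0 z.
suff : f s = 0.
  rewrite /f zs sub0r => /eqP; rewrite oppr_eq0 mulf_eq0 invr_eq0 subr_eq0 (negbTE sn1) orbF.
  by move/eqP.
pose c : R := if complex.Im s == 0 then 1 else 0.
pose p : C := 2 +i* (complex.Im s + c).
apply: (@segment_zero _ f p s) => [t /andP[t0 t1]|]; last first.
  exists (1 / 2) => // z hz; apply/eqP; rewrite subr_eq0; apply/eqP.
  apply: zeta_series_unique => //.
  by have := nc_Re (z - p); rewrite ReB /= ler_norml; lra.
set g := p + _.
have gR : complex.Re g = 2 - t * (2 - complex.Re s) by rewrite /g ReD ReMl ReB /=; ring.
have gI : complex.Im g = complex.Im s + (1 - t) * c by rewrite /g ImD ImMl ImB /=; ring.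
have gR0 : 0 < complex.Re g by rewrite gR; nra.
have g1 : g != 1.
  apply/eqP => e; have := gI; rewrite e /= /c; case: eqP => [i0|i0]; last by rewrite mulr0 addr0 => /esym.
  rewrite i0 mulr1 add0r => /esym/eqP; rewrite subr_eq0 => /eqP t1'.
  by move: gR; rewrite e -t1' /=; lra.
have d1 : 0 < nc (g - 1) by rewrite nc_gt0 subr_eq0.
exists (Num.min (complex.Re g) (nc (g - 1))); first by rewrite lt_min gR0.
move=> z; rewrite lt_min => /andP[h1 h2].
have z0 : 0 < complex.Re z.
  by have := nc_Re (z - g); rewrite ReB ler_norml; lra.
have z1 : z != 1 by apply/eqP => e; move: h2; rewrite e nc_sym ltxx.
have [l1 hl1] := cdiff_zeta0 z0 z1.
have [l2 hl2] := derivable_cdiff (hZ.1 z z0 z1).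
by eexists; exact: cdiffB hl2 hl1.
Qed.

Lemma RH_of_Efun : (forall s : C, 1 / 2 < complex.Re s -> complex.Re s < 1 -> Efun s != 0) ->
  RiemannHypothesis R.
Proof.
move=> hE Z hZ s s01 zs; have E0 := zeta_zero_Efun hZ s01 zs; move: s01 => /andP[s0 s1].
have [h|h|//] := ltgtP (complex.Re s) (1 / 2); last by have := hE s h s1; rewrite E0 eqxx.
have R1 : complex.Re (1 - s) = 1 - complex.Re s by rewrite ReB.
have n1 : 1 - s != 1 by rewrite -subr_eq0 addrAC subrr sub0r oppr_eq0; apply/eqP => e; move: s0; rewrite e /= ltxx.
have := @zeta0_dual_zero R (1 - s) ltac:(rewrite R1; lra) ltac:(rewrite R1; lra).
rewrite subKr /zeta0 E0 mul0r => /(_ erefl)/eqP; rewrite mulf_eq0 invr_eq0 subr_eq0 (negbTE n1) orbF.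
by apply: contraTeq => _; apply: hE; rewrite R1; lra.
Qed.

End ZetaZeros.

(** * Moments of random multiplicative sums *)

Section SignExpectation.
Variable R : realType.
Implicit Types (ps : seq nat) (F G : (nat -> R) -> R) (m phi y : nat -> R).

Definition upd (T : Type) (phi : nat -> T) p v : nat -> T := fun n => if n == p then v else phi n.

(* Expectation over independent signs [phi p], [p \in ps], where [phi p] has mean [m p]. *)
Fixpoint EE m ps F : R :=
  if ps is p :: ps' then
    EE m ps' (fun phi => (1 + m p) / 2 * F (upd phi p 1) + (1 - m p) / 2 * F (upd phi p (-1)))
  else F (fun=> 0).

Lemma EE_ext m ps F G : (forall phi, F phi = G phi) -> EE m ps F = EE m ps G.
Proof.
by elim: ps F G => [|p ps ih] F G FG /=; [exact: FG|apply: ih => phi; rewrite !FG].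
Qed.

Lemma EE_le m ps F G : (forall p, p \in ps -> `|m p| <= 1) -> (forall phi, F phi <= G phi) ->
  EE m ps F <= EE m ps G.
Proof.
elim: ps F G => [|p ps ih] F G hm FG /=; first exact: FG.
apply: ih => [q qs|phi]; first by apply: hm; rewrite inE qs orbT.
have := hm p (mem_head _ _); rewrite ler_norml => h.
by apply: lerD; apply: ler_wpM2l => //; lra.
Qed.

Lemma EE_lin m ps F G a : EE m ps (fun phi => F phi + a * G phi) = EE m ps F + a * EE m ps G.
Proof.
elim: ps F G => [|p ps ih] F G //=; rewrite -ih; apply: EE_ext => phi; ring.
Qed.

Lemma EE_cst m ps (a : R) : EE m ps (fun=> a) = a.
Proof.
by elim: ps => [|p ps ih] //=; rewrite -[RHS]ih; apply: EE_ext => phi; field.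
Qed.

Lemma msum_ext (V : comNzRingType) ps (y y' phi : nat -> V) : (forall n, y n = y' n) -> msum ps y phi = msum ps y' phi.
Proof.
elim: ps y y' => [|p ps ih] y y' h /=; first exact: h.
by rewrite (ih y y' h) (ih _ (fun n => y' (p * n)%N) (fun n => h _)).
Qed.

Lemma msum_upd ps y phi p (v : R) : p \notin ps -> msum ps y (upd phi p v) = msum ps y phi.
Proof.
elim: ps y => [|q ps ih] y //=; rewrite inE negb_or => /andP[pq pps].
by rewrite !ih// /upd eq_sym (negbTE pq).
Qed.

Lemma EE_msum m ps y : uniq ps -> EE m ps (msum ps y) = msum ps y m.
Proof.
elim: ps y => [|p ps ih] y //= /andP[pps ups].
rewrite -(ih y ups) -(ih (fun n => y (p * n)%N) ups) -EE_lin; apply: EE_ext => phi.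
by rewrite !msum_upd// /upd eqxx; field.
Qed.

Lemma pow_1D_le (t : R) k : `|t| <= 1 -> (1 + t) ^+ k <= 1 + k%:R * t + 4 ^+ k * t ^+ 2.
Proof.
move=> t1; have [l u] : -1 <= t /\ t <= 1 by move: t1; rewrite ler_norml => /andP.
elim: k => [|k ih]; first by rewrite !expr0; have := sqr_ge0 t; lra.
rewrite exprS; have t0 : 0 <= 1 + t by lra.
apply: (le_trans (ler_wpM2l t0 ih)).
have k4 : k%:R <= 4 ^+ k :> R by rewrite -natrX ler_nat ltnW// ltn_expl.
have p0 : 0 <= (4 ^+ k : R) by rewrite exprn_ge0.
rewrite [4 ^+ k.+1]exprS -[k.+1%:R]natr1.
have t20 : 0 <= t ^+ 2 by exact: sqr_ge0.
have key : (k%:R + 4 ^+ k * (1 + t)) * t ^+ 2 <= 4 * 4 ^+ k * t ^+ 2.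
  by rewrite ler_wpM2r//; nra.
by move: key; move: (4 ^+ k : R) (k%:R : R) => q n; rewrite !expr2; lra.
Qed.

(** One sign at a time: x, y and z stand for the sums of a^2, a b and b^2, and v - m for the centred
    sign. The terms linear in v - m cancel in the mean, and the quadratic ones are absorbed by
    enlarging z; D^2 = 64 4^k is a crude constant for this. *)
Lemma two_point_moment (m x y z : R) k : `|m| <= 1 -> 0 <= x -> 0 <= z -> y ^+ 2 <= x * z ->
  0 <= x + 2 * (1 - m) * y + (1 - m) ^+ 2 * z -> 0 <= x + 2 * (-1 - m) * y + (-1 - m) ^+ 2 * z ->
  (1 + m) / 2 * (x + 2 * (1 - m) * y + (1 - m) ^+ 2 * z) ^+ k
  + (1 - m) / 2 * (x + 2 * (-1 - m) * y + (-1 - m) ^+ 2 * z) ^+ k <= (x + (2 ^+ (k + 3)) ^+ 2 * z) ^+ k.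
Proof.
move=> m1 x0 z0 yxz X1 X2; have [ml mu] : -1 <= m /\ m <= 1 by move: m1; rewrite ler_norml => /andP.
case: k => [|k]; first by rewrite !expr0; lra.
set n := k.+1; have DE : (2 ^+ (n + 3)) ^+ 2 = 64 * 4 ^+ n :> R.
  have -> : 64 = 4 ^+ 3 :> R by rewrite -natrX.
  have -> : 4 = 2 ^+ 2 :> R by rewrite -natrX.
  by rewrite -!exprM -exprD; congr (_ ^+ _); lia.
have q1 : 1 <= 4 ^+ n :> R by rewrite exprn_ege1// ler1n.
rewrite DE; have [W WE] : exists W, W = x + 4 * z by eexists.
have W0 : 0 <= W by rewrite WE; lra.
have y4 : `|4 * y| <= W.
  rewrite -(ler_pXn2r (_ : (0 < 2)%N)) ?nnegrE//.
  rewrite real_normK ?num_real// WE; have := sqr_ge0 (x - 4 * z); rewrite !expr2 in yxz *; nra.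
have g1 : (1 - m) ^+ 2 * z <= 4 * z by rewrite ler_wpM2r// expr2; nra.
have g2 : (-1 - m) ^+ 2 * z <= 4 * z by rewrite ler_wpM2r// expr2; nra.
have [W00|Wn0] := eqVneq W 0.
  have xz : x = 0 /\ z = 0 by split; lra.
  have y0 : y = 0 by move: yxz; rewrite xz.1 mul0r => h; apply/eqP; rewrite -sqrf_eq0 eq_le h sqr_ge0.
  by rewrite xz.1 xz.2 y0 !mulr0 !addr0 expr0n /= !mulr0 addr0.
have Wp : 0 < W by rewrite lt_neqAle eq_sym Wn0.
have [r rE] : exists r, r = y / W by eexists.
have yE : y = r * W by rewrite rE divfK.
have r4 : `|4 * r| <= 1.
  by rewrite rE mulrA normrM [X in _ * X]gtr0_norm ?invr_gt0// ler_pdivrMr// mul1r.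
have [rl ru] : -1 <= 4 * r /\ 4 * r <= 1 by move: r4; rewrite ler_norml => /andP.
have rz : r ^+ 2 * W <= z.
  rewrite rE expr_div_n mulrAC ler_pdivrMr ?exprn_gt0//.
  have -> : z * W ^+ 2 = (z * W) * W by ring.
  by rewrite ler_wpM2r//; apply: (le_trans yxz); rewrite mulrC ler_wpM2l// WE; lra.
have step (g : R) : -2 <= g -> g <= 2 -> g ^+ 2 * z <= 4 * z -> 0 <= x + 2 * g * y + g ^+ 2 * z ->
   (x + 2 * g * y + g ^+ 2 * z) ^+ n <= W ^+ n * (1 + n%:R * (2 * g * r) + 4 ^+ n * (16 * r ^+ 2)).
  move=> gl gu gz Xp.
  have t1 : `|2 * g * r| <= 1.
    have -> : 2 * g * r = g / 2 * (4 * r) by field.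
    rewrite normrM; have : `|g / 2| <= 1 by rewrite ler_norml; lra.
    by move=> h; rewrite -[leRHS]mul1r; apply: ler_pM.
  apply: (@le_trans _ _ ((W * (1 + 2 * g * r)) ^+ n)).
    have t2 : 0 <= 1 + 2 * g * r by move: t1; rewrite ler_norml; lra.
    rewrite lerXn2r ?nnegrE ?mulr_ge0//; move: gz; rewrite yE [in X in _ -> _ <= X * _]WE.
    have -> : (x + 4 * z) * (1 + 2 * g * r) = x + 4 * z + 2 * g * (r * W) by rewrite WE; ring.
    by lra.
  rewrite exprMn ler_wpM2l ?exprn_ge0//; apply: (le_trans (pow_1D_le n t1)).
  rewrite lerD2l ler_wpM2l ?exprn_ge0//.
  have -> : (2 * g * r) ^+ 2 = (4 * g ^+ 2) * r ^+ 2 by ring.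
  by rewrite ler_wpM2r ?sqr_ge0// expr2; nra.
have [n1 n2 n3 n4] : [/\ -2 <= 1 - m, 1 - m <= 2, -2 <= -1 - m & -1 - m <= 2].
  by move: ml mu; clear; move=> h1 h2; split; lra.
have s1 := step (1 - m) n1 n2 g1 X1; have s2 := step (-1 - m) n3 n4 g2 X2.
apply: (@le_trans _ _ (W ^+ n * (1 + 4 ^+ n * (16 * r ^+ 2)))).
  have [p1 p2] : 0 <= (1 + m) / 2 /\ 0 <= (1 - m) / 2 by move: n2 n3; clear; lra.
  apply: (le_trans (lerD (ler_wpM2l p1 s1) (ler_wpM2l p2 s2))).
  by rewrite le_eqVlt; apply/orP; left; apply/eqP; field.
have [c cE] : exists c : R, c = 16 * 4 ^+ n by eexists.
have c0 : 0 <= c by rewrite cE mulr_ge0// exprn_ge0.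
have cz : 0 <= c * z by rewrite mulr_ge0.
have -> : 4 ^+ n * (16 * r ^+ 2) = c * r ^+ 2 by rewrite cE; ring.
apply: (@le_trans _ _ ((W + c * z) ^+ n)); last first.
  rewrite lerXn2r ?nnegrE ?addr_ge0 ?mulr_ge0 ?exprn_ge0//.
  by rewrite cE WE; nra.
rewrite /n !exprS; apply: (@le_trans _ _ ((W + c * z) * W ^+ k)); last first.
  apply: ler_wpM2l; first by rewrite addr_ge0.
  by rewrite lerXn2r ?nnegrE ?addr_ge0// lerDl.
rewrite [leLHS](_ : _ = (W + c * (r ^+ 2 * W)) * W ^+ k); last by ring.
by rewrite ler_wpM2r ?exprn_ge0// lerD2l ler_wpM2l.
Qed.

Lemma cauchy_schwarz_step (x y z u v : R) : 0 <= x -> 0 <= z -> y ^+ 2 <= x * z ->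
  (u * v + y) ^+ 2 <= (u ^+ 2 + x) * (v ^+ 2 + z).
Proof.
move=> x0 z0 ih; have h : `|2 * y * (u * v)| <= x * v ^+ 2 + z * u ^+ 2.
  have nn : 0 <= x * v ^+ 2 + z * u ^+ 2 by apply: addr_ge0; apply: mulr_ge0 => //; exact: sqr_ge0.
  rewrite -(ler_pXn2r (_ : (0 < 2)%N)) ?nnegrE ?nn//.
  rewrite real_normK ?num_real//; have := sqr_ge0 (x * v ^+ 2 - z * u ^+ 2).
  have := ler_wpM2r (mulr_ge0 (sqr_ge0 u) (sqr_ge0 v)) ih.
  by rewrite !expr2; lra.
by have := ler_norm (2 * y * (u * v)); move: ih h; rewrite !expr2; lra.
Qed.

Lemma sum_cauchy_schwarz (I : Type) (s : seq I) (a b : I -> R) :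
  (\sum_(i <- s) a i * b i) ^+ 2 <= (\sum_(i <- s) a i ^+ 2) * (\sum_(i <- s) b i ^+ 2).
Proof.
elim: s => [|i s ih]; first by rewrite !big_nil expr0n mulr0.
rewrite !big_cons; apply: cauchy_schwarz_step ih; apply: sumr_ge0 => j _; exact: sqr_ge0.
Qed.

(* Each prime splits [y] into its conditional mean and [D] times its fluctuation. *)
Fixpoint qform m (D : R) ps y : R :=
  if ps is p :: ps' then qform m D ps' (fun n => y n + m p * y (p * n)%N) + qform m D ps' (fun n => D * y (p * n)%N)
  else y 1%N ^+ 2.

(** Hypercontractivity for vectors: [ys] is a list because averaging over one prime replaces each y
    by two sequences, its conditional mean and D times its fluctuation. *)
Lemma EE_moment m ps (ys : seq (nat -> R)) k : uniq ps -> (forall p, p \in ps -> `|m p| <= 1) ->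
  EE m ps (fun phi => (\sum_(y <- ys) msum ps y phi ^+ 2) ^+ k) <= (\sum_(y <- ys) qform m (2 ^+ (k + 3)) ps y) ^+ k.
Proof.
set D := 2 ^+ (k + 3); elim: ps ys => [|p ps ih] ys //= /andP[pps ups] hm.
pose ys' := map (fun y n => y n + m p * y (p * n)%N) ys ++ map (fun y n => D * y (p * n)%N) ys.
have hm' q : q \in ps -> `|m q| <= 1 by move=> qs; apply: hm; rewrite inE qs orbT.
have -> : \sum_(y <- ys) (qform m D ps (fun n => y n + m p * y (p * n)%N) + qform m D ps (fun n => D * y (p * n)%N))
   = \sum_(y <- ys') qform m D ps y by rewrite /ys' big_cat !big_map big_split.
apply: le_trans (ih ys' ups hm'); apply: EE_le => // phi.
pose a y := msum ps (fun n => y n + m p * y (p * n)%N) phi.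
pose b y := msum ps (fun n => y (p * n)%N) phi.
have E (v : R) : \sum_(y <- ys) (msum ps y (upd phi p v) + upd phi p v p * msum ps (fun n => y (p * n)%N) (upd phi p v)) ^+ 2
   = \sum_(y <- ys) a y ^+ 2 + 2 * (v - m p) * (\sum_(y <- ys) a y * b y) + (v - m p) ^+ 2 * (\sum_(y <- ys) b y ^+ 2).
  rewrite !mulr_sumr -!big_split /=; apply: eq_bigr => y _.
  rewrite !msum_upd// {1}/upd eqxx /a msum_linear -/(b y); ring.
have -> : \sum_(y <- ys') msum ps y phi ^+ 2 = \sum_(y <- ys) a y ^+ 2 + D ^+ 2 * \sum_(y <- ys) b y ^+ 2.
  rewrite /ys' big_cat !big_map mulr_sumr /=; congr (_ + _); apply: eq_bigr => y _.
  rewrite -exprMn; congr (_ ^+ 2).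
  rewrite (@msum_ext _ _ _ (fun n => 0 + D * y (p * n)%N)) => [|n]; last by rewrite add0r.
  have := @msum_linear _ ps (fun=> 0) (fun n => y (p * n)%N) phi D; rewrite /b => ->.
  have -> : msum ps (fun=> 0) phi = 0; last by rewrite add0r.
  by elim: (ps) => [|q qs h] //=; rewrite h mulr0 addr0.
rewrite !E; apply: two_point_moment.
- exact: hm (mem_head _ _).
- by apply: sumr_ge0 => y _; exact: sqr_ge0.
- by apply: sumr_ge0 => y _; exact: sqr_ge0.
- exact: sum_cauchy_schwarz.
- by rewrite -E; apply: sumr_ge0 => y _; exact: sqr_ge0.
- by rewrite -E; apply: sumr_ge0 => y _; exact: sqr_ge0.
Qed.

Lemma msum_zero ps y phi : all prime ps -> (forall n, (0 < n)%N -> y n = 0) -> msum ps y phi = 0.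
Proof.
elim: ps y => [|p ps ih] y /=; first by move=> _; exact.
move=> /andP[pp aps] h; rewrite !ih ?mulr0 ?addr0// => n n0.
by rewrite h// muln_gt0 prime_gt0.
Qed.

(** By hypothesis all conditional means of y have size w. Removing a prime from the mean costs a
    factor 1 / (1 - mu) on its fluctuation and nothing on its mean part, so the constants collect
    into a weighted sum over squarefree products. The weight w is general because the fluctuation at
    p calls for w(p n). *)
Lemma qform_bound m (D mu : R) ps y K (w : nat -> R) N : all prime ps -> 0 <= D -> 0 <= mu -> mu < 1 -> 0 <= K ->
  (forall p, p \in ps -> `|m p| <= mu) -> (forall n, 0 <= w n) ->
  (forall n n', (0 < n)%N -> (n <= n')%N -> w n' <= w n) -> (forall n, (N < n)%N -> y n = 0) ->
  (forall n, (0 < n)%N -> `|msum ps (fun j => y (n * j)%N) m| <= K * w n) ->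
  qform m D ps y <= K ^+ 2 * msum ps (fun n => w n ^+ 2) (fun=> (D / (1 - mu)) ^+ 2).
Proof.
move=> aps D0 mu0 mu1 K0 hm w0 wm yN hy; pose c := (1 - mu)^-1.
have c0 : 0 <= c by rewrite invr_ge0; lra.
have cmu : 1 + mu * c = c by rewrite /c; field; lra.
elim: ps aps y K w hm K0 w0 wm yN hy => [|p ps ih] /= aps y K w hm K0 w0 wm yN hy.
  rewrite -exprMn -[y 1%N ^+ 2]real_normK ?num_real// lerXn2r ?nnegrE ?mulr_ge0//.
  by have := hy 1%N isT; rewrite muln1.
move: aps => /andP[pp aps]; have hm' q : q \in ps -> `|m q| <= mu by move=> qs; apply: hm; rewrite inE qs orbT.
have p0 := prime_gt0 pp; have p1 := prime_gt1 pp.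
have hmp : `|m p| <= mu by apply: hm; rewrite mem_head.
(* Descending induction on n, which starts beyond N, where y vanishes: the mean without p is the
   mean with p minus m_p times the one at n p, and c = 1 + mu c. *)
have B n : (0 < n)%N -> `|msum ps (fun j => y (n * j)%N) m| <= K * c * w n.
  have [k kE] : exists k, k = (N.+1 - n)%N by eexists.
  elim/ltn_ind: k n kE => k ihk n kE n0; have [nN|nN] := leqP n N; last first.
    rewrite msum_zero ?normr0 ?mulr_ge0// => j j0; rewrite yN//.
    by apply: (leq_trans nN); rewrite leq_pmulr.
  have h1 := hy n n0; have np : (n < n * p)%N by rewrite ltn_Pmulr.
  have lt : (N.+1 - n * p < k)%N by rewrite kE; move: nN np; clear; lia.
  have h2 := ihk _ lt (n * p)%N erefl (ltn_trans n0 np).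
  have h3 := wm _ _ n0 (ltnW np).
  have e : msum ps (fun j => y (n * (p * j))%N) m = msum ps (fun j => y (n * p * j)%N) m.
    by apply: msum_ext => j; rewrite mulnA.
  rewrite e in h1; set A := msum ps _ m in h1 *; set B := msum ps (fun j => y (n * p * j)%N) m in h1 h2.
  have hB : `|m p * B| <= mu * (K * c * w n).
    rewrite normrM; apply: ler_pM => //; apply: (le_trans h2); rewrite ler_wpM2l// mulr_ge0//.
  have := ler_normB (A + m p * B) (m p * B); rewrite addrK => h4.
  apply: (le_trans h4); rewrite -[in leRHS]cmu.
  have -> : K * (1 + mu * c) * w n = K * w n + mu * (K * c * w n) by ring.
  exact: lerD.
have Q1 := ih aps (fun n => y n + m p * y (p * n)%N) K w hm' K0 w0 wm.
have Q2 := ih aps (fun n => D * y (p * n)%N) (K * c * D) (fun n => w (p * n)%N) hm'.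
rewrite mulrDr; apply: lerD.
  apply: Q1 => [n nN|n n0].
    by rewrite !yN ?mulr0 ?addr0// (leq_trans nN)// leq_pmull.
  have -> : msum ps (fun j => y (n * j)%N + m p * y (p * (n * j))%N) m =
     msum ps (fun j => y (n * j)%N) m + m p * msum ps (fun n0 => y (n * (p * n0))%N) m.
    have := msum_linear ps (fun j => y (n * j)%N) (fun j => y (n * (p * j))%N) m (m p) => <-.
    by apply: msum_ext => j; rewrite mulnCA.
  exact: hy.
have -> : K ^+ 2 * ((D / (1 - mu)) ^+ 2 * msum ps (fun n => w (p * n)%N ^+ 2) (fun=> (D / (1 - mu)) ^+ 2)) =
  (K * c * D) ^+ 2 * msum ps (fun n => w (p * n)%N ^+ 2) (fun=> (D / (1 - mu)) ^+ 2) by rewrite /c; ring.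
apply: Q2 => //.
- by rewrite !mulr_ge0.
- by move=> n n' n0 nn; apply: wm; rewrite ?muln_gt0 ?p0// leq_pmul2l.
- by move=> n nN; rewrite yN ?mulr0// (leq_trans nN)// leq_pmull.
- move=> n n0.
  rewrite (@msum_ext _ _ _ (fun j => 0 + D * y (p * n * j)%N)) => [|j]; last by rewrite add0r mulnA.
  have := @msum_linear _ ps (fun=> 0) (fun j => y (p * n * j)%N) m D => ->.
  rewrite (@msum_zero ps (fun=> 0))// add0r normrM (ger0_norm D0).
  have -> : K * c * D * w (p * n)%N = D * (K * c * w (p * n)%N) by ring.
  by rewrite ler_wpM2l//; have := B (p * n)%N; rewrite muln_gt0 p0 n0 => /(_ isT).
Qed.

Lemma msum_powR_bound (b H : R) N : 1 < b -> 0 <= H ->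
  msum (primes_upto N) (fun n => n%:R `^ (- b)) (fun=> H) <= expR (H * (1 + (b - 1)^-1)).
Proof.
move=> b1 H0; have pm (n m : nat) : (n * m)%:R `^ (- b) = n%:R `^ (- b) * m%:R `^ (- b) :> R.
  by rewrite natrM powRM.
have y1 : 1%:R `^ (- b) = 1 :> R by rewrite powR1.
have -> : msum (primes_upto N) (fun n => n%:R `^ (- b)) (fun=> H) = \prod_(p <- primes_upto N) (1 + H * p%:R `^ (- b)).
  have := @msum_completely _ (primes_upto N) (fun n => n%:R `^ (- b)) (fun=> H) 1%N (fun p q _ => pm p q) y1 (fun q => pm 1%N q).
  by rewrite y1 mul1r => <-; apply: msum_ext => n; rewrite mul1n.
apply: (@le_trans _ _ (expR (\sum_(p <- primes_upto N) H * p%:R `^ (- b)))).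
  elim: (primes_upto N) => [|p ps ih]; first by rewrite !big_nil expR0.
  rewrite !big_cons expRD; apply: ler_pM => //.
  - by rewrite addr_ge0// mulr_ge0// powR_ge0.
  - by apply: prodr_ge0 => q _; rewrite addr_ge0// mulr_ge0// powR_ge0.
  - exact: expR_ge1Dx.
rewrite ler_expR -mulr_sumr ler_wpM2l//.
apply: (@le_trans _ _ (\sum_(1 <= p < N.+1) p%:R `^ (- b))).
  apply: sum_uniq_le; [exact: uniq_primes_upto|by move=> n; exact: powR_ge0|].
  by move=> n; rewrite mem_primes_upto => /andP[pn nN]; rewrite prime_gt0.
case: N => [|N]; first by rewrite big_geq// addr_ge0// invr_ge0; lra.
rewrite big_add1 /= big_mkord big_ord_recl powR1 lerD2l.
have := @powR_sum_tail R (b - 1) 1 N ltac:(lra) isT; rewrite powR1 big_add1 /= big_mkord mul1r => h.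
apply: le_trans h; apply: ler_sum => i _; rewrite le_eqVlt; apply/orP; left; apply/eqP.
by congr (_ `^ _); lra.
Qed.

End SignExpectation.

(** * Events depending on finitely many signs, and a tail bound *)

Section SignLaw.
Variables (R : realType) (a : R).
Implicit Types (ps qs : seq nat) (phi : nat -> R).
Local Open Scope classical_set_scope.

Definition sign_mean (p : nat) : R := - p%:R `^ (- a).

Lemma sign_mean_le p : 0 < a -> prime p -> `|sign_mean p| <= 2 `^ (- a).
Proof.
move=> a0 /prime_gt1 p1; rewrite normrN ger0_norm ?powR_ge0//.
by apply: ler_powR_neg; rewrite ?ltr0n// ?(ler_nat R 2) ?(ltW a0).
Qed.

Lemma two_powRN_lt1 : 0 < a -> 2 `^ (- a) < 1 :> R.
Proof.
move=> a0; rewrite powRE// -[ltRHS]expR0 ltr_expR mulNr oppr_lt0 mulr_gt0// ln_gt0//.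
by rewrite (ltr_nat R 1 2).
Qed.

Lemma EE_Z m ps (F : (nat -> R) -> R) (c : R) : EE m ps (fun phi => c * F phi) = c * EE m ps F.
Proof.
have := EE_lin m ps (fun=> 0) F c; rewrite EE_cst add0r => <-.
by apply: EE_ext => phi; rewrite add0r.
Qed.

(** The constant G is uniform in N, y and K. The condition 1 < 2 b makes the Euler product of the
    weights n^(-2b) bounded. *)
Lemma EE_power_bound (b : R) k : 0 < a -> 1 < 2 * b -> exists2 G : R, 0 <= G &
  forall N (y : nat -> R) K, 0 <= K -> (forall n, (N < n)%N -> y n = 0) ->
  (forall n, (0 < n)%N -> `|msum (primes_upto N) (fun j => y (n * j)%N) sign_mean| <= K * n%:R `^ (- b)) ->
  EE sign_mean (primes_upto N) (fun phi => msum (primes_upto N) y phi ^+ (2 * k)) <= (K ^+ 2 * G) ^+ k.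
Proof.
move=> a0 b1; have mu1 := two_powRN_lt1 a0; set mu : R := 2 `^ (- a) in mu1.
have mu0 : 0 <= mu by rewrite powR_ge0.
pose D : R := 2 ^+ (k + 3); have D0 : 0 <= D by rewrite exprn_ge0.
pose H : R := (D / (1 - mu)) ^+ 2.
exists (expR (H * (1 + (2 * b - 1)^-1))); first exact: expR_ge0.
move=> N y K K0 yN hy; have ap := all_primes_upto N; have up := uniq_primes_upto N.
have hm p : p \in primes_upto N -> `|sign_mean p| <= mu.
  by move=> /(seq.allP ap); exact: sign_mean_le.
have hm1 p : p \in primes_upto N -> `|sign_mean p| <= 1 by move=> /hm h; rewrite (le_trans h)// ltW.
have := EE_moment [:: y] k up hm1; rewrite big_seq1.
rewrite (@EE_ext _ _ _ _ (fun phi => msum (primes_upto N) y phi ^+ (2 * k))); last by move=> phi; rewrite big_seq1 exprM.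
move=> /le_trans; apply.
have wm (n n' : nat) : (0 < n)%N -> (n <= n')%N -> n'%:R `^ (- b) <= n%:R `^ (- b).
  by move=> n0 nn; apply: ler_powR_neg; rewrite ?ltr0n ?ler_nat//; lra.
have q := @qform_bound R sign_mean D mu (primes_upto N) y K (fun n => n%:R `^ (- b)) N ap D0 mu0 mu1 K0 hm
  (fun n => powR_ge0 _ _) wm yN hy.
have q0 : 0 <= qform sign_mean D (primes_upto N) y.
  elim: (primes_upto N) (y) => [|p ps ih] z /=; first exact: sqr_ge0.
  by rewrite addr_ge0.
rewrite lerXn2r ?nnegrE//; first by rewrite mulr_ge0 ?sqr_ge0 ?expR_ge0.
apply: (le_trans q); rewrite ler_wpM2l ?sqr_ge0//.
have H0 : 0 <= H by exact: sqr_ge0.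
apply: le_trans (msum_powR_bound N b1 H0); rewrite le_eqVlt; apply/orP; left; apply/eqP.
have nb : - b != 0 by rewrite oppr_eq0 gt_eqF//; lra.
have n2b : - (2 * b) != 0 by rewrite oppr_eq0 gt_eqF//; lra.
apply: msum_ext => n; rewrite expr2; case: n => [|n]; first by rewrite !powR0// mul0r.
by rewrite -powRDp//; congr (_ `^ _); lra.
Qed.

Lemma msum_eq_in ps (y phi phi' : nat -> R) : {in ps, phi =1 phi'} -> msum ps y phi = msum ps y phi'.
Proof.
elim: ps y => [|p ps ih] y //= h.
have h' : {in ps, phi =1 phi'} by move=> q qs; apply: h; rewrite inE qs orbT.
by rewrite !ih// h ?mem_head.
Qed.

Context (d : measure_display) (T : measurableType d) (P : probability T R).
Variable f : nat -> {RV P >-> R}.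
Hypothesis f_rmf : random_multiplicative f.
Hypothesis f_mean : forall p, prime p -> ('E_P[f p] = (sign_mean p)%:E)%E.

Lemma measurable_value p v : measurable (f p @^-1` [set v]).
Proof.
by rewrite -[X in measurable X]setTI; apply: measurable_funP => //; exact: measurable_set1.
Qed.

Lemma sign_prob p (v : R) : prime p -> v = 1 \/ v = -1 ->
  P (f p @^-1` [set v]) = ((1 + v * sign_mean p) / 2)%:E.
Proof.
move=> pp vv; have [_ _ f1 _] := f_rmf; have mA := measurable_value p v.
have v2 : v * v = 1 by case: vv => ->; ring.
set A := f p @^-1` [set v] in mA *.
have fE w : f p w = 2 * v * \1_A w - v.
  rewrite indicE; have [wA|wA] := boolP (w \in A).
    have -> : f p w = v by exact: set_mem wA.
    by rewrite mulr1; ring.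
  have : f p w <> v by move=> e; move/negP: wA; apply; exact: mem_set.
  by rewrite mulr0; case: vv => ->; case: (f1 p w pp) => -> //; rewrite ?sub0r ?opprK.
have iA : P.-integrable setT (EFin \o (\1_A : T -> R)).
  by apply: integrable_indic => //; rewrite (le_lt_trans (probability_le1 _ _))// ltry.
have := f_mean pp; rewrite expectation_def.
rewrite (eq_integral (fun w => (2 * v)%:E * (\1_A w)%:E - v%:E))%E; last first.
  by move=> w _; rewrite fE EFinB EFinM.
rewrite integralB//=; [|exact: integrableZl|exact: finite_measure_integrable_cst].
rewrite integralZl// integral_indic// setIT integral_cst//.
set q := (X in (v%:E * X)%E); have -> : q = 1%E by exact: probability_setT.
rewrite mule1 {q}.
set pA := (X in (_ * X - _)%E); have <- : pA = P A by [].
have : pA \is a fin_num by apply: fin_num_measure.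
case: pA => // r _; rewrite -EFinM -EFinB => -[h].
congr _%:E; have -> : sign_mean p = 2 * v * r - v by [].
have -> : (1 + v * (2 * v * r - v)) / 2 = (1 + (v * v) * (2 * r - 1)) / 2 by ring.
by rewrite v2; field.
Qed.

Definition cylinder qs (e : nat -> R) : set T := [set w | forall q, q \in qs -> f q w = e q].

Lemma cylinder_cons q qs e : cylinder (q :: qs) e = f q @^-1` [set e q] `&` cylinder qs e.
Proof.
apply/seteqP; split => w /=.
  by move=> h; split; [apply: h; rewrite mem_head|move=> r rs; apply: h; rewrite inE rs orbT].
by move=> [h1 h2] r; rewrite inE => /orP[/eqP ->|/h2].
Qed.

Lemma measurable_cylinder qs e : measurable (cylinder qs e).
Proof.
elim: qs => [|q qs ih]; first by rewrite (_ : cylinder _ _ = setT)//; apply/seteqP; split.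
by rewrite cylinder_cons; apply: measurableI => //; exact: measurable_value.
Qed.

Lemma cylinder_prob qs e : uniq qs -> all prime qs ->
  P (cylinder qs e) = (\prod_(q <- qs) P (f q @^-1` [set e q]))%E.
Proof.
move=> uqs aqs; have [_ _ _ ind] := f_rmf.
have mem q : (q \in [fset x in qs]%fset) = (q \in qs) by rewrite !inE.
have := ind [fset x in qs]%fset (fun q => [set e q]).
have -> : cylinder qs e = \bigcap_(i in [set` [fset x in qs]%fset]) f i @^-1` [set e i].
  apply/seteqP; split => w /= h q; first by rewrite /= mem => qq; exact: h.
  by move=> qq; apply: h; rewrite /= mem.
move=> ->; last by move=> q; exact: measurable_set1.
  by apply: perm_big; apply: uniq_perm => // q; exact: mem.
by move=> q /=; rewrite mem => /(seq.allP aqs).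
Qed.

Lemma cylinder_prob_cons q qs e : uniq (q :: qs) -> all prime (q :: qs) ->
  P (cylinder (q :: qs) e) = (P (f q @^-1` [set e q]) * P (cylinder qs e))%E.
Proof.
move=> /= /andP[qn uqs] /andP[qp aqs]; rewrite !cylinder_prob//=; last first.
- by rewrite qp.
- by rewrite qn.
by rewrite big_cons.
Qed.

(** Independence is used through cylinders: the induction moves a prime p from [ps] to the list [qs]
    of prescribed signs and splits the event by the two values of f p. *)
Lemma sign_law ps qs (e : nat -> R) (b : (nat -> R) -> bool) :
  uniq (ps ++ qs) -> all prime (ps ++ qs) -> (forall q, e q = 1 \/ e q = -1) ->
  (forall phi phi', {in ps, phi =1 phi'} -> b phi = b phi') ->
  measurable (cylinder qs e `&` [set w | b (fun p => f p w)]) /\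
  P (cylinder qs e `&` [set w | b (fun p => f p w)]) =
    (P (cylinder qs e) * (EE sign_mean ps (fun phi => (b phi)%:R))%:E)%E.
Proof.
elim: ps qs e b => [|p ps ih] qs e b /=.
  move=> _ _ _ hb; have -> : [set w | b (fun p => f p w)] = if b (fun=> 0) then setT else set0.
    apply/seteqP; split => w /=.
      by rewrite (hb _ (fun=> 0))// => ->.
    by case: ifP => // b0 _; rewrite (hb _ (fun=> 0)).
  case: (b _); rewrite ?setIT ?setI0; split; rewrite ?measure0 ?mule0 ?mule1//.
  exact: measurable_cylinder.
move=> /andP[pn u] /andP[pp ap] he hb; have [_ _ f1 _] := f_rmf.
move: (pn); rewrite mem_cat negb_or => /andP[pps pqs].
pose bv v phi := b (upd phi p v).
have step v : v = 1 \/ v = -1 ->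
  cylinder qs e `&` (f p @^-1` [set v] `&` [set w | b (fun q => f q w)]) =
  cylinder (p :: qs) (upd e p v) `&` [set w | bv v (fun q => f q w)].
  move=> vv; rewrite cylinder_cons {1}/upd eqxx.
  have -> : cylinder qs (upd e p v) = cylinder qs e.
    apply/seteqP; split => w /= h q qs'; have := h q qs'; rewrite /upd;
    by case: eqP => // qp; move: pqs; rewrite -qp qs'.
  have bE w : f p w = v -> bv v (fun q => f q w) = b (fun q => f q w).
    move=> fv; rewrite /bv (hb _ (fun q => f q w))// => q _; rewrite /upd.
    by case: eqP => // ->.
  apply/seteqP; split => w /=.
    by move=> [h1 [h2 h3]]; split => //; rewrite bE.
  by move=> [[h1 h2] h3]; split => //; split => //; rewrite -bE.
have hbv v : forall phi phi', {in ps, phi =1 phi'} -> bv v phi = bv v phi'.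
  move=> phi phi' h; apply: hb => q; rewrite inE /upd; case: eqP => //= _ qs'; exact: h.
have hev v : v = 1 \/ v = -1 -> forall q, upd e p v q = 1 \/ upd e p v q = -1.
  by move=> vv q; rewrite /upd; case: eqP.
have u' : uniq (ps ++ p :: qs).
  by rewrite -cat1s uniq_catCA /= pn u.
have ap' : all prime (ps ++ p :: qs) by rewrite all_cat /=; move: ap; rewrite all_cat => /andP[-> ->]; rewrite pp.
have v1 : (1 : R) = 1 \/ (1 : R) = -1 by left.
have v2 : (-1 : R) = 1 \/ (-1 : R) = -1 by right.
have [m1 P1] := ih (p :: qs) (upd e p 1) (bv 1) u' ap' (hev _ v1) (hbv 1).
have [m2 P2] := ih (p :: qs) (upd e p (-1)) (bv (-1)) u' ap' (hev _ v2) (hbv (-1)).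
rewrite -step// in m1 P1; rewrite -step// in m2 P2.
have uq : uniq (p :: qs) by rewrite /= pqs; move: u; rewrite cat_uniq => /and3P[].
have aq : all prime (p :: qs) by rewrite /= pp; move: ap; rewrite all_cat => /andP[].
have cE v : P (cylinder (p :: qs) (upd e p v)) = (P (f p @^-1` [set v]) * P (cylinder qs e))%E.
  rewrite cylinder_prob_cons// {1}/upd eqxx; congr (_ * P _)%E.
  apply/seteqP; split => w /= h q qs'; have := h q qs'; rewrite /upd;
  by case: eqP => // qp; move: pqs; rewrite -qp qs'.
rewrite cE sign_prob// in P1; rewrite cE sign_prob// in P2.
have split2 : cylinder qs e `&` [set w | b (fun q => f q w)] =
   (cylinder qs e `&` (f p @^-1` [set 1] `&` [set w | b (fun q => f q w)])) `|`
   (cylinder qs e `&` (f p @^-1` [set -1] `&` [set w | b (fun q => f q w)])).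
  apply/seteqP; split => w /=.
    by move=> [h1 h2]; case: (f1 p w pp) => h; [left|right].
  by move=> [[h1 [h2 h3]]|[h1 [h2 h3]]].
rewrite split2; split; first exact: measurableU.
rewrite measureU//; last first.
  apply/seteqP; split => w //= [[_ [-> _]] [_ [h _]]]; move: h; lra.
rewrite [X in (X + _)%E]P1 [X in (_ + X)%E]P2.
have : P (cylinder qs e) \is a fin_num by apply: fin_num_measure; exact: measurable_cylinder.
case: (P (cylinder qs e)) => // r _; rewrite -!EFinM -EFinD; congr _%:E.
have -> : EE sign_mean ps (fun phi => (1 + sign_mean p) / 2 * (b (upd phi p 1))%:R +
     (1 - sign_mean p) / 2 * (b (upd phi p (-1)))%:R) =
   (1 + sign_mean p) / 2 * EE sign_mean ps (fun phi => (bv 1 phi)%:R) +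
     (1 - sign_mean p) / 2 * EE sign_mean ps (fun phi => (bv (-1) phi)%:R).
  by rewrite EE_lin EE_Z.
ring.
Qed.

Lemma sign_event ps (b : (nat -> R) -> bool) : uniq ps -> all prime ps ->
  (forall phi phi', {in ps, phi =1 phi'} -> b phi = b phi') ->
  measurable [set w | b (fun p => f p w)] /\
  P [set w | b (fun p => f p w)] = (EE sign_mean ps (fun phi => (b phi)%:R))%:E.
Proof.
move=> ups aps hb; have [||||m1 p1] := @sign_law ps [::] (fun=> 1) b; rewrite ?cats0//.
  by move=> _; left.
have cT : cylinder [::] (fun=> 1) = setT by apply/seteqP; split.
by move: m1 p1; rewrite cT setTI probability_setT mul1e.
Qed.

Lemma msum_sample N (y : nat -> R) w : (forall n, (N < n)%N -> y n = 0) ->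
  msum (primes_upto N) y (fun p => f p w) = \sum_(1 <= n < N.+1) y n * f n w.
Proof.
move=> yN; rewrite msum_upto//; rewrite big_nat_cond [RHS]big_nat_cond; apply: eq_bigr => n /andP[/andP[n1 nN] _].
have [f1 fn _ _] := f_rmf; congr (_ * _); have [n2|] := leqP 2 n; first by rewrite fn.
by case: n n1 {nN} => [|[|]]// _ _; rewrite f1 big_nil mulr1.
Qed.

Lemma sample_markov N (y : nat -> R) k (t B : R) : 0 < a -> 0 < t -> (forall n, (N < n)%N -> y n = 0) ->
  EE sign_mean (primes_upto N) (fun phi => msum (primes_upto N) y phi ^+ (2 * k)) <= B ->
  measurable [set w | t < `|\sum_(1 <= n < N.+1) y n * f n w|] /\
  (P [set w | (t < `|\sum_(1 <= n < N.+1) y n * f n w|)%R] <= (B / t ^+ (2 * k))%:E)%E.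
Proof.
move=> a0 t0 yN hB; have ap := all_primes_upto N; have up := uniq_primes_upto N.
have -> : [set w | t < `|\sum_(1 <= n < N.+1) y n * f n w|] =
    [set w | t < `|msum (primes_upto N) y (fun p => f p w)|].
  by apply/seteqP; split => w /=; rewrite msum_sample.
have [|m1 ->] := @sign_event (primes_upto N) (fun phi => t < `|msum (primes_upto N) y phi|) up ap.
  by move=> phi phi' h; rewrite (msum_eq_in _ h).
split => //; rewrite lee_fin ler_pdivlMr ?exprn_gt0// mulrC -EE_Z; apply: le_trans hB.
apply: EE_le => [p /(seq.allP ap) pp|phi].
  by rewrite (le_trans (sign_mean_le a0 pp))// ltW// two_powRN_lt1.
have e0 : 0 <= msum (primes_upto N) y phi ^+ (2 * k) by rewrite exprM exprn_ge0// sqr_ge0.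
case: ltP => [h|_]; last by rewrite mulr0.
rewrite mulr1 2!exprM -[msum _ _ _ ^+ 2]real_normK ?num_real// -2!exprM lerXn2r ?nnegrE// ltW//.
Qed.

End SignLaw.

(** * The Riemann hypothesis implies the almost sure bound *)

Section RandomSumBound.
Variables (R : realType) (a : R).
Local Open Scope classical_set_scope.

Lemma abel_bound (x u : nat -> R) (B : R) N : (forall i, 0 <= u i) -> (forall i, u i.+1 <= u i) ->
  (forall n, (n <= N)%N -> `|\sum_(i < n) x i| <= B) -> `|\sum_(i < N) x i * u i| <= B * u 0%N.
Proof.
move=> u0 um hB.
have E n : \sum_(i < n) x i * u i = (\sum_(i < n) x i) * u n + \sum_(j < n) (\sum_(i < j.+1) x i) * (u j - u j.+1).
  elim: n => [|n ih]; first by rewrite !big_ord0 mul0r addr0.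
  rewrite big_ord_recr /= ih [\sum_(j < n.+1) _]big_ord_recr /= !big_ord_recr /=; ring.
rewrite E; apply: (le_trans (ler_normD _ _)).
have -> : B * u 0%N = B * u N + \sum_(j < N) B * (u j - u j.+1).
  rewrite -mulr_sumr -mulrDr; congr (_ * _).
  by elim: (N) => [|n ih]; rewrite ?big_ord0 ?addr0// big_ord_recr /= ih; ring.
apply: lerD; first by rewrite normrM (ger0_norm (u0 _)) ler_wpM2r// hB.
apply: (le_trans (ler_norm_sum _ _ _)); apply: ler_sum => j _.
by rewrite normrM [X in _ * X]ger0_norm ?subr_ge0// ler_wpM2r ?subr_ge0// hB.
Qed.

Lemma msum_scale (V : comNzRingType) ps (y phi : nat -> V) c : msum ps (fun n => c * y n) phi = c * msum ps y phi.
Proof.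
have := msum_linear ps (fun=> 0) y phi c.
have -> : msum ps (fun=> 0) phi = 0 by elim: (ps) => [|p qs ih] //=; rewrite ih mulr0 addr0.
by rewrite add0r => <-; apply: msum_ext => n; rewrite add0r.
Qed.

Lemma msum_twist (V : comNzRingType) ps (y phi c : nat -> V) : (forall m n, c (m * n)%N = c m * c n) -> c 1%N = 1 ->
  msum ps y (fun p => c p * phi p) = msum ps (fun n => y n * c n) phi.
Proof.
move=> cM c1; elim: ps y => [|p ps ih] y /=; first by rewrite c1 mulr1.
rewrite !ih; congr (_ + _).
rewrite (@msum_ext _ _ (fun n => y (p * n)%N * c (p * n)%N) (fun n => c p * (y (p * n)%N * c n))) => [|n].
  by rewrite msum_scale; ring.
by rewrite cM; ring.
Qed.

Lemma msum_sign_mean N (y : nat -> R) : (forall n, (N < n)%N -> y n = 0) ->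
  msum (primes_upto N) y (sign_mean a) = \sum_(1 <= j < N.+1) y j * j%:R `^ (- a) * (moebius j)%:~R.
Proof.
move=> yN.
have -> : msum (primes_upto N) y (sign_mean a) = msum (primes_upto N) (fun j => y j * j%:R `^ (- a)) (fun=> -1).
  rewrite -(@msum_twist _ _ y (fun=> -1) (fun j => j%:R `^ (- a))) ?powR1//; last by move=> m n; rewrite natrM powRM.
  by apply: msum_eq_in => p _; rewrite mulrN1.
rewrite msum_upto => [|n nN]; last by rewrite yN// mul0r.
rewrite big_nat_cond [RHS]big_nat_cond; apply: eq_bigr => j /andP[/andP[j1 _] _].
by rewrite moebius_sqfree.
Qed.

(** The mean over the signs is a sum of mu(j) j^(-a) over j <= N / n. The weights j^(-a) decrease,
    so summation by parts gives the bound of the plain Moebius sums. *)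
Lemma indicator_msum_bound (e K : R) N n : 0 < a -> 0 < e -> 0 <= K ->
  (forall M, `|\sum_(i < M) (moebius i.+1)%:~R| <= K * M%:R `^ (1 / 2 + e) :> R) -> (0 < n)%N ->
  `|msum (primes_upto N) (fun j => (n * j <= N)%N%:R) (sign_mean a)| <= K * N%:R `^ (1 / 2 + e) * n%:R `^ (- (1 / 2 + e)).
Proof.
move=> a0 e0 K0 hK n0; have nR : 0 < n%:R :> R by rewrite ltr0n.
rewrite msum_sign_mean => [|j jN]; last first.
  by rewrite leqNgt (leq_trans jN)// leq_pmull.
set X := (N %/ n)%N; have XN : (X <= N)%N by exact: leq_div.
have -> : \sum_(1 <= j < N.+1) (n * j <= N)%N%:R * j%:R `^ (- a) * (moebius j)%:~R =
   \sum_(i < X) (moebius i.+1)%:~R * i.+1%:R `^ (- a) :> R.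
  rewrite big_add1 /= big_mkord -(subnKC XN) big_split_ord /= [X in _ + X]big1 ?addr0.
    by apply: eq_bigr => i _; rewrite subnKC// mulnC -leq_divRL// ltn_ord mul1r mulrC.
  by move=> i _; rewrite subnKC// mulnC -leq_divRL// -/X ltnNge leq_addr /= !mul0r.
have b0 : 0 <= 1 / 2 + e by lra.
have h := @abel_bound (fun i => (moebius i.+1)%:~R) (fun i => i.+1%:R `^ (- a)) (K * X%:R `^ (1 / 2 + e)) X.
apply: (@le_trans _ _ (K * X%:R `^ (1 / 2 + e) * 1%:R `^ (- a))).
  apply: h => [i|i|m mX]; first exact: powR_ge0.
    by apply: ler_powR_neg; rewrite ?ltr0n ?ler_nat ?(ltW a0).
  by apply: (le_trans (hK m)); rewrite ler_wpM2l// ge0_ler_powR ?nnegrE ?ler_nat.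
rewrite powR1 mulr1 -mulrA ler_wpM2l//.
have -> : n%:R `^ (- (1 / 2 + e)) = (n%:R^-1) `^ (1 / 2 + e) :> R.
  by rewrite -(@powR_inv1 _ n%:R) ?(ltW nR)// -powRrM mulN1r.
rewrite -powRM ?invr_ge0 ?(ltW nR)// ge0_ler_powR ?nnegrE ?mulr_ge0 ?invr_ge0 ?(ltW nR)//.
by rewrite ler_pdivlMr// -natrM ler_nat leq_divM.
Qed.

Context (d : measure_display) (T : measurableType d) (P : probability T R).
Variable f : nat -> {RV P >-> R}.
Hypothesis a0 : 0 < a.
Hypothesis f_rmf : random_multiplicative f.
Hypothesis f_mean : forall p, prime p -> ('E_P[f p] = (sign_mean a p)%:E)%E.

Lemma random_sum_tail (e K : R) : 0 < e -> 0 <= K ->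
  (forall M, `|\sum_(i < M) (moebius i.+1)%:~R| <= K * M%:R `^ (1 / 2 + e) :> R) ->
  exists2 C : R, 0 <= C & forall N, (0 < N)%N ->
   measurable [set w | N%:R `^ (1 / 2 + 2 * e) < `|\sum_(1 <= n < N.+1) f n w|] /\
   (P [set w | (N%:R `^ (1 / 2 + 2 * e) < `|\sum_(1 <= n < N.+1) f n w|)%R] <= (C * N%:R `^ (- 2))%:E)%E.
Proof.
move=> e0 K0 hK; have pa := a0.
(* As k e >= 1, the moment of order 2k divided by the 2k-th power of the threshold is O(N^(-2 k e)),
   hence O(N^(-2)). *)
pose k := (Num.truncn e^-1).+1.
have ke : 1 <= k%:R * e.
  by rewrite -ler_pdivrMr// div1r ltW// truncnS_gt.
have [G G0 hG] := @EE_power_bound R a (1 / 2 + e) k a0 ltac:(lra).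
exists ((K ^+ 2 * G) ^+ k); first by rewrite exprn_ge0// mulr_ge0// sqr_ge0.
move=> N N0; have NR : 0 < N%:R :> R by rewrite ltr0n.
have N1 : 1 <= N%:R :> R by rewrite ler1n.
pose y n : R := (n <= N)%N%:R.
have yN n : (N < n)%N -> y n = 0 by rewrite /y ltnNge => /negbTE ->.
set b := 1 / 2 + e in hG *.
have hE := hG N y (K * N%:R `^ b) ltac:(by rewrite mulr_ge0 ?powR_ge0) yN
  (fun n n0 => indicator_msum_bound N a0 e0 K0 hK n0).
have t0 : 0 < N%:R `^ (1 / 2 + 2 * e) :> R by rewrite powR_gt0.
have [m1 p1] := sample_markov f_rmf f_mean a0 t0 yN hE.
have yE w : \sum_(1 <= n < N.+1) y n * f n w = \sum_(1 <= n < N.+1) f n w.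
  by apply: eq_big_nat => n /andP[_ nN]; rewrite /y -ltnS nN mul1r.
have sE : [set w | N%:R `^ (1 / 2 + 2 * e) < `|\sum_(1 <= n < N.+1) y n * f n w|] =
   [set w | N%:R `^ (1 / 2 + 2 * e) < `|\sum_(1 <= n < N.+1) f n w|].
  by apply/seteqP; split => w /=; rewrite yE.
rewrite sE in m1 p1; split => //; apply: (le_trans p1); rewrite lee_fin.
rewrite ler_pdivrMr ?exprn_gt0//.
have -> : (K * N%:R `^ b) ^+ 2 * G = (K ^+ 2 * G) * (N%:R `^ b) ^+ 2 by ring.
rewrite [leLHS]exprMn -[leRHS]mulrA; apply: ler_wpM2l.
  by rewrite exprn_ge0// mulr_ge0 ?sqr_ge0.
rewrite -exprM -!powR_mulrn ?powR_ge0// -!powRrM -powRDp//.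
apply: ler_powR => //.
rewrite natrM /b; move: ke; move: (k%:R : R) => q qe; lra.
Qed.

(** The tail probabilities are summable by the N^(-2) bound, so Borel-Cantelli applies to all
    integers N. *)
Lemma random_sum_ae (e : R) : 0 < e -> e <= 1 -> RiemannHypothesis R ->
  P.-negligible [set w | ~ exists n0, forall n, (n0 <= n)%N ->
    `|\sum_(1 <= i < n.+1) f i w| <= n%:R `^ (1 / 2 + 2 * e)].
Proof.
move=> e0 e1 RH; have pa := a0; have [K K0 hK] := mertens_bound (RH_Efun RH) e0 e1.
have [C C0 hC] := random_sum_tail e0 K0 hK.
pose F n := [set w | n.+1%:R `^ (1 / 2 + 2 * e) < `|\sum_(1 <= i < n.+2) f i w|].
have mF n : measurable (F n) by exact: (hC n.+1 isT).1.
exists (lim_sup_set F); split.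
- by apply: bigcap_measurable => // n _; exact: bigcup_measurable.
- apply: lim_sup_set_cvg0 => //; apply: (@le_lt_trans _ _ (C * 2)%:E); last exact: ltry.
  apply: lime_le; first by apply: is_cvg_nneseries => n _ _; exact: measure_ge0.
  apply: nearW => n; apply: (@le_trans _ _ (\sum_(0 <= i < n) (C * i.+1%:R `^ (- 2))%:E)%E).
    by apply: lee_sum => i _; exact: (hC i.+1 isT).2.
  rewrite sumEFin lee_fin big_mkord -mulr_sumr ler_wpM2l//.
  exact: powR_sum_le2.
move=> w /= hw n _ /=; apply: contrapT => hn; apply: hw; exists n.+1 => m nm.
rewrite leNgt; apply/negP => h; apply: hn; exists m.-1 => /=; first by rewrite -ltnS prednK// (leq_ltn_trans _ nm).
by rewrite /F /= prednK// (leq_ltn_trans _ nm).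
Qed.

Lemma powR_quot_cvg (g : R -> R) (b c : R) x0 : b < c -> 0 < x0 ->
  (forall x, x0 <= x -> `|g x| <= x `^ b) -> g x / x `^ c @[x --> +oo] --> 0.
Proof.
move=> bc x00 hg; have d0 : 0 < c - b by lra.
apply/cvgrPdist_le => /= e e0.
pose M := Num.max x0 (e^-1 `^ (c - b)^-1).
exists M; split; first exact: num_real.
move=> x Mx; rewrite sub0r normrN.
have [h1 h2] : x0 <= x /\ e^-1 `^ (c - b)^-1 <= x.
  by move: Mx; rewrite /M gt_max => /andP[h1 h2]; split; exact: ltW.
have xp : 0 < x by exact: lt_le_trans h1.
rewrite normrM normfV [X in _ / X]ger0_norm ?powR_ge0// ler_pdivrMr ?powR_gt0//.
apply: (le_trans (hg x h1)); have -> : c = b + (c - b) by ring.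
rewrite powRDp// mulrCA ler_peMr ?powR_ge0// -ler_pdivrMl// mulr1.
have := @ge0_ler_powR R (c - b) (ltW d0) _ _ _ _ h2; rewrite !nnegrE ?powR_ge0 ?(ltW xp)// => /(_ isT isT).
by rewrite -powRrM mulVf ?gt_eqF// powRr1// invr_ge0 ltW.
Qed.

Lemma RH_random_sum : RiemannHypothesis R ->
  {ae P, forall w, forall eps : R, 0 < eps ->
     partial_sum f w x / x `^ (1 / 2 + eps) @[x --> +oo] --> 0}.
Proof.
(* The uncountably many eps are reduced to the countably many values 1 / (j + 1). *)
move=> RH; pose e j : R := j.+1%:R^-1.
pose Bad j := [set w | ~ exists n0, forall n, (n0 <= n)%N ->
    `|\sum_(1 <= i < n.+1) f i w| <= n%:R `^ (1 / 2 + 2 * e j)].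
have nB : P.-negligible (\bigcup_j Bad j).
  apply: negligible_bigcup => j; apply: random_sum_ae => //.
  - by rewrite invr_gt0.
  - by rewrite invf_le1// ler1n.
apply: negligibleS nB => w /= hw; apply: contrapT => hn; apply: hw => eps eps0.
pose j := Num.truncn (4 / eps).
have je : 4 * e j <= eps.
  by rewrite /e ler_pdivrMr// mulrC -ler_pdivrMr// ltW// truncnS_gt.
have ej : 0 < e j by rewrite invr_gt0.
have [n0 hn0] : exists n0, forall n, (n0 <= n)%N -> `|\sum_(1 <= i < n.+1) f i w| <= n%:R `^ (1 / 2 + 2 * e j).
  by apply: contrapT => h; apply: hn; exists j.
apply: (@powR_quot_cvg (partial_sum f w) (1 / 2 + 2 * e j) (1 / 2 + eps) n0.+1%:R); [lra|by rewrite ltr0n|].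
move=> x xn; have x0 : 0 <= x by apply: le_trans xn.
have tn : (n0 <= Num.truncn x)%N.
  by rewrite truncn_ge_nat// (le_trans _ xn)// ler_nat.
apply: (le_trans (hn0 _ tn)); rewrite ge0_ler_powR ?nnegrE//; first by lra.
by rewrite truncn_le.
Qed.

End RandomSumBound.

(** * From random sums to zeros *)

Section LogKernel.
Variable R : realType.
Local Open Scope complex_scope.
Local Notation C := R[i].
Local Notation dm := (@dirichlet_monomial R).
Local Notation e4 := (@e4 R).

Definition logp (X k : nat) : R := Num.max 0 (ln X%:R - ln k%:R).

Lemma logp_ge0 X k : 0 <= logp X k.
Proof.
by rewrite /logp le_max lexx.
Qed.

Lemma logp_le X k : (0 < X)%N -> (0 < k)%N -> logp X k <= ln X%:R.
Proof.
move=> X0 k0; rewrite /logp ge_max ln_ge0 ?ler1n//= lerBlDr lerDl ln_ge0// ler1n//.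
Qed.

Lemma logp0 X k : (X < k)%N -> logp X k = 0.
Proof.
move=> Xk; apply/eqP; rewrite eq_le logp_ge0 andbT /logp ge_max lexx /= subr_le0.
case: X Xk => [|X] Xk; first by rewrite ln0// ln_ge0// ler1n.
by rewrite ler_ln ?posrE ?ltr0n ?(leq_ltn_trans _ Xk)// ler_nat ltnW.
Qed.

Lemma pospart_convex (t t' x x' : R) : t' <= t -> x <= x' ->
  Num.max 0 (t - x') - Num.max 0 (t' - x') <= Num.max 0 (t - x) - Num.max 0 (t' - x).
Proof.
move=> h1 h2; rewrite /Num.max.
by case: ltP => a1; case: ltP => a2; case: ltP => a3; case: ltP => a4; lra.
Qed.

Lemma abel_sum (V : comNzRingType) (x u : nat -> V) N : u N = 0 ->
  \sum_(i < N) x i * u i = \sum_(j < N) (\sum_(i < j.+1) x i) * (u j - u j.+1).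
Proof.
move=> uN; have E n : \sum_(i < n) x i * u i = (\sum_(i < n) x i) * u n + \sum_(j < n) (\sum_(i < j.+1) x i) * (u j - u j.+1).
  elim: n => [|n ih]; first by rewrite !big_ord0 mul0r addr0.
  rewrite big_ord_recr /= ih [\sum_(j < n.+1) _]big_ord_recr /= !big_ord_recr /=; ring.
by rewrite E uN mulr0 add0r.
Qed.

(** Summation by parts in both variables. The mixed second differences of the positive part of ln X
    - ln i - ln j are nonnegative by convexity, so their sum over i telescopes to a first difference
    in j, at most 1 / j. *)
Lemma log_convolution_bound (x b : nat -> C) (A : R) X : (0 < X)%N ->
  (forall n, nc (\sum_(i < n) x i) <= A) ->
  nc (\sum_(i < X) x i * \sum_(j < X) b j * (logp X (i.+1 * j.+1))%:C) <=
  A * \sum_(j < X) nc (\sum_(i < j.+1) b i) * j.+1%:R^-1.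
Proof.
move=> X0 hA.
pose L i j := logp X (i.+1 * j.+1); pose D i j := L i j - L i j.+1.
have LN i j : (X <= i)%N -> L i j = 0 by move=> Xi; apply: logp0; rewrite (leq_trans _ (leq_pmulr _ _)).
have LN' i j : (X <= j)%N -> L i j = 0 by move=> Xi; apply: logp0; rewrite (leq_trans _ (leq_pmull _ _)).
have LE i j : L i j = Num.max 0 ((ln X%:R - ln j.+1%:R) - ln i.+1%:R).
  by rewrite /L /logp natrM lnM ?posrE ?ltr0n//; congr (Num.max _ _); ring.
have lnm (i : nat) : ln i.+1%:R <= ln i.+2%:R :> R by rewrite ler_ln ?posrE ?ltr0n// ler_nat.
have DD i j : 0 <= D i j - D i.+1 j.
  by rewrite subr_ge0 /D !LE; apply: pospart_convex; rewrite ?lnm// lerD2l lerN2 lnm.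
have D0 j : D 0%N j <= j.+1%:R^-1.
  have jR : 0 < j.+1%:R :> R by rewrite ltr0n.
  have h : ln j.+2%:R - ln j.+1%:R <= j.+1%:R^-1 :> R.
    rewrite -ln_div ?posrE ?ltr0n//; have := @ln_sub1_le R (j.+2%:R / j.+1%:R) ltac:(by rewrite divr_gt0 ?ltr0n).
    have -> : j.+2%:R / j.+1%:R - 1 = j.+1%:R^-1 :> R by rewrite -[j.+2%:R]natr1; field; rewrite nat1r pnatr_eq0.
    by [].
  have := lnm j; rewrite /D !LE ln1 !subr0 /Num.max.
  have : 0 <= j.+1%:R^-1 :> R by rewrite invr_ge0 ltW.
  by move: h; move: (j.+1%:R^-1 : R) (ln j.+1%:R : R) (ln j.+2%:R : R) (ln X%:R : R) => u v v' z; case: ltP => a1; case: ltP => a2; lra.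
have -> : \sum_(i < X) x i * (\sum_(j < X) b j * (logp X (i.+1 * j.+1))%:C) =
   \sum_(j < X) (\sum_(i < j.+1) b i) * \sum_(i < X) (\sum_(k < i.+1) x k) * (D i j - D i.+1 j)%:C.
  transitivity (\sum_(i < X) x i * \sum_(j < X) (\sum_(k < j.+1) b k) * (D i j)%:C).
    apply: eq_bigr => i _; congr (_ * _); rewrite (abel_sum b (u := fun j => (L i j)%:C)); last by rewrite LN'.
    by apply: eq_bigr => j _; rewrite -rmorphB.
  under eq_bigr => i _ do rewrite mulr_sumr; rewrite exchange_big /=; apply: eq_bigr => j _.
  have <- : \sum_(i < X) x i * (D i j)%:C = \sum_(i < X) (\sum_(k < i.+1) x k) * (D i j - D i.+1 j)%:C.
    rewrite (abel_sum x (u := fun i => (D i j)%:C)); last by rewrite /D !LN// subrr.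
    by apply: eq_bigr => i _; rewrite -rmorphB.
  by rewrite mulr_sumr; apply: eq_bigr => i _; ring.
apply: (le_trans (nc_sum _ _ _)); rewrite mulr_sumr; apply: ler_sum => j _.
rewrite ncM mulrCA ler_wpM2l ?nc_ge0//.
apply: (le_trans (nc_sum _ _ _)); apply: (@le_trans _ _ (\sum_(i < X) A * (D i j - D i.+1 j))).
  by apply: ler_sum => i _; rewrite ncM nc_real ger0_norm// ler_wpM2r.
have A0 : 0 <= A by apply: le_trans (hA 0%N); exact: nc_ge0.
rewrite -mulr_sumr ler_wpM2l//; apply: le_trans (D0 j).
have tel n : \sum_(i < n) (D i j - D i.+1 j) = D 0%N j - D n j.
  by elim: n => [|n ih]; [rewrite big_ord0 subrr|rewrite big_ord_recr /= ih; ring].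
by rewrite tel [D X j]/D !LN// subrr subr0.
Qed.

Variables (rho : C) (a : R).
Local Notation s0 := (rho - a%:C).

(* The coefficient of [f m] in the sum over [m n <= X] of
   [f(m) m^(-s0) e4(n) n^(-rho) log(X / (m n))]. *)
Definition yseq X m : C := dm s0 m * \sum_(n < X) (e4 n.+1)%:C * dm rho n.+1 * (logp X (m * n.+1))%:C.

Lemma yseq0 X m : (X < m)%N -> yseq X m = 0.
Proof.
move=> Xm; rewrite /yseq big1 ?mulr0// => n _; rewrite logp0 ?mulr0//.
by rewrite (leq_trans Xm)// leq_pmulr.
Qed.

Lemma sum_e4 (V : comNzRingType) (E : nat -> V) (Psi : nat -> V) X :
  (forall n, E n = 1 - 3 * (2 %| n)%N%:R + 2 * (4 %| n)%N%:R) -> (forall n, (X < n)%N -> Psi n = 0) ->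
  \sum_(n < X) E n.+1 * Psi n.+1 = \sum_(n < X) Psi n.+1 - 3 * \sum_(n < X) Psi (2 * n.+1)%N + 2 * \sum_(n < X) Psi (4 * n.+1)%N.
Proof.
move=> EE PX.
have ext q : (0 < q)%N -> \sum_(n < X) Psi (q * n.+1)%N = \sum_(n < X) (q %| n.+1)%N%:R * Psi n.+1.
  move=> q0; rewrite -sum_dvdn//.
  have XqX : (X <= q * X)%N by rewrite leq_pmull.
  rewrite -(subnKC XqX) big_split_ord /= [X in _ + X]big1 ?addr0// => i _.
  by rewrite PX ?mulr0// ltnS leq_addr.
rewrite !ext// !mulr_sumr -sumrB -big_split /=; apply: eq_bigr => n _; rewrite EE; ring.
Qed.

(** As j^(-s0) j^(-a) = j^(-rho), the sum over j and n contains the convolution of mu with e4, a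
    combination of multiples of 1, 2 and 4 against the constant 1; only the products 1, 2 and 4
    survive. *)
Lemma yseq_moebius X k : (0 < X)%N -> (0 < k)%N ->
  \sum_(1 <= j < X.+1) yseq X (k * j) * (j%:R `^ (- a))%:C * muC R j =
  dm s0 k * ((logp X k)%:C - 3 * dm rho 2 * (logp X (2 * k))%:C + 2 * dm rho 4 * (logp X (4 * k))%:C).
Proof.
move=> X0 k0; pose Phi q t : C := dm rho (q * t) * (logp X (q * t * k))%:C.
have PX q t : (0 < q)%N -> (X < t)%N -> Phi q t = 0.
  move=> q0 Xt; rewrite /Phi logp0 ?mulr0// (leq_trans Xt)// -mulnA mulnCA leq_pmulr// muln_gt0 q0//.
have cv q : (0 < q)%N -> \sum_(1 <= j < X.+1) muC R j * \sum_(n < X) Phi q (j * n.+1)%N = Phi q 1%N.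
  move=> q0; rewrite -(divisors_moebius_sum (Phi := Phi q) (X := X)) => [|t Xt|//]; last exact: PX.
  apply: eq_bigr => j _; rewrite mulr_sumr [RHS]big_add1 /= big_mkord; apply: eq_bigr => n _; by [].
transitivity (dm s0 k * (Phi 1%N 1%N - 3 * Phi 2 1%N + 2 * Phi 4 1%N)); last first.
  by rewrite /Phi !muln1 !mul1n dm1 mul1r (mulrA 3) (mulrA 2).
rewrite -!cv// !mulr_sumr -sumrB -big_split mulr_sumr /=; apply: eq_big_nat => j /andP[j1 _].
rewrite /yseq dmM//.
have dj : dm s0 j * (j%:R `^ (- a))%:C = dm rho j.
  have -> : (j%:R `^ (- a))%:C = dm a%:C j.
    rewrite /dirichlet_monomial -rmorphN -rmorphM cexp_real powRE ?ltr0n//.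
  by rewrite -dmD subrK.
have E4C n : (e4 n)%:C = 1 - 3 * (2 %| n)%N%:R + 2 * (4 %| n)%N%:R :> C.
  by rewrite /e4 rmorphD rmorphB !rmorphM /= !rmorph_nat.
have -> : \sum_(n < X) (e4 n.+1)%:C * dm rho n.+1 * (logp X (k * j * n.+1))%:C =
    \sum_(n < X) (e4 n.+1)%:C * (dm rho n.+1 * (logp X (k * j * n.+1))%:C).
  by apply: eq_bigr => n _; rewrite (mulrA (e4 n.+1)%:C).
rewrite (@sum_e4 _ (fun n => (e4 n)%:C) (fun n => dm rho n * (logp X (k * j * n))%:C))//; last first.
  by move=> n Xn; rewrite logp0 ?mulr0// (leq_trans Xn)// leq_pmull// muln_gt0 k0.
have PE q n : (0 < q)%N -> dm rho j * (dm rho (q * n.+1) * (logp X (k * j * (q * n.+1)))%:C) = Phi q (j * n.+1)%N.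
  move=> q0; rewrite /Phi mulrA -dmM// ?muln_gt0//; last by rewrite q0.
  by congr (dm _ _ * (logp X _)%:C); lia.
have S q : (0 < q)%N -> dm rho j * \sum_(n < X) dm rho (q * n.+1) * (logp X (k * j * (q * n.+1)))%:C = \sum_(n < X) Phi q (j * n.+1)%N.
  by move=> q0; rewrite mulr_sumr; apply: eq_bigr => n _; exact: PE.
have S1 : dm rho j * \sum_(n < X) dm rho n.+1 * (logp X (k * j * n.+1))%:C = \sum_(n < X) Phi 1%N (j * n.+1)%N.
  by rewrite -(S 1%N isT); congr (_ * _); apply: eq_bigr => n _; rewrite !mul1n.
rewrite -S1 -(S 2%N isT) -(S 4%N isT); move: dj.
move: (\sum_(n < X) dm rho n.+1 * _) (\sum_(n < X) dm rho (2 * n.+1) * _) (\sum_(n < X) dm rho (4 * n.+1) * _).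
by move: (dm s0 k) (dm s0 j) (dm rho j) (_%:C) (muC R j) => u v r ja m B1 B2 B4 <-; ring.
Qed.

End LogKernel.

(** * The almost sure bound excludes zeros with Re s > 1/2 *)

Section Converse.
Variable R : realType.
Local Open Scope complex_scope.
Local Notation C := R[i].
Local Notation dm := (@dirichlet_monomial R).
Local Open Scope classical_set_scope.

Lemma twisted_sum_bounded (s : C) (b K : R) (x : nat -> R) : 0 <= b -> b < complex.Re s -> 0 <= K ->
  (forall n, `|\sum_(i < n) x i| <= K * n%:R `^ b) ->
  exists A : R, forall n, nc (\sum_(i < n) (x i)%:C * dm s i.+1) <= A.
Proof.
move=> b0 bs K0 hK; pose D := vbound (s + 1) + nc s.
have D0 : 0 <= D by rewrite addr_ge0 ?vbound_ge0 ?nc_ge0.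
have d0 : 0 < complex.Re s - b by lra.
exists (K + K * D * (1 + (complex.Re s - b)^-1)) => n.
have -> : \sum_(i < n) (x i)%:C * dm s i.+1 = (\sum_(i < n) (x i)%:C) * dm s n.+1 +
    \sum_(j < n) (\sum_(i < j.+1) (x i)%:C) * (dm s j.+1 - dm s j.+2).
  elim: n => [|n ih]; first by rewrite !big_ord0 mul0r addr0.
  rewrite big_ord_recr /= ih [\sum_(j < n.+1) (_ * (_ - _))]big_ord_recr /= !big_ord_recr /=.
  move: (dm s n.+1) (dm s n.+2) => u v; ring.
have nx m : nc (\sum_(i < m) (x i)%:C) <= K * m%:R `^ b by rewrite -rmorph_sum nc_real.
apply: (le_trans (ncD _ _)); apply: lerD.
  rewrite ncM nc_dm//; apply: (@le_trans _ _ (K * n.+1%:R `^ b * n.+1%:R `^ (- complex.Re s))).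
    rewrite ler_wpM2r ?powR_ge0//; apply: (le_trans (nx n)); rewrite ler_wpM2l// ge0_ler_powR ?nnegrE ?ler_nat//.
  rewrite -mulrA -powRDp ?ltr0n// -[leRHS]mulr1 ler_wpM2l// -[leRHS](powRr0 n.+1%:R) ler_powR ?ler1n//; lra.
apply: (le_trans (nc_sum _ _ _)).
apply: (@le_trans _ _ (\sum_(j < n) K * D * j.+1%:R `^ (- (complex.Re s - b) - 1))).
  apply: ler_sum => j _; rewrite ncM nc_sym.
  have hd := @dm_step R s j.+1 isT ltac:(lra).
  apply: (le_trans (ler_pM (nc_ge0 _) (nc_ge0 _) (nx j.+1) hd)); rewrite -/D.
  have -> : - (complex.Re s - b) - 1 = b + (- complex.Re s - 1) by ring.
  rewrite powRDp ?ltr0n// le_eqVlt; apply/orP; left; apply/eqP; ring.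
rewrite -mulr_sumr ler_wpM2l ?mulr_ge0//.
case: n => [|n]; first by rewrite big_ord0 addr_ge0// invr_ge0 ltW.
rewrite big_ord_recl powR1 lerD2l.
have := @powR_sum_tail R (complex.Re s - b) 1 n d0 isT; rewrite powR1 big_add1 /= big_mkord mul1r => h.
by apply: le_trans h; apply: ler_sum.
Qed.

Lemma cvg_partial_sum_bound (T : Type) (f : nat -> T -> R) (w : T) (c : R) : 0 < c ->
  partial_sum f w x / x `^ c @[x --> +oo] --> 0 ->
  exists2 K : R, 0 <= K & forall n, `|\sum_(i < n) f i.+1 w| <= K * n%:R `^ c.
Proof.
move=> c0 /cvgrPdist_le /(_ 1 ltr01)[M [_ hM]].
pose S n := `|\sum_(i < n) f i.+1 w|; pose N := (Num.truncn M).+1.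
exists (1 + \sum_(n < N) S n) => [|n]; first by apply: addr_ge0 => //; apply: sumr_ge0 => i _; exact: normr_ge0.
have S0 : 0 <= \sum_(n < N) S n by apply: sumr_ge0 => i _; exact: normr_ge0.
case: n => [|n]; first by rewrite big_ord0 normr0 mulr_ge0 ?powR_ge0// addr_ge0.
have n1 : 1 <= n.+1%:R `^ c :> R by rewrite -[leLHS](powRr0 n.+1%:R) ler_powR ?ler1n// ltW.
have p0 : 0 < n.+1%:R `^ c :> R by apply: powR_gt0; exact: ltr0Sn.
have [nN|nN] := ltnP n.+1 N.
  apply: (@le_trans _ _ (S n.+1 * 1)); first by rewrite mulr1.
  apply: ler_pM => //; first exact: normr_ge0.
  by rewrite (bigD1 (Ordinal nN)) //= addrCA lerDl addr_ge0// sumr_ge0// => i _; exact: normr_ge0.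
have Mn : M < n.+1%:R by apply: (lt_le_trans (truncnS_gt M)); rewrite ler_nat.
have := hM _ Mn; rewrite sub0r normrN normrM normfV [X in _ / X]ger0_norm ?powR_ge0// ler_pdivrMr// mul1r.
rewrite /partial_sum natrK big_add1 /= big_mkord => h; apply: (le_trans h).
by rewrite mulrDl mul1r lerDl mulr_ge0// powR_ge0.
Qed.

Lemma Re_conj_mul (c z : C) : `|complex.Re (conjc c * z)| <= nc c * nc z.
Proof.
by apply: le_trans (nc_Re _) _; rewrite ncM nc_conj.
Qed.

Lemma Re_conj_self (c : C) (l : R) : complex.Re (conjc c * (c * l%:C)) = nc c ^+ 2 * l.
Proof.
by rewrite nc_sqr; case: c => x y; rewrite /conjc; simpc => /=; ring.
Qed.

(** On the event that V exceeds q l / 4, the bound V <= t V^2 / 2 + 1 / (2 t) is used in place of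
    the Cauchy-Schwarz inequality; the choice of t makes the second moment cost at most q l / 8. *)
Lemma EE_paley_zygmund m ps (V : (nat -> R) -> R) (q G l : R) : (forall p, p \in ps -> `|m p| <= 1) ->
  0 < q -> 0 <= G -> 0 < l -> q / 2 * l <= EE m ps V -> EE m ps (fun phi => V phi ^+ 2) <= G * l ^+ 2 ->
  q ^+ 2 / (16 * (G + 1)) <= EE m ps (fun phi => (q / 4 * l < V phi)%R%:R).
Proof.
move=> hm q0 G0 l0 h1 h2; have G1 : 0 < G + 1 by lra.
have [t tE] : exists t, t = q / (4 * (G + 1) * l) by eexists.
have t0 : 0 < t by rewrite tE divr_gt0// !mulr_gt0.
set p := EE m ps _; suff : q / 2 * l <= q / 4 * l + (t / 2 * (G * l ^+ 2) + (2 * t)^-1 * p).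
  have tl : t / 2 * (G * l ^+ 2) <= q * l / 8.
    have -> : t / 2 * (G * l ^+ 2) = q * l / 8 * (G / (G + 1)) by rewrite tE; field; rewrite !gt_eqF.
    rewrite ler_piMr//; first by rewrite divr_ge0// mulr_ge0 ?ltW.
    by rewrite ler_pdivrMr//; lra.
  move=> h; have h3 : q * l / 8 <= (2 * t)^-1 * p by lra.
  have t2 : 0 < 2 * t by rewrite mulr_gt0.
  have h4 : q * l / 8 * (2 * t) <= p by rewrite -ler_pdivlMr// [leRHS]mulrC.
  apply: le_trans h4; rewrite le_eqVlt; apply/orP; left; apply/eqP.
  by rewrite tE; field; rewrite !gt_eqF.
apply: (le_trans h1).
have pw phi : V phi <= q / 4 * l + 1 * (t / 2 * V phi ^+ 2 + (2 * t)^-1 * (q / 4 * l < V phi)%R%:R).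
  have i0 : 0 < (2 * t)^-1 by rewrite invr_gt0 mulr_gt0.
  have v0 : 0 <= t / 2 * V phi ^+ 2 by rewrite mulr_ge0 ?sqr_ge0// divr_ge0// ltW.
  case: ltP => h; last by rewrite mulr0; lra.
  have : 0 <= (t * V phi - 1) ^+ 2 / (2 * t) by rewrite divr_ge0 ?sqr_ge0// mulr_ge0// ltW.
  have -> : (t * V phi - 1) ^+ 2 / (2 * t) = t / 2 * V phi ^+ 2 + (2 * t)^-1 - V phi by field; rewrite gt_eqF.
  have : 0 < q / 4 * l by rewrite mulr_gt0// divr_gt0.
  by rewrite mulr1; lra.
apply: (le_trans (EE_le hm pw)); rewrite EE_lin EE_cst mul1r lerD2l EE_lin EE_Z lerD2r.
by rewrite ler_wpM2l// divr_ge0// ltW.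
Qed.

Context (d : measure_display) (T : measurableType d) (P : probability T R).
Variable f : nat -> {RV P >-> R}.
Variables (rho : C) (a : R).
Hypothesis rho1 : 1 / 2 < complex.Re rho.
Hypothesis rho2 : complex.Re rho < 1.
Hypothesis aE : a = (complex.Re rho - 1 / 2) / 2.
Hypothesis f_rmf : random_multiplicative f.
Hypothesis f_mean : forall p, prime p -> ('E_P[f p] = (sign_mean a p)%:E)%E.

Local Notation s0 := (rho - a%:C).
Local Notation c := (e4factor rho).

(** The mean of the complex sum is about c l with l = ln X; multiplication by the conjugate of c
    makes its real part |c|^2 l, so real random variables are enough. *)
Definition Yseq X n : R := complex.Re (conjc c * yseq rho a X n).

Lemma Yseq0 X n : (X < n)%N -> Yseq X n = 0.
Proof.
by move=> Xn; rewrite /Yseq yseq0// mulr0.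
Qed.

Lemma Yseq_msum X k : (0 < X)%N -> (0 < k)%N ->
  msum (primes_upto X) (fun j => Yseq X (k * j)%N) (sign_mean a) =
  complex.Re (conjc c * (dm s0 k * ((logp R X k)%:C - 3 * dm rho 2 * (logp R X (2 * k))%:C + 2 * dm rho 4 * (logp R X (4 * k))%:C))).
Proof.
move=> X0 k0; rewrite msum_sign_mean => [|j Xj]; last first.
  by rewrite Yseq0// (leq_trans Xj)// leq_pmull.
rewrite -yseq_moebius// mulr_sumr Re_sum; apply: eq_bigr => j _.
have -> : conjc c * (yseq rho a X (k * j) * (j%:R `^ (- a))%:C * muC R j) =
   (j%:R `^ (- a) * (moebius j)%:~R)%:C * (conjc c * yseq rho a X (k * j)).
  by rewrite rmorphM /= rmorph_int /muC; ring.
by rewrite ReMl /Yseq; ring.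
Qed.

(** A bound independent of X: the decay of [e4sum rho] makes the sum of |e4sum| / j in
    [log_convolution_bound] converge. *)
Lemma Yseq_sample_bound w (A K : R) X : 0 <= K -> (0 < X)%N ->
  (forall n, nc (\sum_(i < n) (f i.+1 w)%:C * dm s0 i.+1) <= A) ->
  (forall n, (0 < n)%N -> nc (e4sum rho n) <= K * n%:R `^ (- complex.Re rho)) ->
  \sum_(1 <= n < X.+1) Yseq X n * f n w <= nc c * (A * (K * (1 + (complex.Re rho)^-1))).
Proof.
move=> K0 X0 hA hK; have r1 := rho1.
have A0 : 0 <= A by apply: le_trans (hA 0%N); exact: nc_ge0.
pose V : C := \sum_(i < X) ((f i.+1 w)%:C * dm s0 i.+1) * \sum_(j < X) (e4 R j.+1)%:C * dm rho j.+1 * (logp R X (i.+1 * j.+1))%:C.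
have -> : \sum_(1 <= n < X.+1) Yseq X n * f n w = complex.Re (conjc c * V).
  rewrite big_add1 /= big_mkord /V mulr_sumr Re_sum; apply: eq_bigr => i _.
  have -> : conjc c * ((f i.+1 w)%:C * dm s0 i.+1 * \sum_(j < X) (e4 R j.+1)%:C * dm rho j.+1 * (logp R X (i.+1 * j.+1))%:C)
    = (f i.+1 w)%:C * (conjc c * yseq rho a X i.+1).
    by rewrite /yseq; set S := \sum_(j < X) _; move: (dm s0 i.+1) => u; ring.
  by rewrite ReMl mulrC.
apply: (le_trans (ler_norm _)); apply: (le_trans (Re_conj_mul _ _)); rewrite ler_wpM2l ?nc_ge0//.
have := @log_convolution_bound R (fun i => (f i.+1 w)%:C * dm s0 i.+1) (fun j => (e4 R j.+1)%:C * dm rho j.+1) A X X0 hA.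
move/le_trans; apply; rewrite ler_wpM2l//.
apply: (@le_trans _ _ (\sum_(j < X) K * j.+1%:R `^ (- complex.Re rho - 1))).
  apply: ler_sum => j _.
  have -> : j.+1%:R `^ (- complex.Re rho - 1) = j.+1%:R `^ (- complex.Re rho) * j.+1%:R^-1 :> R.
    by rewrite powRDp ?ltr0n// powR_inv1.
  by rewrite mulrA ler_wpM2r ?invr_ge0//; exact: hK.
rewrite -mulr_sumr ler_wpM2l//; case: X X0 {V} => // X _.
rewrite big_ord_recl powR1 lerD2l.
have := @powR_sum_tail R (complex.Re rho) 1 X ltac:(lra) isT; rewrite powR1 big_add1 /= big_mkord mul1r => h.
by apply: le_trans h; apply: ler_sum.
Qed.

Lemma Yseq_large : exists2 del : R, 0 < del & exists q : R, 0 < q /\ exists n0, forall X, (n0 <= X)%N ->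
  measurable [set w | q * ln X%:R < \sum_(1 <= n < X.+1) Yseq X n * f n w] /\
  (del%:E <= P [set w | (q * ln X%:R < \sum_(1 <= n < X.+1) Yseq X n * f n w)%R])%E.
Proof.
have r1 := rho1; have r2 := rho2; have aE' := aE; have a0 : 0 < a by lra.
have Rs0 : complex.Re s0 = complex.Re rho - a by rewrite ReB.
have cn0 : c != 0 by apply: e4factor_neq0; [rewrite gt_eqF//; lra|rewrite lt_eqF].
have c0 : 0 < nc c by rewrite nc_gt0.
have [q qE] : exists q, q = nc c ^+ 2 by eexists.
have q0 : 0 < q by rewrite qE exprn_gt0.
have [G G0 hG] := @EE_power_bound R a (complex.Re s0) 1 a0 ltac:(rewrite Rs0; lra).
(* The mean is c l + E, where E collects the shifts ln 2 and ln 4 of the logarithm. By the choice of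
   n0 below, its contribution is at most half of |c|^2 l. *)
pose E : C := 3 * dm rho 2 * (ln 2%:R)%:C - 2 * dm rho 4 * (ln 4%:R)%:C.
have nE := nc_ge0 E.
have G'0 : 0 <= 36 * q * G by rewrite !mulr_ge0// ltW.
exists (q ^+ 2 / (16 * (36 * q * G + 1))); first by rewrite divr_gt0 ?exprn_gt0// mulr_gt0//; lra.
exists (q / 4); split; first by rewrite divr_gt0.
pose n0 := (4 + Num.truncn (expR (2 * nc c * nc E / q + 1))).+1.
exists n0 => X nX; have X4 : (4 <= X)%N by apply: leq_trans nX; rewrite /n0 -addnS leq_addr.
have X0 : (0 < X)%N by exact: leq_trans X4.
have XR : 0 < X%:R :> R by rewrite ltr0n.
have [l lE] : exists l : R, l = ln X%:R by eexists.
have ll : 2 * nc c * nc E / q + 1 <= l.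
  rewrite lE -ler_expR lnK ?posrE//; apply/ltW/(lt_le_trans (truncnS_gt _)).
  by rewrite ler_nat (leq_trans _ nX)// ltnS leq_addl.
have qn : 0 <= 2 * nc c * nc E / q by rewrite divr_ge0 ?mulr_ge0 ?nc_ge0// ltW.
have l0 : 0 < l by lra.
have ap := all_primes_upto X; have up := uniq_primes_upto X.
have hm p : p \in primes_upto X -> `|sign_mean a p| <= 1.
  by move=> /(seq.allP ap) pp; rewrite (le_trans (sign_mean_le a0 pp))// ltW// two_powRN_lt1.
have logE k : (0 < k <= 4)%N -> logp R X k = l - ln k%:R.
  move=> /andP[k0 k4]; rewrite /logp -lE; apply/max_idPr; rewrite subr_ge0 lE.
  by rewrite ler_ln ?posrE ?ltr0n// ler_nat (leq_trans k4).
have sE : [set w | q / 4 * ln X%:R < \sum_(1 <= n < X.+1) Yseq X n * f n w] =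
    [set w | q / 4 * l < msum (primes_upto X) (Yseq X) (fun p => f p w)].
  by apply/seteqP; split => w /=; rewrite lE (msum_sample f_rmf)//; exact: Yseq0.
rewrite sE.
have [|m1 ->] := sign_event f_rmf f_mean (b := fun phi => q / 4 * l < msum (primes_upto X) (Yseq X) phi) up ap.
  by move=> phi phi' h; rewrite (msum_eq_in _ h).
split => //; rewrite lee_fin; apply: EE_paley_zygmund => //.
  rewrite EE_msum//; have := Yseq_msum X0 (isT : (0 < 1)%N).
  rewrite (@msum_ext _ _ _ (Yseq X)); last by move=> n; rewrite mul1n.
  move=> ->; rewrite dm1 mul1r !muln1 !logE// ln1 subr0.
  have -> : l%:C - 3 * dm rho 2 * (l - ln 2%:R)%:C + 2 * dm rho 4 * (l - ln 4%:R)%:C = c * l%:C + E.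
    have hC (x y : R) : (x - y)%:C = x%:C - y%:C :> C by rewrite rmorphB.
    by rewrite !hC /E /e4factor; move: (dm rho 2) (dm rho 4) => u v; ring.
  rewrite mulrDr ReD Re_conj_self -qE.
  have := Re_conj_mul c E; rewrite ler_norml => /andP[h _].
  have : 2 * nc c * nc E <= q * l.
    by rewrite [leRHS]mulrC -ler_pdivrMr//; lra.
  by move: h; lra.
(* 6 = 1 + 3 + 2 bounds the three logarithmic terms of a conditional mean, whose remaining size is
   k^(-Re s0); here 2 Re s0 = 1 + 2 a > 1, as [EE_power_bound] requires. *)
have K0 : 0 <= nc c * 6 * l by rewrite !mulr_ge0 ?nc_ge0// ltW.
have := hG X (Yseq X) (nc c * 6 * l) K0 (@Yseq0 X) _; rewrite expr1.
have -> : (nc c * 6 * l) ^+ 2 * G = 36 * q * G * l ^+ 2 by rewrite qE; ring.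
apply => k k0; rewrite Yseq_msum//; apply: (le_trans (Re_conj_mul _ _)).
rewrite ncM nc_dm//.
have -> : nc c * 6 * l * k%:R `^ (- complex.Re s0) = nc c * (k%:R `^ (- complex.Re s0) * (6 * l)) by ring.
rewrite ler_wpM2l ?nc_ge0// ler_wpM2l ?powR_ge0//.
have lb (j : nat) : (0 < j)%N -> nc ((logp R X j)%:C : C) <= l.
  by move=> j0; rewrite nc_real ger0_norm ?logp_ge0// lE logp_le.
have nd j : (0 < j)%N -> nc (dm rho j) <= 1.
  by move=> j0; rewrite nc_dm// -[leRHS](powRr0 j%:R) ler_powR ?ler1n//; lra.
have t1 : nc (3 * dm rho 2 * (logp R X (2 * k))%:C) <= 3 * l.
  rewrite (ncM (3 * dm rho 2)) (ncM 3) -[3]/(3%:R) nc_nat -mulrA ler_wpM2l//.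
  rewrite -[leRHS]mul1r; apply: ler_pM; rewrite ?nc_ge0 ?nd// lb// muln_gt0//.
have t2 : nc (2 * dm rho 4 * (logp R X (4 * k))%:C) <= 2 * l.
  rewrite (ncM (2 * dm rho 4)) (ncM 2) -[2]/(2%:R) nc_nat -mulrA ler_wpM2l//.
  rewrite -[leRHS]mul1r; apply: ler_pM; rewrite ?nc_ge0 ?nd// lb// muln_gt0//.
have t0 := lb k k0.
apply: (le_trans (ncD _ _)); have := ncB (logp R X k)%:C (3 * dm rho 2 * (logp R X (2 * k))%:C).
by move: t0 t1 t2; lra.
Qed.

(** The events that the sum exceeds q ln X have probability at least del for all large X, hence so
    has their upper limit. At a sample with the bound on M_f, however, the sums stay bounded in X if
    [Efun rho] is 0. *)
Lemma random_sum_zero_free :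
  {ae P, forall w, forall eps : R, 0 < eps ->
     partial_sum f w x / x `^ (1 / 2 + eps) @[x --> +oo] --> 0} -> Efun rho != 0.
Proof.
move=> [Bad [mBad PBad subBad]]; apply/eqP => E0.
have r1 := rho1; have r2 := rho2; have aE' := aE; have a0 : 0 < a by lra.
have rn1 : rho != 1 by apply/eqP => e; move: r2; rewrite e /= ltxx.
have [K K0 hK] := e4sum_bound (s := rho) ltac:(lra) rn1.
have hK' n : (0 < n)%N -> nc (e4sum rho n) <= K * n%:R `^ (- complex.Re rho).
  by move=> nn; have := hK n nn; rewrite /zeta0 E0 mul0r mulr0 subr0.
have [del del0 [q [q0 [n0 hn0]]]] := Yseq_large.
pose F n := [set w | q * ln (n0 + n)%:R < \sum_(1 <= i < (n0 + n).+1) Yseq (n0 + n) i * f i w].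
have mF n : measurable (F n) by exact: (hn0 (n0 + n)%N (leq_addr _ _)).1.
have PF n : (del%:E <= P (F n))%E by exact: (hn0 (n0 + n)%N (leq_addr _ _)).2.
have mU n : measurable (\bigcup_(k >= n) F k) by apply: bigcup_measurable => k _; exact: mF.
have cv : (P (\bigcup_(k >= n) F k) @[n --> \oo] --> P (lim_sup_set F))%E.
  by apply: lim_sup_set_cvg => //; rewrite (le_lt_trans (probability_le1 _ (mU _)))// ltry.
have lb : (del%:E <= P (lim_sup_set F))%E.
  move/cvg_lim : (cv) => <- //; apply: lime_ge; first by apply/cvg_ex; exists (P (lim_sup_set F)).
  apply: nearW => n; apply: (le_trans (PF n)); apply: le_measure.
  - exact/mem_set/mF.
  - exact/mem_set/mU.
  - by move=> w Fw; exists n => /=.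
have mL : measurable (lim_sup_set F) by apply: bigcap_measurable => // n _.
suff sub : lim_sup_set F `<=` Bad.
  have : (P (lim_sup_set F) <= P Bad)%E by apply: le_measure => //; exact/mem_set.
  by rewrite PBad => h; have := le_trans lb h; rewrite lee_fin leNgt del0.
move=> w hw; apply: subBad => /= good.
have Rs0 : complex.Re s0 = complex.Re rho - a by rewrite ReB.
(* Taking eps = a / 2 gives an exponent 1/2 + a/2 still below Re s0 = 1/2 + a, as
   [twisted_sum_bounded] requires. *)
have [K1 K10 h1] := cvg_partial_sum_bound (c := 1 / 2 + a / 2) ltac:(lra) (good (a / 2) ltac:(lra)).
have [A hA] := @twisted_sum_bounded s0 (1 / 2 + a / 2) K1 (fun i => f i.+1 w) ltac:(lra) ltac:(rewrite Rs0; lra) K10 h1.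
pose B := nc c * (A * (K * (1 + (complex.Re rho)^-1))).
pose n1 := (Num.truncn (expR (B / q))).+1.
have [n /= n1n Fn] := hw n1 I.
have nn : (0 < n0 + n)%N by rewrite addn_gt0 (leq_trans _ n1n) ?orbT.
have := Yseq_sample_bound K0 nn hA hK'; rewrite -/B leNgt => /negP; apply.
apply: le_lt_trans Fn; rewrite mulrC -ler_pdivrMr// -ler_expR lnK ?posrE ?ltr0n//.
apply/ltW/(lt_le_trans (truncnS_gt _)); rewrite ler_nat.
by apply: (leq_trans n1n); rewrite leq_addl.
Qed.

End Converse.

Local Open Scope classical_set_scope.
Local Open Scope ring_scope.

Theorem theorem1p1 (R : realType)
    (d : R -> measure_display)
    (T : forall a : R, measurableType (d a))
    (P : forall a : R, probability (T a) R)
    (f : forall a : R, nat -> {RV (P a) >-> R})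
    (f_rmf : forall a : R, 0 < a -> random_multiplicative (f a))
    (f_mean : forall (a : R) (p : nat), 0 < a -> prime p ->
       ('E_(P a)[f a p] = (- (p%:R `^ (- a)))%:E)%E) :
  RiemannHypothesis R <->
  (forall a : R, 0 < a ->
     {ae P a, forall w, forall eps : R, 0 < eps ->
        partial_sum (f a) w x / x `^ (1 / 2 + eps) @[x --> +oo] --> 0}).
Proof.
split=> [RH a a0|h].
  exact: (RH_random_sum a0 (f_rmf a a0) (fun p pp => f_mean a p a0 pp) RH).
apply: RH_of_Efun => s s1 s2.
have a0 : 0 < (complex.Re s - 1 / 2) / 2 by rewrite divr_gt0// subr_gt0.
exact: (random_sum_zero_free s1 s2 erefl (f_rmf _ a0) (fun p pp => f_mean _ p a0 pp) (h _ a0)).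
Qed.
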